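(* Let $\mathcal P$ be an unshaded planar algebra, $M_{\mathcal P}$ its associated von Neumann algebra and $A\subset M_{\mathcal P}$ the cup subalgebra. The $A$-bimodule ${}_AL^2(M_{\mathcal P})_A$ is isomorphic to the direct sum of the bimodule ${}_AL^2(A)_A$ and some copies of the coarse correspondence. In particular, $M_{\mathcal P}$ is a II$_1$ factor and $A\subset M_{\mathcal P}$ is a maximal abelian subalgebra.
   Context: Unshaded planar tangles: an unshaded planar tangle has an outer disk, a finite number of ordered inner disks, and a finite number of non-intersecting strings lying in the outer disk outside the inner disks; each string is either a closed loop or an edge with endpoints on boundary circles of disks; each disk has a marked point on its boundary (away from string endpoints). Isotopic tangles are identified. Tangles are composed by placing a tangle inside an inner disk of another one (same number of boundary endpoints), lining up marked points and connecting endpoints. Unshaded planar algebra: a family of finite dimensional complex vector spaces $\mathcal P=\{\mathcal P_n\}_{n\geq0}$ with $\dim \mathcal P_0=1$ (identified with $\mathbb C$, the empty diagram being $1$), with an anti-linear involution $*:\mathcal P_n\to\mathcal P_n$ for each $n$, such that every unshaded planar tangle $T$ with $n_i$ endpoints on the $i$-th inner disk ($1\le i\le k$) and $n_0$ endpoints on the outer disk defines a linear map $\mathcal P_{n_1}\otimes\cdots\otimes\mathcal P_{n_k}\to\mathcal P_{n_0}$, compatibly with composition of tangles. It is required that: $\mathcal P$ is spherically invariant; $T(b_1,\dots,b_k)^*=T^*(b_1^*,\dots,b_k^* )$ where $T^*$ is the reflection of $T$ in a line of the plane; a closed loop has value $\delta$ (the modulus) with $\delta>1$; and for every $n$ the sesquilinear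 form $\langle a,b\rangle$ on $\mathcal P_n$, obtained by connecting all $n$ strings of $a$ to those of $b^*$ by parallel strings, is an inner product. Conventions: $a\in\mathcal P_n$ is drawn as a box with marked point at the top left and its $n$ boundary points, numbered $1,\dots,n$ from left to right (clockwise from the marked point), on the top. For $a\in\mathcal P_n$, $b\in\mathcal P_m$, $0\le j\le\min(n,m)$, let $a\star_j b\in\mathcal P_{n+m-2j}$ be obtained by placing $a$ to the left of $b$ and joining, for $1\le i\le j$, the point $n+1-i$ of $a$ to the point $i$ of $b$ (nested arcs), the remaining strings going to the outer boundary in left-to-right order. Thus $\langle a,b\rangle=a\star_n b^*$ for $a,b\in\mathcal P_n$. Graded algebra: $Gr(\mathcal P)=\bigoplus_{n\ge0}\mathcal P_n$ (algebraic direct sum), with the inner product making the $\mathcal P_n$ pairwise orthogonal, the involution $*$ of the $\mathcal P_n$, and the product $\star$ determined by $a\star b=\sum_{j=0}^{\min(n,m)}a\star_j b$ for $a\in\mathcal P_n$, $b\in\mathcal P_m$; its unit is the empty diagram $1\in\mathcal P_0$. Let $\mathcal H$ be the Hilbert space completion of $Gr(\mathcal P)$. Left multiplications $\pi(a):b\mapsto a\star b$ and right multiplications $\rho(a):b\mapsto b\star a$, $a\in Gr(\mathcal P)$, extend to bounded operators on $\mathcal H$. $M_{\mathcal P}\subset\mathcal B(\mathcal H)$ is the von Neumann algebra generated by $\pi(Gr(\mathcal P))$. It carries the faithful normal trace $tr(a)=\langle a,1\rangle$; the GNS space $L^2(M_{\mathcal P})$ is identified with $\mathcal H$, with $M_{\mathcal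 P}$ acting on the left by $\pi$ and on the right by $\rho$. Cup subalgebra: $\cup\in\mathcal P_2$ is the element given by the tangle with no inner disk and a single string joining the two boundary points; $A\subset M_{\mathcal P}$ is the abelian von Neumann subalgebra generated by $\cup$. $L^2(A)\subset L^2(M_{\mathcal P})$ is the closure of $A$. The coarse correspondence is the $A$-bimodule $L^2(A)\otimes L^2(A)$ with $a\cdot(\xi\otimes\eta)\cdot b=a\xi\otimes\eta b$. *)

(* Defs.v *)
From HB Require Import structures.
From mathcomp Require Import all_boot all_order all_algebra complex.
From mathcomp Require Import all_classical all_reals all_analysis.

Set Implicit Arguments.
Unset Strict Implicit.
Unset Printing Implicit Defensive.

Import Order.TTheory GRing.Theory Num.Theory.
Import numFieldNormedType.Exports.

Local Open Scope classical_set_scope.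
Local Open Scope ring_scope.

(** * Unshaded planar tangles

    An isotopy class of planar tangles is encoded as a planar map drawn on the
    sphere.  The vertices are the outer disk, the inner disks (labelled by
    [I]) and finitely many auxiliary bivalent _nodes_ lying on the strings.
    Nodes have no meaning of their own: a planar algebra must be invariant
    under inserting and erasing them (see [pa_subdivide]).  They let closed
    loops be represented (each carries at least one node), and they make
    composition of tangles free of any string tracing.

    A _flag_ is an end of an edge at a vertex: a boundary point of a disk, or
    one of the two sides [(v, b)] of a node [v].  The boundary points of every
    disk, outer or inner, are numbered 0, 1, ... clockwise from its marked
    point.

    A _spot_ is a germ of region at a vertex.  Cutting the boundary of a disk
    with [n] points at these points and at the marked point gives the spots
    0, ..., n, spot [j] lying just before point [j] and spot [j+1] just after
    it; spots 0 and n are in the same region, that of the marked point.  The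
    spot [(v, b)] of a node is to the left of its flag [(v, b)] when leaving
    the node along that flag.

    A tangle consists of the pairing [mate] of the flags by the edges and of
    the relation [same] of lying in the same region.  The latter records how
    the connected components of the diagram are nested. *)

Section Flags.
Variables (I : finType) (n : I -> nat) (l : nat) (V : finType).

Definition flag : finType := ('I_l + {i : I & 'I_(n i)} + V * bool)%type.
Definition spot : finType :=
  ('I_l.+1 + {i : I & 'I_(n i).+1} + V * bool)%type.

(** [None] is the outer disk. *)
Definition vertex : finType := (option I + V)%type.

Definition flag_out (k : 'I_l) : flag := inl (inl k).
Definition flag_in (i : I) (k : 'I_(n i)) : flag :=
  inl (inr (existT (fun i => 'I_(n i)) i k)).
Definition flag_node (v : V) (b : bool) : flag := inr (v, b).

Definition spot_out (k : 'I_l.+1) : spot := inl (inl k).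
Definition spot_in (i : I) (k : 'I_(n i).+1) : spot :=
  inl (inr (existT (fun i => 'I_(n i).+1) i k)).
Definition spot_node (v : V) (b : bool) : spot := inr (v, b).

Definition flag_vertex (p : flag) : vertex :=
  match p with
  | inl (inl _) => inl None
  | inl (inr (existT i _)) => inl (Some i)
  | inr (v, _) => inr v
  end.

Definition spot_vertex (s : spot) : vertex :=
  match s with
  | inl (inl _) => inl None
  | inl (inr (existT i _)) => inl (Some i)
  | inr (v, _) => inr v
  end.

(** Going clockwise around an inner disk the strings are on the left-hand
    side, around the outer disk they are on the right-hand side. *)
Definition lspot (p : flag) : spot :=
  match p with
  | inl (inl k) => spot_out (lift ord0 k)
  | inl (inr (existT i k)) => spot_in (widen_ord (leqnSn (n i)) k)
  | inr (v, b) => spot_node v b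
  end.

Definition rspot (p : flag) : spot :=
  match p with
  | inl (inl k) => spot_out (widen_ord (leqnSn l) k)
  | inl (inr (existT i k)) => spot_in (lift ord0 k)
  | inr (v, b) => spot_node v (~~ b)
  end.

End Flags.

Record tangle (I : finType) (n : I -> nat) (l : nat) := Tangle {
  node : finType;
  mate : flag n l node -> flag n l node;
  same : rel (spot n l node) }.

Arguments mate {I n l} t p.
Arguments same {I n l} t.

Section Planar.
Variables (I : finType) (n : I -> nat) (l : nat) (T : tangle n l).

Definition edge_rel : rel (vertex I (node T)) := fun u v =>
  [exists p : flag n l (node T),
     (flag_vertex p == u) && (flag_vertex (mate T p) == v)].

Definition link_rel : rel (spot n l (node T)) := fun s t =>
  same T s t || (spot_vertex s == spot_vertex t).

(** The underlying surface is obtained by gluing the regions to the diagram;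
    [planar_connected] says that it is connected, and then [planar_euler],
    i.e. V - E + F = 1 + C with #|flag| = 2 E, says that it is a sphere and
    that each region is a sphere with holes. *)
Record planar : Prop := Planar {
  planar_mateK : involutive (mate T);
  planar_mate_neq : forall p, mate T p != p;
  planar_equiv : equivalence_rel (same T);
  planar_face : forall p, same T (lspot p) (rspot (mate T p));
  planar_mark_out : same T (spot_out n _ ord0) (spot_out n _ ord_max);
  planar_mark_in : forall i, same T (spot_in l _ (ord0 : 'I_(n i).+1))
                                    (spot_in l _ (ord_max : 'I_(n i).+1));
  planar_connected : forall s t, connect link_rel s t;
  planar_euler :
    (#|vertex I (node T)| + n_comp (same T) predT).*2
    = (#|flag n l (node T)|
       + (n_comp edge_rel predT).+1.*2)%N }.

End Planar.

(** ** Isotopy *)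

(** [T'] is [T] with its inner disks and nodes renamed along [f] and [h]. *)
Section Relabel.
Variables (I I' : finType) (n : I -> nat) (l : nat) (f : I' -> I).
Variables (T : tangle n l) (T' : tangle (fun i => n (f i)) l).
Variable h : node T' -> node T.

Definition relabel_flag (p : flag (fun i => n (f i)) l (node T')) :
    flag n l (node T) :=
  match p with
  | inl (inl k) => flag_out n _ k
  | inl (inr (existT i k)) => flag_in l _ (k : 'I_(n (f i)))
  | inr (v, b) => flag_node n l (h v) b
  end.

Definition relabel_spot (s : spot (fun i => n (f i)) l (node T')) :
    spot n l (node T) :=
  match s with
  | inl (inl k) => spot_out n _ k
  | inl (inr (existT i k)) => spot_in l _ (k : 'I_(n (f i)).+1)
  | inr (v, b) => spot_node n l (h v) b
  end.

Definition is_relabeling : Prop :=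
  [/\ bijective f, bijective h,
      forall p, mate T (relabel_flag p) = relabel_flag (mate T' p) &
      forall s t, same T (relabel_spot s) (relabel_spot t) = same T' s t].

End Relabel.

(** Insertion of a node [None] on the edge from [p] to [mate T p], with side
    [false] towards [p]. *)
Section Subdivide.
Variables (I : finType) (n : I -> nat) (l : nat) (T : tangle n l).
Variable p : flag n l (node T).
Let V := node T.

Definition old_flag (q : flag n l V) : flag n l (option V) :=
  match q with
  | inl d => inl d
  | inr (v, b) => inr (Some v, b)
  end.

Definition subdivide_mate (q : flag n l (option V)) : flag n l (option V) :=
  let mate_old (q : flag n l V) :=
    if q == p then flag_node n l None false
    else if q == mate T p then flag_node n l None true
    else old_flag (mate T q) in
  match q with
  | inl d => mate_old (inl d)
  | inr (Some v, b) => mate_old (inr (v, b))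
  | inr (None, false) => old_flag p
  | inr (None, true) => old_flag (mate T p)
  end.

Definition subdivide_spot (s : spot n l (option V)) : spot n l V :=
  match s with
  | inl d => inl d
  | inr (Some v, b) => inr (v, b)
  | inr (None, true) => lspot p
  | inr (None, false) => rspot p
  end.

Definition subdivide : tangle n l :=
  Tangle subdivide_mate
    (fun s t => same T (subdivide_spot s) (subdivide_spot t)).

End Subdivide.

(** ** Composition

    [compose T S] is [S] placed in the inner disk [None] of [T].  Each of the
    points where the boundaries meet becomes a node, whose side [true] is in
    [T] and whose side [false] is in [S]. *)
Definition compose_arity (I J : finType) (n : option I -> nat) (m : J -> nat)
    (s : I + J) : nat :=
  match s with inl i => n (Some i) | inr j => m j end.

Section Compose.
Variables (I J : finType) (n : option I -> nat) (m : J -> nat) (l : nat).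
Variables (T : tangle n l) (S : tangle m (n None)).

Let nm := compose_arity n m.
Definition compose_node : finType := (node T + node S + 'I_(n None))%type.

Definition compose_split (p : flag nm l compose_node) :
    flag n l (node T) + flag m (n None) (node S) :=
  match p with
  | inl (inl k) => inl (flag_out n _ k)
  | inl (inr (existT (inl i) k)) => inl (flag_in l _ (k : 'I_(n (Some i))))
  | inl (inr (existT (inr j) k)) => inr (flag_in (n None) _ (k : 'I_(m j)))
  | inr (inl (inl v), b) => inl (flag_node n l v b)
  | inr (inl (inr w), b) => inr (flag_node m (n None) w b)
  | inr (inr k, true) => inl (flag_in l _ k)
  | inr (inr k, false) => inr (flag_out m _ k)
  end.

Definition compose_flagT (p : flag n l (node T)) : flag nm l compose_node :=
  match p with
  | inl (inl k) => flag_out nm _ k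
  | inl (inr (existT o k)) =>
      match o return 'I_(n o) -> flag nm l compose_node with
      | Some i => fun k => @flag_in _ nm l _ (inl i) k
      | None => fun k => flag_node nm l (inr k) true
      end k
  | inr (v, b) => flag_node nm l (inl (inl v)) b
  end.

Definition compose_flagS (p : flag m (n None) (node S)) :
    flag nm l compose_node :=
  match p with
  | inl (inl k) => flag_node nm l (inr k) false
  | inl (inr (existT j k)) => @flag_in _ nm l _ (inr j) k
  | inr (w, b) => flag_node nm l (inl (inr w)) b
  end.

Definition compose_mate (p : flag nm l compose_node) :
    flag nm l compose_node :=
  match compose_split p with
  | inl q => compose_flagT (mate T q)
  | inr q => compose_flagS (mate S q)
  end.

Definition compose_spot (s : spot nm l compose_node) :
    spot n l (node T) + spot m (n None) (node S) :=
  match s with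
  | inl (inl k) => inl (spot_out n _ k)
  | inl (inr (existT (inl i) k)) => inl (spot_in l _ (k : 'I_(n (Some i)).+1))
  | inl (inr (existT (inr j) k)) => inr (spot_in (n None) _ (k : 'I_(m j).+1))
  | inr (inl (inl v), b) => inl (spot_node n l v b)
  | inr (inl (inr w), b) => inr (spot_node m (n None) w b)
  | inr (inr k, true) => inl (lspot (flag_in l (node T) k))
  | inr (inr k, false) => inl (rspot (flag_in l (node T) k))
  end.

(** Regions of [T] and [S] are merged along the boundary of the disk. *)
Definition compose_glue :
    rel (spot n l (node T) + spot m (n None) (node S))%type := fun s t =>
  match s, t with
  | inl s, inl t => same T s t
  | inr s, inr t => same S s t
  | inl s, inr t | inr t, inl s =>
      [exists k : 'I_(n None).+1, (s == spot_in l _ k) && (t == spot_out m _ k)]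
  end.

Definition compose : tangle (compose_arity n m) l :=
  Tangle compose_mate
    (fun s t => connect compose_glue (compose_spot s) (compose_spot t)).

End Compose.

(** ** Reflection in a line

    The order of the boundary points is reversed and left and right are
    exchanged. *)
Section Reflect.
Variables (I : finType) (n : I -> nat) (l : nat) (T : tangle n l).

Definition reflect_flag (p : flag n l (node T)) : flag n l (node T) :=
  match p with
  | inl (inl k) => flag_out n _ (rev_ord k)
  | inl (inr (existT i k)) => flag_in l _ (rev_ord k)
  | inr (v, b) => flag_node n l v b
  end.

Definition reflect_spot (s : spot n l (node T)) : spot n l (node T) :=
  match s with
  | inl (inl k) => spot_out n _ (rev_ord k)
  | inl (inr (existT i k)) => spot_in l _ (rev_ord k)
  | inr (v, b) => spot_node n l v (~~ b)
  end.

Definition reflect_tangle : tangle n l :=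
  Tangle (fun p => reflect_flag (mate T (reflect_flag p)))
         (fun s t => same T (reflect_spot s) (reflect_spot t)).

End Reflect.

(** ** Particular tangles *)

(** The diagram with edges [mt] in which the marked points of all disks lie in
    the same region, also containing the spots in [base]. *)
Section Based.
Variables (I : finType) (n : I -> nat) (l : nat) (V : finType).
Variables (mt : flag n l V -> flag n l V) (base : pred (spot n l V)).

Definition marked_spot (s : spot n l V) : bool :=
  [|| s == spot_out n V ord0, s == spot_out n V ord_max,
      [exists i : I, (s == spot_in l V (ord0 : 'I_(n i).+1))
                     || (s == spot_in l V (ord_max : 'I_(n i).+1))]
    | base s].

Definition based_step : rel (spot n l V) := fun s t =>
  [exists p : flag n l V, (s == lspot p) && (t == rspot (mt p))]
  || marked_spot s && marked_spot t.

Definition based_tangle : tangle n l :=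
  Tangle mt (connect (fun s t => based_step s t || based_step t s)).

End Based.

Definition no_disk : void -> nat := fun _ => 0%N.

Definition empty_tangle : tangle no_disk 0 :=
  @based_tangle _ no_disk 0 void (fun p => p) pred0.

Definition cup_mate (p : flag no_disk 2 void) : flag no_disk 2 void :=
  match p with
  | inl (inl k) => flag_out no_disk void (rev_ord k)
  | _ => p
  end.

Definition cup_tangle : tangle no_disk 2 := based_tangle cup_mate pred0.

Definition loop_mate (p : flag no_disk 0 unit) : flag no_disk 0 unit :=
  match p with
  | inr (v, b) => flag_node no_disk 0 v (~~ b)
  | _ => p
  end.

Definition loop_tangle : tangle no_disk 0 :=
  based_tangle loop_mate (pred1 (spot_node no_disk 0 tt true)).

(** [star_tangle n m j l] is the tangle of the operation a, b |-> a *_j b; the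
    disk [false] is the left one (a), the disk [true] is the right one (b).
    It is meant to be used for [j <= minn n m] and [l + 2 j = n + m] only, in
    which case the default value of [odflt] is never used. *)
Definition pair_arity (n m : nat) (b : bool) : nat := if b then m else n.

Section Star.
Variables (n m j l : nat).

Let F := flag (pair_arity n m) l void.
Let to_out (k : nat) : option F := omap (@flag_out _ _ _ _) (insub k).
Let to_left (k : nat) : option F :=
  omap (fun k : 'I_n => @flag_in _ (pair_arity n m) l void false k) (insub k).
Let to_right (k : nat) : option F :=
  omap (fun k : 'I_m => @flag_in _ (pair_arity n m) l void true k) (insub k).

Definition star_mate (p : F) : F :=
  odflt p
    match p with
    | inl (inl k) =>
        if (k < n - j)%N then to_left k else to_right (k - (n - j) + j)%N
    | inl (inr (existT false k)) =>
        if (k < n - j)%N then to_out k else to_right (n.-1 - k)%N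
    | inl (inr (existT true k)) =>
        if (k < j)%N then to_left (n.-1 - k)%N else to_out (n - j + (k - j))%N
    | inr (v, _) => match v with end
    end.

Definition star_tangle : tangle (pair_arity n m) l :=
  based_tangle star_mate pred0.

End Star.

(** * Unshaded planar algebras

    [pa_act] is only constrained, and only meaningful, on planar tangles. *)

Arguments subdivide {I n l} T p.

Record planar_data (R : realType) := PlanarData {
  pa_space :> nat -> vectType R[i];
  pa_star : forall n, pa_space n -> pa_space n;
  pa_act : forall (I : finType) (n : I -> nat) (l : nat), tangle n l ->
    (forall i, pa_space (n i)) -> pa_space l;
  pa_modulus : R }.

Arguments pa_star {R p n} _.
Arguments pa_act {R} p {I n l} _ _.

Section PlanarData.
Variables (R : realType) (P : planar_data R).

Definition no_input (i : void) : P (no_disk i) := match i with end.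

Definition pa_one : P 0%N := pa_act P empty_tangle no_input.
Definition pa_cup : P 2%N := pa_act P cup_tangle no_input.

(** The identification of the line [P 0] with the complex numbers. *)
Definition pa_scalar (x : P 0%N) : R[i] := coord [tuple pa_one] ord0 x.

Definition pair_input (n m : nat) (a : P n) (b : P m) (c : bool) :
    P (pair_arity n m c) :=
  if c as c return P (pair_arity n m c) then b else a.

Definition pa_starj (n m j l : nat) (a : P n) (b : P m) : P l :=
  pa_act P (star_tangle n m j l) (pair_input a b).

Definition pa_ip (n : nat) (a b : P n) : R[i] :=
  pa_scalar (pa_starj n 0 a (pa_star b)).

Definition compose_input (I J : finType) (n : option I -> nat) (m : J -> nat)
    (l : nat) (S : tangle m (n None))
    (z : forall s, P (compose_arity n m s)) (o : option I) : P (n o) :=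
  match o with
  | Some i => z (inl i)
  | None => pa_act P S (fun j => z (inr j))
  end.

Record is_planar_algebra : Prop := IsPlanarAlgebra {
  pa_dim0 : \dim {: P 0%N} = 1%N;
  pa_starK : forall n, involutive (@pa_star R P n);
  pa_star_antilinear : forall n (c : R[i]) (a b : P n),
    pa_star (c *: a + b) = c^* *: pa_star a + pa_star b;
  pa_multilinear : forall (I : finType) (n : I -> nat) l (T : tangle n l)
      (x : forall i, P (n i)) (i : I) (c : R[i]) (a b : P (n i)),
    planar T ->
    pa_act P T (dfwith x i (c *: a + b))
    = c *: pa_act P T (dfwith x i a) + pa_act P T (dfwith x i b);
  pa_relabel : forall (I I' : finType) (n : I -> nat) l (f : I' -> I)
      (T : tangle n l) (T' : tangle (fun i => n (f i)) l)
      (h : node T' -> node T) (x : forall i, P (n i)),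
    planar T -> is_relabeling h ->
    pa_act P T' (fun i => x (f i)) = pa_act P T x;
  pa_subdivide : forall (I : finType) (n : I -> nat) l (T : tangle n l)
      (p : flag n l (node T)) (x : forall i, P (n i)),
    planar T -> pa_act P (subdivide T p) x = pa_act P T x;
  pa_compose : forall (I J : finType) (n : option I -> nat) (m : J -> nat) l
      (T : tangle n l) (S : tangle m (n None))
      (z : forall s, P (compose_arity n m s)),
    planar T -> planar S ->
    pa_act P (compose T S) z = pa_act P T (compose_input l S z);
  pa_reflect : forall (I : finType) (n : I -> nat) l (T : tangle n l)
      (x : forall i, P (n i)),
    planar T ->
    pa_star (pa_act P T x)
    = pa_act P (reflect_tangle T) (fun i => pa_star (x i));
  (* Two tangles without outer boundary points are isotopic on the sphere when
     they differ only by the region containing the outer disk. *)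
  pa_spherical : forall (I : finType) (n : I -> nat) (T : tangle n 0)
      (e : rel (spot n 0 (node T))) (x : forall i, P (n i)),
    planar T -> planar (Tangle (mate T) e) ->
    (forall s t, spot_vertex s != inl None -> spot_vertex t != inl None ->
       e s t = same T s t) ->
    pa_act P (Tangle (mate T) e) x = pa_act P T x;
  pa_modulus_gt1 : 1 < pa_modulus P;
  pa_loop : pa_act P loop_tangle no_input = ((pa_modulus P)%:C)%C *: pa_one;
  pa_ip_conj : forall n (a b : P n), pa_ip b a = (pa_ip a b)^*;
  pa_ip_ge0 : forall n (a : P n), 0 <= pa_ip a a;
  pa_ip_eq0 : forall n (a : P n), pa_ip a a = 0 -> a = 0 }.

(** * The graded algebra

    Its elements are the finitely supported families in [forall n, P n]; all
    the sums below have finitely many non-zero terms on such families. *)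
Definition Gr : set (forall n, P n) :=
  [set a | exists N : nat, forall n, (N <= n)%N -> a n = 0].

Definition gr_hom (n : nat) (x : P n) : forall k, P k :=
  dfwith (fun k => 0 : P k) n x.

Definition gr_one : forall n, P n := gr_hom pa_one.
Definition gr_cup : forall n, P n := gr_hom pa_cup.

Definition gr_ip (a b : forall n, P n) : R[i] :=
  \sum_(n \in [set: nat]) pa_ip (a n) (b n).

Definition gr_mul (a b : forall n, P n) (l : nat) : P l :=
  \sum_(t \in [set t : nat * nat * nat |
                let: (n, m, j) := t in
                (j <= minn n m)%N /\ (l + j.*2 = n + m)%N])
    (let: (n, m, j) := t in pa_starj j l (a n) (b m)).

End PlanarData.

(** * Hilbert spaces and von Neumann algebras *)

Record hilbert (R : realType) := Hilbert {
  hspace :> completeNormedModType R[i];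
  ip : hspace -> hspace -> R[i];
  ip_linear : forall (c : R[i]) x y z,
    ip (c *: x + y) z = c * ip x z + ip y z;
  ip_conj : forall x y, ip y x = (ip x y)^*;
  ip_norm : forall x, ip x x = `|x| ^+ 2 }.

Section Operators.
Variables (R : realType) (H : hilbert R).

Definition bounded_op (X : H -> H) : Prop := linear X /\ continuous X.

Definition is_adjoint (X Y : H -> H) : Prop :=
  forall x y, ip (X x) y = ip x (Y y).

Definition commutant (S : set (H -> H)) : set (H -> H) :=
  [set X | bounded_op X /\ forall Y, S Y -> X \o Y = Y \o X].

Record von_neumann (M : set (H -> H)) : Prop := VonNeumann {
  vn_bounded : M `<=` bounded_op;
  vn_adjoint : forall X, M X -> exists2 Y, M Y & is_adjoint X Y;
  vn_bicommutant : commutant (commutant M) = M }.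

Definition vn_generated (S : set (H -> H)) : set (H -> H) :=
  [set X | forall M, von_neumann M -> S `<=` M -> M X].

Definition abelian_ops (A : set (H -> H)) : Prop :=
  forall X Y, A X -> A Y -> X \o Y = Y \o X.

Definition is_factor (M : set (H -> H)) : Prop :=
  von_neumann M /\
  M `&` commutant M = [set X | exists c : R[i], X = (fun x => c *: x)].

Definition finite_dimensional (M : set (H -> H)) : Prop :=
  exists (k : nat) (F : 'I_k -> H -> H), forall X, M X ->
    exists c : 'I_k -> R[i], X = (fun x => \sum_(i < k) c i *: F i x).

(** Normality is ultraweak continuity: phi(X) = sum_k <X xi_k, eta_k> with
    square-summable sequences of vectors. *)
Definition normal_functional (M : set (H -> H)) (phi : (H -> H) -> R[i]) :
    Prop :=
  exists xi eta : nat -> H,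
    [/\ exists B : R[i], forall N, \sum_(k < N) `|xi k| ^+ 2 <= B,
        exists B : R[i], forall N, \sum_(k < N) `|eta k| ^+ 2 <= B &
        forall X, M X -> forall e : R[i], 0 < e ->
          exists N0, forall N, (N0 <= N)%N ->
            `| \sum_(k < N) ip (X (xi k)) (eta k) - phi X | < e].

Record faithful_normal_trace (M : set (H -> H)) (tau : (H -> H) -> R[i]) :
    Prop := FaithfulNormalTrace {
  tau_linear : forall (c : R[i]) X Y, M X -> M Y ->
    tau (fun x => c *: X x + Y x) = c * tau X + tau Y;
  tau_one : tau (fun x => x) = 1;
  tau_ge0 : forall X Y, M X -> M Y -> is_adjoint X Y -> 0 <= tau (Y \o X);
  tau_faithful : forall X Y, M X -> M Y -> is_adjoint X Y ->
    tau (Y \o X) = 0 -> X = (fun _ => 0);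
  tau_trace : forall X Y, M X -> M Y -> tau (X \o Y) = tau (Y \o X);
  tau_normal : normal_functional M tau }.

Definition II1_factor (M : set (H -> H)) : Prop :=
  [/\ is_factor M, ~ finite_dimensional M &
      exists tau, faithful_normal_trace M tau].

Definition maximal_abelian (A M : set (H -> H)) : Prop :=
  [/\ von_neumann A, abelian_ops A, A `<=` M &
      forall B, von_neumann B -> abelian_ops B -> A `<=` B -> B `<=` M ->
        B = A].

(** The right action of [a] on the GNS space of [M] with cyclic vector [Om]:
    the bounded operator extending y Om |-> (y a) Om. *)
Definition right_op (M : set (H -> H)) (Om : H) (a : H -> H) : H -> H :=
  xget (fun _ => 0)
    [set X | bounded_op X /\ forall y, M y -> X (y Om) = y (a Om)].

End Operators.

Definition hspan (R : realType) (H : hilbert R) (S : set H) : set H :=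
  [set x | exists (k : nat) (c : 'I_k -> R[i]) (s : 'I_k -> H),
     (forall i, S (s i)) /\ x = \sum_(i < k) c i *: s i].

Definition isometric (R : realType) (H K : hilbert R) (U : H -> K) : Prop :=
  linear U /\ forall x y, ip (U x) (U y) = ip x y.

Definition is_hilbert_tensor (R : realType) (H K W : hilbert R)
    (t : H -> K -> W) : Prop :=
  [/\ forall y, linear (fun x => t x y), forall x, linear (t x),
      forall x y x' y', ip (t x y) (t x' y') = ip x x' * ip y y' &
      closure (hspan [set w | exists x y, w = t x y]) = setT].

Definition is_hilbert_sum (R : realType) (J : Type) (F : J -> hilbert R)
    (D : hilbert R) (inj : forall j, F j -> D) : Prop :=
  [/\ forall j, isometric (inj j),
      forall j k, j <> k -> forall x y, ip (inj j x) (inj k y) = 0 &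
      closure (hspan [set w | exists j x, w = inj j x]) = setT].

(** * Bimodules

    [A] is a von Neumann algebra acting on [H]; only the actions of the
    operators belonging to [A] are relevant. *)
Record bimodule (R : realType) (H : hilbert R) := Bimodule {
  bm_space :> hilbert R;
  bm_left : (H -> H) -> bm_space -> bm_space;
  bm_right : (H -> H) -> bm_space -> bm_space }.

Arguments bm_left {R H} b a x.
Arguments bm_right {R H} b a x.

Section Bimodules.
Variables (R : realType) (H : hilbert R) (A : set (H -> H)).

Definition bounded_actions (B : bimodule H) : Prop :=
  forall a, A a -> bounded_op (bm_left B a) /\ bounded_op (bm_right B a).

Definition intertwining (B C : bimodule H) (U : B -> C) : Prop :=
  forall a x, A a ->
    U (bm_left B a x) = bm_left C a (U x) /\
    U (bm_right B a x) = bm_right C a (U x).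

Definition bimodule_iso (B C : bimodule H) : Prop :=
  exists U : B -> C,
    [/\ isometric U, forall z, exists x, U x = z & intertwining U].

(** The space of [B], embedded by [e], is the closure of A Om in [E], with the
    actions of [A] inherited from [E]. *)
Definition is_L2 (E : bimodule H) (toE : H -> E) (Om : H) (B : bimodule H) :
    Prop :=
  exists e : B -> E,
    [/\ isometric e,
        range e = closure [set x | exists2 a, A a & x = toE (a Om)] &
        intertwining e].

(** [W] is the coarse correspondence built on the [A]-bimodule [L] = L^2(A). *)
Definition is_coarse (L W : bimodule H) : Prop :=
  bounded_actions W /\
  exists t : L -> L -> W, is_hilbert_tensor t /\
    forall a x y, A a ->
      bm_left W a (t x y) = t (bm_left L a x) y /\
      bm_right W a (t x y) = t x (bm_right L a y).

Definition is_bimodule_sum (J : Type) (F : J -> bimodule H) (D : bimodule H) :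
    Prop :=
  bounded_actions D /\
  exists inj : forall j, F j -> D,
    is_hilbert_sum inj /\ forall j, intertwining (inj j).

End Bimodules.

(** * The von Neumann algebra of a planar algebra and its cup subalgebra *)

Section GJS.
Variables (R : realType) (P : planar_data R) (H : hilbert R).
Variable iota : (forall n, P n) -> H.

(** [H] is the completion of Gr(P), with canonical map [iota]; the values of
    [iota] outside of [Gr P] are irrelevant. *)
Definition is_completion : Prop :=
  [/\ forall (c : R[i]) a b, Gr a -> Gr b ->
        iota (fun n => c *: a n + b n) = c *: iota a + iota b,
      forall a b, Gr a -> Gr b -> ip (iota a) (iota b) = gr_ip a b &
      closure (iota @` Gr (P := P)) = setT].

(** [X] is the operator pi(a). *)
Definition is_pi (a : forall n, P n) (X : H -> H) : Prop :=
  bounded_op X /\ forall b, Gr b -> X (iota b) = iota (gr_mul a b).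

Definition vacuum : H := iota (gr_one P).

Definition planar_vn : set (H -> H) :=
  vn_generated [set X | exists2 a, Gr a & is_pi a X].

Definition cup_vn : set (H -> H) :=
  vn_generated [set X | is_pi (gr_cup P) X].

Definition L2M : bimodule H :=
  Bimodule (bm_space := H) (fun a => a) (right_op planar_vn vacuum).

Definition is_L2A : bimodule H -> Prop :=
  @is_L2 R H cup_vn L2M (fun x => x) vacuum.

End GJS.

(* Main.v *)
(** Up to an affine change and a rank one perturbation, left multiplication by the cup is [S + S*],
    where the isometry [S] places a cup on the left; the right action gives in the same way [T + T*],
    and [S] commutes with [T].  The vectors [S^i 1] span [L^2(A)].  They span [L^2(M)] together with
    the vectors [S^i T^j v], where [v] runs over the homogeneous elements killed by capping off on
    either side.  If [v] has degree at least 2, the [S^i T^j v] are orthogonal and [S + S*], [T + T*]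
    act on them as two commuting free Jacobi matrices: this is a coarse correspondence.  In degree 1
    they are not orthogonal, but their Chebyshev combinations are the image of the orthogonal model
    under a bounded intertwiner with bounded inverse, and its polar part is a bimodule isomorphism.
    The perturbed Jacobi matrix on [L^2(A)] is straightened in the same way.

    If [x] commutes with the cup, the coordinates of [x 1] in a coarse summand have differences along
    the antidiagonals which are constant on the diagonals, so they vanish by square summability and
    [x 1] lies in [L^2(A)]; hence [A] is maximal abelian.  A central element then belongs to [A] and
    acts in the same way from the left and from the right on a coarse correspondence, so it is a
    scalar.  Such a summand exists: in degree 4 the nested cups and the two adjacent cups are
    independent, since [delta > 1].

    The maps [b |-> a *_j b] are bounded by iterating the Cauchy-Schwarz inequality, and the identities
    between the [a *_j b] come from planar tangles described by numeric codes. *)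

From HB Require Import structures.
Require Import Defs.
From mathcomp Require Import all_boot all_order all_algebra complex.
From mathcomp Require Import all_classical all_reals all_analysis.
From mathcomp Require Import zify ring lra.

Set Implicit Arguments.
Unset Strict Implicit.
Unset Printing Implicit Defensive.

Import Order.TTheory GRing.Theory Num.Theory.
Import numFieldNormedType.Exports.

Local Open Scope classical_set_scope.
Local Open Scope ring_scope.

(** * Erasing nodes of tangles *)

Arguments edge_rel {I n l} T _ _.
Arguments link_rel {I n l} T _ _.

(** The bimodule structure is controlled by two operators. [A] is the double commutant of the
    self-adjoint operator [XL], left multiplication by the cup, and the right action is conjugated
    from the left one by the involution, so a bounded operator that commutes with [XL] and [XR]
    commutes with both actions of [A]. The intertwiners that can be written down are only bounded
    below; the polar decomposition, with an inverse square root found by iteration, makes them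
    isometric. A single vector of degree 4 is the model of the coarse correspondence, and every
    other summand is compared with it. The exceptional constant of degree 1 is the inverse of the
    modulus: a cup on the right, capped from the left, straightens to one string and closes no loop,
    so that only the normalisation remains. A modulus above 1 turns the corrections into
    contractions. On the planar side, composing tangles creates nodes and merges regions, so equal
    values require a comparison of tangles. Most tangles used have their marked points in one region
    and no further merging of regions; their strings determine them, and identities become
    arithmetic on point numbers. *)

Lemma connect_map (A B : finType) (e : rel A) (e' : rel B) (f : A -> B) :
  (forall x y, e x y -> connect e' (f x) (f y)) ->
  forall x y, connect e x y -> connect e' (f x) (f y).
Proof.
move=> h x y /connectP[p]; elim: p x => [|z p IH] x /=; first by move=> _ ->.
by case/andP=> /h exz pz yE; apply: connect_trans exz (IH _ pz yE).
Qed.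

Lemma connect_invariant (A : finType) (B : eqType) (e : rel A) (f : A -> B) :
  (forall x y, e x y -> f x = f y) -> forall x y, connect e x y -> f x = f y.
Proof.
move=> h x y /connectP[p]; elim: p x => [|z p IH] x /=; first by move=> _ ->.
by case/andP=> /h -> pz yE; apply: IH.
Qed.

Lemma equivalence_connect (A : finType) (e : rel A) :
  equivalence_rel e -> connect e =2 e.
Proof.
move=> he x y; apply/idP/idP; last exact: connect1.
have eq_class : forall x' y', e x' y' -> e x x' = e x y'.
  move=> x' y' exy; have [_ htr] := he x x y.
  apply/idP/idP => h.
    by have [_ /(_ h) ->] := he x x' y'.
  have exy' : e y' x' by have [hr /(_ exy) <-] := he x' y' x'; have [] := he x' x' x'.
  by have [_ /(_ h) ->] := he x y' x'.
by move/(connect_invariant eq_class) <-; have [] := he x x x.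
Qed.

Lemma n_comp_map (A B : finType) (e : rel A) (e0 : rel B) (h : B -> A) :
  connect_sym e -> connect_sym e0 ->
  (forall x, exists x', connect e x (h x')) ->
  (forall x y, connect e0 x y = connect e (h x) (h y)) ->
  n_comp e predT = n_comp e0 predT.
Proof.
move=> se se0 hex heq; rewrite (adjunction_n_comp h se se0) //.
by split=> [x _|x y _]; [exact: sigW (hex x) | exact: heq].
Qed.

(** The roots of the components correspond to the values of the complete invariant [f], which [s]
    lists without repetition. Regions and components are counted below through such explicit
    labels. *)
Lemma n_comp_labels (A : finType) (X : eqType) (e : rel A) (f : A -> X)
    (s : seq X) :
  connect e =2 (fun x y => f x == f y) -> uniq s ->
  (forall x, f x \in s) -> (forall y, y \in s -> exists x, f x = y) ->
  n_comp e predT = size s.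
Proof.
move=> he us fs sf.
have se : connect_sym e by move=> x y; rewrite !he eq_sym.
rewrite /n_comp_mem; set r := (X in #|X|).
have -> : size s = size (map f (enum r)).
  apply/eqP; rewrite -uniq_size_uniq // ?map_inj_in_uniq ?enum_uniq //.
    move=> x y; rewrite !mem_enum !inE !andbT => /eqP hx /eqP hy fxy.
    by rewrite -hx -hy; apply/(fingraph.rootP se); rewrite he fxy.
  move=> y; apply/idP/idP => [|/(sf _)[x <-]].
    by case/seq.mapP=> x _ ->.
  have -> : f x = f (fingraph.root e x) by apply/eqP; rewrite -he connect_root.
  by apply: map_f; rewrite mem_enum !inE andbT; apply: roots_root.
by rewrite size_map cardE.
Qed.

Lemma symmetric_edge (I : finType) (n : I -> nat) (l : nat) (T : tangle n l) :
  involutive (mate T) -> connect_sym (edge_rel T).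
Proof.
move=> mK; apply: sym_connect_sym => u v.
by apply/existsP/existsP=> -[p /andP[h1 h2]]; exists (mate T p);
  rewrite mK h1 h2.
Qed.

Lemma edge_mate (I : finType) (n : I -> nat) (l : nat) (T : tangle n l) p :
  connect (edge_rel T) (flag_vertex p) (flag_vertex (mate T p)).
Proof. by apply/connect1/existsP; exists p; rewrite !eqxx. Qed.

Lemma card_flag (I : finType) (n : I -> nat) (l : nat) (V : finType) :
  #|flag n l V| = (l + #|{: {i : I & 'I_(n i)}}| + #|V|.*2)%N.
Proof. by rewrite !card_sum card_prod card_bool card_ord muln2. Qed.

Lemma card_vertex (I V : finType) : #|vertex I V| = (#|I| + #|V|).+1%N.
Proof. by rewrite card_sum card_option addSn. Qed.

(** A tangle [T] reduces to [T0] when erasing the nodes of [T] outside of the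
    image of [inc] yields [T0]: [e p] is the end in [T0] of the walk leaving
    along the flag [p], and the decrease of [rk] along walks excludes closed
    loops among the erased strings. *)
Section Reduction.
Variables (I : finType) (n : I -> nat) (l : nat).
Variables (T T0 : tangle n l) (inc : node T0 -> node T).

Definition keep_flag (q : flag n l (node T0)) : flag n l (node T) :=
  match q with inl d => inl d | inr (v, b) => inr (inc v, b) end.

Definition keep_spot (s : spot n l (node T0)) : spot n l (node T) :=
  match s with inl d => inl d | inr (v, b) => inr (inc v, b) end.

Definition keep_vertex (u : vertex I (node T0)) : vertex I (node T) :=
  match u with inl d => inl d | inr v => inr (inc v) end.

Record reduction (X : eqType) (e : flag n l (node T) -> flag n l (node T0))
    (rk : flag n l (node T) -> nat) (lab : spot n l (node T) -> X) : Prop :=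
  Reduction {
  red_inj : injective inc;
  red_mateK : involutive (mate T);
  red_neq : forall p, mate T p != p;
  red_end : forall p, mate T p = keep_flag (e p) \/
    exists v b, [/\ v \notin codom inc, mate T p = flag_node n l v b,
      e p = e (flag_node n l v (~~ b)) &
      (rk (flag_node n l v (~~ b)) < rk p)%N];
  red_keep : forall q, e (keep_flag q) = mate T0 q;
  red_same : forall s t, same T s t = (lab s == lab t);
  red_same0 : forall s t,
    same T0 s t = (lab (keep_spot s) == lab (keep_spot t));
  red_face : forall p, lab (lspot p) = lab (rspot (mate T p)) }.

Lemma keep_rspot q : rspot (keep_flag q) = keep_spot (rspot q).
Proof. by case: q => [[k|[i k]]|[v b]]. Qed.

Lemma keep_flag_vertex q : flag_vertex (keep_flag q) = keep_vertex (flag_vertex q).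
Proof. by case: q => [[k|[i k]]|[v b]]. Qed.

Lemma keep_spot_vertex q : spot_vertex (keep_spot q) = keep_vertex (spot_vertex q).
Proof. by case: q => [[k|[i k]]|[v b]]. Qed.

Variables (X : eqType) (e : flag n l (node T) -> flag n l (node T0)).
Variables (rk : flag n l (node T) -> nat) (lab : spot n l (node T) -> X).
Hypothesis red : reduction e rk lab.

Lemma rank_ind (Q : flag n l (node T) -> Prop) :
  (forall p, mate T p = keep_flag (e p) -> Q p) ->
  (forall p v b, v \notin codom inc -> mate T p = flag_node n l v b ->
     e p = e (flag_node n l v (~~ b)) -> Q (flag_node n l v (~~ b)) -> Q p) ->
  forall p, Q p.
Proof.
move=> h1 h2 p; have [m] := ubnP (rk p); elim: m p => // m IH p ltp.
have [/h1//|[v [b [vN mp ep lrk]]]] := red_end red p.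
by apply: (h2 p v b) => //; apply: IH; apply: leq_trans lrk _.
Qed.

Lemma not_kept v b q : v \notin codom inc -> flag_node n l v b <> keep_flag q.
Proof.
move=> vN; case: q => // -[w c] [vE _]; move: vN.
by rewrite vE codom_f.
Qed.

Lemma end_back p v b : v \notin codom inc -> mate T p = flag_node n l v b ->
  e p = e (flag_node n l v (~~ b)).
Proof.
move=> vN mp; have [h|[v' [b' [_ mp' -> _]]]] := red_end red p.
  by case: (not_kept vN (etrans (esym mp) h)).
by move: mp'; rewrite mp => -[-> ->].
Qed.

(** Leaving along the other end of the first edge is following the same string backwards, and this
    leads to its opposite end. *)
Lemma end_mate p : e (mate T p) = mate T0 (e p).
Proof.
elim/rank_ind: p => [p ->|p v b vN mp ep IH]; first exact: red_keep red _.
rewrite ep -IH mp.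
rewrite -{1}[b]negbK -(end_back (p := mate T (flag_node n l v (~~ b)))) //.
exact: red_mateK red _.
Qed.

Lemma label_end p : lab (lspot p) = lab (keep_spot (rspot (e p))).
Proof.
elim/rank_ind: p => [p mp|p v b vN mp -> <-]; rewrite (red_face red) mp //.
by rewrite keep_rspot.
Qed.

Lemma vertex_end p :
  connect (edge_rel T) (flag_vertex p) (keep_vertex (flag_vertex (e p))).
Proof.
elim/rank_ind: p => [p mp|p v b vN mp -> IH]; apply: connect_trans (edge_mate _) _.
  by rewrite mp keep_flag_vertex.
by rewrite mp.
Qed.

(** A retraction onto the vertices of [T0] that respects connected components: an erased node slides
    along its string to one end. The choice of the side is immaterial for connectivity, since both
    ends lie on the same string. *)
Definition anchor (u : vertex I (node T)) : vertex I (node T0) :=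
  match u with
  | inl d => inl d
  | inr v => if [pick w | inc w == v] is Some w then inr w
             else flag_vertex (e (flag_node n l v true))
  end.

Lemma anchor_keep u : anchor (keep_vertex u) = u.
Proof.
case: u => //= w; case: pickP => [w' /eqP/(red_inj red)->//|/(_ w)].
by rewrite eqxx.
Qed.

Lemma anchor_end (mK : involutive (mate T0)) p :
  connect (edge_rel T0) (anchor (flag_vertex p)) (flag_vertex (e p)).
Proof.
have kept q : connect (edge_rel T0) (anchor (flag_vertex (keep_flag q)))
                (flag_vertex (e (keep_flag q))).
  by rewrite keep_flag_vertex anchor_keep (red_keep red) edge_mate.
case: p => [d|[v b]]; first exact: (kept (inl d)).
case vN: (v \in codom inc).
  by have /codomP[w ->] := vN; apply: (kept (inr (w, b))).
move/negbT: vN => vN /=; case: pickP => [w /eqP wE|_].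
  by move: vN; rewrite -wE codom_f.
case: b => //.
rewrite -(@end_back (mate T (flag_node n l v false)) v false) //; last exact: red_mateK red _.
by rewrite end_mate (symmetric_edge mK) edge_mate.
Qed.

Lemma anchor_edge (mK : involutive (mate T0)) u v :
  edge_rel T u v -> connect (edge_rel T0) (anchor u) (anchor v).
Proof.
case/existsP=> p /andP[/eqP <- /eqP <-].
apply: connect_trans (anchor_end mK p) _; rewrite (symmetric_edge mK).
apply: connect_trans (anchor_end mK _) _.
by rewrite end_mate (symmetric_edge mK) edge_mate.
Qed.

Lemma keep_edge u v :
  edge_rel T0 u v -> connect (edge_rel T) (keep_vertex u) (keep_vertex v).
Proof.
case/existsP=> p /andP[/eqP <- /eqP <-].
by rewrite -keep_flag_vertex -(red_keep red) vertex_end.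
Qed.

Lemma keep_spot_ex s : exists s0, lab s = lab (keep_spot s0).
Proof.
case: s => [d|[v b]]; first by exists (inl d).
by exists (rspot (e (flag_node n l v b))); rewrite -label_end.
Qed.

Lemma equivalence_label (A : finType) (Y : eqType) (f : A -> Y) (r : rel A) :
  (forall s t, r s t = (f s == f t)) -> equivalence_rel r.
Proof. by move=> h x y z; rewrite !h eqxx; split => // /eqP->. Qed.

(** Each erased node accounts for one vertex and one edge, that is two flags, while regions and
    components stay the same. Both sides of Euler's relation thus grow by the same amount. *)
Lemma reduction_planar : planar T0 -> planar T.
Proof.
move=> pT0; have mK := planar_mateK pT0.
have eqT := equivalence_label (red_same red).
have eqT0 := equivalence_label (red_same0 red).
have keep_link s t : connect (link_rel T0) s t ->
    connect (link_rel T) (keep_spot s) (keep_spot t).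
  apply: connect_map => x y /orP[h|/eqP h]; apply/connect1/orP; [left|right].
    by rewrite (red_same red) -(red_same0 red).
  by rewrite !keep_spot_vertex h.
have link_keep s : exists s0, connect (link_rel T) s (keep_spot s0) /\
   connect (link_rel T) (keep_spot s0) s.
  have [s0 h] := keep_spot_ex s; exists s0.
  by split; apply/connect1/orP; left; rewrite (red_same red) h.
split => //.
- exact: red_mateK red.
- exact: red_neq red.
- by move=> p; rewrite (red_same red) (red_face red).
- by have := planar_mark_out pT0; rewrite (red_same red) (red_same0 red).
- by move=> i; have := planar_mark_in pT0 i; rewrite (red_same red) (red_same0 red).
- move=> s t; have [s0 [h1 _]] := link_keep s; have [t0 [_ h2]] := link_keep t.
  apply: connect_trans h1 (connect_trans _ h2); apply: keep_link.
  exact: planar_connected pT0 _ _.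
- have := planar_euler pT0.
  rewrite (@n_comp_map _ _ (same T) (same T0) keep_spot); first last.
  + by move=> s t; rewrite !equivalence_connect // (red_same red) (red_same0 red).
  + move=> s; have [s0 h] := keep_spot_ex s; exists s0.
    by rewrite equivalence_connect // (red_same red) h.
  + by move=> x y; rewrite !equivalence_connect // !(red_same0 red) eq_sym.
  + by move=> x y; rewrite !equivalence_connect // !(red_same red) eq_sym.
  rewrite (@n_comp_map _ _ (edge_rel T) (edge_rel T0) keep_vertex); first last.
  + move=> x y; apply/idP/idP; first exact: (connect_map keep_edge).
    by move/(connect_map (anchor_edge mK)); rewrite !anchor_keep.
  + case=> [d|v]; first by exists (inl d).
    by exists (flag_vertex (e (flag_node n l v true))); apply: (vertex_end (flag_node n l v true)).
  + exact: symmetric_edge mK.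
  + exact: symmetric_edge (red_mateK red).
  rewrite !card_flag !card_vertex; lia.
Qed.

End Reduction.

Section Erase.
Variables (I : finType) (n : I -> nat) (l : nat) (T : tangle n l) (v : node T).

Definition other_node : finType := {w : node T | w != v}.

Definition other_flag (p : flag n l other_node) : flag n l (node T) :=
  match p with inl d => inl d | inr (w, b) => inr (val w, b) end.

Definition other_spot (s : spot n l other_node) : spot n l (node T) :=
  match s with inl d => inl d | inr (w, b) => inr (val w, b) end.

Definition skip (p : flag n l (node T)) : flag n l (node T) :=
  match mate T p with
  | inr (w, b) => if w == v then mate T (inr (v, ~~ b)) else inr (w, b)
  | q => q
  end.

(** The mate is found by search because the remaining nodes form a subtype. The default [p] is never
    returned when the two edges at [v] lead away from [v], which is the hypothesis [noloop]
    below. *)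
Definition erase : tangle n l :=
  Tangle (fun p => odflt p [pick q | other_flag q == skip (other_flag p)])
    (fun s t => same T (other_spot s) (other_spot t)).

Lemma other_flag_inj : injective other_flag.
Proof.
move=> [d|[w b]] [d'|[w' b']] //=; first by case=> ->.
by case=> /val_inj -> ->.
Qed.

Definition at_node (p : flag n l (node T)) := flag_vertex p == inr v.

Lemma at_nodeP p : at_node p -> exists b, p = flag_node n l v b.
Proof.
by case: p => [[k|[i k]]|[w b]] //=; rewrite /at_node /= => /eqP[->]; exists b.
Qed.

Lemma other_flag_ex p : ~~ at_node p -> exists q, other_flag q = p.
Proof.
case: p => [d|[w b]]; first by exists (inl d).
rewrite /at_node /= => h; have wv : w != v by apply: contra h => /eqP->.
by exists (inr (exist _ w wv, b)).
Qed.

Lemma other_flagN p : ~~ at_node (other_flag p).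
Proof.
by case: p => [[k|[i k]]|[[w wv] b]].
Qed.

Hypothesis mK : involutive (mate T).
Hypothesis mN : forall p, mate T p != p.
Hypothesis noloop : forall b b', mate T (flag_node n l v b) <> flag_node n l v b'.

Lemma skip_node p b : mate T p = flag_node n l v b ->
  skip p = mate T (flag_node n l v (~~ b)).
Proof. by rewrite /skip => ->; rewrite /= eqxx. Qed.

Lemma skip_other p : ~~ at_node (mate T p) -> skip p = mate T p.
Proof.
rewrite /skip; case: (mate T p) => // -[w c]; rewrite /at_node /=.
by case: (w =P v) => [->|//]; rewrite eqxx.
Qed.

Lemma skipN p : ~~ at_node (skip p).
Proof.
case h: (at_node (mate T p)); last by rewrite skip_other h.
have [b mp] := at_nodeP h; rewrite (skip_node mp).
by apply/negP=> /at_nodeP[b' /noloop].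
Qed.

Lemma other_erase p : other_flag (mate erase p) = skip (other_flag p).
Proof.
rewrite /=; case: pickP => [q /eqP//|h].
have [q hq] := other_flag_ex (skipN (other_flag p)).
by have := h q; rewrite hq eqxx.
Qed.

Lemma skipK p : ~~ at_node p -> skip (skip p) = p.
Proof.
move=> pN; case h: (at_node (mate T p)); last first.
  by rewrite (skip_other (negbT h)) skip_other mK.
have [b mp] := at_nodeP h; rewrite (skip_node mp).
by rewrite (@skip_node _ (~~ b)) ?mK // negbK -mp mK.
Qed.

Lemma skip_neq p : ~~ at_node p -> skip p != p.
Proof.
move=> pN; case h: (at_node (mate T p)); last first.
  by rewrite (skip_other (negbT h)) mN.
have [b mp] := at_nodeP h; rewrite (skip_node mp).
apply/eqP=> /(congr1 (mate T)); rewrite mK mp => -[].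
by case: (b).
Qed.

End Erase.

Section PlanarAlgebra.
Variables (R : realType) (P : planar_data R).
Hypothesis hP : is_planar_algebra P.

(** Induction on the number [k] of nodes to erase. Up to relabelling, [T] is a subdivision of the
    tangle in which one node is erased, and [pa_subdivide] applies. The planarity that it demands
    propagates upwards from [T0] by [reduction_planar]. *)
Lemma reduction_act (I : finType) (n : I -> nat) (l : nat) (T0 : tangle n l)
    (k : nat) (T : tangle n l) (inc : node T0 -> node T) (X : eqType) e rk
    (lab : spot n l (node T) -> X) :
  planar T0 -> reduction inc e rk lab -> #|node T| = (#|node T0| + k)%N ->
  forall x, pa_act P T x = pa_act P T0 x.
Proof.
move=> pT0; elim: k T inc X e rk lab => [|k IH] T inc X e rk lab red cardT x.
  have bi : bijective inc.
    by apply: inj_card_bij (red_inj red) _; rewrite cardT addn0.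
  symmetry; apply: (@pa_relabel _ _ hP I I n l id T T0 inc) (reduction_planar red pT0) _.
  split => // [|q|s t]; first by exists id.
  - have relE q' : relabel_flag (f := id) inc q' = keep_flag inc q'.
      by case: q' => [[?|[? ?]]|[? ?]].
    rewrite !relE -(red_keep red).
    have [//|[v [b [vN _ _ _]]]] := red_end red (keep_flag inc q).
    have [g _ gK] := bi; by rewrite -[v]gK codom_f in vN.
  - have relE q' : relabel_spot (f := id) inc q' = keep_spot inc q'.
      by case: q' => [[?|[? ?]]|[? ?]].
    by rewrite !relE (red_same red) (red_same0 red).
have [v vN] : exists v, v \notin codom inc.
  apply/existsP; rewrite -negb_forall; apply/negP=> /forallP h.
  suff : (#|node T| <= #|node T0|)%N by rewrite cardT; lia.
  rewrite -(card_codom (red_inj red)); apply: subset_leq_card.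
  by apply/fintype.subsetP=> w _.
have mK := red_mateK red; have mN := red_neq red.
(* A string that closes up on [v] alone would start a walk returning to its own first flag, whose
   rank would be smaller than itself. *)
have noloop b b' : mate T (flag_node n l v b) <> flag_node n l v b'.
  move=> h; have neq : b' = ~~ b.
    by case: b b' h => -[] // /eqP; rewrite (negbTE (mN _)).
  subst b'.
  have [h1|[w [c [_ h1 _ lt]]]] := red_end red (flag_node n l v b).
    by rewrite h in h1; case: (@not_kept _ _ _ _ _ inc v (~~ b) _ vN h1).
  have [h1'|[w' [c' [_ h1' _ lt']]]] := red_end red (flag_node n l v (~~ b)).
    by rewrite -h mK in h1'; case: (@not_kept _ _ _ _ _ inc v b _ vN h1').
  rewrite -h mK in h1'; rewrite h in h1.
  by case: h1 h1' => ? ? [? ?]; subst; rewrite negbK in lt lt'; lia.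
pose T1 := erase v.
have valN w : inc w != v by apply: contraNneq vN => <-; rewrite codom_f.
pose inc1 (w : node T0) : node T1 := exist _ (inc w) (valN w).
have keep1 q : other_flag (keep_flag inc1 q) = keep_flag inc q by case: q => [d|[w b]].
have keeps1 q : other_spot (keep_spot inc1 q) = keep_spot inc q by case: q => [d|[w b]].
have lsp1 q : other_spot (lspot q) = lspot (@other_flag _ _ _ T v q) by case: q => [[?|[? ?]]|[? ?]].
have rsp1 q : other_spot (rspot q) = rspot (@other_flag _ _ _ T v q) by case: q => [[?|[? ?]]|[? ?]].
have oE q : other_flag (mate T1 q) = skip v (other_flag q) by apply: other_erase.
have oI := @other_flag_inj _ _ _ T v.
have step p : lab (lspot p) = lab (rspot (skip v p)).
  rewrite (red_face red); case h: (at_node v (mate T p)); last first.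
    by rewrite (skip_other (negbT h)).
  have [b mp] := at_nodeP h; rewrite (skip_node mp) mp.
  by rewrite -(red_face red).
have red1 : reduction inc1 (e \o @other_flag _ _ _ T v) (rk \o @other_flag _ _ _ T v)
    (lab \o @other_spot _ _ _ T v).
  split => /=.
  - by move=> w w' [/(red_inj red)].
  - by move=> q; apply: oI; rewrite !oE skipK // other_flagN.
  - by move=> q; apply/eqP=> /(congr1 (@other_flag _ _ _ T v)); rewrite oE; apply/eqP/skip_neq => //; apply: other_flagN.
  - have key p : ~~ at_node v (mate T p) -> forall q, other_flag (mate T1 q) = mate T p ->
       (mate T1 q = keep_flag inc1 (e p)) \/ exists v' b, [/\ v' \notin codom inc1,
         mate T1 q = flag_node n l v' b, e p = e (other_flag (flag_node n l v' (~~ b))) &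
         (rk (other_flag (flag_node n l v' (~~ b))) < rk p)%N].
      move=> pN q qE; have [h|[w [b [wN mp ep lt]]]] := red_end red p.
        by left; apply: oI; rewrite keep1 qE.
      have wv : w != v by move: pN; rewrite mp /at_node /=; apply: contra => /eqP->.
      right; exists (exist _ w wv), b; split => //.
        by apply: contra wN => /codomP[w' [->]]; rewrite codom_f.
      by apply: oI; rewrite qE mp.
    move=> q; case h: (at_node v (mate T (other_flag q))); last first.
      by apply: key (negbT h) _ _; rewrite oE skip_other ?h.
    have [b mp] := at_nodeP h.
    have [h'|[w' [b' [_ h' ep lt]]]] := red_end red (other_flag q).
      by rewrite mp in h'; case: (@not_kept _ _ _ _ _ inc v b _ vN h').
    rewrite mp in h'; case: h' => ? ?; subst w' b'; rewrite ep.
    have [||e1|[v' [b' [h1 h2 h3 h4]]]] := key (flag_node n l v (~~ b)) _ q.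
    + by apply/negP=> /at_nodeP[b' /noloop].
    + by rewrite oE (skip_node mp).
    + by left.
    + by right; exists v', b'; split => //; apply: leq_trans h4 (ltnW lt).
  - by move=> q; rewrite keep1 (red_keep red).
  - by move=> s t; rewrite (red_same red).
  - by move=> s t; rewrite !keeps1 (red_same0 red).
  - by move=> q; rewrite lsp1 rsp1 oE step.
have card1 : #|node T1| = (#|node T0| + k)%N.
  have := cardC1 v; rewrite cardT addnS /= => <-.
  by rewrite card_sig; apply: eq_card => w; rewrite !inE.
rewrite -(IH T1 inc1 _ _ _ _ red1 card1).
(* [T] is recovered by subdividing [T1] on the edge at [p], the flag that was tied to the side
   [false] of [v]. *)
have [p pE] : exists p : flag n l (node T1), other_flag p = mate T (flag_node n l v false).
  by apply: other_flag_ex; apply/negP=> /at_nodeP[b' /noloop].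
rewrite -(@pa_subdivide _ _ hP _ _ _ T1 p x (reduction_planar red1 pT0)).
pose h : node (subdivide T1 p) -> node T := fun w : option (node T1) => if w is Some w then val w else v.
symmetry; apply: (@pa_relabel _ _ hP I I n l id T (subdivide T1 p) h) (reduction_planar red pT0) _.
have mp : mate T (other_flag p) = flag_node n l v false by rewrite pE mK.
have skp : other_flag (mate T1 p) = mate T (flag_node n l v true).
  by rewrite oE (skip_node mp).
pose rf := @relabel_flag I I n l id T (subdivide T1 p) h.
pose rs := @relabel_spot I I n l id T (subdivide T1 p) h.
split => [||q|s t]; rewrite -?/(rf _) -?/(rs _); first by exists id.
- pose g (w : node T) : option (node T1) := insub w.
  exists g => [[w|]|w]; rewrite /g /h /=.
  + by rewrite valK.
  + by rewrite insubN ?eqxx.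
  + by case: insubP => [w' _ //|]; rewrite negbK => /eqP.
- have relo q' : rf (old_flag q') = other_flag q'.
    by case: q' => [[?|[? ?]]|[? ?]].
  have main q' : mate T (other_flag q') = rf
     (if q' == p then flag_node n l None false
      else if q' == mate T1 p then flag_node n l None true else old_flag (mate T1 q')).
    case: eqP => [->//|qp]; case: eqP => [->|qm]; first by rewrite skp mK.
    rewrite relo oE skip_other //; apply/negP=> /at_nodeP[b hb]; case: b hb => hb.
      by apply: qm; apply: oI; rewrite skp -hb mK.
    by apply: qp; apply: oI; rewrite pE -hb mK.
  case: q => [[k'|[i k']]|[[w|] b]]; [exact: (main (inl (inl k')))|
    exact: (main (inl (inr (existT _ i k'))))|exact: (main (inr (w, b)))|].
  by case: b => /=; rewrite relo ?skp ?pE.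
- have relS s' : lab (rs s') = lab (other_spot (subdivide_spot p s')).
    case: s' => [[?|[? ?]]|[[?|] []]] //=.
      by rewrite lsp1 (red_face red) mp.
    by rewrite rsp1 pE -(red_face red).
  by rewrite /= (red_same red) !relS (red_same red).
Qed.

End PlanarAlgebra.

(** * Numeric codes for planar tangles *)

(** Boundary points and spots are given numeric codes: the [k]-th one of the
    disk with code [d] is [(d, k)], and the outer disk has code 0. *)
Section Codes.
Variables (I : finType) (n : I -> nat) (l : nat) (V : finType) (c : I -> nat).

Definition flag_code (p : flag n l V) : nat * nat :=
  match p with
  | inl (inl k) => (0%N, k : nat)
  | inl (inr (existT i k)) => (c i, k : nat)
  | inr _ => (0%N, 0%N)
  end.

Definition spot_code (s : spot n l V) : nat * nat :=
  match s with
  | inl (inl k) => (0%N, k : nat)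
  | inl (inr (existT i k)) => (c i, k : nat)
  | inr _ => (0%N, 0%N)
  end.

Definition vertex_code (u : vertex I V) : nat :=
  match u with inl (Some i) => c i | _ => 0%N end.

End Codes.

(** Codes of the gaps to the left and to the right of a point. Around the outer disk, met from its
    inside, left and right are exchanged, hence the special case of code 0. *)
Definition lcode (p : nat * nat) := if p.1 == 0%N then (0%N, p.2.+1) else p.
Definition rcode (p : nat * nat) := if p.1 == 0%N then p else (p.1, p.2.+1).

Section CodeTheory.
Variables (I : finType) (n : I -> nat) (l : nat) (V : finType) (c : I -> nat).
Hypothesis void : V -> False.
Hypothesis cI : injective c.
Hypothesis c0 : forall i, c i != 0%N.

Lemma lspot_code (p : flag n l V) : spot_code c (lspot p) = lcode (flag_code c p).
Proof.
case: p => [[k|[i k]]|[v]]; [by rewrite /lcode /= /bump leq0n add1n| |by case: (void v)].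
by rewrite /lcode /= (negbTE (c0 i)).
Qed.

Lemma rspot_code (p : flag n l V) : spot_code c (rspot p) = rcode (flag_code c p).
Proof.
case: p => [[k|[i k]]|[v]]; [by []| |by case: (void v)].
by rewrite /rcode /= (negbTE (c0 i)) /bump leq0n add1n.
Qed.

Lemma flag_code_inj : injective (@flag_code I n l V c).
Proof.
move=> [[k|[i k]]|[v b]] [[k'|[i' k']]|[v' b']] /=.
all: try by (case: (void v)).
all: try by (case: (void v')).
- by case=> /val_inj ->.
- by case=> /esym/eqP; rewrite (negbTE (c0 i')).
- by case=> /eqP; rewrite (negbTE (c0 i)).
- by case=> /cI ii'; subst i' => /val_inj ->.
Qed.

Lemma spot_code_inj : injective (@spot_code I n l V c).
Proof.
move=> [[k|[i k]]|[v b]] [[k'|[i' k']]|[v' b']] /=.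
all: try by (case: (void v)).
all: try by (case: (void v')).
- by case=> /val_inj ->.
- by case=> /esym/eqP; rewrite (negbTE (c0 i')).
- by case=> /eqP; rewrite (negbTE (c0 i)).
- by case=> /cI ii'; subst i' => /val_inj ->.
Qed.

Lemma vertex_code_inj : injective (@vertex_code I V c).
Proof.
move=> [[i|]|v] [[i'|]|v'] /=.
all: try by (case: (void v)).
all: try by (case: (void v')).
- by move/cI->.
- by move/eqP; rewrite (negbTE (c0 i)).
- by move/esym/eqP; rewrite (negbTE (c0 i')).
by [].
Qed.

Lemma flag_vertex_code (p : flag n l V) :
  vertex_code c (flag_vertex p) = (flag_code c p).1.
Proof. by case: p => [[k|[i k]]|[v]]. Qed.

Definition codes := 0%N :: map c (enum I).

Variable N : nat -> nat.
Hypothesis N0 : N 0 = l.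
Hypothesis Nc : forall i, N (c i) = n i.

Definition is_point (p : nat * nat) := (p.1 \in codes) && (p.2 < N p.1)%N.
Definition is_gap (s : nat * nat) := (s.1 \in codes) && (s.2 <= N s.1)%N.

Lemma codesP d : d \in codes -> d = 0%N \/ exists i, d = c i.
Proof.
by rewrite inE => /orP[/eqP|/seq.mapP[i _]]; [left|right; exists i].
Qed.

Lemma mem_codes i : c i \in codes.
Proof. by rewrite inE map_f ?orbT // mem_enum. Qed.

Lemma flag_codeP (p : flag n l V) : is_point (flag_code c p).
Proof.
case: p => [[k|[i k]]|[v]]; [by rewrite /is_point /= N0| |by case: (void v)].
by rewrite /is_point /= mem_codes Nc /=.
Qed.

Lemma spot_codeP (p : spot n l V) : is_gap (spot_code c p).
Proof.
case: p => [[k|[i k]]|[v]]; [by rewrite /is_gap /= N0 -ltnS| |by case: (void v)].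
by rewrite /is_gap /= mem_codes Nc -ltnS /=; case: k.
Qed.

Lemma flag_code_ex p : is_point p -> exists q : flag n l V, flag_code c q = p.
Proof.
case: p => d k /andP[/= /codesP[->|[i ->]]]; rewrite ?N0 ?Nc => lk.
  by exists (flag_out n V (Ordinal lk)).
by exists (flag_in l V (Ordinal lk)).
Qed.

Lemma spot_code_ex p : is_gap p -> exists q : spot n l V, spot_code c q = p.
Proof.
case: p => d k /andP[/= /codesP[->|[i ->]]]; rewrite ?N0 ?Nc -ltnS => lk.
  by exists (spot_out n V (Ordinal lk)).
by exists (spot_in l V (Ordinal lk)).
Qed.

Lemma spot_function (X : Type) (f : spot n l V -> X) :
  exists g : nat * nat -> X, forall s, g (spot_code c s) = f s.
Proof.
exists (fun x => if [pick s | spot_code c s == x] is Some s then f s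
                 else f (spot_out n V ord0)) => s.
by case: pickP => [t /eqP/spot_code_inj->//|/(_ s)]; rewrite eqxx.
Qed.

Lemma vertex_function (X : Type) (f : vertex I V -> X) :
  exists g : nat -> X, forall s, g (vertex_code c s) = f s.
Proof.
exists (fun x => if [pick s | vertex_code c s == x] is Some s then f s
                 else f (inl None)) => s.
by case: pickP => [t /eqP/vertex_code_inj->//|/(_ s)]; rewrite eqxx.
Qed.

End CodeTheory.

(** [T] has no nodes and the strings [mt], and its regions are the smallest
    ones that contain the marked points of all disks in a common region. *)
Record drawn (I : finType) (n : I -> nat) (l : nat) (T : tangle n l)
    (c : I -> nat) (mt : nat * nat -> nat * nat) : Prop := Drawn {
  drawn_planar : planar T;
  drawn_void : node T -> False;
  drawn_inj : injective c;
  drawn_pos : forall i, c i != 0%N;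
  drawn_mate : forall p, flag_code c (mate T p) = mt (flag_code c p);
  drawn_marked : forall s, marked_spot pred0 s -> same T s (spot_out n _ ord0);
  drawn_tight : forall (X : eqType) (f : spot n l (node T) -> X),
    (forall p, f (lspot p) = f (rspot (mate T p))) ->
    (forall s, marked_spot pred0 s -> f s = f (spot_out n _ ord0)) ->
    forall s t, same T s t -> f s = f t }.

Definition labelled (I : finType) (n : I -> nat) (l : nat) (T : tangle n l)
    (c : I -> nat) (X : eqType) (L : nat * nat -> X) : Prop :=
  forall s t, same T s t = (L (spot_code c s) == L (spot_code c t)).

Section Draw.
Variables (I : finType) (n : I -> nat) (l : nat) (c : I -> nat) (N : nat -> nat).
Variables (m : flag n l void -> flag n l void) (mt : nat * nat -> nat * nat).
Hypothesis cI : injective c.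
Hypothesis c0 : forall i, c i != 0%N.
Hypothesis N0 : N 0 = l.
Hypothesis Nc : forall i, N (c i) = n i.
Hypothesis mE : forall p, flag_code c (m p) = mt (flag_code c p).

Let cs := codes c.
Let point := is_point c N.
Let gap := is_gap c N.

(** These are the functions on gaps that factor through the regions. Only codes occur in this form,
    so that regions can be computed without mentioning a tangle. *)
Definition face_function (X : Type) (f : nat * nat -> X) :=
  (forall p, point p -> f (lcode p) = f (rcode (mt p))) /\
  (forall d, d \in cs -> f (d, 0%N) = f (0%N, 0%N) /\ f (d, N d) = f (0%N, 0%N)).

(** [L] labels the gaps by their regions and [rep] picks a gap in each region, so that any face
    function factors through [L]. In the same way [kap] picks a disk in each connected component. *)
Variables (X : eqType) (L : nat * nat -> X) (rep : X -> nat * nat).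
Variables (Ls : seq X) (kap : nat -> nat).
Hypothesis mtK : forall p, point p -> mt (mt p) = p /\ mt p <> p.
Hypothesis faceL : face_function L.
Hypothesis repP : forall (Y : eqType) (f : nat * nat -> Y), face_function f ->
  forall s, gap s -> f s = f (rep (L s)).
Hypothesis Ls_uniq : uniq Ls.
Hypothesis LsP : forall s, gap s -> L s \in Ls.
Hypothesis repLs : forall x, x \in Ls -> gap (rep x) /\ L (rep x) = x.
Hypothesis kapP : forall p, point p -> kap p.1 = kap (mt p).1.
Hypothesis kap_rep : forall (Y : eqType) (f : nat -> Y),
  (forall p, point p -> f p.1 = f (mt p).1) -> forall d, d \in cs -> f d = f (kap d).
Hypothesis euler : ((size cs + size Ls).*2 =
  sumn (map N cs) + (size (undup (map kap cs))).+1.*2)%N.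

Let T := based_tangle m pred0.
Let voidF : void -> False := fun v => match v with end.

Lemma draw_marked X' (f : spot n l void -> X') (g : nat * nat -> X') :
  (forall s, g (spot_code c s) = f s) ->
  (forall d, d \in cs -> g (d, 0%N) = g (0%N, 0%N) /\ g (d, N d) = g (0%N, 0%N)) ->
  forall s, marked_spot pred0 s -> f s = f (spot_out n _ ord0).
Proof.
move=> gE h s; rewrite -!gE => /or4P[/eqP->//|/eqP->|ex|//] /=.
  by have [|_] := h 0%N; rewrite ?inE // N0.
case/existsP: ex => i hi; move: hi.
have [|h1 h2] := h (c i); first exact: mem_codes.
by case/orP=> /eqP-> /=; rewrite // -Nc.
Qed.

Lemma draw_tight (Y : eqType) (f : spot n l void -> Y) :
  (forall p, f (lspot p) = f (rspot (mate T p))) ->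
  (forall s, marked_spot pred0 s -> f s = f (spot_out n _ ord0)) ->
  forall s t, same T s t -> f s = f t.
Proof.
move=> h1 h2; apply: connect_invariant => s t.
have h u v : based_step m pred0 u v -> f u = f v.
  case/orP=> [/existsP[p /andP[/eqP-> /eqP->]]|/andP[/h2-> /h2->]//]; exact: h1.
by case/orP=> /h.
Qed.

Lemma draw_step s t : based_step m pred0 s t -> same T s t.
Proof. by move=> h; apply: connect1; rewrite h. Qed.

(** The root function of the region relation is itself a face function. It factors through [L] by
    [repP], and so equal labels force equal regions. *)
Lemma draw_labelled : labelled T c L.
Proof.
move=> s t; apply/idP/eqP.
  move: s t; apply: draw_tight => [p|].
    rewrite lspot_code // rspot_code // mE (proj1 faceL) //.
    exact: flag_codeP.
  by apply: (draw_marked (g := L)) => //; exact: (proj2 faceL).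
have symT : connect_sym (fun s t => based_step m pred0 s t || based_step m pred0 t s).
  by apply: sym_connect_sym => x y; rewrite orbC.
pose f := fingraph.root (fun s t => based_step m pred0 s t || based_step m pred0 t s).
have fP x y : same T x y -> f x = f y by move=> h; apply/eqP; rewrite root_connect.
have [g gE] := spot_function voidF cI c0 f.
have fg : face_function g.
  split=> [p pp|d].
    have [q <-] := flag_code_ex void N0 Nc pp.
    rewrite -lspot_code // -mE -rspot_code // !gE; apply/fP/draw_step.
    by apply/orP; left; apply/existsP; exists q; rewrite !eqxx.
  have mk x y : marked_spot pred0 x -> marked_spot pred0 y -> f x = f y.
    by move=> hx hy; apply/fP/draw_step; rewrite /based_step hx hy orbT.
  have m0 : marked_spot (n := n) (l := l) (V := void) pred0 (spot_out n void ord0).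
    by rewrite /marked_spot eqxx.
  move=> /codesP[->|[i ->]].
    split=> //; rewrite N0 -[(0%N, l)]/(spot_code c (spot_out n void (ord_max : 'I_l.+1))).
    rewrite -[(0%N, 0%N)]/(spot_code c (spot_out n void (ord0 : 'I_l.+1))) !gE.
    by apply: mk => //; rewrite /marked_spot eqxx orbT.
  rewrite -[(0%N, 0%N)]/(spot_code c (spot_out n void (ord0 : 'I_l.+1))) Nc.
  rewrite -[(c i, 0%N)]/(spot_code c (spot_in l void (ord0 : 'I_(n i).+1))).
  rewrite -[(c i, n i)]/(spot_code c (spot_in l void (ord_max : 'I_(n i).+1))) !gE.
  by split; apply: mk => //; apply/or4P; apply: Or43; apply/existsP; exists i; rewrite eqxx ?orbT.
move=> LE; have : f s = f t.
  rewrite -!gE (repP fg) ?(repP fg (s := spot_code c t)) ?LE //; exact: spot_codeP.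
by move/eqP; rewrite root_connect.
Qed.

(** The surface is connected since every disk meets the common region of the marked points. Regions
    are counted by [Ls] and components by the values of [kap], which reduces Euler's relation to the
    numerical hypothesis [euler]. *)
Lemma draw_planar : planar T.
Proof.
have lab := draw_labelled.
have mK : involutive m.
  move=> p; apply: (flag_code_inj voidF cI c0); rewrite !mE.
  by have [] := mtK (flag_codeP voidF N0 Nc p).
have steps s t : based_step m pred0 s t -> same T s t := @draw_step s t.
have mk x y : marked_spot pred0 x -> marked_spot pred0 y -> same T x y.
  by move=> hx hy; apply/steps; rewrite /based_step hx hy orbT.
have m0 : marked_spot (n := n) (l := l) (V := void) pred0 (spot_out n void ord0).
  by rewrite /marked_spot eqxx.
have mi i : marked_spot (l := l) (V := void) pred0 (spot_in l void (ord0 : 'I_(n i).+1)).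
  by apply/or4P; apply: Or43; apply/existsP; exists i; rewrite eqxx.
split => //.
- move=> p; apply/eqP=> h; have [_ []] := mtK (flag_codeP voidF N0 Nc p).
  by rewrite -mE; congr flag_code.
- exact: equivalence_label lab.
- by move=> p; apply: steps; apply/orP; left; apply/existsP; exists p; rewrite !eqxx.
- by apply: mk => //; rewrite /marked_spot eqxx orbT.
- by move=> i; apply: mk => //; apply/or4P; apply: Or43; apply/existsP; exists i; rewrite eqxx orbT.
- have main (s : spot n l void) : exists s0 : spot n l void, [/\ marked_spot pred0 s0,
     connect (link_rel T) s s0 & connect (link_rel T) s0 s].
    case: s => [[k|[i k]]|[[]]].
      exists (spot_out n void ord0); split => //; apply: connect1; apply/orP; right; exact: eqxx.
    exists (spot_in l void (ord0 : 'I_(n i).+1)); split => //; apply: connect1; apply/orP; right; exact: eqxx.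
  move=> s t; have [s0 [h1 h2 _]] := main s; have [t0 [h3 _ h4]] := main t.
  apply: connect_trans h2 (connect_trans _ h4); apply: connect1.
  by rewrite /link_rel mk.
- have -> : n_comp (same T) predT = size Ls.
    apply: (n_comp_labels (f := L \o spot_code c)) => //.
    + move=> x y; rewrite equivalence_connect; first exact: lab.
      exact: equivalence_label lab.
    + by move=> x; apply: LsP; apply: spot_codeP.
    + move=> y /repLs[/(spot_code_ex void N0 Nc)[s sE] <-]; exists s.
      by rewrite /= sE.
  have vcs (u : vertex I void) : vertex_code c u \in cs.
    case: u => [[i|]|[]] /=; last exact: mem_head.
    by rewrite /cs mem_codes.
  have -> : n_comp (edge_rel T) predT = size (undup (map kap cs)).
    apply: (n_comp_labels (f := kap \o vertex_code c)); rewrite ?undup_uniq //.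
    + move=> u v; apply/idP/eqP.
        apply: (connect_invariant (f := kap \o vertex_code c)) => x y.
        case/existsP=> p /andP[/eqP <- /eqP <-] /=.
        rewrite !flag_vertex_code mE; apply: kapP; exact: flag_codeP.
      move=> /= kE; have symE := symmetric_edge (T := T) mK.
      have [g gE] := vertex_function voidF cI c0 (fingraph.root (edge_rel T)).
      have gp p : point p -> g p.1 = g (mt p).1.
        move=> pp; have [q <-] := flag_code_ex void N0 Nc pp.
        rewrite -mE -!(flag_vertex_code c) !gE; apply/eqP.
        by rewrite (root_connect symE); apply: edge_mate.
      rewrite -(root_connect symE); apply/eqP.
      by rewrite -!gE (kap_rep gp) // kE -(kap_rep gp).
    + by move=> x; rewrite mem_undup; apply: (map_f kap); exact: vcs.
    + move=> y; rewrite mem_undup => /seq.mapP[d /codesP[->|[i ->]] ->].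
        by exists (inl None).
      by exists (inl (Some i)).
  have := euler; rewrite card_flag card_vertex card_void.
  move: (size (undup _)) => K; rewrite /= N0 size_map -cardE.
  have -> : #|{: {i : I & 'I_(n i)}}| = sumn [seq N i | i <- [seq c i | i <- enum I]].
    rewrite card_tagged -map_comp; congr sumn; apply: eq_map => i /=.
    by rewrite card_ord Nc.
  by move=> h; rewrite addn0 h double0 addn0.
Qed.

Lemma draw : drawn T c mt.
Proof.
split => //; [exact: draw_planar| |exact: draw_tight].
move=> s ms; apply: draw_step; rewrite /based_step ms orbC.
by rewrite /marked_spot eqxx.
Qed.

End Draw.

Section CodedMate.
Variables (I : finType) (n : I -> nat) (l : nat) (c : I -> nat).

Definition coded_mate (mt : nat * nat -> nat * nat) (p : flag n l void) :=
  odflt p [pick q | flag_code c q == mt (flag_code c p)].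

Lemma coded_mateE (N : nat -> nat) (mt : nat * nat -> nat * nat) :
  N 0 = l -> (forall i, N (c i) = n i) ->
  (forall p, is_point c N p -> is_point c N (mt p)) ->
  forall p, flag_code c (coded_mate mt p) = mt (flag_code c p).
Proof.
move=> N0 Nc h p; rewrite /coded_mate; case: pickP => [q /eqP//|hq] /=.
have voidF : void -> False by case.
have [q qE] := flag_code_ex void N0 Nc (h _ (flag_codeP voidF N0 Nc p)).
by have := hq q; rewrite qE eqxx.
Qed.

End CodedMate.

Section DrawnTheory.
Variables (I : finType) (n : I -> nat) (l : nat) (T : tangle n l).
Variables (c : I -> nat) (mt : nat * nat -> nat * nat) (N : nat -> nat).
Hypothesis dT : drawn T c mt.
Hypothesis N0 : N 0 = l.
Hypothesis Nc : forall i, N (c i) = n i.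

Lemma drawn_class : exists f : spot n l (node T) -> spot n l (node T),
  forall s t, same T s t = (f s == f t).
Proof.
have eqT := planar_equiv (drawn_planar dT).
have symT : connect_sym (same T).
  by move=> x y; rewrite !equivalence_connect //; have [h1 h2] := eqT x y x;
    apply/idP/idP => h; [have [h3 /(_ h) <-] := eqT x y x|have [h3 /(_ h) <-] := eqT y x y].
by exists (fingraph.root (same T)) => s t; rewrite root_connect // equivalence_connect.
Qed.

Lemma drawn_face_function (X : Type) (g : nat * nat -> X) :
  (forall s t, same T s t -> g (spot_code c s) = g (spot_code c t)) ->
  face_function c N mt g.
Proof.
have vT := drawn_void dT; have cI := drawn_inj dT; have c0 := drawn_pos dT.
move=> gP; split=> [p pp|d].
  have [q <-] := flag_code_ex (node T) N0 Nc pp.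
  rewrite -lspot_code // -(drawn_mate dT) -rspot_code //; apply: gP.
  exact: planar_face (drawn_planar dT) _.
move=> /codesP[->|[i ->]].
  split=> //; rewrite N0 -[(0%N, l)]/(spot_code c (spot_out n (node T) (ord_max : 'I_l.+1))).
  rewrite -[(0%N, 0%N)]/(spot_code c (spot_out n (node T) (ord0 : 'I_l.+1))).
  by apply: gP; apply: (drawn_marked dT); rewrite /marked_spot eqxx orbT.
rewrite -[(0%N, 0%N)]/(spot_code c (spot_out n (node T) (ord0 : 'I_l.+1))) Nc.
rewrite -[(c i, 0%N)]/(spot_code c (spot_in l (node T) (ord0 : 'I_(n i).+1))).
rewrite -[(c i, n i)]/(spot_code c (spot_in l (node T) (ord_max : 'I_(n i).+1))).
by split; apply: gP; apply: (drawn_marked dT); apply/or4P; apply: Or43;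
  apply/existsP; exists i; rewrite eqxx ?orbT.
Qed.

Lemma drawn_numeric (X : eqType) (g : nat * nat -> X) :
  face_function c N mt g ->
  forall s t, same T s t -> g (spot_code c s) = g (spot_code c t).
Proof.
have vT := drawn_void dT; have cI := drawn_inj dT; have c0 := drawn_pos dT.
move=> [g1 g2] s t; apply: (drawn_tight dT (f := g \o spot_code c)) => [p|{}s] /=.
  rewrite lspot_code // rspot_code // (drawn_mate dT) g1 //; exact: flag_codeP.
move=> /or4P[/eqP->//|/eqP->|ex|//].
  by have [|_] := g2 0%N; rewrite ?mem_head // N0.
case/existsP: ex => i; have [|h1 h2] := g2 (c i); first exact: mem_codes.
by case/orP=> /eqP-> /=; rewrite // -Nc.
Qed.

Lemma drawn_mateK p : is_point c N p -> mt (mt p) = p.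
Proof.
move=> /(flag_code_ex (node T) N0 Nc)[q <-].
by rewrite -!(drawn_mate dT) (planar_mateK (drawn_planar dT)).
Qed.

Lemma drawn_point p : is_point c N p -> is_point c N (mt p).
Proof.
move=> /(flag_code_ex (node T) N0 Nc)[q <-].
by rewrite -(drawn_mate dT); apply: flag_codeP => //; apply: drawn_void dT.
Qed.

End DrawnTheory.

Lemma Tagged_inj (X : nat -> Type) k (x y : X k) :
  Tagged X x = Tagged X y -> x = y.
Proof.
exact: (@Eqdep_dec.inj_pair2_eq_dec nat PeanoNat.Nat.eq_dec X k x y).
Qed.

Lemma is_point_mem (I I' : finType) (c : I -> nat) (c' : I' -> nat) N :
  codes c =i codes c' -> is_point c N =1 is_point c' N.
Proof. by move=> h p; rewrite /is_point h. Qed.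

(** * Values of tangles described by codes *)

Section Pictures.
Variables (R : realType) (P : planar_data R).
Hypothesis hP : is_planar_algebra P.

Definition vector := {k : nat & P k}.

Definition arity (l : nat) (tab : nat -> vector) (d : nat) : nat :=
  if d == 0%N then l else tag (tab d).

(** The strings [mt] define a tangle, with regions labelled by [L], for inner
    disks with codes [s] and arities [N]. *)
Definition drawable (s : seq nat) (N : nat -> nat)
    (mt : nat * nat -> nat * nat) (X : eqType) (L : nat * nat -> X) : Prop :=
  forall (I : finType) (n : I -> nat) l (c : I -> nat),
  injective c -> (forall i, c i != 0%N) -> perm_eq (map c (enum I)) s ->
  N 0 = l -> (forall i, N (c i) = n i) ->
  let T := based_tangle (coded_mate (n := n) (l := l) c mt) pred0 in
  drawn T c mt /\ labelled T c L.

(** [v] is the value of the tangle with strings [mt] on the vectors [tab]. *)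
Definition pic (mt : nat * nat -> nat * nat) (s : seq nat)
    (tab : nat -> vector) (l : nat) (v : P l) : Prop :=
  exists (I : finType) (n : I -> nat) (T : tangle n l) (c : I -> nat)
    (x : forall i, P (n i)),
  [/\ drawn T c mt, perm_eq (map c (enum I)) s,
      forall i, Tagged (fun k => P k) (x i) = tab (c i) & v = pa_act P T x].

(** The codes match the inner disks of the two tangles and the strings agree, so one tangle is a
    relabelling of the other as soon as their regions agree. *)
Lemma pic_unique mt mt' s tab tab' l (v v' : P l) :
  pic mt s tab v -> pic mt' s tab' v' -> (forall d, d \in s -> tab d = tab' d) ->
  (forall p, p.1 \in 0%N :: s -> (p.2 < arity l tab p.1)%N -> mt p = mt' p) ->
  v = v'.
Proof.
move=> [I [n [T [c [x [dT sT xT ->]]]]]] [I' [n' [T' [c' [x' [dT' sT' xT' ->]]]]]] tabE mtE.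
have mem i : c' i \in s by rewrite -(perm_mem sT') map_f ?mem_enum.
have ex i' : exists i, c i == c' i'.
  have := mem i'; rewrite -(perm_mem sT) => /seq.mapP[i _ ->]; by exists i.
pose f i' := xchoose (ex i'); have fE i' : c (f i') = c' i' by apply/eqP/(xchooseP (ex i')).
have tE i' : Tagged (fun k => P k) (x' i') = Tagged (fun k => P k) (x (f i')).
  by rewrite xT xT' fE tabE.
have nE : n' = fun i' => n (f i') by apply/funext=> i'; exact: (congr1 (fun u : {k & P k} => tag u) (tE i')).
subst n'.
have xE : x' = fun i' => x (f i').
  by apply: functional_extensionality_dep => i'; apply: Tagged_inj (tE i').
rewrite xE; pose h (w : node T') : node T := match drawn_void dT' w with end.
symmetry; apply: (@pa_relabel _ _ hP I I' n l f T T' h) (drawn_planar dT) _.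
have cI := drawn_inj dT; have c0 := drawn_pos dT; have vT := drawn_void dT.
have cI' := drawn_inj dT'; have c0' := drawn_pos dT'; have vT' := drawn_void dT'.
pose N := arity l tab.
have N0 : N 0 = l by [].
have Nc i : N (c i) = n i by rewrite /N /arity (negbTE (c0 i)) -xT.
have Nc' i : N (c' i) = n (f i) by rewrite -fE Nc.
have codesE : codes c =i codes c'.
  by move=> d; rewrite !inE (perm_mem sT) (perm_mem sT').
have pE := is_point_mem N codesE.
have mtE' p : is_point c N p -> mt p = mt' p.
  by case/andP=> h1 h2; apply: mtE => //; move: h1; rewrite !inE (perm_mem sT).
have fc p : flag_code c (relabel_flag h p) = flag_code c' p.
  by case: p => [[?|[? ?]]|[w ?]] //=; rewrite fE.
have sc p : spot_code c (relabel_spot h p) = spot_code c' p.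
  by case: p => [[?|[? ?]]|[w ?]] //=; rewrite fE.
have ffE X g : @face_function I c N mt X g <-> @face_function I' c' N mt' X g.
  split=> -[h1 h2]; split.
  - by move=> p; rewrite -pE => pp; rewrite -mtE' // h1.
  - by move=> d; rewrite -codesE; apply: h2.
  - by move=> p pp; rewrite mtE' // h1 // -pE.
  - by move=> d; rewrite codesE; apply: h2.
split => [|||s1 t1].
- have exg i : exists i', c' i' == c i.
    have : c i \in s by rewrite -(perm_mem sT) map_f ?mem_enum.
    by rewrite -(perm_mem sT') => /seq.mapP[i' _ ->]; exists i'.
  exists (fun i => xchoose (exg i)) => i; [apply: cI'|apply: cI].
    by rewrite (eqP (xchooseP (exg _))) fE.
  by rewrite fE (eqP (xchooseP (exg _))).
- by exists (fun w => match vT w with end) => w; [case: (vT' w)|case: (vT w)].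
- move=> p; apply: (flag_code_inj vT cI c0); rewrite (drawn_mate dT) !fc (drawn_mate dT').
  by apply: mtE'; rewrite pE; apply: flag_codeP.
(* The function sending a gap to its region in one tangle is a face function for the other, because
   the strings are the same. Tightness of each tangle gives one of the two inclusions. *)
apply/idP/idP => [hs|hs].
  have [cl clE] := drawn_class dT'.
  have [g gE] := spot_function vT' cI' c0' cl.
  rewrite clE -!gE -!sc; apply/eqP; apply: (drawn_numeric dT N0 Nc) hs.
  apply/ffE; apply: (drawn_face_function dT' N0 Nc') => s2 t2.
  by rewrite clE !gE => /eqP.
have [cl clE] := drawn_class dT.
have [g gE] := spot_function vT cI c0 cl.
rewrite clE -!gE !sc; apply/eqP; apply: (drawn_numeric dT' N0 Nc') hs.
apply/ffE; apply: (drawn_face_function dT N0 Nc) => s2 t2.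
by rewrite clE !gE => /eqP.
Qed.

End Pictures.

(** Strings of a composite, followed through the glued circle: [walk f b k]
    leaves the [k]-th glued point into the outer tangle if [b], and into the
    inner one otherwise. *)
Section Walk.
Variables (z : nat) (mtT mtS : nat * nat -> nat * nat).

Definition walk_step (b : bool) (k : nat) := if b then mtT (z, k) else mtS (0%N, k).

Fixpoint walk (f : nat) (b : bool) (k : nat) : option (nat * nat) :=
  if f is f'.+1 then
    let x := walk_step b k in
    if x.1 == (if b then z else 0%N) then walk f' (~~ b) x.2 else Some x
  else None.

Fixpoint walk_length (f : nat) (b : bool) (k : nat) : nat :=
  if f is f'.+1 then
    let x := walk_step b k in
    if x.1 == (if b then z else 0%N) then (walk_length f' (~~ b) x.2).+1 else 0
  else 0.

Lemma walk_length_le f b k : (walk_length f b k <= f)%N.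
Proof. by elim: f b k => //= f IH b k; case: ifP => // _; rewrite ltnS. Qed.

Lemma walk_stable f b k : walk f b k != None ->
  walk f.+1 b k = walk f b k /\ walk_length f.+1 b k = walk_length f b k.
Proof.
elim: f b k => // f IH b k; rewrite ![walk _.+1 _ _]/= ![walk_length _.+1 _ _]/=.
by case: ifP => // _ /IH[<- <-].
Qed.

End Walk.

(** * Composition of drawn tangles *)

Section Glue.
Variables (R : realType) (P : planar_data R).
Hypothesis hP : is_planar_algebra P.
Variables (I J : finType) (n : option I -> nat) (m : J -> nat) (l : nat).
Variables (T : tangle n l) (S : tangle m (n None)).
Let nm := compose_arity n m.
Variables (T0 : tangle nm l).
Variables (cT : option I -> nat) (cS : J -> nat) (N : nat -> nat).
Variables (mtT mtS mt0 : nat * nat -> nat * nat).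
Variables (X : eqType) (L0 : nat * nat -> X) (nu : nat -> X) (fuel : nat).
Let z := cT None.
Let c0 (s : I + J) : nat := match s with inl i => cT (Some i) | inr j => cS j end.
Hypothesis dT : drawn T cT mtT.
Hypothesis dS : drawn S cS mtS.
Hypothesis d0 : drawn T0 c0 mt0.
Hypothesis lab0 : labelled T0 c0 L0.
Hypothesis N0 : N 0 = l.
Hypothesis Nc : forall s, N (c0 s) = nm s.
Let NT d := if d == z then n None else N d.
Let NS d := if d == 0%N then n None else N d.
Let walk := walk z mtT mtS.

(** Gaps along the glued circle do not exist in [T0]. The function [nu] names the regions of [T0]
    that touch them, and [y] is the code of this circle: [z] seen from [T] and 0 seen from [S]. *)
Definition glue_label (y : nat) (s : nat * nat) := if s.1 == y then nu s.2 else L0 s.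

Hypothesis walkT : forall i k, (k < nm (inl i))%N ->
  (let x := mtT (cT (Some i), k) in
   if x.1 == z then walk fuel false x.2 else Some x) = Some (mt0 (cT (Some i), k)).
Hypothesis walk_out : forall k, (k < l)%N ->
  (let x := mtT (0%N, k) in
   if x.1 == z then walk fuel false x.2 else Some x) = Some (mt0 (0%N, k)).
Hypothesis walkS : forall j k, (k < nm (inr j))%N ->
  (let x := mtS (cS j, k) in
   if x.1 == 0%N then walk fuel true x.2 else Some x) = Some (mt0 (cS j, k)).
Hypothesis walk_end : forall b k, (k < n None)%N -> walk fuel b k != None.
Hypothesis nuT : forall k, (k < n None)%N ->
  glue_label z (lcode (z, k)) = glue_label z (rcode (mtT (z, k))) /\
  glue_label z (rcode (z, k)) = glue_label z (lcode (mtT (z, k))).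
Hypothesis nuS : forall k, (k < n None)%N ->
  glue_label 0 (lcode (0%N, k)) = glue_label 0 (rcode (mtS (0%N, k))) /\
  glue_label 0 (rcode (0%N, k)) = glue_label 0 (lcode (mtS (0%N, k))).
Hypothesis nu_marked : nu 0%N = L0 (0%N, 0%N) /\ nu (n None) = L0 (0%N, 0%N).

Let C := compose T S.
Let cs := @compose_spot I J n m l T S.
Let flagT := @compose_flagT I J n m l T S.
Let flagS := @compose_flagS I J n m l T S.
Let split := @compose_split I J n m l T S.
Let vT := drawn_void dT.
Let vS := drawn_void dS.
Let v0 := drawn_void d0.
Let cTI := drawn_inj dT.
Let c0I := drawn_inj d0.
Let cT0 := drawn_pos dT.
Let cS0 := drawn_pos dS.
Let c00 := drawn_pos d0.

Lemma glue_flagTK q : split (flagT q) = inl q.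
Proof. by case: q => [[k|[[i|] k]]|[w b]]. Qed.

Lemma glue_flagSK q : split (flagS q) = inr q.
Proof. by case: q => [[k|[j k]]|[w b]]. Qed.

Lemma glue_splitK p : match split p with inl q => flagT q | inr q => flagS q end = p.
Proof.
case: p => [[k|[[i|j] k]]|[[[w|w]|k] b]] //; by case: b.
Qed.

Lemma glue_mateK : involutive (mate C).
Proof.
move=> p; rewrite /C /= /compose_mate -/split -{2}(glue_splitK p).
case: (split p) => q; rewrite -/flagT -/flagS ?glue_flagTK ?glue_flagSK.
  by rewrite (planar_mateK (drawn_planar dT)).
by rewrite (planar_mateK (drawn_planar dS)).
Qed.

Lemma glue_mate_neq p : mate C p != p.
Proof.
apply/eqP=> h; have := congr1 split h; rewrite /C /= /compose_mate -/split.
case: (split p) => q; rewrite -/flagT -/flagS ?glue_flagTK ?glue_flagSK => -[] /eqP.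
  by rewrite (negbTE (planar_mate_neq (drawn_planar dT) q)).
by rewrite (negbTE (planar_mate_neq (drawn_planar dS) q)).
Qed.

Let glue := compose_glue (T := T) (S := S).

Lemma glue_circle (k : 'I_(n None).+1) :
  glue (inl (spot_in l _ k)) (inr (spot_out m _ k)) /\
  glue (inr (spot_out m _ k)) (inl (spot_in l _ k)).
Proof. by split; apply/existsP; exists k; rewrite !eqxx. Qed.

Lemma glue_face p : same C (lspot p) (rspot (mate C p)).
Proof.
have faceT := planar_face (drawn_planar dT).
have faceS := planar_face (drawn_planar dS).
rewrite /C /= /compose_mate -/cs -/split.
have lT q : split p = inl q -> cs (lspot p) = inl (lspot q).
  by case: p => [[k|[[i|j] k]]|[[[w|w]|k] []]] //= [<-].
have lS q : split p = inr q -> connect glue (cs (lspot p)) (inr (lspot q)).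
  case: p {lT} => [[k|[[i|j] k]]|[[[w|w]|k] []]] //= [<-] //.
  by apply: connect1; have [] := glue_circle (lift ord0 k).
have rT q : cs (rspot (flagT q)) = inl (rspot q).
  by case: q => [[k|[[i|] k]]|[w b]].
have rS q : connect glue (inr (rspot q)) (cs (rspot (flagS q))).
  case: q => [[k|[j k]]|[w b]] //=.
  by apply: connect1; have [] := glue_circle (widen_ord (leqnSn _) k).
case E : (split p) => [q|q]; rewrite -/flagT -/flagS.
  by rewrite (lT q E) rT; apply: connect1; apply: faceT.
apply: connect_trans (lS q E) (connect_trans _ (rS _)).
by apply: connect1; apply: faceS.
Qed.

Lemma glue_symmetric : connect_sym glue.
Proof.
apply: sym_connect_sym.
have symT s t : same T s t = same T t s.
  have [cl clE] := drawn_class dT; by rewrite !clE eq_sym.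
have symS s t : same S s t = same S t s.
  have [cl clE] := drawn_class dS; by rewrite !clE eq_sym.
by move=> [s|s] [t|t] //=.
Qed.

Let NT0 : NT 0 = l.
Proof. by rewrite /NT eq_sym (negbTE (cT0 None)). Qed.

Let NTc i : NT (cT i) = n i.
Proof.
rewrite /NT; case: i => [i|]; last by rewrite eqxx.
by case: eqP => [/cTI//|_]; exact: (Nc (inl i)).
Qed.

Let NS0 : NS 0 = n None. Proof. by []. Qed.

Let NSc j : NS (cS j) = m j.
Proof. by rewrite /NS (negbTE (cS0 j)); exact: (Nc (inr j)). Qed.

Let face0 : face_function c0 N mt0 L0.
Proof. by apply: (drawn_face_function d0 N0 Nc) => s t; rewrite lab0 => /eqP. Qed.

Let c0_codes d : d \in codes c0 -> L0 (d, 0%N) = L0 (0%N, 0%N) /\ L0 (d, N d) = L0 (0%N, 0%N).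
Proof. exact: (proj2 face0). Qed.

Lemma face_label_T : face_function cT NT mtT (glue_label z).
Proof.
have NZ d : d != z -> d \in codes cT -> d \in codes c0 /\ NT d = N d.
  move=> dz /codesP[->|[[i|] di]]; rewrite /NT.
  - by rewrite mem_head eq_sym (negbTE (cT0 None)).
  - rewrite (negbTE dz) di; split=> //; exact: (mem_codes c0 (inl i)).
  - by rewrite di eqxx in dz.
have gl d k : d != z -> glue_label z (d, k) = L0 (d, k).
  by rewrite /glue_label /= => /negbTE->.
have lz d k : (lcode (d, k)).1 = d by rewrite /lcode; case: eqP.
have rz d k : (rcode (d, k)).1 = d by rewrite /rcode; case: eqP.
have gll p : p.1 != z -> glue_label z (lcode p) = L0 (lcode p).
  by case: p => d k h; rewrite /glue_label lz (negbTE h).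
have glr p : p.1 != z -> glue_label z (rcode p) = L0 (rcode p).
  by case: p => d k h; rewrite /glue_label rz (negbTE h).
split=> [p pp|d dc].
  have mpp := drawn_mateK dT NT0 NTc pp.
  have pm := drawn_point dT NT0 NTc pp.
  case pz: (p.1 == z).
    case: p pz pp {mpp pm} => d k /= /eqP-> /andP[_ /=]; rewrite /NT eqxx => kn.
    by have [] := nuT kn.
  case mz: ((mtT p).1 == z).
    move: (mtT p) mz pm mpp => [d k] /= /eqP-> /andP[_ /=]; rewrite /NT eqxx => kn <-.
    by have [_ ->] := nuT kn.
  rewrite gll ?pz // glr ?mz //.
  have mt0E : mtT p = mt0 p.
    move: pp => /andP[]; case: p pz mz {mpp pm} => d k /= dz mz /codesP[|[[i|] dE]].
    + move=> dE; rewrite dE in mz *; rewrite NT0 => /walk_out /=.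
      by rewrite mz => -[].
    + by rewrite dE in mz *; rewrite NTc => /walkT /=; rewrite mz => -[].
    + by rewrite dE eqxx in dz.
  rewrite mt0E; apply: (proj1 face0).
  move: pp => /andP[h1 h2]; have [h3 h4] := NZ _ (negbT pz) h1.
  by apply/andP; rewrite -h4.
case dz: (d == z).
  move/eqP: dz => ->; rewrite /glue_label /= eqxx /NT eqxx eq_sym (negbTE (cT0 None)).
  exact: nu_marked.
have [h1 h2] := NZ d (negbT dz) dc.
rewrite /glue_label /= dz eq_sym (negbTE (cT0 None)) h2; exact: c0_codes.
Qed.

Lemma face_label_S : face_function cS NS mtS (glue_label 0).
Proof.
have lz p : (lcode p).1 = p.1 by rewrite /lcode; case: eqP.
have rz p : (rcode p).1 = p.1 by rewrite /rcode; case: eqP.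
split=> [p pp|d dc].
  have mpp := drawn_mateK dS NS0 NSc pp.
  have pm := drawn_point dS NS0 NSc pp.
  case pz: (p.1 == 0%N).
    case: p pz pp {mpp pm} => d k /= /eqP-> /andP[_ /=]; rewrite /NS eqxx => kn.
    by have [] := nuS kn.
  case mz: ((mtS p).1 == 0%N).
    move: (mtS p) mz pm mpp => [d k] /= /eqP-> /andP[_ /=]; rewrite /NS eqxx => kn <-.
    by have [_ ->] := nuS kn.
  rewrite /glue_label lz rz pz mz.
  case/andP: pp; case: p pz mz {mpp pm} => d k /= pz mz /codesP[dE|[j dE]].
    by rewrite dE in pz.
  rewrite dE NSc => kj; have /= := walkS kj; rewrite -dE mz => -[mt0E].
  rewrite mt0E; apply: (proj1 face0); rewrite dE; apply/andP; split.
    exact: (mem_codes c0 (inr j)).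
  by rewrite -[cS j]/(c0 (inr j)) Nc.
case dz: (d == 0%N).
  by move/eqP: dz => ->; rewrite /glue_label /= NS0; have [-> ->] := nu_marked.
have [m0 _] := nu_marked.
rewrite /glue_label /= dz m0 /NS dz; apply: c0_codes.
case/codesP: dc => [dE|[j ->]]; first by rewrite dE in dz.
exact: (mem_codes c0 (inr j)).
Qed.

Definition spot_label (s : spot nm l (compose_node T S)) : X :=
  match cs s with
  | inl t => glue_label z (spot_code cT t)
  | inr t => glue_label 0 (spot_code cS t)
  end.

Lemma spot_label_same s t : same C s t -> spot_label s = spot_label t.
Proof.
rewrite /C /= -/cs /spot_label; set f := fun u : spot n l (node T) + spot m (n None) (node S) =>
  match u with inl t => glue_label z (spot_code cT t) | inr t => glue_label 0 (spot_code cS t) end.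
rewrite -/(f (cs s)) -/(f (cs t)).
have circ k : f (inl (spot_in l _ (k : 'I_(n None).+1))) = f (inr (spot_out m _ k)).
  by rewrite /f /= /glue_label /= !eqxx.
apply: connect_invariant => -[u|u] [v|v] /=.
- exact: (drawn_numeric dT NT0 NTc face_label_T).
- by case/existsP=> k /andP[/eqP-> /eqP->]; exact: circ.
- by case/existsP=> k /andP[/eqP-> /eqP->]; rewrite -[LHS]/(f (inr _)) -circ.
- exact: (drawn_numeric dS NS0 NSc face_label_S).
Qed.

Lemma spot_label_disk d : spot_label (inl d) = L0 (spot_code (V := node T0) c0 (inl d)).
Proof.
rewrite /spot_label; case: d => [k|[[i|j] k]] /=; rewrite /glue_label /=.
- by rewrite eq_sym (negbTE (cT0 None)).
- by case: eqP => // /cTI.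
- by rewrite (negbTE (cS0 j)).
Qed.

Lemma walk_point f b k x : (k < n None)%N -> walk f b k = Some x -> is_point c0 N x.
Proof.
elim: f b k => // f IH b k kn; rewrite /walk /=.
have pT : is_point cT NT (z, k) by rewrite /is_point /= mem_codes /NT eqxx.
have pS : is_point cS NS (0%N, k) by apply/andP; split; [exact: mem_head|].
case: b; rewrite /walk_step.
  have := drawn_point dT NT0 NTc pT; case: (mtT (z, k)) => d k' /andP[/= dc lk'].
  case: (d =P z) => [dz|dz [<-]].
    by apply: IH; move: lk'; rewrite dz /NT eqxx.
  case/codesP: dc lk' dz => [->|[[i|] ->]] //.
    by rewrite NT0 => lk' _; apply/andP; split; [exact: mem_head|rewrite N0].
  rewrite NTc => lk' _; rewrite /is_point /= (mem_codes c0 (inl i)).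
  by rewrite -[cT _]/(c0 (inl i)) Nc.
have := drawn_point dS NS0 NSc pS; case: (mtS (0%N, k)) => d k' /andP[/= dc lk'].
case: (d =P 0%N) => [dz|dz [<-]].
  by apply: IH; move: lk'; rewrite dz.
case/codesP: dc lk' dz => [->|[j ->]] //.
rewrite NSc => lk' _; rewrite /is_point /= (mem_codes c0 (inr j)).
by rewrite -[cS _]/(c0 (inr j)) Nc.
Qed.

(** A flag of a disk starts its walk before the first crossing of the circle. Its rank must exceed
    the length of any walk, and [fuel] bounds these lengths. *)
Definition glue_rank (p : flag nm l (compose_node T S)) : nat :=
  match p with
  | inr (inr k, b) => walk_length z mtT mtS fuel b k
  | _ => fuel.+1
  end.

(** As [T] and [S] have no nodes, the nodes of the composite are exactly the glued points, and
    erasing all of them yields [T0]. The end of a string of the composite is given by [walk]. *)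
Lemma glue_reduction (x : forall s, P (nm s)) : pa_act P C x = pa_act P T0 x.
Proof.
pose inc (w : node T0) : node C := match v0 w with end.
have exE (kb : 'I_(n None) * bool) : exists q : flag nm l (node T0),
    walk fuel kb.2 kb.1 = Some (flag_code c0 q).
  case E: (walk fuel kb.2 kb.1) => [y|].
    by have [q <-] := flag_code_ex (node T0) N0 Nc (walk_point (ltn_ord _) E); exists q.
  by have := walk_end kb.2 (ltn_ord kb.1); rewrite E.
have [E EP] := choice exE.
have [e eE] : exists e : flag nm l (node C) -> flag nm l (node T0),
   (forall d, e (inl d) = mate T0 (inl d)) /\ (forall k b, e (inr (inr k, b)) = E (k, b)).
  exists (fun p => match p with
    | inl d => mate T0 (inl d)
    | inr (inr k, b) => E (k, b)
    | inr (inl (inl w), _) => match vT w with end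
    | inr (inl (inr w), _) => match vS w with end end) => //.
have [eD eN] := eE.
have [cl clE] : exists cl : spot nm l (node C) -> spot n l (node T) + spot m (n None) (node S),
    forall s t, same C s t = (cl s == cl t).
  by exists (fun s => fingraph.root glue (cs s)) => s t; rewrite (root_connect glue_symmetric).
have codeT (q : flag n l (node T)) :
    (exists2 k : 'I_(n None), flag_code cT q = (z, k : nat) & flagT q = inr (inr k, true)) \/
    ((flag_code cT q).1 != z /\ exists2 d, flagT q = inl d & flag_code (V := node T0) c0 (inl d) = flag_code cT q).
  case: q => [[k|[[i|] k]]|[w b]].
  - by right; split; [rewrite eq_sym; exact: cT0|exists (inl k)].
  - by right; split; [apply/eqP=> /cTI|exists (inr (existT _ (inl i) k))].
  - by left; exists k.
  - by case: (vT w).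
have codeS (q : flag m (n None) (node S)) :
    (exists2 k : 'I_(n None), flag_code cS q = (0%N, k : nat) & flagS q = inr (inr k, false)) \/
    ((flag_code cS q).1 != 0%N /\ exists2 d, flagS q = inl d & flag_code (V := node T0) c0 (inl d) = flag_code cS q).
  case: q => [[k|[j k]]|[w b]].
  - by left; exists k.
  - by right; split; [exact: cS0|exists (inr (existT _ (inr j) k))].
  - by case: (vS w).
have keepD d : keep_flag inc (inl d) = inl d by [].
have fI : injective (@flag_code _ nm l (node T0) c0) := flag_code_inj v0 c0I c00.
have walkS1 f b k : walk f.+1 b k = 
    if (walk_step z mtT mtS b k).1 == (if b then z else 0%N)
    then walk f (~~ b) (walk_step z mtT mtS b k).2
    else Some (walk_step z mtT mtS b k) by [].
have nodeN (k : 'I_(n None)) : (inr k : node C) \notin codom inc.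
  by apply/negP=> /codomP[w]; case: (v0 w).
have stepT (q : flag n l (node T)) (ep : flag nm l (node T0)) r :
    (forall k : 'I_(n None), flag_code cT (mate T q) = (z, k : nat) ->
       walk fuel false k = Some (flag_code c0 ep) /\
       (walk_length z mtT mtS fuel false k < r)%N) ->
    ((flag_code cT (mate T q)).1 != z -> flag_code cT (mate T q) = flag_code c0 ep) ->
    flagT (mate T q) = keep_flag inc ep \/ exists v b', [/\ v \notin codom inc,
      flagT (mate T q) = flag_node nm l v b', ep = e (flag_node nm l v (~~ b')) &
      (glue_rank (flag_node nm l v (~~ b')) < r)%N].
  move=> h1 h2; have [[k kE fE]|[nz [d fE dE]]] := codeT (mate T q).
    have [w lt] := h1 k kE.
    right; exists (inr k), true; split=> //=; rewrite eN; apply: fI.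
    by apply: Some_inj; rewrite -w -(EP (k, false)).
  have -> : ep = inl d by apply: fI; rewrite dE h2.
  by left; rewrite fE.
have stepS (q : flag m (n None) (node S)) (ep : flag nm l (node T0)) r :
    (forall k : 'I_(n None), flag_code cS (mate S q) = (0%N, k : nat) ->
       walk fuel true k = Some (flag_code c0 ep) /\
       (walk_length z mtT mtS fuel true k < r)%N) ->
    ((flag_code cS (mate S q)).1 != 0%N -> flag_code cS (mate S q) = flag_code c0 ep) ->
    flagS (mate S q) = keep_flag inc ep \/ exists v b', [/\ v \notin codom inc,
      flagS (mate S q) = flag_node nm l v b', ep = e (flag_node nm l v (~~ b')) &
      (glue_rank (flag_node nm l v (~~ b')) < r)%N].
  move=> h1 h2; have [[k kE fE]|[nz [d fE dE]]] := codeS (mate S q).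
    have [w lt] := h1 k kE.
    right; exists (inr k), false; split=> //=; rewrite eN; apply: fI.
    by apply: Some_inj; rewrite -w -(EP (k, true)).
  have -> : ep = inl d by apply: fI; rewrite dE h2.
  by left; rewrite fE.
have ends p : mate C p = keep_flag inc (e p) \/ exists v b, [/\ v \notin codom inc,
    mate C p = flag_node nm l v b, e p = e (flag_node nm l v (~~ b)) &
    (glue_rank (flag_node nm l v (~~ b)) < glue_rank p)%N].
  have le_len b k : (walk_length z mtT mtS fuel b k < fuel.+1)%N.
    by rewrite ltnS walk_length_le.
  have stable b (k : 'I_(n None)) k' : walk_step z mtT mtS b k = (if b then z else 0%N, k') ->
      walk fuel (~~ b) k' = walk fuel b k /\
      (walk_length z mtT mtS fuel (~~ b) k' < walk_length z mtT mtS fuel b k)%N.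
    have := walk_end b (ltn_ord k); case: (fuel) => // f.
    rewrite (walkS1 f b k) [walk_length _ _ _ f.+1 b k]/= => h E1; move: h; rewrite E1 [(_, _).1]/= [(_, _).2]/= eqxx.
    by case/walk_stable=> h1 h2; split; [exact: h1|rewrite [X in (X < _)%N]h2].
  have last_step b (k : 'I_(n None)) : (walk_step z mtT mtS b k).1 != (if b then z else 0%N) ->
      walk fuel b k = Some (walk_step z mtT mtS b k).
    have := walk_end b (ltn_ord k); case: (fuel) => // f _ h.
    by rewrite (walkS1 f b k) (negbTE h).
  rewrite {1 2}/C /= /compose_mate -/split -/flagT -/flagS.
  case: p => [[k|[[i|j] k]]|[[[w|w]|k] b]] /=; first last.
  - case: b; rewrite -[X in e X]/(inr (inr k, _)) eN.
      have yE : flag_code cT (mate T (flag_in l (node T) k)) = walk_step z mtT mtS true k.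
        by rewrite (drawn_mate dT).
      apply: stepT => [k'|]; rewrite yE.
        move=> yk; have [-> ->] := stable true k k' yk; split=> //; exact: (EP (k, true)).
      by move=> ny; apply: Some_inj; rewrite -(last_step true) // -(EP (k, true)).
    have yE : flag_code cS (mate S (flag_out m (node S) k)) = walk_step z mtT mtS false k.
      by rewrite (drawn_mate dS).
    apply: stepS => [k'|]; rewrite yE.
      move=> yk; have [-> ->] := stable false k k' yk; split=> //; exact: (EP (k, false)).
    by move=> ny; apply: Some_inj; rewrite -(last_step false) // -(EP (k, false)).
  - by case: (vS w).
  - by case: (vT w).
  - have h := walkS (ltn_ord (k : 'I_(nm (inr j)))).
    have yE : flag_code cS (mate S (flag_in (n None) (node S) (k : 'I_(m j)))) = mtS (cS j, k : nat).
      by rewrite (drawn_mate dS).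
    rewrite eD; apply: stepS => [k'|]; rewrite yE (drawn_mate d0).
      by move=> yk; move: h; rewrite /= yk /= => h; split.
    by move=> ny; move: h; rewrite /= (negbTE ny) => -[].
  - have h := walkT (ltn_ord (k : 'I_(nm (inl i)))).
    have yE : flag_code cT (mate T (flag_in l (node T) (k : 'I_(n (Some i))))) = mtT (cT (Some i), k : nat).
      by rewrite (drawn_mate dT).
    rewrite eD; apply: stepT => [k'|]; rewrite yE (drawn_mate d0).
      by move=> yk; move: h; rewrite /= yk /= eqxx => h; split.
    by move=> ny; move: h; rewrite /= (negbTE ny) => -[].
  - have h := walk_out (ltn_ord k).
    have yE : flag_code cT (mate T (flag_out n (node T) k)) = mtT (0%N, k : nat).
      by rewrite (drawn_mate dT).
    rewrite eD; apply: stepT => [k'|]; rewrite yE (drawn_mate d0).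
      by move=> yk; move: h; rewrite /= yk /= eqxx => h; split.
    by move=> ny; move: h; rewrite /= (negbTE ny) => -[].
have faceC p : cl (lspot p) = cl (rspot (mate C p)).
  by apply/eqP; rewrite -clE glue_face.
have label_walk p : cl (lspot p) = cl (keep_spot inc (rspot (e p))).
  have [r] := ubnP (glue_rank p); elim: r p => // r IH p ltp.
  rewrite faceC; have [->|[v [b [_ -> -> lt]]]] := ends p.
    by rewrite keep_rspot.
  by rewrite -IH //; apply: leq_trans lt _.
have keepE q : e (keep_flag inc q) = mate T0 q.
  by case: q => [d|[w b]]; [rewrite keepD eD|case: (v0 w)].
have markedC s : marked_spot pred0 s ->
    cl (keep_spot inc s) = cl (keep_spot inc (spot_out nm _ ord0)).
  have mkT u : marked_spot pred0 u -> connect glue (inl u) (inl (spot_out n _ ord0)).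
    by move=> /(drawn_marked dT) h; apply: connect1.
  have mkS u : marked_spot pred0 u -> connect glue (inr u) (inl (spot_out n _ ord0)).
    move=> /(drawn_marked dS) h; apply: (@connect_trans _ _ (inr (spot_out m _ ord0))).
      exact: connect1.
    apply: connect_trans (connect1 (proj2 (glue_circle ord0))) (mkT _ _).
    by apply/or4P; apply: Or43; apply/existsP; exists None; rewrite eqxx.
  move=> ms; apply/eqP; rewrite -clE; move: ms => /or4P[/eqP->|/eqP->|ex|//].
  - by apply: mkT; rewrite /marked_spot eqxx.
  - by apply: mkT; rewrite /marked_spot eqxx orbT.
  case/existsP: ex => -[i|j] /orP[] /eqP->.
  - by apply: mkT; apply/or4P; apply: Or43; apply/existsP; exists (Some i); rewrite eqxx.
  - by apply: mkT; apply/or4P; apply: Or43; apply/existsP; exists (Some i); rewrite eqxx orbT.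
  - by apply: mkS; apply/or4P; apply: Or43; apply/existsP; exists j; rewrite eqxx.
  - by apply: mkS; apply/or4P; apply: Or43; apply/existsP; exists j; rewrite eqxx orbT.
have red : reduction inc e glue_rank cl.
  split => //.
  - exact: glue_mateK.
  - exact: glue_mate_neq.
  (* Regions of [T0] stay connected in the composite by tightness of [T0]. Conversely, two gaps
     merged in the composite have the same label, because [L0] extended by [nu] is compatible with
     both pieces. *)
  - move=> s t; apply/idP/eqP => [|clst].
      apply: (drawn_tight d0 (f := cl \o keep_spot inc)) => [p|u mu] /=; last exact: markedC.
      have -> : keep_spot inc (lspot p) = lspot (keep_flag inc p).
        by case: p => [[?|[? ?]]|[w ?]] //; case: (v0 w).
      by rewrite label_walk keepE.
    case: s clst => [s|[w b]]; last by case: (v0 w).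
    case: t => [t|[w b]]; last by case: (v0 w).
    rewrite lab0 -!spot_label_disk => clst; apply/eqP; apply: spot_label_same.
    by rewrite clE; apply/eqP.
rewrite -(reduction_act hP (drawn_planar d0) red (k := #|node C|)) //.
by rewrite [X in (X + _)%N]eq_card0 // => w; case: (v0 w).
Qed.

End Glue.

(** * Bands of parallel strings *)

Section PicGlue.
Variables (R : realType) (P : planar_data R).
Hypothesis hP : is_planar_algebra P.

(** The numerical form of [pa_compose]: once the two diagrams are known to be drawable, what remains
    is to follow the strings through the circle and to name the regions along it. *)
Lemma pic_glue (mtT mtS mt0 : nat * nat -> nat * nat) (X XT : eqType)
    (L0 : nat * nat -> X) (LT : nat * nat -> XT) (nu : nat -> X) (fuel z : nat)
    (s1 s2 : seq nat) (tabT tab : nat -> vector P) (l d : nat) (v : P l) (u : P d) :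
  pic mtT (z :: s1) tabT v -> pic mtS s2 tab u ->
  tabT z = Tagged (fun k => P k) u -> {in s1, tabT =1 tab} ->
  drawable (z :: s1) (arity l tabT) mtT LT ->
  drawable (s1 ++ s2) (arity l tab) mt0 L0 ->
  uniq [:: 0%N, z & s1 ++ s2] ->
  (forall e k, e \in 0%N :: s1 -> (k < arity l tab e)%N ->
    (let x := mtT (e, k) in
     if x.1 == z then walk z mtT mtS fuel false x.2 else Some x) = Some (mt0 (e, k))) ->
  (forall e k, e \in s2 -> (k < arity l tab e)%N ->
    (let x := mtS (e, k) in
     if x.1 == 0%N then walk z mtT mtS fuel true x.2 else Some x) = Some (mt0 (e, k))) ->
  (forall b k, (k < d)%N -> walk z mtT mtS fuel b k != None) ->
  (forall k, (k < d)%N ->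
    glue_label L0 nu z (lcode (z, k)) = glue_label L0 nu z (rcode (mtT (z, k))) /\
    glue_label L0 nu z (rcode (z, k)) = glue_label L0 nu z (lcode (mtT (z, k)))) ->
  (forall k, (k < d)%N ->
    glue_label L0 nu 0 (lcode (0%N, k)) = glue_label L0 nu 0 (rcode (mtS (0%N, k))) /\
    glue_label L0 nu 0 (rcode (0%N, k)) = glue_label L0 nu 0 (lcode (mtS (0%N, k)))) ->
  nu 0%N = L0 (0%N, 0%N) /\ nu d = L0 (0%N, 0%N) ->
  pic mt0 (s1 ++ s2) tab v.
Proof.
move=> picT [J [m [S [cS [y [dS sS yT uE]]]]]] tz t1 drT dr0.
rewrite /= !inE !mem_cat cat_uniq !negb_or.
move=> /and3P[/and3P[z0 n01 n02] /andP[nz1 nz2] /and3P[u1 n12 u2]].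
move=> wT wS wE nT nS nM.
(* The outer picture is redrawn with its disks indexed by an option type, [None] being the disk to
   fill, as [compose] requires. [pic_unique] shows that its value does not change. *)
pose I := 'I_(size s1).
pose n (o : option I) := if o is Some i then tag (tab (nth 0%N s1 i)) else d.
pose cT (o : option I) := if o is Some i then nth 0%N s1 i else z.
have m1 (i : I) : nth 0%N s1 i \in s1 by rewrite mem_nth.
have nz_pos e : e \in s1 -> e != 0%N by move=> h; apply: contraNneq n01 => <-.
have cTI : injective cT.
  move=> [i|] [j|] //= h.
  - by move/eqP: h; rewrite nth_uniq // => /eqP/val_inj->.
  - by rewrite -h m1 in nz1.
  - by rewrite h m1 in nz1.
have cT0 o : cT o != 0%N by case: o => [i|]; [exact: nz_pos (m1 i)|rewrite eq_sym].
have exI e : e \in s1 -> exists i : I, nth 0%N s1 i = e.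
  by move=> /(nthP 0%N)[i li <-]; exists (Ordinal li).
have permT : perm_eq (map cT (enum (option I : finType))) (z :: s1).
  apply: uniq_perm; [by rewrite map_inj_uniq ?enum_uniq|by rewrite /= nz1|move=> e].
  rewrite inE; apply/seq.mapP/orP => [[[i|] _ ->]|[/eqP->|/exI[i <-]]].
  - by right; exact: m1.
  - by left; exact: eqxx.
  - by exists None; rewrite ?mem_enum.
  - by exists (Some i); rewrite ?mem_enum.
pose N := arity l tab.
have arT o : arity l tabT (cT o) = n o.
  rewrite /arity (negbTE (cT0 o)); case: o => [i|] /=; first by rewrite t1.
  by rewrite tz.
have [dT _] := drT _ n l cT cTI cT0 permT erefl arT; set T := based_tangle _ _ in dT.
pose x (o : option I) : P (n o) :=
  match o return P (n o) with Some i => tagged (tab (nth 0%N s1 i)) | None => u end.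
have xT o : Tagged (fun k => P k) (x o) = tabT (cT o).
  by case: o => [i|] /=; [rewrite t1 //; case: (tab _)|rewrite tz].
have -> : v = pa_act P T x.
  apply: (pic_unique hP picT (v' := pa_act P T x)) => [|e _|e _ _]; [|reflexivity|reflexivity].
  by exists _, n, T, cT, x; split.
pose c0 (s : I + J) : nat := match s with inl i => cT (Some i) | inr j => cS j end.
have mS j : cS j \in s2 by rewrite -(perm_mem sS) map_f ?mem_enum.
have c0I : injective c0.
  move=> [i|j] [i'|j'] //= h.
  - by have /= := @cTI (Some i) (Some i') h; case=> ->.
  - by case/hasP: n12; exists (cS j') => //; rewrite -h m1.
  - by case/hasP: n12; exists (cS j) => //; rewrite h m1.
  - by congr inr; apply: (drawn_inj dS).
have c00 s : c0 s != 0%N by case: s => [i|j]; [exact: cT0|exact: drawn_pos dS _].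
have perm0 : perm_eq (map c0 (enum (I + J : finType)%type)) (s1 ++ s2).
  apply: uniq_perm; [by rewrite map_inj_uniq ?enum_uniq|by rewrite cat_uniq u1 n12|move=> e].
  rewrite mem_cat; apply/seq.mapP/orP => [[[i|j] _ ->]|[/exI[i <-]|]].
  - by left; exact: m1.
  - by right; exact: mS.
  - by exists (inl i); rewrite ?mem_enum.
  - rewrite -(perm_mem sS) => /seq.mapP[j _ ->].
    by exists (inr j); rewrite ?mem_enum.
pose nm := compose_arity n m.
have ar0 s : N (c0 s) = nm s.
  rewrite /N /arity (negbTE (c00 s)); case: s => [i|j] //=.
  by rewrite -yT.
have [d0 lab0] := dr0 _ nm l c0 c0I c00 perm0 erefl ar0; set T0 := based_tangle _ _ in d0 lab0.
pose w (s : I + J) : P (nm s) :=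
  match s return P (nm s) with inl i => x (Some i) | inr j => y j end.
have xE : x = @compose_input R P I J n m l S w.
  by apply: functional_extensionality_dep => -[i|] //=; rewrite uE.
have -> : pa_act P T x = pa_act P (compose T S) w.
  by rewrite (pa_compose hP _ (drawn_planar dT) (drawn_planar dS)) -xE.
have -> : pa_act P (compose T S) w = pa_act P T0 w.
  apply: (glue_reduction hP dT dS d0 lab0 (N := N) (nu := nu) (fuel := fuel)) => //.
  - by move=> i k lk; apply: wT; rewrite ?inE ?m1 ?orbT // -/N (ar0 (inl i)).
  - by move=> k lk; apply: wT; rewrite ?inE.
  - by move=> j k lk; apply: wS; rewrite ?mS // -/N (ar0 (inr j)).
exists _, nm, T0, c0, w; split => // -[i|j] /=; last by rewrite yT.
by case: (tab _).
Qed.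

End PicGlue.

Ltac band_case := rewrite /=;
  repeat match goal with |- context [if ?b then _ else _] =>
    let H := fresh in destruct b eqn:H; try (exfalso; lia) end;
  try lia; try (congr (_, _); lia).

(** Three disks side by side, with codes 1, 2, 3 from left to right, and six
    bundles of parallel strings: [x], [y], [w] strings run from the disks 1, 2
    and 3 to the outer disk, [p] from 1 to 2, [r] from 2 to 3, and [q] from 1
    to 3, over the disk 2.  This is planar when [q] or [y] vanishes. *)
Section Band.
Variables (x p q y r w : nat).

Definition band_mate (c : nat * nat) : nat * nat :=
  let: (d, k) := c in
  match d with
  | 0 => if (k < x)%N then (1, k) else
         if (k < x + y)%N then (2, p + (k - x)) else (3, r + q + (k - x - y))
  | 1 => if (k < x)%N then (0, k) else
         if (k < x + q)%N then (3, r + (x + q - k.+1)) else (2, x + q + p - k.+1)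
  | 2 => if (k < p)%N then (1, x + q + p - k.+1) else
         if (k < p + y)%N then (0, x + (k - p)) else (3, p + y + r - k.+1)
  | _ => if (k < r)%N then (2, p + y + r - k.+1) else
         if (k < r + q)%N then (1, x + (r + q - k.+1)) else (0, x + y + (k - r - q))
  end%N.

Definition band_arity (d : nat) : nat :=
  match d with
  | 0 => x + y + w | 1 => x + q + p | 2 => p + y + r | 3 => r + q + w | _ => 0
  end%N.

(** Labels of the four places where two bundles of a disk meet: 0 is the region
    of the marked points, 1 and 2 are the possible other regions that are not
    between two parallel strings. *)
Definition corner (a b c : bool) (m : nat) : nat :=
  (if 0 < y then (if a then m else 0) else
   if 0 < q then (if b then (if c then 1 else 2) else 0) else
   nat_of_bool [&& 0 < x, 0 < p, 0 < r & 0 < w])%N.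
Definition corner_out_left := corner ((0 < x) && (0 < p))%N ((0 < x) && (0 < w))%N true 1.
Definition corner_out_right := corner ((0 < r) && (0 < w))%N ((0 < x) && (0 < w))%N true 2.
Definition corner_in_left := corner ((0 < x) && (0 < p))%N ((0 < p) && (0 < r))%N false 1.
Definition corner_in_right := corner ((0 < r) && (0 < w))%N ((0 < p) && (0 < r))%N false 2.

(** The gap before string number [t] of the bundle [id]. For [t = 0] it is not between two parallel
    strings but in the large region with label [e]. *)
Definition lens (id t : nat) (e : nat) : nat * nat := if t == 0%N then (0%N, e) else (id, t).

Definition band_label (c : nat * nat) : nat * nat :=
  let: (d, k) := c in
  match d with
  | 0 => if (k < x)%N then lens 1 k 0 else
         if (k < x + y)%N then lens 2 (k - x) corner_out_left else
         if (k < x + y + w)%N then lens 3 (k - x - y) corner_out_right else (0, 0)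
  | 1 => if (k < x)%N then lens 1 k 0 else
         if (k < x + q)%N then (if k == x then (0, corner_out_left) else (4, x + q - k)) else
         if (k < x + q + p)%N then (if k == x + q then (0, corner_in_left) else (5, x + q + p - k))
         else (0, 0)
  | 2 => if (k < p)%N then lens 5 k 0 else
         if (k < p + y)%N then lens 2 (k - p) corner_in_left else
         if (k < p + y + r)%N then (if k == p + y then (0, corner_in_right) else (6, p + y + r - k))
         else (0, 0)
  | _ => if (k < r)%N then lens 6 k 0 else
         if (k < r + q)%N then lens 4 (k - r) corner_in_right else
         if (k < r + q + w)%N then lens 3 (k - r - q) corner_out_right else (0, 0)
  end%N.

(** A bundle of [x] strings has [x + 1] gaps, counting its two borders, and each of them is seen
    from both ends. These identifications are all that the strings impose on the regions. *)
Definition bundles (X : Type) (f : nat * nat -> X) : Prop :=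
  [/\ (0 < x)%N -> forall t, (t <= x)%N -> f (1, t) = f (0, t),
      (0 < y)%N -> forall t, (t <= y)%N -> f (2, p + t) = f (0, x + t),
      (0 < w)%N -> forall t, (t <= w)%N -> f (3, r + q + t) = f (0, x + y + t) &
   [/\ (0 < q)%N -> forall t, (t <= q)%N -> f (1, x + q - t) = f (3, r + t),
      (0 < p)%N -> forall t, (t <= p)%N -> f (1, x + q + p - t) = f (2, t) &
      (0 < r)%N -> forall t, (t <= r)%N -> f (2, p + y + r - t) = f (3, t)]]%N.

Definition band_face (X : Type) (f : nat * nat -> X) : Prop :=
  forall d k, (d < 4)%N -> (k < band_arity d)%N ->
  f (lcode (d, k)) = f (rcode (band_mate (d, k))).

Hypothesis flat : q = 0%N \/ y = 0%N.

Lemma corner_facts :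
  [/\ x = 0 -> corner_out_left = 0, p = 0 -> corner_in_left = 0,
      r = 0 -> corner_in_right = 0 & w = 0 -> corner_out_right = 0]%N /\
  (y = 0 -> corner_out_left = corner_out_right /\ corner_in_left = corner_in_right)%N /\
  (q = 0 -> corner_out_left = corner_in_left /\ corner_out_right = corner_in_right)%N.
Proof.
rewrite /corner_out_left /corner_in_left /corner_in_right /corner_out_right /corner.
split; [split|split] => h; rewrite ?h ?ltnn ?andbF //=.
all: try by repeat case: ifP => //.
Qed.

Lemma band_label_bundles : bundles band_label.
Proof.
have := corner_facts; rewrite /bundles /band_label /lens.
move: corner_out_left corner_out_right corner_in_left corner_in_right => A B C D.
move=> [[hx hp hr hw] [hy hq]].
split; [| | |split] => h t ht.
all: repeat match goal with |- context [if ?b then _ else _] =>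
  let H := fresh in destruct b eqn:H; try (exfalso; lia) end.
all: congr (_, _); lia.
Qed.

Lemma band_faceP (X : Type) (f : nat * nat -> X) : band_face f <-> bundles f.
Proof.
split=> [h|[hx hy hw [hq hp hr]] d k].
  have key d k d' k' : (d < 4)%N -> (k < band_arity d)%N -> band_mate (d, k) = (d', k') ->
      f (lcode (d, k)) = f (rcode (d', k')) by move=> h1 h2 <-; exact: h.
  split; [| | |split] => s0 t ht.
  (* Gap [t] lies to the left of string [t] read from one end. The last gap has no such string and
     is obtained by reading the last string from its other end. *)
  - have [lt|ge] := ltnP t x; first by apply: (key 1 t 0 t)%N; band_case.
    case: t ht ge => [|t] ht ge; first by move: s0 ge; clear; lia.
    by symmetry; apply: (key 0 t 1 t)%N; band_case.
  - have [lt|ge] := ltnP t y; first by apply: (key 2 (p + t) 0 (x + t))%N; band_case.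
    case: t ht ge => [|t] ht ge; first by move: s0 ge; clear; lia.
    by rewrite !addnS; symmetry; apply: (key 0 (x + t) 2 (p + t))%N; band_case.
  - have [lt|ge] := ltnP t w; first by apply: (key 3 (r + q + t) 0 (x + y + t))%N; band_case.
    case: t ht ge => [|t] ht ge; first by move: s0 ge; clear; lia.
    by rewrite !addnS; symmetry; apply: (key 0 (x + y + t) 3 (r + q + t))%N; band_case.
  - case: t ht => [|t] ht.
      rewrite subn0 addn0 -(prednK s0) addnS; symmetry.
      by apply: (key 3 r 1 (x + q.-1))%N; rewrite ?prednK //; band_case.
    by rewrite addnS; apply: (key 1 (x + q - t.+1) 3 (r + t))%N; band_case.
  - case: t ht => [|t] ht.
      rewrite subn0 -(prednK s0) addnS; symmetry.
      by apply: (key 2 0 1 (x + q + p.-1))%N; rewrite ?prednK //; band_case.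
    by apply: (key 1 (x + q + p - t.+1) 2 t)%N; band_case.
  - case: t ht => [|t] ht.
      rewrite subn0 -(prednK s0) addnS; symmetry.
      by apply: (key 3 0 2 (p + y + r.-1))%N; rewrite ?prednK //; band_case.
    by apply: (key 2 (p + y + r - t.+1) 3 t)%N; band_case.
case: d => [|[|[|[|//]]]] _ /= lk; rewrite /lcode /rcode /=.
- have [l1|l1] := ltnP k (x); rewrite /=; first by rewrite hx //; move: l1; clear; lia.
  have [l2|l2] := ltnP k (x + y)%N; rewrite /=.
    have := hy _ (k - x).+1; rewrite addnS => ->; [congr (f (_, _))|..]; move: l1 l2; clear; lia.
  have := hw _ (k - x - y).+1; rewrite addnS => ->; [congr (f (_, _))|..]; move: l1 l2 lk; clear; lia.
- have [l1|l1] := ltnP k (x); rewrite /=; first by rewrite hx //; move: l1; clear; lia.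
  have [l2|l2] := ltnP k (x + q)%N; rewrite /=.
    have := hq _ (x + q - k)%N; rewrite subKn => [->|]; [congr (f (_, _))|..]; move: l1 l2; clear; lia.
  have := hp _ (x + q + p - k)%N; rewrite subKn => [->|]; [congr (f (_, _))|..]; move: l1 l2 lk; clear; lia.
- have [l1|l1] := ltnP k (p); rewrite /=; first by rewrite -hp; [congr (f (_, _))|..]; move: l1; clear; lia.
  have [l2|l2] := ltnP k (p + y)%N; rewrite /=.
    have := hy _ (k - p)%N; rewrite subnKC => [->|]; [congr (f (_, _))|..]; move: l1 l2; clear; lia.
  have := hr _ (p + y + r - k)%N; rewrite subKn => [->|]; [congr (f (_, _))|..]; move: l1 l2 lk; clear; lia.
- have [l1|l1] := ltnP k (r); rewrite /=; first by rewrite -hr; [congr (f (_, _))|..]; move: l1; clear; lia.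
  have [l2|l2] := ltnP k (r + q)%N; rewrite /=.
    have := hq _ (k - r)%N; rewrite subnKC => [<-|]; [congr (f (_, _))|..]; move: l1 l2; clear; lia.
  have := hw _ (k - r - q)%N; rewrite -subnDA subnKC => [->|]; [congr (f (_, _))|..]; move: l1 l2 lk; clear; lia.
Qed.

Lemma band_mateK d k : (d < 4)%N -> (k < band_arity d)%N ->
  band_mate (band_mate (d, k)) = (d, k) /\ band_mate (d, k) <> (d, k).
Proof.
case: d => [|[|[|[|//]]]] _ /= lk.
all: repeat match goal with |- context [if ?b then _ else _] =>
  let H := fresh in destruct b eqn:H; try (exfalso; lia) end; rewrite /=.
all: repeat match goal with |- context [if ?b then _ else _] =>
  let H := fresh in destruct b eqn:H; try (exfalso; lia) end.
all: by split; [congr (_, _); lia|case].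
Qed.

Lemma band_mate_point d k : (d < 4)%N -> (k < band_arity d)%N ->
  ((band_mate (d, k)).1 < 4)%N /\ ((band_mate (d, k)).2 < band_arity (band_mate (d, k)).1)%N.
Proof.
case: d => [|[|[|[|//]]]] _ /= lk.
all: repeat match goal with |- context [if ?b then _ else _] =>
  let H := fresh in destruct b eqn:H; try (exfalso; lia) end; rewrite /=.
all: by split => //; lia.
Qed.

(** Whether the large regions with labels [(0, 1)] and [(0, 2)] occur. They appear when nonempty
    bundles close up around a place away from the marked points. *)
Definition band_has1 : bool :=
  if (0 < y)%N then (0 < x)%N && (0 < p)%N else
  if (0 < q)%N then (0 < x)%N && (0 < w)%N else [&& 0 < x, 0 < p, 0 < r & 0 < w]%N.
Definition band_has2 : bool :=
  if (0 < y)%N then (0 < r)%N && (0 < w)%N else (0 < q)%N && (0 < p)%N && (0 < r)%N.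

Definition band_labels_at (id : nat) : seq nat :=
  match id with
  | 0 => 0 :: nseq band_has1 1 ++ nseq band_has2 2
  | 1 => iota 1 x.-1 | 2 => iota 1 y.-1 | 3 => iota 1 w.-1
  | 4 => iota 1 q.-1 | 5 => iota 1 p.-1 | _ => iota 1 r.-1
  end%N.

Definition band_labels : seq (nat * nat) :=
  [seq (id, t) | id <- iota 0 7, t <- band_labels_at id].

Definition band_rep (c : nat * nat) : nat * nat :=
  let: (id, t) := c in
  match id with
  | 0 => match t with
    | 0 => (0, 0)
    | 1 => if (y == 0) && (0 < q) then (3, r + q) else (2, p)
    | _ => (2, p + y) end
  | 1 => (0, t) | 2 => (0, x + t) | 3 => (0, x + y + t)
  | 4 => (3, r + t) | 5 => (2, t) | _ => (3, t)
  end%N.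

Lemma mem_band_labels id t : ((id, t) \in band_labels) =
  ((id < 7)%N && (t \in band_labels_at id)).
Proof.
apply/allpairsPdep/andP => [[a [b [ha hb [-> ->]]]]|[h1 h2]].
  by rewrite mem_iota in ha.
by exists id, t; rewrite mem_iota.
Qed.

Lemma band_labels_uniq : uniq band_labels.
Proof.
apply: allpairs_uniq_dep; rewrite ?iota_uniq //; last by move=> [? ?] [? ?] _ _ /= [-> ->].
move=> id _; case: id => [|[|[|[|[|[|id]]]]]] /=; rewrite ?iota_uniq //.
by case: band_has1; case: band_has2.
Qed.

(** A bundle of [k > 0] strings encloses [k - 1] thin regions, whence a correction of 1 for each
    nonempty bundle. To these the marked region and the other large regions are added. *)
Lemma size_band_labels :
  (size band_labels + ((0 < x) + (0 < y) + (0 < w) + (0 < q) + (0 < p) + (0 < r)) =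
   1 + band_has1 + band_has2 + (x + y + w + q + p + r))%N.
Proof.
rewrite size_allpairs_dep /= size_cat !size_nseq !size_iota.
case: (x) (y) (w) (q) (p) (r) => [|?] [|?] [|?] [|?] [|?] [|?] /=; lia.
Qed.

Section Rep.
Variables (X : Type) (f : nat * nat -> X).
Hypothesis bf : bundles f.
Hypothesis ends : forall d, (d < 4)%N -> (0 < band_arity d)%N ->
  f (d, 0%N) = f (0, 0)%N /\ f (d, band_arity d) = f (0, 0)%N.

Lemma corner_rep :
  [/\ (0 < y)%N -> f (0, x)%N = f (band_rep (0, corner_out_left)%N),
      (0 < q)%N -> f (1, x)%N = f (band_rep (0, corner_out_left)%N),
      (0 < w)%N -> f (0, x + y)%N = f (band_rep (0, corner_out_right)%N) &
      (0 < w)%N -> f (3, r + q)%N = f (band_rep (0, corner_out_right)%N)] /\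
  [/\ (0 < p)%N -> f (1, x + q)%N = f (band_rep (0, corner_in_left)%N),
      (0 < y)%N -> f (2, p)%N = f (band_rep (0, corner_in_left)%N),
      (0 < r)%N -> f (2, p + y)%N = f (band_rep (0, corner_in_right)%N) &
      (0 < q)%N -> f (3, r)%N = f (band_rep (0, corner_in_right)%N)].
Proof.
have [hx hy hw [hq hp hr]] := bf.
have e1 h := hx h _ (leqnn x).
have e2 h := hy h _ (leq0n y). have e3 h := hy h _ (leqnn y).
have e4 h := hw h _ (leq0n w).
have e5 h := hq h _ (leqnn q). have e6 h := hq h _ (leq0n q).
have e7 h := hp h _ (leqnn p). have e8 h := hr h _ (leqnn r).
have a0 := @ends 0%N isT. have a1 := @ends 1%N isT.
have a2 := @ends 2%N isT. have a3 := @ends 3%N isT.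
move: {hx hy hw hq hp hr} e1 e2 e3 e4 e5 e6 e7 e8 a0 a1 a2 a3.
rewrite /= !addnK ?addn0 ?subn0 /band_rep /corner_out_left /corner_out_right
  /corner_in_left /corner_in_right /corner.
have gt0 k : ((k.+1 : nat) == 0%N) = false by [].
have [q0|y0] := flat; rewrite ?q0 ?y0 ?ltnn ?eqxx ?andbF ?addn0.
  case: (posnP x) => [->|px]; case: (posnP p) => [->|pp]; case: (posnP y) => [->|py];
  case: (posnP r) => [->|pr]; case: (posnP w) => [->|pw];
  rewrite ?px ?pp ?py ?pr ?pw ?ltnn ?eqxx ?add0n ?addn0 ?addn_gt0 ?px ?pp ?py ?pr ?pw ?orbT /= ?addn0 ?add0n;
  move=> e1 e2 e3 e4 e5 e6 e7 e8 a0 a1 a2 a3;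
  repeat match goal with H : true -> _ |- _ => specialize (H isT) | H : is_true true -> _ |- _ => specialize (H isT)
    | H : _ /\ _ |- _ => destruct H end;
  by split; split => //; try (move=> _; congruence).
case: (posnP x) => [->|px]; case: (posnP p) => [->|pp]; case: (posnP q) => [->|py];
case: (posnP r) => [->|pr]; case: (posnP w) => [->|pw];
rewrite ?px ?pp ?py ?pr ?pw ?ltnn ?eqxx ?add0n ?addn0 ?addn_gt0 ?px ?pp ?py ?pr ?pw ?orbT /= ?addn0 ?add0n;
move=> e1 e2 e3 e4 e5 e6 e7 e8 a0 a1 a2 a3;
repeat match goal with H : true -> _ |- _ => specialize (H isT) | H : is_true true -> _ |- _ => specialize (H isT)
    | H : _ /\ _ |- _ => destruct H end;
by split; split => //; try (move=> _; congruence).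
Qed.

Lemma band_repP d k : (d < 4)%N -> (k <= band_arity d)%N -> f (d, 0%N) = f (0, 0)%N ->
  f (d, k) = f (band_rep (band_label (d, k))).
Proof.
move=> d4 lk fd.
have [[cA0 cA1 cB0 cB3] [cC1 cC2 cD2 cD3]] := corner_rep.
have [hx hy hw [hq hp hr]] := bf.
have last : k = band_arity d -> f (d, k) = f (0, 0)%N.
  move=> ->; have [->//|h] := posnP (band_arity d).
  by case: (ends d4 h).
case: d d4 lk fd last => [|[|[|[|//]]]] _ /= lk fd last; rewrite /lens.
- case: (ltnP k x) => l1.
    by case: eqP => [->|_] //=.
  case: (ltnP k (x + y)) => l2.
    case: eqP => [h|_] /=; last by congr (f (_, _)); lia.
    have -> : k = x by lia. by apply: cA0; lia.
  case: (ltnP k (x + y + w)) => l3; last by apply: last; lia.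
  case: eqP => [h|_] /=; last by congr (f (_, _)); lia.
  have -> : k = (x + y)%N by lia. by apply: cB0; lia.
- case: (ltnP k x) => l1.
    case: eqP => [->|_] //=; by apply: hx; lia.
  case: (ltnP k (x + q)) => l2.
    case: eqP => [->|_]; first by apply: cA1; lia.
    rewrite /= -hq; [congr (f (_, _))|..]; lia.
  case: (ltnP k (x + q + p)) => l3; last by apply: last; lia.
  case: eqP => [->|_]; first by apply: cC1; lia.
  rewrite /= -hp; [congr (f (_, _))|..]; lia.
- case: (ltnP k p) => l1.
    by case: eqP => [->|_] //=.
  case: (ltnP k (p + y)) => l2.
    case: eqP => [h|_] /=.
      have -> : k = p by lia. by apply: cC2; lia.
    rewrite -hy; [congr (f (_, _))|..]; lia.
  case: (ltnP k (p + y + r)) => l3; last by apply: last; lia.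
  case: eqP => [->|_]; first by apply: cD2; lia.
  rewrite /= -hr; [congr (f (_, _))|..]; lia.
- case: (ltnP k r) => l1.
    by case: eqP => [->|_] //=.
  case: (ltnP k (r + q)) => l2.
    case: eqP => [h|_] /=.
      have -> : k = r by lia. by apply: cD3; lia.
    congr (f (_, _)); lia.
  case: (ltnP k (r + q + w)) => l3; last by apply: last; lia.
  case: eqP => [h|_] /=.
    have -> : k = (r + q)%N by lia. by apply: cB3; lia.
  rewrite -hw; [congr (f (_, _))|..]; lia.
Qed.

End Rep.

Lemma mem_iota1 k m : (k \in iota 1 m.-1) = (0 < k < m)%N.
Proof. by rewrite mem_iota; case: m => [|m]; rewrite ?ltn0 ?andbF //; lia. Qed.

Lemma corner_mem :
  [/\ corner_out_left \in band_labels_at 0, corner_out_right \in band_labels_at 0,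
      corner_in_left \in band_labels_at 0 & corner_in_right \in band_labels_at 0].
Proof.
rewrite /corner_out_left /corner_out_right /corner_in_left /corner_in_right /corner /=.
rewrite !inE !mem_cat !mem_nseq /band_has1 /band_has2.
case: (0 < x)%N; case: (0 < y)%N; case: (0 < p)%N; case: (0 < q)%N; case: (0 < r)%N;
  by case: (0 < w)%N.
Qed.

Lemma band_label_mem d k : (d < 4)%N -> (k <= band_arity d)%N ->
  band_label (d, k) \in band_labels.
Proof.
move=> d4 lk; have [cA cB cC cD] := corner_mem.
have c0 : 0%N \in band_labels_at 0 by rewrite mem_head.
case: d d4 lk => [|[|[|[|//]]]] _ /= lk; rewrite /lens.
all: repeat match goal with |- context [if ?b then _ else _] =>
  let H := fresh in destruct b eqn:H; try (exfalso; lia) end;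
  rewrite mem_band_labels //=; change (0 :: ?s)%N with (band_labels_at 0)%N;
  rewrite ?cA ?cB ?cC ?cD ?mem_iota1 //; lia.
Qed.

Lemma band_rep_gap c : c \in band_labels ->
  ((band_rep c).1 < 4)%N && ((band_rep c).2 <= band_arity (band_rep c).1)%N /\
  band_label (band_rep c) = c.
Proof.
case: c => id t; rewrite mem_band_labels => /andP[].
case: id => [|[|[|[|[|[|[|//]]]]]]] _; rewrite [band_labels_at _]/= ?mem_iota1; first last.
1-6: by move=> /andP[t0 lt]; split; [apply/andP; split => //=; lia|];
  rewrite /= /lens;
  repeat match goal with |- context [if ?b then _ else _] =>
    let H := fresh in destruct b eqn:H; try (exfalso; lia) end; congr (_, _); lia.
rewrite !inE mem_cat !mem_nseq => /or3P[/eqP->|/andP[h /eqP->]|/andP[h /eqP->]].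
- split => //=; have := corner_facts.
  rewrite /lens; move: corner_out_left corner_out_right corner_in_left corner_in_right => A B C D.
  move=> [[hx hp hr hw] [hy hq]].
  repeat match goal with |- context [if ?b then _ else _] =>
    let H := fresh in destruct b eqn:H; try (exfalso; lia) end; congr (_, _); lia.
- move: h; rewrite /band_has1; case: (posnP y) => [y0|py] /=.
    case: (posnP q) => [q0|pq] /=; rewrite lt0b => h; rewrite /lens y0 /=.
      have [px pp pr pw] : [/\ (0 < x), (0 < p), (0 < r) & (0 < w)]%N by apply/and4P.
      have e1 : corner_in_right = 1%N by rewrite /corner_in_right /corner y0 q0 px pp pr pw.
      split; first by lia.
      rewrite ltnn ifF; last by lia.
      by rewrite ifT ?ifT ?e1 //; lia.
    have [px pw] : (0 < x)%N /\ (0 < w)%N by apply/andP.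
    have e1 : corner_out_right = 1%N by rewrite /corner_out_right /corner y0 pq px pw.
    split; first by lia.
    rewrite ifF; last by lia.
    rewrite ltnn.
    by rewrite ifT ?addKn ?subnn ?e1 //; lia.
  rewrite lt0b => h; have [px pp] : (0 < x)%N /\ (0 < p)%N by apply/andP.
  have e1 : corner_in_left = 1%N by rewrite /corner_in_left /corner py px pp.
  rewrite /band_rep (gtn_eqF py) /=; split; first by lia.
  rewrite ltnn ifT; last by lia.
  by rewrite subnn e1.
- move: h; rewrite /band_has2 /= lt0b => h.
  have [pr e2] : (0 < r)%N /\ corner_in_right = 2.
    rewrite /corner_in_right /corner; case: (posnP y) h => [y0|py] /= h.
      by have [/andP[-> ->] ->] := andP h.
    by have [-> ->] := andP h.
  split; first by lia.
  rewrite e2 ifF; last by lia.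
  by rewrite ltnn eqxx ifT //; lia.
Qed.

End Band.

(** Connected components of the four disks, in terms of the nonempty bundles. *)
Section Components.
Variables bx bp bq byy br bw : bool.

Definition band_adj (d e : nat) : bool :=
  [|| d == e,
      bx && ((d, e) \in [:: (0, 1); (1, 0)]),
      byy && ((d, e) \in [:: (0, 2); (2, 0)]),
      bw && ((d, e) \in [:: (0, 3); (3, 0)]),
      bp && ((d, e) \in [:: (1, 2); (2, 1)]),
      br && ((d, e) \in [:: (2, 3); (3, 2)]) |
      bq && ((d, e) \in [:: (1, 3); (3, 1)])]%N.

(** Paths of at most three edges suffice to connect four disks. *)
Definition band_conn (d e : nat) : bool :=
  has (fun a => has (fun b => [&& band_adj d a, band_adj a b & band_adj b e]) (iota 0 4)) (iota 0 4).

Definition band_component (d : nat) : nat := find (band_conn d) (iota 0 4).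

End Components.

Lemma band_component_adj bx bp bq byy br bw d e : (d < 4)%N -> (e < 4)%N ->
  band_adj bx bp bq byy br bw d e ->
  band_component bx bp bq byy br bw d = band_component bx bp bq byy br bw e.
Proof.
move=> d4 e4.
have : all (fun d => all (fun e => band_adj bx bp bq byy br bw d e ==>
   (band_component bx bp bq byy br bw d == band_component bx bp bq byy br bw e)) (iota 0 4)) (iota 0 4).
  by move: {d e d4 e4} bx bp bq byy br bw => [] [] [] [] [] []; vm_compute.
by move=> /allP/(_ d)/[!mem_iota]/(_ d4)/allP/(_ e)/[!mem_iota]/(_ e4)/implyP h /h/eqP.
Qed.

Lemma band_component_conn bx bp bq byy br bw d : (d < 4)%N ->
  (band_component bx bp bq byy br bw d < 4)%N /\
  band_conn bx bp bq byy br bw d (band_component bx bp bq byy br bw d).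
Proof.
move=> d4.
have : all (fun d => (band_component bx bp bq byy br bw d < 4)%N &&
   band_conn bx bp bq byy br bw d (band_component bx bp bq byy br bw d)) (iota 0 4).
  by move: {d d4} bx bp bq byy br bw => [] [] [] [] [] []; vm_compute.
by move=> /allP/(_ d)/[!mem_iota]/(_ d4)/andP.
Qed.

(** Removing all but one string of each nonempty bundle changes the numbers of edges and of regions
    equally. Euler's relation therefore depends only on which bundles are empty, and it becomes a
    finite check. *)
Definition euler_check (s : seq nat) (bx bp bq byy br bw : bool) : bool :=
  ~~ (bq && byy) ==>
  (size s + nat_of_bool (if byy then bx && bp else if bq then bx && bw else [&& bx, bp, br & bw])
     + nat_of_bool (if byy then br && bw else [&& bq, bp & br]) ==
   bx + byy + bw + bq + bp + br + size (undup (map (band_component bx bp bq byy br bw) s)))%N.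

Definition all_bools (f : bool -> bool) : bool := f true && f false.

Lemma all_boolsP (f : bool -> bool) : all_bools f -> forall b, f b.
Proof. by case/andP=> h1 h2 []. Qed.

Lemma euler_check3 bx bp bq byy br bw : euler_check [:: 0; 1; 2; 3]%N bx bp bq byy br bw.
Proof.
have h : all_bools (fun bx => all_bools (fun bp => all_bools (fun bq => all_bools (fun byy =>
  all_bools (fun br => all_bools (fun bw => euler_check [:: 0; 1; 2; 3]%N bx bp bq byy br bw)))))).
  by vm_compute.
exact: (all_boolsP (all_boolsP (all_boolsP (all_boolsP (all_boolsP (all_boolsP h bx) bp) bq) byy) br) bw).
Qed.

Lemma euler_check2 bx bp byy : euler_check [:: 0; 1; 2]%N bx bp false byy false false.
Proof.
have h : all_bools (fun bx => all_bools (fun bp => all_bools (fun byy =>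
  euler_check [:: 0; 1; 2]%N bx bp false byy false false))) by vm_compute.
exact: (all_boolsP (all_boolsP (all_boolsP h bx) bp) byy).
Qed.

Lemma euler_check1 byy : euler_check [:: 0; 2]%N false false false byy false false.
Proof. by case: byy; vm_compute. Qed.

(** The possible codes of the inner disks; the absent ones meet no string. *)
Definition band_codes (x p q y r w : nat) (s : seq nat) : bool :=
  [|| s == [:: 1; 2; 3],
      (s == [:: 1; 2]) && [&& q == 0, r == 0 & w == 0] |
      (s == [:: 2]) && [&& x == 0, p == 0, q == 0, r == 0 & w == 0]]%N.

Section BandDraw.
Variables (x p q y r w : nat) (s : seq nat).
Hypothesis flat : q = 0%N \/ y = 0%N.
Hypothesis scode : band_codes x p q y r w s.
Let N := band_arity x p q y r w.
Let kap := band_component (0 < x)%N (0 < p)%N (0 < q)%N (0 < y)%N (0 < r)%N (0 < w)%N.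
Let adj := band_adj (0 < x)%N (0 < p)%N (0 < q)%N (0 < y)%N (0 < r)%N (0 < w)%N.

Lemma band_codes_lt d : d \in 0%N :: s -> (d < 4)%N.
Proof.
case/or3P: scode => [/eqP->|/andP[/eqP->]|/andP[/eqP->]]; rewrite !inE.
- by case/or4P => /eqP->.
- by move=> _ /or3P[] /eqP->.
- by move=> _ /orP[] /eqP->.
Qed.

Lemma band_codes_arity d : (d < 4)%N -> (0 < N d)%N -> d \in 0%N :: s.
Proof.
case/or3P: scode => [/eqP->|/andP[/eqP-> /and3P[/eqP q0 /eqP r0 /eqP w0]]|
  /andP[/eqP-> /and5P[/eqP x0 /eqP p0 /eqP q0 /eqP r0 /eqP w0]]]; rewrite /N.
all: case: d => [|[|[|[|//]]]] _ //=; rewrite ?q0 ?r0 ?w0 ?x0 ?p0 //.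
Qed.

Lemma band_mate_adj d k : (d < 4)%N -> (k < N d)%N ->
  adj d (band_mate x p q y r (d, k)).1.
Proof.
rewrite /N /adj; case: d => [|[|[|[|//]]]] _ /= lk.
all: repeat match goal with |- context [if ?b then _ else _] =>
  let H := fresh in destruct b eqn:H; try (exfalso; lia) end; rewrite /band_adj /= ?inE /=.
all: rewrite ?orbT ?andbT ?andbF ?orbF //; lia.
Qed.

Lemma band_adj_mate d e : adj d e -> d = e \/
  exists k, [/\ (d < 4)%N, (k < N d)%N & (band_mate x p q y r (d, k)).1 = e].
Proof.
rewrite /adj /band_adj /N.
case: eqP => [->|_ /=]; first by left.
move=> h; right; move: h; rewrite !inE.
case/or4P => [/andP[h /orP[]/eqP[-> ->]]|/andP[h /orP[]/eqP[-> ->]]|/andP[h /orP[]/eqP[-> ->]]|].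
- by exists 0%N; split => //; band_case.
- by exists 0%N; split => //; band_case.
- by exists x; split => //; band_case.
- by exists p; split => //; band_case.
- by exists (x + y)%N; split => //; band_case.
- by exists (r + q)%N; split => //; band_case.
case/or3P => [/andP[h /orP[]/eqP[-> ->]]|/andP[h /orP[]/eqP[-> ->]]|/andP[h /orP[]/eqP[-> ->]]].
- by exists (x + q)%N; split => //; band_case.
- by exists 0%N; split => //; band_case.
- by exists (p + y)%N; split => //; band_case.
- by exists 0%N; split => //; band_case.
- by exists x; split => //; band_case.
- by exists r; split => //; band_case.
Qed.

Lemma band_euler :
  ((size (0%N :: s) + size (band_labels x p q y r w)).*2 =
   sumn (map N (0%N :: s)) + (size (undup (map kap (0%N :: s)))).+1.*2)%N.
Proof.
have := @size_band_labels x p q y r w flat.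
have key : (size (0%N :: s) + band_has1 x p q y r w + band_has2 p q y r w =
  (0 < x) + (0 < y) + (0 < w) + (0 < q) + (0 < p) + (0 < r) + size (undup (map kap (0%N :: s))))%N.
  have noqy : ~~ ((0 < q)%N && (0 < y)%N) by case: flat => ->; rewrite ?andbF.
  rewrite /band_has1 /band_has2 /kap -[X in (_ + nat_of_bool X = _)%N]/(if _ then _ else _) -andbA.
  case/or3P: scode => [/eqP->|/andP[/eqP-> /and3P[/eqP q0 /eqP r0 /eqP w0]]|
    /andP[/eqP-> /and5P[/eqP x0 /eqP p0 /eqP q0 /eqP r0 /eqP w0]]].
  - exact/eqP/(implyP (euler_check3 _ _ _ _ _ _) noqy).
  - by rewrite q0 r0 w0; apply/eqP/(implyP (euler_check2 _ _ _)).
  - by rewrite x0 p0 q0 r0 w0; apply/eqP/(implyP (euler_check1 _)).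
have -> : sumn (map N (0%N :: s)) = (x + y + w + q + p + r).*2%N.
  rewrite /N; case/or3P: scode => [/eqP->|/andP[/eqP-> /and3P[/eqP q0 /eqP r0 /eqP w0]]|
    /andP[/eqP-> /and5P[/eqP x0 /eqP p0 /eqP q0 /eqP r0 /eqP w0]]] /=; lia.
lia.
Qed.

Lemma band_drawable (M : nat -> nat) : (forall d, d \in 0%N :: s -> M d = N d) ->
  drawable s M (band_mate x p q y r) (band_label x p q y r w).
Proof.
move=> MN I n l c cI c0 cs M0 Mc.
have cds : perm_eq (codes c) (0%N :: s) by rewrite perm_cons.
have mem d : (d \in codes c) = (d \in 0%N :: s) by rewrite (perm_mem cds).
have N0 : N 0 = l by rewrite -MN ?mem_head.
have Nc i : N (c i) = n i by rewrite -MN -?mem ?mem_codes.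
have pt d k : is_point c N (d, k) -> (d < 4)%N /\ (k < N d)%N.
  by case/andP => /= h ->; split=> //; apply: band_codes_lt; rewrite -mem.
have tp d k : (d < 4)%N -> (k < N d)%N -> is_point c N (d, k).
  by move=> d4 lk; rewrite /is_point /= lk andbT mem; apply: band_codes_arity => //; lia.
have mp : forall v, is_point c N v -> is_point c N (band_mate x p q y r v).
  move=> [d k] /pt[d4 lk]; have [h1 h2] := band_mate_point flat d4 lk.
  by move: h1 h2; case: (band_mate _ _ _ _ _ _) => d' k'; exact: tp.
have mE := coded_mateE N0 Nc mp.
have faceE (X : Type) (f : nat * nat -> X) : face_function c N (band_mate x p q y r) f ->
    bundles x p q y r w f /\ (forall d, (d < 4)%N -> (0 < N d)%N ->
      f (d, 0%N) = f (0, 0)%N /\ f (d, N d) = f (0, 0)%N).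
  move=> [h1 h2]; split.
    by apply/band_faceP => // d k d4 lk; apply: h1; apply: tp.
  by move=> d d4 Nd; apply: h2; rewrite mem; apply: band_codes_arity.
have lab : face_function c N (band_mate x p q y r) (band_label x p q y r w).
  split=> [[d k] /pt[d4 lk]|d].
    by have /(band_faceP _ _ _ _ flat) h := band_label_bundles x p r w flat; apply: h.
  rewrite mem => /band_codes_lt; have := corner_facts x p q y r w.
  rewrite /N /band_label /lens; move: (corner_out_left _ _ _ _ _ _) (corner_out_right _ _ _ _ _ _) (corner_in_left _ _ _ _ _ _) (corner_in_right _ _ _ _ _ _) => A B C D.
  move=> [[hx hp hr hw] [hy hq]]; case: d => [|[|[|[|//]]]] _ /=; split.
  all: repeat match goal with |- context [if ?b then _ else _] =>
    let H := fresh in destruct b eqn:H; try (exfalso; lia) end; try by first [done|congr (_, _); lia].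
have args := (draw (N := N) (mt := band_mate x p q y r) (L := band_label x p q y r w)
  (rep := band_rep x p q y r) (Ls := band_labels x p q y r w) (kap := kap) cI c0 N0 Nc mE).
have args' := (draw_labelled (N := N) (mt := band_mate x p q y r) (L := band_label x p q y r w)
  (rep := band_rep x p q y r) cI c0 N0 Nc mE lab).
have repP (Y : eqType) (f : nat * nat -> Y) : face_function c N (band_mate x p q y r) f ->
    forall v, is_gap c N v -> f v = f (band_rep x p q y r (band_label x p q y r w v)).
  move=> hf [d k] /andP[/= dc lk]; have [bf ef] := faceE _ f hf.
  apply: band_repP => //; first by apply: band_codes_lt; rewrite -mem.
  by have [-> _] := (proj2 hf) d dc.
split; last exact: args'.
apply: args => //.
- by move=> [d k] /pt[d4 lk]; first [exact: (band_mateK d4 lk)|exact: (band_mateK flat d4 lk)].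
- exact: band_labels_uniq.
- move=> [d k] /andP[/= dc lk]; apply: band_label_mem => //; apply: band_codes_lt; by rewrite -mem.
- move=> v hv; have [/andP[h1 h2] h3] := band_rep_gap flat hv; split => //.
  apply/andP; split => //; rewrite mem.
  (* A disk without points may be absent from [s]. Its only gap is in the marked region, which is
     represented on the outer disk. *)
  case: (posnP (N (band_rep x p q y r v).1)) => [Nz|Np]; last exact: band_codes_arity.
  suff -> : v = (0, 0)%N by rewrite mem_head.
  rewrite -h3; move: h1 h2 Nz; case: (band_rep x p q y r v) => d k /=.
  rewrite /N => d4 h2 Nz; rewrite Nz leqn0 in h2; rewrite (eqP h2) /lens.
  by case: d d4 Nz {h2 h3} => [|[|[|[|//]]]] _ /= Nz; band_case.
- move=> [d k] /pt[d4 lk]; have [h1 _] := band_mate_point flat d4 lk.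
  by apply: band_component_adj => //; apply: band_mate_adj.
- move=> Y f hf d dc; have d4 : (d < 4)%N by move: dc; rewrite mem; apply: band_codes_lt.
  have [_] := band_component_conn (0 < x)%N (0 < p)%N (0 < q)%N (0 < y)%N (0 < r)%N (0 < w)%N d4.
  have st a b : adj a b -> f a = f b.
    case/band_adj_mate => [->//|[k [a4 lk <-]]]; apply: (hf (a, k)); exact: tp.
  by case/hasP => a _ /hasP[b _ /and3P[/st-> /st-> /st->]].
- have := band_euler; rewrite -(perm_size cds) -(perm_sumn (perm_map N cds)).
  have -> // : size (undup (map kap (0%N :: s))) = size (undup (map kap (codes c))).
  apply/perm_size/perm_undup; move=> e; apply: perm_mem; rewrite perm_sym.
  exact: perm_map.
Qed.

End BandDraw.

(** * Renaming the codes of the disks *)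

Section Recode.
Variables (g g' : nat -> nat).
Hypothesis gK : cancel g g'.
Hypothesis g0 : g 0 = 0%N.

Definition recode (mt : nat * nat -> nat * nat) (p : nat * nat) : nat * nat :=
  (g (mt (g' p.1, p.2)).1, (mt (g' p.1, p.2)).2).

Lemma recode_code (I : finType) n l V (c : I -> nat) (p : flag n l V) :
  flag_code (g \o c) p = (g (flag_code c p).1, (flag_code c p).2).
Proof. by case: p => [[k|[i k]]|[v b]] //=; rewrite g0. Qed.

Lemma recode_spot (I : finType) n l V (c : I -> nat) (p : spot n l V) :
  spot_code (g \o c) p = (g (spot_code c p).1, (spot_code c p).2).
Proof. by case: p => [[k|[i k]]|[v b]] //=; rewrite g0. Qed.

Lemma drawn_recode (I : finType) n l (T : tangle n l) (c : I -> nat) mt :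
  drawn T c mt -> drawn T (g \o c) (recode mt).
Proof.
case=> pT vT cI c0 mE mk tg; split => //.
- exact: inj_comp (can_inj gK) cI.
- by move=> i /=; rewrite -g0 (inj_eq (can_inj gK)).
- by move=> p; rewrite !recode_code mE /recode /= gK; case: (flag_code c p).
Qed.

Lemma drawable_recode s N mt (X : eqType) (L : nat * nat -> X) : cancel g' g ->
  drawable s N mt L ->
  drawable (map g s) (N \o g') (recode mt) (fun p => L (g' p.1, p.2)).
Proof.
move=> g'K dr I n l c cI c0 cs N0 Nc T.
have g'0 : g' 0 = 0%N by rewrite -g0 gK.
have [||||| dT lT] := dr I n l (g' \o c).
- exact: inj_comp (can_inj g'K) cI.
- by move=> i /=; rewrite -g'0 (inj_eq (can_inj g'K)).
- by rewrite map_comp -[s](mapK gK); apply: perm_map.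
- by rewrite -N0 /= g'0.
- by move=> i; rewrite -Nc.
have cE : g \o (g' \o c) = c by apply/funext=> i /=; rewrite g'K.
have TE : based_tangle (coded_mate (n := n) (l := l) (g' \o c) mt) pred0 = T.
  congr (based_tangle _ _); apply/funext=> p.
  have vF : void -> False by case.
  have [cI' c0'] : injective (g' \o c) /\ (forall i, (g' \o c) i != 0%N).
    by split; [exact: drawn_inj dT|exact: drawn_pos dT].
  rewrite /coded_mate; congr odflt; apply: eq_pick => q.
  have fc (r : flag n l void) :
      flag_code c r = (g (flag_code (g' \o c) r).1, (flag_code (g' \o c) r).2).
    by rewrite -recode_code cE.
  rewrite !fc /recode /= gK -surjective_pairing.
  rewrite -(inj_eq (f := fun x : nat * nat => (g x.1, x.2))) //.
  by move=> [a b] [a' b'] /= [/(can_inj gK)-> ->].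
rewrite TE in dT lT; split; first by have := drawn_recode dT; rewrite cE.
have sc (r : spot n l void) :
    spot_code c r = (g (spot_code (g' \o c) r).1, (spot_code (g' \o c) r).2).
  by rewrite -recode_spot cE.
by move=> u v; rewrite lT !sc /= !gK -!surjective_pairing.
Qed.

Lemma pic_recode (R : realType) (P : planar_data R) mt s (tab tab' : nat -> vector P) l (v : P l) :
  pic mt s tab v -> {in s, forall d, tab' (g d) = tab d} ->
  pic (recode mt) (map g s) tab' v.
Proof.
move=> [I [n [T [c [x [dT sT xT ->]]]]]] tE.
exists I, n, T, (g \o c), x; split => //.
- exact: drawn_recode.
- by rewrite map_comp; apply: perm_map.
- by move=> i; rewrite xT /= tE // -(perm_mem sT) map_f ?mem_enum.
Qed.

End Recode.

(** * Reflection of drawn tangles *)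

Section Reflection.

Lemma reflect_flagK I n l (T : @tangle I n l) : involutive (@reflect_flag I n l T).
Proof. by case=> [[k|[i k]]|[v b]] //=; rewrite ?rev_ordK // /flag_in rev_ordK. Qed.

Lemma reflect_spotK I n l (T : @tangle I n l) : involutive (@reflect_spot I n l T).
Proof. by case=> [[k|[i k]]|[v b]] //=; rewrite ?rev_ordK /spot_in ?rev_ordK ?negbK. Qed.

Lemma reflect_lspot I n l (T : @tangle I n l) (p : flag n l (node T)) :
  reflect_spot (lspot p) = rspot (reflect_flag p).
Proof.
case: p => [[k|[i k]]|[v b]] //=; congr (inl _).
  by congr (inl _); apply/val_inj; rewrite /= /bump leq0n add1n subSS.
congr (inr (existT _ _ _)); apply/val_inj; rewrite /= /bump leq0n add1n.
by have := ltn_ord k; case: (n i) k => [|m] // k lk; rewrite subSS subSn // -ltnS.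
Qed.

Lemma reflect_rspot I n l (T : @tangle I n l) (p : flag n l (node T)) :
  reflect_spot (rspot p) = lspot (reflect_flag p).
Proof. by rewrite -[RHS]reflect_spotK reflect_lspot reflect_flagK. Qed.

Lemma reflect_flag_vertex I n l (T : @tangle I n l) (p : flag n l (node T)) :
  flag_vertex (reflect_flag p) = flag_vertex p.
Proof. by case: p => [[k|[i k]]|[v b]]. Qed.

Lemma reflect_spot_vertex I n l (T : @tangle I n l) (p : spot n l (node T)) :
  spot_vertex (reflect_spot p) = spot_vertex p.
Proof. by case: p => [[k|[i k]]|[v b]]. Qed.

Lemma reflect_planar I n l (T : @tangle I n l) : planar T -> planar (reflect_tangle T).
Proof.
case=> mK mN eqT face mo mi con eul; set T' := reflect_tangle T.
have rK := @reflect_flagK I n l T; have sK := @reflect_spotK I n l T.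
have r0 m : rev_ord (ord0 : 'I_m.+1) = ord_max by apply/val_inj; rewrite /= subn1.
have rM m : rev_ord (ord_max : 'I_m.+1) = ord0 by apply/val_inj; rewrite /= subnn.
have symT s t : same T s t = same T t s.
  by have [h1 h2] := eqT s t s; apply/idP/idP => h; [have [h3 /(_ h) <-] := eqT s t s|have [h3 /(_ h) <-] := eqT t s t].
have eqT' : equivalence_rel (same T') by move=> a b c; apply: eqT.
split => //.
- by move=> p /=; rewrite rK mK rK.
- by move=> p /=; apply/eqP=> /(congr1 (@reflect_flag _ _ _ T)); rewrite rK; apply/eqP/mN.
- move=> p /=; rewrite reflect_lspot reflect_rspot rK symT.
  have := face (mate T (reflect_flag p)); by rewrite mK.
- by rewrite /= r0 rM symT.
- by move=> i; rewrite /T' /= /spot_in r0 rM symT; apply: mi.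
- move=> s t; rewrite -[s]sK -[t]sK; have := con (reflect_spot s) (reflect_spot t).
  apply: connect_map => u v /orP[h|/eqP h]; apply/connect1/orP; [left|right].
    by rewrite /= !sK.
  by rewrite !reflect_spot_vertex h.
have -> : n_comp (same T') predT = n_comp (same T) predT.
  apply: (n_comp_map (h := @reflect_spot I n l T)) => [x y|x y|x|x y].
  - by rewrite !equivalence_connect //=; rewrite symT.
  - by rewrite !equivalence_connect.
  - by exists (reflect_spot x); rewrite sK connect0.
  - by rewrite !equivalence_connect //= !sK.
have -> : n_comp (edge_rel T') predT = n_comp (edge_rel T) predT.
  apply: eq_n_comp; apply: eq_connect => u v.
  apply/existsP/existsP => -[p /andP[/eqP h1 /eqP h2]]; exists (reflect_flag p); apply/andP.
    by rewrite reflect_flag_vertex h1 -h2 /= reflect_flag_vertex.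
  by rewrite reflect_flag_vertex h1 -h2 /= rK reflect_flag_vertex.
exact: eul.
Qed.

Definition rev_point (N : nat -> nat) (p : nat * nat) := (p.1, N p.1 - p.2.+1)%N.

Lemma drawn_reflect I n l (T : @tangle I n l) c mt N : drawn T c mt ->
  N 0 = l -> (forall i, N (c i) = n i) ->
  drawn (reflect_tangle T) c (rev_point N \o mt \o rev_point N).
Proof.
move=> dT N0 Nc; case: (dT) => pT vT cI c0 mE mk tg.
have fE (p : flag n l (node T)) : flag_code c (reflect_flag p) = rev_point N (flag_code c p).
  by case: p => [[k|[i k]]|[v b]] //=; rewrite /rev_point /= ?N0 ?Nc //; case: (vT v).
have r0 m : rev_ord (ord0 : 'I_m.+1) = ord_max by apply/val_inj; rewrite /= subn1.
have rM m : rev_ord (ord_max : 'I_m.+1) = ord0 by apply/val_inj; rewrite /= subnn.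
have mkr s : marked_spot pred0 s -> marked_spot pred0 (@reflect_spot I n l T s).
  case/or4P => [/eqP->|/eqP->|ex|//] /=; rewrite ?r0 ?rM; [by apply/or4P; apply: Or42|by apply/or4P; apply: Or41|].
  case/existsP: ex => i /orP[] /eqP->; apply/or4P; apply: Or43; apply/existsP; exists i;
    rewrite /= /spot_in ?r0 ?rM eqxx ?orbT //.
have [cl clE] := drawn_class dT.
have mke s t : marked_spot pred0 s -> marked_spot pred0 t -> same T s t.
  by move=> /mk + /mk; rewrite !clE => /eqP-> /eqP->.
split => //.
- exact: reflect_planar.
- by move=> p /=; rewrite !fE mE fE.
- move=> s ms /=; apply: mke; [exact: mkr|rewrite r0].
  by apply/or4P; apply: Or42.
- move=> X f h1 h2 s t /= h.
  rewrite -[s](@reflect_spotK I n l T) -[t](@reflect_spotK I n l T).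
  apply: (tg X (f \o @reflect_spot I n l T)) h => [p|{}s ms] /=.
    have := h1 (mate (reflect_tangle T) (reflect_flag p)).
    rewrite (planar_mateK (reflect_planar pT)) /= reflect_flagK => h.
    by rewrite reflect_lspot reflect_rspot h.
  by rewrite !h2 //; [rewrite r0; apply/or4P; apply: Or42|exact: mkr].
Qed.

Lemma pic_reflect (R : realType) (P : planar_data R) (hP : is_planar_algebra P)
    mt s (tab tab' : nat -> vector P) l (v : P l) :
  pic mt s tab v -> {in s, forall d, tab' d = Tagged (fun k => P k) (pa_star (tagged (tab d)))} ->
  pic (rev_point (arity l tab) \o mt \o rev_point (arity l tab)) s tab' (pa_star v).
Proof.
move=> [I [n [T [c [x [dT sT xT ->]]]]]] tE.
exists I, n, (reflect_tangle T), c, (fun i => pa_star (x i)); split => //.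
- apply: drawn_reflect => // i.
  by rewrite /arity (negbTE (drawn_pos dT i)) -xT.
- move=> i; rewrite tE -?xT // -(perm_mem sT) map_f ?mem_enum //.
- by rewrite (pa_reflect hP _ (drawn_planar dT)).
Qed.

End Reflection.

(** * Small diagrams checked by computation *)

Section SmallDiagrams.
Variables (s : seq nat) (N : nat -> nat) (mt : nat * nat -> nat * nat).

Definition all_points : seq (nat * nat) := [seq (d, k) | d <- 0%N :: s, k <- iota 0 (N d)].
Definition all_gaps : seq (nat * nat) := [seq (d, k) | d <- 0%N :: s, k <- iota 0 (N d).+1].

Definition gap_links : seq ((nat * nat) * (nat * nat)) :=
  [seq (lcode p, rcode (mt p)) | p <- all_points] ++
  [seq ((d, 0%N), (0%N, 0%N)) | d <- 0%N :: s] ++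
  [seq ((d, N d), (0%N, 0%N)) | d <- 0%N :: s].

Definition reach_step (T : eqType) (links : seq (T * T)) (S : seq T) : seq T :=
  undup (S ++ [seq e.2 | e <- links & e.1 \in S] ++ [seq e.1 | e <- links & e.2 \in S]).

(** The eight rounds are a fixed budget and need not exhaust a component in general. Soundness does
    not depend on it: [small_check] verifies that the resulting labels are constant along the
    links. *)
Definition reach (T : eqType) (links : seq (T * T)) (u : T) : seq T :=
  iter 8 (reach_step links) [:: u].

Definition small_label (u : nat * nat) : nat := find (mem (reach gap_links u)) all_gaps.

Definition code_links : seq (nat * nat) := [seq (p.1, (mt p).1) | p <- all_points].
Definition small_component (d : nat) : nat := nth 0%N (0%N :: s) (find (mem (reach code_links d)) (0%N :: s)).

Definition small_check : bool :=
  [&& all (fun p => (mt (mt p) == p) && (mt p != p) && (mt p \in all_points)) all_points,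
      all (fun e => small_label e.1 == small_label e.2) gap_links,
      all (fun e => small_component e.1 == small_component e.2) code_links &
  [&& all (fun u => small_label (nth (0, 0)%N all_gaps (small_label u)) == small_label u) all_gaps,
      all (fun d => small_component d \in reach code_links d) (0%N :: s) &
      ((size (0%N :: s) + size (undup (map small_label all_gaps))).*2 ==
        sumn (map N (0%N :: s)) + (size (undup (map small_component (0%N :: s)))).+1.*2)%N]].

Lemma reachP (T : eqType) (links : seq (T * T)) (Y : Type) (f : T -> Y) u v :
  (forall e, e \in links -> f e.1 = f e.2) -> v \in reach links u -> f v = f u.
Proof.
move=> h; rewrite /reach; elim: 8%N v => [|k IH] v /=; first by rewrite inE => /eqP->.
rewrite {1}/reach_step mem_undup !mem_cat => /or3P[/IH//|/seq.mapP[e]|/seq.mapP[e]];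
  by rewrite mem_filter => /andP[/IH <- /h he] ->.
Qed.

Lemma reach_refl (T : eqType) (links : seq (T * T)) u : u \in reach links u.
Proof.
rewrite /reach; elim: 8%N => [|k IH] /=; first by rewrite inE.
by rewrite {1}/reach_step mem_undup mem_cat IH.
Qed.

Lemma small_drawable (M : nat -> nat) : small_check -> {in 0%N :: s, M =1 N} ->
  drawable s M mt small_label.
Proof.
case/and4P=> /allP ptP /allP labP /allP compP /and3P[/allP repLP /allP kapP /eqP eul] MN.
move=> I n l c cI c0 cs M0 Mc T.
have cds : perm_eq (codes c) (0%N :: s) by rewrite perm_cons.
have mem d : (d \in codes c) = (d \in 0%N :: s) by rewrite (perm_mem cds).
have N0 : N 0 = l by rewrite -MN ?mem_head.
have Nc i : N (c i) = n i by rewrite -MN -?mem ?mem_codes.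
have pE p : is_point c N p = (p \in all_points).
  case: p => d k; rewrite /is_point /= mem; apply/andP/allpairsPdep => [[h1 h2]|[d' [k' [h1 h2 [-> ->]]]]].
    by exists d, k; rewrite mem_iota.
  by move: h2; rewrite mem_iota.
have gE p : is_gap c N p = (p \in all_gaps).
  case: p => d k; rewrite /is_gap /= mem; apply/andP/allpairsPdep => [[h1 h2]|[d' [k' [h1 h2 [-> ->]]]]].
    by exists d, k; rewrite mem_iota.
  by move: h2; rewrite mem_iota.
have mp p : is_point c N p -> is_point c N (mt p).
  by rewrite !pE => /ptP/andP[].
have mE := coded_mateE N0 Nc mp.
have faceP Y (f : nat * nat -> Y) : face_function c N mt f <-> (forall e, e \in gap_links -> f e.1 = f e.2).
  split=> [[h1 h2] e|h].
    rewrite !mem_cat => /or3P[]/seq.mapP[p hp ->] /=.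
    - by apply: h1; rewrite pE.
    - by have [|-> _] := h2 p; rewrite ?mem.
    - by have [|_ ->] := h2 p; rewrite ?mem.
  split=> [p|d]; rewrite ?pE ?mem => hp.
    by apply: (h (_, _)); rewrite !mem_cat; apply/orP; left; apply/seq.mapP; exists p.
  by split; apply: (h (_, _)); rewrite !mem_cat; apply/orP; right; apply/orP; [left|right];
    apply/seq.mapP; exists d.
have labF : face_function c N mt small_label by apply/faceP => e /labP/eqP.
have repP (Y : eqType) (f : nat * nat -> Y) : face_function c N mt f ->
    forall u, is_gap c N u -> f u = f (nth (0, 0)%N all_gaps (small_label u)).
  move=> /faceP hf u; rewrite gE => hu; symmetry; apply: reachP hf _.
  by apply: (nth_find (0, 0)%N); apply/hasP; exists u => //; exact: reach_refl.
split; last exact: (draw_labelled (N := N) cI c0 N0 Nc mE labF repP).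
apply: (draw (N := N) (mt := mt) (L := small_label) (rep := nth (0, 0)%N all_gaps)
   (Ls := undup (map small_label all_gaps)) (kap := small_component) cI c0 N0 Nc mE).
- by move=> p; rewrite pE => /ptP/andP[/andP[/eqP h1 /eqP h2] _].
- exact: labF.
- exact: repP.
- exact: undup_uniq.
- by move=> u; rewrite gE mem_undup => hu; apply: map_f.
- move=> x; rewrite mem_undup => /seq.mapP[u hu ->]; split; last by apply/eqP/repLP.
  rewrite gE mem_nth // -has_find; apply/hasP; exists u => //; exact: reach_refl.
- move=> p; rewrite pE => hp; apply/eqP; apply: (compP (_, _)).
  by apply/seq.mapP; exists p.
- move=> Y f hf d; rewrite mem => hd; symmetry.
  apply: (reachP (links := code_links)); last exact: kapP.
  by move=> e /seq.mapP[p hp ->] /=; apply: hf; rewrite pE.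
- rewrite -(perm_sumn (perm_map N cds)) in eul; rewrite (perm_size cds) eul; congr (_ + _.+1.*2)%N.
  by apply/perm_size/perm_undup => e; apply: perm_mem; apply: perm_map; rewrite perm_sym.
Qed.

End SmallDiagrams.

(** * The products [a *_j b] *)

Ltac all_ifs :=
  repeat match goal with |- context [if ?b then _ else _] =>
    lazymatch b with context [if _ then _ else _] => fail | _ =>
      let H := fresh in destruct b eqn:H; try (exfalso; lia) end end.

Ltac glue_ifs := rewrite /=;
  repeat match goal with |- context [if ?b then _ else _] =>
    lazymatch b with context [if _ then _ else _] => fail | _ =>
      let H := fresh in destruct b eqn:H; try (exfalso; lia); rewrite /= end end.

Lemma band_mate_reflect x p q y r w N N' d j (swap13 := fun d => match d with 1 => 3 | 3 => 1 | _ => d end%N) :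
  (forall e, (e < 4)%N -> N e = band_arity w r q y p x e) ->
  N' = band_arity x p q y r w -> (d < 4)%N -> (j < N' d)%N ->
  band_mate x p q y r (d, j) =
  recode swap13 swap13 (rev_point N \o band_mate w r q y p \o rev_point N) (d, j).
Proof.
move=> NE ->; have := (NE 0 isT, NE 1 isT, NE 2 isT, NE 3 isT)%N.
move=> [[[N0 N1] N2] N3]; case: d => [|[|[|[|//]]]] _; rewrite /recode /rev_point /swap13 /= ?N0 ?N1 ?N2 ?N3 /= => lj.
all: move: N0 N1 N2 N3 lj; clear; rewrite /= => N0 N1 N2 N3 lj.
all: repeat (rewrite ?N0 ?N1 ?N2 ?N3; glue_ifs); rewrite ?N0 ?N1 ?N2 ?N3; congr (_, _); lia.
Qed.

Lemma band_label_ends x p q y r w d : (d < 4)%N ->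
  band_label x p q y r w (d, 0)%N = band_label x p q y r w (0, 0)%N /\
  band_label x p q y r w (d, band_arity x p q y r w d) = band_label x p q y r w (0, 0)%N.
Proof.
have := corner_facts x p q y r w; rewrite /band_label /lens.
move: (corner_out_left _ _ _ _ _ _) (corner_out_right _ _ _ _ _ _)
  (corner_in_left _ _ _ _ _ _) (corner_in_right _ _ _ _ _ _) => A B C D.
move=> [[hx hp hr hw] [hy hq]].
by case: d => [|[|[|[|//]]]] _ /=; split; all_ifs; congr (_, _); lia.
Qed.

(** Names of the regions along a circle around the disks 1 and 2 of a band diagram. Its first
    [x + q] strings come from disk 1, and the following [y + r] from disk 2, whose first [p] points
    stay inside. *)
Definition seam (X : Type) (L : nat * nat -> X) (x p q j : nat) : X :=
  if (j <= x + q)%N then L (1, j)%N else L (2, j - (x + q) + p)%N.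

(** The same gaps are also seen from the outer disk and, in the opposite order, from disk 3. Inside,
    the strings come in the order [x], [q], [y], [r], outside in the order [x], [y], [q], [r]; the
    two agree because [q] or [y] vanishes. *)
Lemma seamP x p q y r w (X : Type) (L : nat * nat -> X) (nu := seam L x p q) :
  q = 0%N \/ y = 0%N -> bundles x p q y r w L ->
  (forall d, (d < 4)%N ->
    L (d, 0)%N = L (0, 0)%N /\ L (d, band_arity x p q y r w d) = L (0, 0)%N) ->
  [/\ forall k, (k <= x + q)%N -> nu k = L (1, k)%N,
      forall k, (x + q <= k)%N -> (k <= x + q + y + r)%N -> nu k = L (2, k - (x + q) + p)%N,
      forall k, (k <= x + y)%N -> nu k = L (0, k)%N &
      forall k, (x + y <= k)%N -> (k <= x + y + q + r)%N ->
        nu k = L (3, x + y + q + r - k)%N].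
Proof.
move=> flat [hx hy hw [hq hp hr]] ends.
have nu1 k : (k <= x + q)%N -> nu k = L (1, k)%N by rewrite /nu /seam => ->.
have [[e1 E1] [e2 E2]] := (ends 1%N isT, ends 2%N isT).
have [[_ E0] [e3 E3]] := (ends 0%N isT, ends 3%N isT).
have nu2 k : (x + q <= k)%N -> (k <= x + q + y + r)%N -> nu k = L (2, k - (x + q) + p)%N.
  rewrite /nu /seam; case: ltngtP => // kE _ _; rewrite [in RHS]kE subnn add0n.
  have [p0|p0] := posnP p; last by rewrite -(hp p0 p (leqnn p)); congr (L (_, _)); lia.
  by rewrite p0 e2 -E1; congr (L (_, _)); rewrite /= p0; lia.
split=> // k.
- move=> k1; case: (leqP k x) => kx.
    have [x0|x0] := posnP x; last by rewrite nu1; [rewrite hx|lia].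
    by rewrite (_ : k = 0%N) ?nu1 //; lia.
  rewrite nu2; [|lia|lia]; rewrite (_ : k = x + (k - x))%N -?hy; [congr (L (_, _))| | |]; lia.
- move=> k1 k2; case: (leqP k (x + q)) => kx.
    have [q0|q0] := posnP q; last first.
      have kE : (x + q - (x + q - k) = k)%N by lia.
      by rewrite nu1 // -[in LHS]kE hq; [congr (L (_, _))| |]; lia.
    have [r0|r0] := posnP r.
      rewrite nu2; [|lia|lia]; rewrite (_ : x + y + q + r - k = 0)%N ?e3; last lia.
      by rewrite -E2; congr (L (_, _)); rewrite /=; lia.
    rewrite nu2; [|lia|lia]; rewrite -hr; [congr (L (_, _))| |]; lia.
  have [r0|r0] := posnP r.
    rewrite nu2; [|lia|lia]; rewrite (_ : x + y + q + r - k = 0)%N ?e3; last lia.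
    by rewrite -E2; congr (L (_, _)); rewrite /=; lia.
  rewrite nu2; [|lia|lia]; rewrite -hr; [congr (L (_, _))| |]; lia.
Qed.

Section StarPictures.
Variables (R : realType) (P : planar_data R).
Hypothesis hP : is_planar_algebra P.

Notation vec x := (Tagged (fun k => P k) x).

Definition tab2 (u v : vector P) (d : nat) : vector P := if d == 1%N then u else v.
Definition tab3 (u v w : vector P) (d : nat) : vector P :=
  if d == 1%N then u else if d == 2%N then v else w.

Definition pair_code (b : bool) : nat := if b then 2%N else 1%N.

Lemma pair_codes : perm_eq (map pair_code (enum {: bool})) [:: 1; 2]%N.
Proof.
apply: uniq_perm; [by rewrite map_inj_uniq ?enum_uniq //; case=> [] []|by []|move=> d].
rewrite !inE; apply/seq.mapP/orP => [[[] _ ->]|[/eqP->|/eqP->]]; [by right|by left| |].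
  by exists false; rewrite ?mem_enum.
by exists true; rewrite ?mem_enum.
Qed.

Lemma star_drawn (n m j l : nat) :
  (j <= n)%N -> (j <= m)%N -> (l + j.*2 = n + m)%N ->
  drawn (star_tangle n m j l) pair_code (band_mate (n - j) j 0 (m - j) 0).
Proof.
move=> jn jm lE; pose c := pair_code.
pose mt := band_mate (n - j) j 0 (m - j) 0.
have cI : injective c by move=> [] [].
have c0 i : c i != 0%N by case: i.
have cs : perm_eq (map c (enum {: bool})) [:: 1; 2]%N by exact: pair_codes.
have dr := band_drawable (x := n - j) (p := j) (q := 0) (y := m - j) (r := 0) (w := 0)
  (s := [:: 1; 2]%N) (or_introl erefl) erefl (M := band_arity (n - j) j 0 (m - j) 0 0) (fun _ _ => erefl).
have [||dT _] := dr bool (pair_arity n m) l c cI c0 cs.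
- by rewrite /=; lia.
- by case=> /=; lia.
suff -> : star_tangle n m j l = based_tangle (coded_mate c mt) pred0 by [].
congr (based_tangle _ _); apply/funext => p.
have vF : void -> False by case.
apply: (flag_code_inj vF cI c0); rewrite [RHS](drawn_mate dT p).
have out k (lk : (k < l)%N) : odflt p (omap (@flag_out _ (pair_arity n m) l void) (insub k)) = flag_out _ _ (Ordinal lk).
  by rewrite insubT.
have left_ k (lk : (k < n)%N) : odflt p (omap (fun k : 'I_n => @flag_in _ (pair_arity n m) l void false k) (insub k)) = @flag_in _ (pair_arity n m) l void false (Ordinal lk).
  by rewrite insubT.
have right_ k (lk : (k < m)%N) : odflt p (omap (fun k : 'I_m => @flag_in _ (pair_arity n m) l void true k) (insub k)) = @flag_in _ (pair_arity n m) l void true (Ordinal lk).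
  by rewrite insubT.
rewrite /star_mate.
case: p out left_ right_ => [[k|[[] k]]|[[] ?]] out left_ right_ /=; have /= lk := ltn_ord k.
- case: ifP => h; first by rewrite left_ //=; lia.
  rewrite right_; [lia|move=> lk'] => /=; all_ifs; congr (_, _); lia.
- case: ifP => h.
    rewrite left_; [lia|move=> lk'] => /=; all_ifs; congr (_, _); lia.
  rewrite out; [lia|move=> lk'] => /=; all_ifs; congr (_, _); lia.
- case: ifP => h.
    rewrite out; [lia|move=> lk'] => /=; all_ifs; congr (_, _); lia.
  rewrite right_; [lia|move=> lk'] => /=; all_ifs; congr (_, _); lia.
Qed.

Lemma pic_star (n m j l : nat) (a : P n) (b : P m) :
  (j <= n)%N -> (j <= m)%N -> (l + j.*2 = n + m)%N ->
  pic (band_mate (n - j) j 0 (m - j) 0) [:: 1; 2]%N (tab2 (vec a) (vec b)) (pa_starj j l a b).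
Proof.
move=> jn jm lE.
exists bool, (pair_arity n m), (star_tangle n m j l), pair_code, (pair_input a b).
by split => //; [exact: star_drawn|exact: pair_codes|case].
Qed.

Definition swap (i k d : nat) : nat := if d == i then k else if d == k then i else d.

Lemma swapK i k : involutive (swap i k).
Proof. by move=> d; rewrite /swap; repeat case: eqP => //; congruence. Qed.

Lemma swap0 i k : i != 0%N -> k != 0%N -> swap i k 0 = 0%N.
Proof. by rewrite /swap ![0%N == _]eq_sym => /negbTE-> /negbTE->. Qed.

Lemma pic_perm mt s s' (tab : nat -> vector P) l (v : P l) :
  pic mt s tab v -> perm_eq s s' -> pic mt s' tab v.
Proof.
move=> [I [n [T [c [x [dT sT xT ->]]]]]] ss'; exists I, n, T, c, x; split => //.
exact: perm_trans ss'.
Qed.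

(** A reflection puts [b] to the left of [a] and keeps the nested arcs between them. *)
Lemma pa_star_starj (n m j l : nat) (a : P n) (b : P m) :
  (j <= n)%N -> (j <= m)%N -> (l + j.*2 = n + m)%N ->
  pa_star (pa_starj j l a b) = pa_starj j l (pa_star b) (pa_star a).
Proof.
move=> h1 h2 h3; pose t := tab2 (vec (pa_star a)) (vec (pa_star b)).
have p1 := pic_reflect hP (tab' := t) (pic_star a b h1 h2 h3).
have h4 : (l + j.*2 = m + n)%N by lia.
have p2 := pic_recode (swapK 1 2) (swap0 (i := 1) (k := 2) isT isT)
  (tab' := t) (pic_star (pa_star b) (pa_star a) h2 h1 h4).
apply: (pic_unique hP (p1 _) (pic_perm (p2 _) _)) => //.
- by move=> d; rewrite !inE => /orP[]/eqP->.
- by move=> d; rewrite !inE => /orP[]/eqP->.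
move=> [d k]; rewrite !inE /= /arity /t /tab2 => /or3P[]/eqP-> /= lk;
  rewrite /recode /swap /rev_point; move: h1 h2 h3 lk; clear; move=> *; glue_ifs; congr (_, _); lia.
Qed.

(** The pairing of the points by nested arcs is symmetric in the two disks, and all marked points
    lie in one region, so exchanging the disks is a relabelling. *)
Lemma starj_trace (n : nat) (a b : P n) : pa_starj n 0 a b = pa_starj n 0 b a.
Proof.
pose t := tab2 (vec a) (vec b).
have h : (0 + n.*2 = n + n)%N by lia.
have p2 := pic_recode (swapK 1 2) (swap0 (i := 1) (k := 2) isT isT)
  (tab' := t) (pic_star b a (leqnn n) (leqnn n) h).
apply: (pic_unique hP (pic_star a b (leqnn n) (leqnn n) h) (pic_perm (p2 _) _)) => //.
- by move=> d; rewrite !inE => /orP[]/eqP->.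
move=> [d k]; rewrite !inE /= /arity /tab2 => /or3P[]/eqP-> /= lk;
  rewrite /recode /swap; move: lk; clear; move=> *; glue_ifs; congr (_, _); lia.
Qed.

(** Code 4 is given to the disk about to be filled. Then 1 and 2 are free for its contents, and the
    other factor gets code 3. *)
Definition flip41 (d : nat) : nat :=
  match d with 1 => 4 | 4 => 1 | 2 => 3 | 3 => 2 | _ => d end%N.

Lemma flip41K : involutive flip41.
Proof. by do 5! case=> //. Qed.

Section Associativity.
Variables (x p q y r w n m k l l1 : nat) (a : P n) (b : P m) (c : P k).
Hypothesis flat : q = 0%N \/ y = 0%N.
Hypothesis nE : n = (x + q + p)%N.
Hypothesis mE : m = (p + y + r)%N.
Hypothesis kE : k = (r + q + w)%N.
Hypothesis lE : l = (x + y + w)%N.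

Let tab := tab3 (vec a) (vec b) (vec c).

Lemma band3_arity : {in [:: 0; 1; 2; 3]%N, arity l tab =1 band_arity x p q y r w}.
Proof. by move=> d; rewrite !inE => /or4P[] /eqP->; rewrite /arity /tab /tab3 /=. Qed.

(** The tangle of [pa_starj p] is placed in the left disk of the tangle of [pa_starj (q + r)]. The
    [q + r] strings that reach [c] come partly from [a], passing over [b], and partly from [b]. *)
Lemma pic_band3_left : l1 = (x + q + y + r)%N ->
  pic (band_mate x p q y r) [:: 1; 2; 3]%N tab
    (pa_starj (q + r) l (pa_starj p l1 a b) c).
Proof.
move=> l1E; set u := pa_starj p l1 a b.
pose tabT d := if d == 4%N then vec u else vec c.
pose mtT := recode flip41 flip41 (band_mate (x + y) (q + r) 0 w 0).
have pT : pic mtT [:: 4; 3]%N tabT (pa_starj (q + r) l u c).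
  have := @pic_star _ _ (q + r) l u c; rewrite (_ : l1 - (q + r) = x + y)%N; last lia.
  rewrite (_ : k - (q + r) = w)%N; last lia.
  have h1 : (q + r <= l1)%N by lia. have h2 : (q + r <= k)%N by lia.
  have h3 : (l + (q + r).*2 = l1 + k)%N by lia.
  move=> /(_ h1 h2 h3)/(pic_recode flip41K erefl); apply.
  by move=> d; rewrite !inE => /orP[] /eqP->.
have pS : pic (band_mate (x + q) p 0 (y + r) 0) [:: 1; 2]%N tab u.
  have := @pic_star _ _ p l1 a b; rewrite (_ : n - p = x + q)%N; last lia.
  rewrite (_ : m - p = y + r)%N; last lia.
  have h1 : (p <= n)%N by lia. have h2 : (p <= m)%N by lia.
  have h3 : (l1 + p.*2 = n + m)%N by lia.
  move=> /(_ h1 h2 h3) [I [n' [T [c' [x' [dT sT xT uE]]]]]].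
  exists I, n', T, c', x'; split => // i; rewrite xT.
  have : c' i \in [:: 1; 2]%N by rewrite -(perm_mem sT) map_f ?mem_enum.
  by rewrite !inE => /orP[]/eqP->.
have dT : drawable [:: 4; 3]%N (arity l tabT) mtT
    (fun v => band_label (x + y) (q + r) 0 w 0 0 (flip41 v.1, v.2)).
  have -> : arity l tabT = (arity l tabT \o flip41) \o flip41.
    by apply/funext=> d /=; rewrite flip41K.
  have := @drawable_recode flip41 flip41 flip41K erefl [:: 1; 2]%N; apply => //; first exact: flip41K.
  apply: band_drawable; [by left|by []|].
  by move=> d; rewrite !inE => /or3P[]/eqP->; rewrite /arity /tabT /=; lia.
have d0 : drawable [:: 3; 1; 2]%N (arity l tab) (band_mate x p q y r) (band_label x p q y r w).
  move=> I n' l' c' cI c0 cs; apply: (band_drawable flat (s := [:: 1; 2; 3]%N) _ _ cI c0) => //.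
    by move=> d dd; apply: band3_arity.
  by apply: perm_trans cs _; apply: uniq_perm => // d; rewrite !inE; do 3!case: (_ == _).
move: d0 (band_label_bundles x p r w flat) (@band_label_ends x p q y r w).
move: (band_label x p q y r w) => L d0 bL eL.
have [] := seamP flat bL eL; set nu := seam L x p q; move=> nu1 nu2 nu0 nu3.
have main : pic (band_mate x p q y r) ([:: 3] ++ [:: 1; 2])%N tab (pa_starj (q + r) l u c).
  apply: (pic_glue hP (LT := fun v => band_label (x + y) (q + r) 0 w 0 0 (flip41 v.1, v.2))
      (nu := nu) (fuel := 2) pT pS) d0 _ _ _ _ _ _ _ => //.
  - by move=> d; rewrite inE => /eqP->.
  - move=> e j; rewrite !inE => /orP[]/eqP->; rewrite /arity /tab /tab3 /= => lj;
      rewrite /mtT /recode /flip41; glue_ifs; congr (Some (_, _)); lia.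
  - move=> e j; rewrite !inE => /orP[]/eqP->; rewrite /arity /tab /tab3 /= => lj;
      rewrite /mtT /recode /flip41; glue_ifs; congr (Some (_, _)); lia.
  - by move=> [] j lj; rewrite /mtT /recode /flip41; glue_ifs.
  - move=> j lj; rewrite /glue_label /mtT /recode /flip41 /=; case: ltnP => h; rewrite /=.
      rewrite !nu0; [|lia|lia]; by [].
    rewrite (_ : (j < x + y + 0)%N = false) /=; last lia.
    rewrite /rcode /lcode /= !nu3; [|lia|lia|lia|lia]; split; congr (L (_, _)); lia.
  - move=> j lj; rewrite /glue_label /=; case: ltnP => h; rewrite /=.
      rewrite !nu1; [|lia|lia]; by [].
    rewrite (_ : (j < x + q + (y + r))%N) /=; last lia.
    rewrite /rcode /lcode /= !nu2; [|lia|lia|lia|lia]; split; congr (L (_, _)); lia.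
  - rewrite nu0 // nu2; [|lia|lia]; split=> //.
    have [_ <-] := eL 2 isT; congr (L (_, _)); rewrite /=; lia.
by apply: pic_perm main _; apply: uniq_perm => // d; rewrite !inE; do 3!case: (_ == _).
Qed.

End Associativity.

(** Here [p], [q], [r] count the strings joining [a] to [b], [a] to [c] and [b] to [c]. A reflection
    turns the right bracketing into a left one, so one composition settles both, and the two band
    diagrams coincide. Strings from [a] to [c] pass over [b], which must then send none to the outer
    disk. *)
Lemma starjA (n m k l l1 l2 p q r : nat) (a : P n) (b : P m) (c : P k) :
  (p + q <= n)%N -> (p + r <= m)%N -> (q + r <= k)%N -> q = 0%N \/ (p + r = m)%N ->
  (l1 + p.*2 = n + m)%N -> (l2 + r.*2 = m + k)%N -> (l + (p + q + r).*2 = n + m + k)%N ->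
  pa_starj (q + r) l (pa_starj p l1 a b) c = pa_starj (p + q) l a (pa_starj r l2 b c).
Proof.
move=> h1 h2 h3 flat e1 e2 e3.
pose x := (n - p - q)%N; pose y := (m - p - r)%N; pose w := (k - q - r)%N.
have fl : q = 0%N \/ y = 0%N by case: flat => ?; [left|right; rewrite /y; lia].
have pl := @pic_band3_left x p q y r w n m k l l1 a b c fl.
have pr := @pic_band3_left w r q y p x k m n l l2 (pa_star c) (pa_star b) (pa_star a) fl.
have {}pl := pl ltac:(rewrite /x; lia) ltac:(rewrite /y; lia) ltac:(rewrite /w; lia)
  ltac:(rewrite /x /y /w; lia) ltac:(rewrite /x /y; lia).
have {}pr := pr ltac:(rewrite /w; lia) ltac:(rewrite /y; lia) ltac:(rewrite /x; lia)
  ltac:(rewrite /x /y /w; lia) ltac:(rewrite /w /y; lia).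
have {pr} := pic_reflect hP (tab' := tab3 (vec c) (vec b) (vec a)) pr.
rewrite !pa_star_starj ?(pa_starK hP); try lia; move=> pr.
pose swap13 d := (match d with 1 => 3 | 3 => 1 | _ => d end)%N.
have s13K : involutive swap13 by do 4! case=> //.
have {}pr := pic_recode s13K erefl (tab' := tab3 (vec a) (vec b) (vec c)) (pr _) _.
rewrite [(p + q)%N]addnC.
apply: (pic_unique hP pl (pic_perm (pr _ _) _)) => //.
- by move=> d; rewrite !inE => /or3P[]/eqP->; rewrite /= (pa_starK hP).
- by move=> d; rewrite !inE => /or3P[]/eqP->.
move=> [d j] /= d4 lj; apply: (@band_mate_reflect x p q y r w _ (band_arity x p q y r w)) => //.
- by move=> e; move: (h1) (h2) (h3) (e3); case: e => [|[|[|[|//]]]]; rewrite /arity /x /y /w /=; lia.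
- by move: d4; rewrite !inE => /or4P[]/eqP->.
by move: d4 lj; rewrite !inE => /or4P[]/eqP->; rewrite /arity /x /y /w /=; lia.
Qed.

End StarPictures.

(** * The identity, the unit and the cup *)

Section SmallGlue.
Variables (R : realType) (P : planar_data R).
Hypothesis hP : is_planar_algebra P.

Notation vec x := (Tagged (fun k => P k) x).

Definition strings (ps : seq ((nat * nat) * (nat * nat))) (p : nat * nat) : nat * nat :=
  head p ([seq e.2 | e <- ps & e.1 == p] ++ [seq e.1 | e <- ps & e.2 == p]).

Lemma drawn_mate_ext (I : finType) (n : I -> nat) l (T : tangle n l) c mt mt' :
  drawn T c mt -> (forall p : flag n l (node T), mt (flag_code c p) = mt' (flag_code c p)) ->
  drawn T c mt'.
Proof. by move=> [pT vT cI c0 mE mk tg] E; split=> // p; rewrite mE. Qed.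

Lemma mem_all_points s N d k : ((d, k) \in all_points s N) = (d \in 0%N :: s) && (k < N d)%N.
Proof.
apply/allpairsPdep/andP => [[e [j [eS]]]|[dS kN]].
  by rewrite mem_iota add0n => jN [-> ->].
by exists d, k; rewrite mem_iota.
Qed.

Lemma pic_small mt mt' s N (tab : nat -> vector P) l (v : P l) :
  pic mt s tab v -> {in 0%N :: s, arity l tab =1 N} ->
  all (fun p => mt p == mt' p) (all_points s N) -> pic mt' s tab v.
Proof.
move=> [I [n [T [c [x [dT sT xT vE]]]]]] aN /allP mtE.
exists I, n, T, c, x; split => //; apply: drawn_mate_ext (dT) _ => p.
apply/eqP/mtE; case: p => [[k|[i k]]|[v' b]]; last by case: (drawn_void dT v').
  by rewrite mem_all_points mem_head -aN ?mem_head //=.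
have cs : c i \in s by rewrite -(perm_mem sT) map_f ?mem_enum.
rewrite mem_all_points inE cs orbT -aN ?inE ?cs ?orbT //= /arity (negbTE (drawn_pos dT i)).
by rewrite -xT.
Qed.

(** The conditions of [pic_glue] as a computation. The entry [k] of [seam] is a gap of the final
    diagram in the region that touches gap [k] of the glued circle. *)
Definition glue_check (z : nat) (s1 s2 : seq nat) (N : nat -> nat) (d fuel : nat)
    (mtT mtS mt0 : nat * nat -> nat * nat) (seam : seq (nat * nat)) : bool :=
  let L := small_label (s1 ++ s2) N mt0 in
  let nu k := L (nth (0, 0)%N seam k) in
  [&& uniq [:: 0%N, z & s1 ++ s2],
      all (fun p => (let x := mtT p in
        if x.1 == z then walk z mtT mtS fuel false x.2 else Some x) == Some (mt0 p)) (all_points s1 N),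
      all (fun p => (p.1 == 0%N) || ((let x := mtS p in
        if x.1 == 0%N then walk z mtT mtS fuel true x.2 else Some x) == Some (mt0 p))) (all_points s2 N) &
  [&& all (fun k => (walk z mtT mtS fuel true k != None) && (walk z mtT mtS fuel false k != None)) (iota 0 d),
      all (fun k =>
        (glue_label L nu z (lcode (z, k)) == glue_label L nu z (rcode (mtT (z, k)))) &&
        (glue_label L nu z (rcode (z, k)) == glue_label L nu z (lcode (mtT (z, k))))) (iota 0 d),
      all (fun k =>
        (glue_label L nu 0 (lcode (0%N, k)) == glue_label L nu 0 (rcode (mtS (0%N, k)))) &&
        (glue_label L nu 0 (rcode (0%N, k)) == glue_label L nu 0 (lcode (mtS (0%N, k))))) (iota 0 d) &
      (nu 0%N == L (0, 0)%N) && (nu d == L (0, 0)%N)]].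

Lemma pic_small_glue mtT mtS mt0 z s1 s2 NT N seam fuel (tabT tab : nat -> vector P)
    (l d : nat) (v : P l) (u : P d) :
  pic mtT (z :: s1) tabT v -> pic mtS s2 tab u ->
  tabT z = vec u -> {in s1, tabT =1 tab} ->
  {in [:: 0%N, z & s1], arity l tabT =1 NT} -> {in 0%N :: s1 ++ s2, arity l tab =1 N} ->
  small_check (z :: s1) NT mtT -> small_check (s1 ++ s2) N mt0 ->
  glue_check z s1 s2 N d fuel mtT mtS mt0 seam ->
  pic mt0 (s1 ++ s2) tab v.
Proof.
move=> pT pS tz t1 aT a0 cT c0 /and4P[us /allP wT /allP wS /and4P[/allP wE /allP nT /allP nS /andP[/eqP n0 /eqP nd]]].
have dT := small_drawable cT aT; have d0 := small_drawable c0 a0; clear cT c0.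
move: (small_label (s1 ++ s2) N mt0) d0 nT nS n0 nd => L d0 nT nS n0 nd.
apply: (pic_glue hP (nu := fun k => L (nth (0, 0)%N seam k)) (fuel := fuel) pT pS tz t1 dT d0 us); last by split.
- move=> e k es ke; apply/eqP; apply: (wT (e, k)); rewrite mem_all_points es -a0 //.
  by move: es; rewrite !inE mem_cat => /orP[->|->]; rewrite ?orbT.
- move=> e k es ke; have e0 : e != 0%N.
    by move: us; rewrite /= !inE mem_cat !negb_or => /andP[/and3P[_ _ h] _]; apply: contraNneq h => <-.
  have := wS (e, k); rewrite /= (negbTE e0) => h; apply/eqP/h.
  by rewrite mem_all_points inE es orbT -a0 // !inE mem_cat es !orbT.
- by move=> b k kd; have := wE k; rewrite mem_iota add0n kd => /(_ isT)/andP[h1 h2]; case: b.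
- by move=> k kd; have /andP[/eqP h1 /eqP h2] := nT k ltac:(by rewrite mem_iota); split.
- by move=> k kd; have /andP[/eqP h1 /eqP h2] := nS k ltac:(by rewrite mem_iota); split.
Qed.

Definition code_void (i : void) : nat := match i with end.

Lemma enum_void : map code_void (enum {: void}) = [::].
Proof. by apply/eqP; rewrite -size_eq0 size_map -cardE card_void. Qed.

Lemma void_drawn l mt (N : nat -> nat) : N 0 = l -> small_check [::] N mt ->
  drawn (based_tangle (coded_mate (n := no_disk) (l := l) code_void mt) pred0) code_void mt.
Proof.
move=> N0 ck; have dr := @small_drawable [::] N mt N ck (fun _ _ => erefl).
by have [] := dr void no_disk l code_void; try (by case); rewrite ?enum_void.
Qed.

Lemma pic_one (tab : nat -> vector P) : pic (strings [::]) [::] tab (pa_one P).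
Proof.
exists void, no_disk, empty_tangle, code_void, (no_input P); split; [|by rewrite enum_void|by case|by []].
suff -> : empty_tangle = based_tangle (coded_mate code_void (strings [::])) pred0.
  exact: (void_drawn (N := fun _ => 0%N)).
by congr (based_tangle _ _); apply/funext => -[[[]|[[]]]|[[]]].
Qed.

Definition cup_strings := strings [:: ((0, 0), (0, 1))]%N.

Lemma cup_tangleE : cup_tangle = based_tangle (coded_mate code_void cup_strings) pred0.
Proof.
have dT := @void_drawn 2 cup_strings (fun d => if d == 0%N then 2 else 0)%N erefl ltac:(by vm_compute).
congr (based_tangle _ _); apply/funext => p.
have vF : void -> False by case.
have cI : injective code_void by case.
have c0 (i : void) : code_void i != 0%N by case: i.
apply: (flag_code_inj vF cI c0); rewrite [RHS](drawn_mate dT p).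
by case: p => [[[[|[|//]] lk]|[[]]]|[[]]].
Qed.

Lemma cup_drawn : drawn cup_tangle code_void cup_strings.
Proof. by rewrite cup_tangleE; apply: (@void_drawn 2 _ (fun d => if d == 0%N then 2 else 0)%N). Qed.

Lemma pic_cup (tab : nat -> vector P) : pic cup_strings [::] tab (pa_cup P).
Proof.
exists void, no_disk, cup_tangle, code_void, (no_input P).
by split; [exact: cup_drawn|rewrite enum_void|case|].
Qed.

Lemma pa_starjPl (n m j l : nat) (c : R[i]) (a a' : P n) (b : P m) :
  (j <= n)%N -> (j <= m)%N -> (l + j.*2 = n + m)%N ->
  pa_starj j l (c *: a + a') b = c *: pa_starj j l a b + pa_starj j l a' b.
Proof.
move=> h1 h2 h3; have pT := drawn_planar (star_drawn h1 h2 h3).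
have E u : pair_input u b = dfwith (pair_input (0 : P n) b) false (u : P (pair_arity n m false)).
  apply: functional_extensionality_dep => -[]; last by rewrite dfwithin.
  by rewrite dfwithout.
by rewrite /pa_starj (E (c *: a + a')) (E a) (E a'); exact: (pa_multilinear hP).
Qed.

Lemma pa_starjPr (n m j l : nat) (c : R[i]) (a : P n) (b b' : P m) :
  (j <= n)%N -> (j <= m)%N -> (l + j.*2 = n + m)%N ->
  pa_starj j l a (c *: b + b') = c *: pa_starj j l a b + pa_starj j l a b'.
Proof.
move=> h1 h2 h3; have pT := drawn_planar (star_drawn h1 h2 h3).
have E u : pair_input a u = dfwith (pair_input a (0 : P m)) true (u : P (pair_arity n m true)).
  apply: functional_extensionality_dep => -[]; first by rewrite dfwithin.
  by rewrite dfwithout.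
by rewrite /pa_starj (E (c *: b + b')) (E b) (E b'); exact: (pa_multilinear hP).
Qed.

Definition swap14 (d : nat) : nat := match d with 1 => 4 | 4 => 1 | _ => d end%N.

Lemma swap14K : involutive swap14. Proof. by do 5! case=> //. Qed.

Lemma pic_star4 (n m j l : nat) (a : P n) (b : P m) (tab : nat -> vector P) :
  (j <= n)%N -> (j <= m)%N -> (l + j.*2 = n + m)%N ->
  tab 4 = vec a -> tab 2 = vec b ->
  let mt := recode swap14 swap14 (band_mate (n - j) j 0 (m - j) 0) in
  pic mt [:: 4; 2]%N tab (pa_starj j l a b) /\
  drawable [:: 4; 2]%N (arity l tab) mt
    (fun v => band_label (n - j) j 0 (m - j) 0 0 (swap14 v.1, v.2)).
Proof.
move=> h1 h2 h3 t4 t2 mt; split.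
  have := pic_recode swap14K erefl (tab' := tab) (pic_star a b h1 h2 h3); apply.
  by move=> d; rewrite !inE => /orP[]/eqP->.
have -> : arity l tab = (arity l tab \o swap14) \o swap14.
  by apply/funext=> d /=; rewrite swap14K.
have := @drawable_recode swap14 swap14 swap14K erefl [:: 1; 2]%N; apply => //; first exact: swap14K.
apply: band_drawable; [by left|by []|].
by move=> d; rewrite !inE => /or3P[]/eqP->; rewrite /arity /= ?t4 ?t2 /=; lia.
Qed.

Definition id_mate (n : nat) := band_mate 0 0 0 n 0.

Lemma id_drawable (n : nat) (tab : nat -> vector P) : tag (tab 2) = n ->
  drawable [:: 2]%N (arity n tab) (id_mate n) (band_label 0 0 0 n 0 0).
Proof.
move=> t2; apply: band_drawable; [by left|by []|].
by move=> d; rewrite !inE => /orP[]/eqP->; rewrite /arity /= ?t2; lia.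
Qed.

(** The axioms do not mention the identity tangle. Its effect is determined by pairing: inserted
    into the inner product it gives the inner product back, and this form is definite. *)
Lemma pic_id (n : nat) (a u : P n) (tab : nat -> vector P) : tab 2 = vec a ->
  pic (id_mate n) [:: 2]%N tab u -> u = a.
Proof.
move=> t2 pS; apply/eqP; rewrite -subr_eq0; apply/eqP; apply: (pa_ip_eq0 hP).
rewrite /pa_ip; set b := pa_star _.
suff E : pa_starj n 0 u b = pa_starj n 0 a b.
  have h : (0 + n.*2 = n + n)%N by lia.
  rewrite addrC -scaleN1r pa_starjPl // E scaleN1r addNr /pa_scalar.
  by rewrite linear0.
pose tT d := if d == 4%N then vec u else vec b.
pose t0 := tab2 (vec a) (vec b).
have h : (0 + n.*2 = n + n)%N by lia.
have [pT dT] := @pic_star4 n n n 0 u b tT (leqnn n) (leqnn n) h erefl erefl.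
have pS1 := pic_recode (swapK 1 2) (swap0 (i := 1) (k := 2) isT isT) (tab' := t0) pS.
have {}pS1 : pic (recode (swap 1 2) (swap 1 2) (id_mate n)) [:: 1]%N t0 u.
  by apply: pS1 => d; rewrite inE => /eqP->; rewrite t2.
have d0 : drawable ([:: 2] ++ [:: 1])%N (arity 0 t0) (band_mate 0 n 0 0 0) (band_label 0 n 0 0 0 0).
  move=> I n' l' c' cI c0 cs; apply: (band_drawable (s := [:: 1; 2]%N) _ _ _ cI c0) => //; first by left.
    by move=> d; rewrite !inE => /or3P[]/eqP->; rewrite /arity /=; lia.
  by apply: perm_trans cs _.
move: d0 (@band_label_bundles 0 n 0 0 0 0 (or_introl erefl)) (@band_label_ends 0 n 0 0 0 0).
move: (band_label 0 n 0 0 0 0) => L d0 [_ _ _ [_ hp _]] ends.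
have [[e1 E1] [e2 E2]] := (ends 1%N isT, ends 2%N isT).
rewrite /= in E1 E2.
have main : pic (band_mate 0 n 0 0 0) ([:: 2] ++ [:: 1])%N t0 (pa_starj n 0 u b).
  apply: (pic_glue hP (nu := fun j => L (1, j)%N) (fuel := 2) pT pS1) dT d0 _ _ _ _ _ _ _ => //.
  - by move=> d; rewrite inE => /eqP->.
  - move=> e j; rewrite !inE => /orP[]/eqP->; rewrite /arity /t0 /tab2 //= => lj;
      rewrite /recode /swap14 /swap /id_mate; move: lj; clear; move=> lj; glue_ifs; congr (Some (_, _)); lia.
  - move=> e j; rewrite !inE => /eqP->; rewrite /arity /t0 /tab2 /= => lj;
      rewrite /recode /swap14 /swap /id_mate; move: lj; clear; move=> lj; glue_ifs; congr (Some (_, _)); lia.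
  - by move=> [] j lj; rewrite /recode /swap14 /swap /id_mate; move: lj; clear; move=> lj; glue_ifs.
  - move=> j lj; rewrite /glue_label /recode /swap14 /= (_ : (j < n - n) = false)%N; last lia.
    rewrite (_ : (j < n - n + 0) = false)%N /=; last lia.
    rewrite /rcode /lcode /= -!hp; [|lia|lia|lia|lia]; split; congr (L (_, _)); lia.
  - move=> j lj; rewrite /glue_label /recode /swap /id_mate /= (_ : (j < 0 + n)%N) //=.
    by rewrite /rcode /lcode /= subn0 add0n.
apply: (pic_unique hP (pic_perm main _) (pic_star a b (leqnn n) (leqnn n) h)) => //.
by move=> [d k] _ _; rewrite subnn.
Qed.

Lemma one_starj (n : nat) (a : P n) : pa_starj 0 n (pa_one P) a = a.
Proof.
pose t0 (_ : nat) := vec a; apply: (pic_id (tab := t0) erefl).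
pose tT d := if d == 4%N then vec (pa_one P) else vec a.
have [pT dT] := @pic_star4 0 n 0 n (pa_one P) a tT (leqnn 0) (leq0n n) (addn0 n) erefl erefl.
rewrite !subn0 in pT dT.
apply: (pic_glue hP (nu := fun j => band_label 0 0 0 n 0 0 (0,0)%N) (fuel := 1) pT (pic_one t0)
  _ _ dT (id_drawable (n := n) (tab := t0) erefl)) => //; first by move=> d; rewrite inE => /eqP->.
move=> e j; rewrite !inE => /orP[]/eqP->; rewrite /arity /= => lj;
  rewrite /recode /swap14 /id_mate; move: lj; clear; move=> lj; glue_ifs; congr (Some (_, _)); lia.
Qed.

(** A cup joined to [a] by one string only lengthens the first string of [a]. *)
Lemma cup_starj (n : nat) (a : P n) : (0 < n)%N -> pa_starj 1 n (pa_cup P) a = a.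
Proof.
move=> n0; pose t0 (_ : nat) := vec a; apply: (pic_id (tab := t0) erefl).
pose tT d := if d == 4%N then vec (pa_cup P) else vec a.
have h : (n + 1.*2 = 2 + n)%N by lia.
have [pT dT] := @pic_star4 2 n 1 n (pa_cup P) a tT isT n0 h erefl erefl.
have d0 := id_drawable (n := n) (tab := t0) erefl.
move: d0 (@band_label_bundles 0 0 0 n 0 0 (or_introl erefl)) (@band_label_ends 0 0 0 n 0 0).
move: (band_label 0 0 0 n 0 0) => L d0 [_ hy _ _] ends.
have [[e2 E2] [_ E0]] := (ends 2%N isT, ends 0%N isT); rewrite /= in E2 E0.
(* The gap between the two ends of the cup belongs to the region just after the first string of [a];
   its outer gaps lie in the marked region. *)
apply: (pic_glue hP (nu := fun j => if j == 1%N then L (0, 1)%N else L (0, 0)%N) (fuel := 3) pT (pic_cup t0)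
  _ _ dT d0) => //.
- by move=> d; rewrite inE => /eqP->.
- move=> e j; rewrite !inE => /orP[]/eqP->; rewrite /arity /= => lj;
    rewrite /recode /swap14 /id_mate; move: lj n0; clear; case: j => [|j] lj n0; glue_ifs; congr (Some (_, _)); lia.
- by move=> [] [|[|//]] _; rewrite /recode /swap14; glue_ifs.
- have h0 := hy n0 0%N isT; have h1 := hy n0 1%N n0; rewrite /= !add0n in h0 h1.
  by move=> [|[|//]] _; rewrite /glue_label /recode /swap14; glue_ifs; rewrite /lcode /rcode /=; split; rewrite ?h1 ?e2.
- by move=> [|[|//]] _; rewrite /glue_label /=.
Qed.

End SmallGlue.

(** * Values of small diagrams made of cups *)

Section CupRelations.
Variables (R : realType) (P : planar_data R).
Hypothesis hP : is_planar_algebra P.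

Notation vec x := (Tagged (fun k => P k) x).
Notation one := (pa_one P).
Notation cup := (pa_cup P).

(** The involution turns a left unit into a right unit, and a left unit equals a right unit. *)
Lemma star_one : pa_star one = one.
Proof.
have e := one_starj hP (pa_star one); rewrite -[RHS](pa_starK hP one) -{2}e.
by rewrite (pa_star_starj hP) ?(pa_starK hP) ?(one_starj hP).
Qed.

Lemma starj_one (n : nat) (a : P n) : pa_starj 0 n a one = a.
Proof.
rewrite -[LHS](pa_starK hP) (pa_star_starj hP) ?addn0 // star_one (one_starj hP).
exact: (pa_starK hP).
Qed.

Lemma star_cup : pa_star cup = cup.
Proof.
have e := cup_starj hP (pa_star cup) isT; rewrite -[RHS](pa_starK hP cup) -{2}e.
by rewrite (pa_star_starj hP) // (pa_starK hP) e.
Qed.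

Lemma starj_cup (n : nat) (a : P n) : (0 < n)%N -> pa_starj 1 n a cup = a.
Proof.
move=> n0; rewrite -[LHS](pa_starK hP) (pa_star_starj hP) ?addn2 //.
by rewrite star_cup (cup_starj hP) // (pa_starK hP).
Qed.

Lemma pa_one_neq0 : one != 0.
Proof.
apply/eqP => e; have := pa_dim0 hP; have E (x : P 0%N) : x = 0.
  rewrite -[x](one_starj hP) e; have := pa_starjPl hP (-1) (0 : P 0%N) 0 x (leqnn 0) (leqnn 0) (erefl (0 + 0.*2)%N).
  by rewrite scaler0 addr0 scaleN1r addNr.
have -> : fullv = 0%VS :> {vspace P 0%N} by apply/vspaceP => x; rewrite (E x) !mem0v.
by rewrite dimv0.
Qed.

Lemma pa_scalarE (s : P 0%N) : s = pa_scalar s *: one.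
Proof.
have fr : free [tuple one] by rewrite seq1_free pa_one_neq0.
have sp : s \in <<[tuple one]>>%VS.
  suff -> : <<[tuple one]>>%VS = fullv by rewrite memvf.
  by apply/eqP; rewrite eqEdim subvf (pa_dim0 hP) (eqnP fr).
by rewrite {1}(coord_span sp) big_ord1.
Qed.

Lemma pa_scalar_one : pa_scalar one = 1.
Proof.
have := pa_scalarE one; rewrite -{1}[one]scale1r => /eqP; rewrite -subr_eq0 -scalerBl scaler_eq0.
by rewrite (negbTE pa_one_neq0) orbF subr_eq0 => /eqP.
Qed.

(** Filling all inner disks leaves the empty index type [void + void] rather than [void], so the
    loop is needed over every empty family of disks. *)
Definition loop_over (I : finType) (n : I -> nat) : tangle n 0 :=
  @based_tangle _ n 0 unit
    (fun p => match p with inr (v, b) => flag_node n 0 v (~~ b) | _ => p end)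
    (pred1 (spot_node n 0 tt true)).

Definition inside (I : finType) (n : I -> nat) (s : spot n 0 unit) : bool :=
  match s with inr (_, false) => true | _ => false end.

Lemma loop_same (I : finType) (n : I -> nat) : (I -> False) ->
  forall s t, same (loop_over n) s t = (inside s == inside t).
Proof.
move=> vI.
have mk1 (u : spot n 0 unit) : marked_spot (pred1 (spot_node n 0 tt true)) u -> inside u = false.
  by case/or4P => [/eqP->|/eqP->|ex|/eqP->] //; case/existsP: ex => i; case: (vI i).
have step (s t : spot n 0 unit) :
    based_step (mate (loop_over n)) (pred1 (spot_node n 0 tt true)) s t -> inside s = inside t.
  case/orP => [/existsP[p /andP[/eqP-> /eqP->]]|/andP[h1 h2]]; last by rewrite !mk1.
  by case: p => [[[]//|[i ?]]|[v []]] //; case: (vI i).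
move=> s t; apply/idP/eqP.
  by apply: connect_invariant => {}s {}t /orP[]/step.
have mk (u : spot n 0 unit) : inside u = false -> marked_spot (pred1 (spot_node n 0 tt true)) u.
  case: u => [[k _|[i ?]]|[[] [_|//]]]; last by rewrite /marked_spot /= eqxx !orbT.
    by rewrite (_ : k = ord0) ?/marked_spot ?eqxx //; apply/val_inj; case: k => -[].
  by case: (vI i).
case sE: (inside s); case tE: (inside t) => // _.
  by case: s t sE tE => [[?|?]|[[] []]] [[?|?]|[[] []]] // _ _; apply: connect0.
by apply/connect1; rewrite /based_step !mk ?orbT.
Qed.

Lemma loop_planar (I : finType) (n : I -> nat) : (I -> False) -> planar (loop_over n).
Proof.
move=> vI; have sE := loop_same (n := n) vI.
have cI : #|I| = 0%N by apply: eq_card0 => i; case: (vI i).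
split.
- by case=> [[[]//|[i ?]]|[v b]] /=; [case: (vI i)|rewrite negbK].
- by case=> [[[]//|[i ?]]|[v []]] //=; case: (vI i).
- exact: equivalence_label sE.
- by case=> [[[]//|[i ?]]|[v []]]; rewrite sE //; case: (vI i).
- by rewrite sE.
- by move=> i; case: (vI i).
- have conn s : connect (link_rel (loop_over n)) s (spot_out n _ ord0).
    case: s => [[k|[i ?]]|[[] b]]; [|by case: (vI i)|].
      by apply/connect1; rewrite /link_rel /= eqxx orbT.
    apply: (@connect_trans _ _ (spot_node n 0 tt true)); apply/connect1.
      by rewrite /link_rel /= eqxx orbT.
    by rewrite /link_rel sE.
  move=> s t; apply: connect_trans (conn s) _.
  rewrite (sym_connect_sym (e := link_rel (loop_over n))) // => u v.
  by rewrite /link_rel !sE eq_sym [spot_vertex u == _]eq_sym.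
have -> : n_comp (same (loop_over n)) predT = size [:: false; true].
  apply: (n_comp_labels (f := @inside _ n)) => // [s t|s|b _].
  - by rewrite equivalence_connect ?sE //; exact: equivalence_label sE.
  - by case: (inside s).
  - by exists (spot_node n 0 tt (~~ b)); case: b.
have -> : n_comp (edge_rel (loop_over n)) predT = size [:: inl None : vertex I unit; inr tt].
  apply: (n_comp_labels (f := fun u : vertex I unit => u)) => // [s t|s|s _]; last by exists s.
  - apply/idP/eqP => [|->]; last exact: connect0.
    apply: (connect_invariant (f := id)) => u v /existsP[[[[]//|[i ?]]|[w b]]]; first by case: (vI i).
    by case/andP => /eqP<- /eqP<-.
  - by case: s => [[i|]|[]] //; case: (vI i).
rewrite card_vertex card_flag cI card_unit (_ : #|{: {i : I & 'I_(n i)}}| = 0%N) //.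
by apply: eq_card0 => -[i ?]; case: (vI i).
Qed.

Lemma loop_over_act (I : finType) (n : I -> nat) (x : forall i, P (n i)) : (I -> False) ->
  pa_act P (loop_over n) x = ((pa_modulus P)%:C)%C *: one.
Proof.
move=> vI; pose f (i : I) : void := match vI i with end.
have nE : n = (fun i => no_disk (f i)) by apply/funext => i; case: (vI i).
subst n; rewrite -(pa_loop hP).
have -> : x = (fun i => no_input P (f i)) by apply: functional_extensionality_dep => i; case: (vI i).
apply: (@pa_relabel _ _ hP void I no_disk 0 f loop_tangle (loop_over (fun i => no_disk (f i))) id).
  have -> : loop_tangle = loop_over no_disk by congr (based_tangle _ _).
  by apply: loop_planar; case.
have vI' : void -> False by case.
split.
- by exists (fun v : void => match v with end) => i; [case: (vI i)|case: i].
- by exists id.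
- by case=> [[[]//|[i ?]]|[v b]] //=; case: (vI i).
move=> s t; rewrite -[same loop_tangle]/(same (loop_over no_disk)).
rewrite !loop_same //.
by case: s => [[?|[i ?]]|[? ?]]; [|case: (vI i)|]; case: t => [[?|[j]]|[? ?]] //; case: (vI j).
Qed.

Lemma cup_labelled : labelled cup_tangle code_void
  (small_label [::] (fun d => if d == 0%N then 2 else 0)%N cup_strings).
Proof.
have dr := @small_drawable [::] (fun d => if d == 0%N then 2 else 0)%N cup_strings
  (fun d => if d == 0%N then 2 else 0)%N ltac:(by vm_compute) (fun _ _ => erefl).
have [|||||_ h] := dr void no_disk 2%N code_void; try (by case); rewrite ?enum_void //.
by rewrite cup_tangleE.
Qed.

Definition cap_strings := strings [:: ((2, 0), (2, 1))]%N.

(** The strings close up to a loop through the two glued points. A tangle without nodes cannot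
    represent a loop, so the composite is reduced directly to the loop with one node instead of
    going through [pic_glue]. *)
Lemma cap_cup (v : P 0%N) :
  pic cap_strings [:: 2]%N (fun _ => vec cup) v -> v = ((pa_modulus P)%:C)%C *: one.
Proof.
pose n (_ : option void) := 2%N; pose c (_ : option void) := 2%N.
pose T := based_tangle (coded_mate (n := n) (l := 0) c cap_strings) pred0.
pose N d := if d == 0%N then 0%N else 2%N.
have dr := @small_drawable [:: 2]%N N cap_strings N ltac:(by vm_compute) (fun _ _ => erefl).
have cs : perm_eq (map c (enum (option void : finType))) [:: 2]%N.
  apply: uniq_perm; [rewrite map_inj_uniq ?enum_uniq //; by case=> [[]|] [[]|]|by []|move=> d].
  rewrite inE; apply/seq.mapP/eqP => [[[[]|] _ ->]//|->].
  by exists None; rewrite ?mem_enum.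
have [||||| dT lT] := dr (option void) n 0%N c.
- by case=> [[]|] [[]|].
- by [].
- exact: cs.
- by [].
- by [].
rewrite -/T in dT lT.
have dS := cup_drawn; set S := cup_tangle in dS.
have lS := cup_labelled; rewrite -/S in lS.
pose z (s : void + void) : P (compose_arity n no_disk s) :=
  match s with inl i => match i with end | inr j => match j with end end.
have vE : pic cap_strings [:: 2]%N (fun _ => vec cup) (pa_act P T (compose_input 0 S z)).
  exists (option void), n, T, c, (compose_input 0 S z); split=> //.
  by case=> [[]|] /=; congr (vec (pa_act P _ _)); apply: functional_extensionality_dep => -[].
move=> /(pic_unique hP)/(_ vE)-> //.
rewrite -(pa_compose hP z (drawn_planar dT) (drawn_planar dS)).
have vI : (void + void)%type -> False by case=> -[].
rewrite -(loop_over_act z vI).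
set C := compose T S; pose nm := compose_arity n no_disk.
pose gT (s : spot n 0 void) : bool := small_label [:: 2]%N N cap_strings (spot_code c s)
  == small_label [:: 2]%N N cap_strings (2, 1)%N.
pose gS (s : spot no_disk 2 void) : bool :=
  small_label [::] (fun d => if d == 0%N then 2 else 0)%N cup_strings (spot_code code_void s)
  == small_label [::] (fun d => if d == 0%N then 2 else 0)%N cup_strings (0, 1)%N.
pose g (u : spot n 0 void + spot no_disk 2 void) := match u with inl s => gT s | inr s => gS s end.
pose lab (s : spot nm 0 (node C)) := g (compose_spot s).
have gTE s t : same T s t = (gT s == gT t).
  pose L := small_label [:: 2]%N N cap_strings; pose r := [:: (0, 0); (2, 0); (2, 1); (2, 2)]%N.
  have sr (u : spot n 0 void) : spot_code c u \in r.
    by case: u => [[[[|k] //]|[i [[|[|[|k]]] //]]]|[[]]].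
  have /allP/(_ _ (sr s))/allP/(_ _ (sr t))/eqP : all (fun a => all (fun b =>
    (L a == L b) == ((L a == L (2, 1)%N) == (L b == L (2, 1)%N))) r) r by vm_compute.
  by rewrite lT.
have gTs s t : same T s t -> gT s = gT t by rewrite gTE => /eqP.
have gSE s t : same S s t -> gS s = gS t by rewrite lS /gS => /eqP->.
have CE s t : same C s t = (lab s == lab t).
  apply/idP/eqP.
    apply: (connect_invariant (f := g)) => -[u|u] [w|w] /=; [exact: gTs| | |exact: gSE].
      by case/existsP => -[[|[|[|//]]] ?] /andP[/eqP-> /eqP->]; vm_compute.
    by case/existsP => -[[|[|[|//]]] ?] /andP[/eqP-> /eqP->]; vm_compute.
  have inT (u : spot nm 0 (node C)) : exists s', compose_spot (T := T) (S := S) u = inl s'.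
    case: u => [[k|[[[]|[]] k]]|[[[[]|[]]|k] []]]; by [exists (spot_out n _ k)|eexists].
  rewrite /lab /=; have [s' ->] := inT s; have [t' ->] := inT t.
  move=> e; apply/connect1; change (is_true (same T s' t')); rewrite gTE; exact/eqP.
have nodeE (k : 'I_2) : k = ord0 \/ k = ord_max.
  by case: k => -[|[|//]] lk; [left|right]; apply/val_inj.
have mC (k : 'I_2) b : mate C (inr (inr k, b)) = inr (inr (rev_ord k), b).
  case: b; last by [].
  change (compose_flagT S (mate T (@flag_in _ n 0 void None k)) = inr (inr (rev_ord k), true)).
  suff -> : mate T (@flag_in _ n 0 void None k) = @flag_in _ n 0 void None (rev_ord k) by [].
  apply: (flag_code_inj (drawn_void dT) (drawn_inj dT) (drawn_pos dT)); rewrite (drawn_mate dT).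
  by case: (nodeE k) => ->.
pose L := small_label [:: 2]%N N cap_strings.
have LE k : (k < 3)%N -> (L (2, k)%N == L (2, 1)%N) = (k == 1)%N by case: k => [|[|[|]]].
have labN (k : 'I_2) b : lab (inr (inr k, b)) = ((if b then k : nat else k.+1) == 1)%N.
  case: (nodeE k) => ->; case: b;
    [exact: (LE 0%N isT)|exact: (LE 1%N isT)|exact: (LE 1%N isT)|exact: (LE 2%N isT)].
have labO k : lab (inl (inl k)) = false.
  by case: k => -[|//] ?; change ((L (0, 0)%N == L (2, 1)%N) = false).
pose e (p : flag nm 0 (node C)) : flag nm 0 unit :=
  match p with
  | inr (inr k, b) => flag_node nm 0 tt (if k == ord0 then ~~ b else b)
  | _ => flag_node nm 0 tt true
  end.
pose rk (p : flag nm 0 (node C)) : nat :=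
  match p with inr (inr k, b) => (k == ord0) | _ => 0%N end.
(* The first glued point is kept and the second one erased. A walk from the kept node passes through
   the erased one and comes back to the other side. *)
pose inc (u : unit) : node C := inr ord0.
apply: (@reduction_act R P hP _ nm 0 (loop_over nm) 1 C inc bool e rk lab) => //.
- exact: loop_planar.
- split.
  + by move=> [] [].
  + by case=> [[[]//|[[[]|[]]]]|[[[[]|[]]|k] b]]; rewrite !mC rev_ordK.
  + case=> [[[]//|[[[]|[]]]]|[[[[]|[]]|k] b]]; rewrite mC; apply/eqP => -[] /(congr1 val) /=.
    by case: (nodeE k) => ->.
  + case=> [[[]//|[[[]|[]]]]|[[[[]|[]]|k] b]]; rewrite mC; case: (nodeE k) => ->; [right|left].
      exists (inr ord_max), b; split => //; first by apply/negP => /codomP[[]] /eqP.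
      by congr (inr (inr _, _)); apply/val_inj.
    by congr (inr (inr _, _)); apply/val_inj.
  + by case=> [[[]//|[[[]|[]]]]|[[] b]].
  + exact: CE.
  + have lE (u : spot nm 0 unit) : lab (@keep_spot _ nm 0 C (loop_over nm) inc u) = inside u.
      case: u => [[k|[i ?]]|[u b]]; [exact: labO|by case: (vI i)|].
      by rewrite (labN ord0 b); case: b.
    by move=> s t; rewrite loop_same // !lE.
  + case=> [[[]//|[[[]|[]]]]|[[[[]|[]]|k] b]]; rewrite mC (labN k b) (labN (rev_ord k) (~~ b)).
    by case: (nodeE k) => ->; case: b.
- by rewrite /C /= !card_sum !card_void card_ord card_unit.
Qed.

Lemma cup_cup : pa_starj 2 0 cup cup = ((pa_modulus P)%:C)%C *: one.
Proof.
pose tab (_ : nat) := vec cup; pose N d := if d == 0%N then 0%N else 2%N.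
have p1 := pic_star cup cup (leqnn 2) (leqnn 2) (erefl (0 + 2.*2)%N).
have p2 := pic_small (mt' := strings [:: ((1, 0), (2, 1)); ((1, 1), (2, 0))]%N) (N := N) p1.
apply: cap_cup; apply: (pic_small_glue hP (seam := [:: (0, 0); (2, 1); (0, 0)]%N) (fuel := 3)
  (NT := N) (N := N) (p2 _ _) (pic_cup tab)) => //.
- by move=> d; rewrite !inE => /or3P[]/eqP->.
- by move=> d; rewrite !inE => /eqP->.
- by move=> d; rewrite !inE => /or3P[]/eqP->.
Qed.

Definition nest_strings := strings [:: ((0, 0), (0, 3)); ((0, 1), (0, 2))]%N.

Definition nest_tangle : tangle no_disk 4 :=
  based_tangle (coded_mate code_void nest_strings) pred0.

Definition nest : P 4 := pa_act P nest_tangle (no_input P).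

Lemma nest_drawn : drawn nest_tangle code_void nest_strings.
Proof. by apply: (@void_drawn 4 _ (fun d => if d == 0%N then 4 else 0)%N) => //; vm_compute. Qed.

Lemma pic_nest (tab : nat -> vector P) : pic nest_strings [::] tab nest.
Proof.
exists void, no_disk, nest_tangle, code_void, (no_input P).
by split; [exact: nest_drawn|rewrite enum_void|case|].
Qed.

Lemma star_nest : pa_star nest = nest.
Proof.
pose N (d : nat) := 4%N; pose tab (_ : nat) := vec (pa_star cup).
have p := pic_reflect hP (tab' := tab) (pic_nest (fun _ => vec cup)) (fun _ _ => erefl).
have p2 := pic_small (mt' := nest_strings) (N := N) p.
apply: (pic_unique hP (p2 _ _) (pic_nest tab)) => //.
by move=> d; rewrite inE => /eqP->.
Qed.

(** Filling in the cup caps the first two points of the nested cups. The outer and the inner string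
    then become one, which joins the remaining two points. *)
Lemma cup_nest : pa_starj 2 2 cup nest = cup.
Proof.
pose t1 d := if d == 1%N then vec cup else vec nest.
pose N1 d := if d == 2%N then 4%N else 2%N.
have p1 := pic_star cup nest (leqnn 2) (isT : 2 <= 4)%N (erefl (2 + 2.*2)%N).
have p2 := pic_small (N := N1) (mt' := strings [:: ((1, 0), (2, 1)); ((1, 1), (2, 0));
  ((2, 2), (0, 0)); ((2, 3), (0, 1))]%N) p1.
have p3 : pic (strings [:: ((2, 0), (2, 1)); ((2, 2), (0, 0)); ((2, 3), (0, 1))]%N) [:: 2]%N
    (fun _ => vec nest) (pa_starj 2 2 cup nest).
  apply: (pic_small_glue hP (seam := [:: (0, 0); (2, 1); (0, 0)]%N) (fuel := 3)
    (NT := N1) (N := N1) (p2 _ _) (pic_cup _)) => //.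
  - by move=> d; rewrite !inE => /or3P[]/eqP->.
  - by move=> d; rewrite !inE => /eqP->.
  - by move=> d; rewrite !inE => /or3P[]/eqP->.
  - by move=> d; rewrite !inE => /orP[]/eqP->.
pose tab (_ : nat) := vec cup.
have p4 : pic cup_strings [::] tab (pa_starj 2 2 cup nest).
  apply: (pic_small_glue hP (s1 := [::]) (seam := [:: (0, 0); (0, 1); (0, 0); (0, 1); (0, 0)]%N) (fuel := 7)
    (NT := N1) (N := N1) p3 (pic_nest _)) => //.
  - by move=> d; rewrite !inE => /orP[]/eqP->.
  - by move=> d; rewrite !inE => /eqP->.
exact: (pic_unique hP p4 (pic_cup tab)).
Qed.

End CupRelations.

(** * A loop enclosed by a cup *)

Section NestedLoop.
Variables (R : realType) (P : planar_data R).
Hypothesis hP : is_planar_algebra P.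

Notation vec x := (Tagged (fun k => P k) x).
Notation one := (pa_one P).
Notation cup := (pa_cup P).
Notation nest := (nest P).

Section VoidRelabel.
Variables (I : finType) (n : I -> nat) (l : nat) (V V0 : finType) (h : V -> V0).
Hypothesis vI : I -> False.

Definition void_flag (p : flag n l V) : flag no_disk l V0 :=
  match p with
  | inl (inl k) => flag_out no_disk V0 k
  | inl (inr (existT i _)) => match vI i with end
  | inr (v, b) => flag_node no_disk l (h v) b
  end.

Definition void_spot (s : spot n l V) : spot no_disk l V0 :=
  match s with
  | inl (inl k) => spot_out no_disk V0 k
  | inl (inr (existT i _)) => match vI i with end
  | inr (v, b) => spot_node no_disk l (h v) b
  end.

End VoidRelabel.

Lemma void_relabel (I : finType) (n : I -> nat) (l : nat) (T0 : tangle no_disk l)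
    (T : tangle n l) (h : node T -> node T0) (vI : I -> False) (x : forall i, P (n i)) :
  planar T0 -> bijective h ->
  (forall p, mate T0 (void_flag h vI p) = void_flag h vI (mate T p)) ->
  (forall s t, same T0 (void_spot h vI s) (void_spot h vI t) = same T s t) ->
  pa_act P T x = pa_act P T0 (no_input P).
Proof.
move=> pT0 hB mE sE; pose f (i : I) : void := match vI i with end.
have nE : n = (fun i => no_disk (f i)) by apply/funext => i; case: (vI i).
subst n.
have -> : x = (fun i => no_input P (f i)) by apply: functional_extensionality_dep => i; case: (vI i).
apply: (@pa_relabel _ _ hP void I no_disk l f T0 T h) => //.
have fE p : relabel_flag h p = void_flag h vI p.
  by case: p => [[k|[i ?]]|[v b]] //; case: (vI i).
have spE s : relabel_spot h s = void_spot h vI s.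
  by case: s => [[k|[i ?]]|[v b]] //; case: (vI i).
split=> [|//|p|s t]; [|by rewrite !fE|by rewrite !spE].
by exists (fun v : void => match v with end) => i; [case: (vI i)|case: i].
Qed.

Let no : void + void -> False. Proof. by case=> -[]. Qed.

Definition pocket_arity (_ : option void) := 0%N.

Definition pocket_label (s : spot pocket_arity 2 void) : bool :=
  match s with inl (inl k) => (k : nat) == 1%N | _ => true end.

(** An empty disk is placed in the region that the cup cuts off, away from the marked point. A loop
    in that region is then evaluated by composition, and linearity in the disk extracts its
    value. *)
Definition pocket : tangle pocket_arity 2 :=
  Tangle (fun p => match p with inl (inl k) => flag_out pocket_arity void (rev_ord k) | _ => p end)
    (fun s t => pocket_label s == pocket_label t).

Lemma pocket_planar : planar pocket.
Proof.
have O2 (k : 'I_2) : k = ord0 \/ k = ord_max.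
  by case: k => -[|[|//]] lk; [left|right]; apply/val_inj.
split.
- by case=> [[k|[i []//]]|[[]]] /=; rewrite rev_ordK.
- by case=> [[k|[i []//]]|[[]]] /=; case: (O2 k) => ->.
- exact: (equivalence_label (f := pocket_label)).
- by case=> [[k|[i []//]]|[[]]] /=; case: (O2 k) => ->.
- by [].
- by [].
- have conn s : connect (link_rel pocket) s (spot_out pocket_arity void (@Ordinal 3 1 isT)).
    case: s => [[k|[i k]]|[[]]]; apply/connect1; last by rewrite /link_rel.
    by rewrite /link_rel /= eqxx orbT.
  move=> s t; apply: connect_trans (conn s) _.
  rewrite (sym_connect_sym (e := link_rel pocket)) // => u v.
  by rewrite /link_rel /= eq_sym [spot_vertex u == _]eq_sym.
have -> : n_comp (same pocket) predT = size [:: false; true].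
  apply: (n_comp_labels (f := pocket_label)) => // [s t|s|b _].
  - by rewrite equivalence_connect //; exact: equivalence_label.
  - by case: (pocket_label s).
  - by case: b; [exists (spot_out pocket_arity void (@Ordinal 3 1 isT))|exists (spot_out pocket_arity void ord0)].
have -> : n_comp (edge_rel pocket) predT = size [:: inl None : vertex (option void) void; inl (Some None)].
  apply: (n_comp_labels (f := fun u : vertex (option void) void => u)) => // [s t|s|s _]; last by exists s.
  - apply/idP/eqP => [|->]; last exact: connect0.
    apply: (connect_invariant (f := id)) => u v /existsP[[[k|[i []//]]|[[]]]].
    by case/andP => /eqP<- /eqP<-.
  - by case: s => [[[[]|]|]|[]].
rewrite card_vertex card_flag card_void card_option card_void (_ : #|{: {i : option void & 'I_(pocket_arity i)}}| = 0%N) //.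
by apply: eq_card0 => -[i []].
Qed.

Definition pocket_act (s : P 0%N) : P 2%N := pa_act P pocket (fun _ => s).

Lemma pocket_actZ (c : R[i]) (s : P 0%N) : pocket_act (c *: s) = c *: pocket_act s.
Proof.
pose x0 (i : option void) : P (pocket_arity i) := 0.
have E u : (fun _ => u) = dfwith x0 None (u : P (pocket_arity None)).
  by apply: functional_extensionality_dep => -[[]|]; rewrite dfwithin.
have add u v c' : pocket_act (c' *: u + v) = c' *: pocket_act u + pocket_act v.
  by rewrite /pocket_act (E (c' *: u + v)) (E u) (E v); exact: (pa_multilinear hP) pocket_planar.
have z0 : pocket_act 0 = 0.
  by have := add 0 0 (-1); rewrite scaler0 addr0 scaleN1r addNr.
by have := add s 0 c; rewrite z0 !addr0.
Qed.

Definition loop_in_cup_label (I : finType) (n : I -> nat) (s : spot n 2 unit) : nat :=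
  match s with
  | inl (inl k) => ((k : nat) == 1%N)
  | inr (_, b) => if b then 1 else 2
  | _ => 0
  end%N.

Definition loop_in_cup (I : finType) (n : I -> nat) : tangle n 2 :=
  Tangle (fun p => match p with
     | inl (inl k) => flag_out n unit (rev_ord k)
     | inr (v, b) => flag_node n 2 v (~~ b)
     | _ => p end)
    (fun s t => loop_in_cup_label s == loop_in_cup_label t).

Lemma loop_in_cup_planar (I : finType) (n : I -> nat) : (I -> False) -> planar (loop_in_cup n).
Proof.
move=> vI.
have O2 (k : 'I_2) : k = ord0 \/ k = ord_max.
  by case: k => -[|[|//]] lk; [left|right]; apply/val_inj.
have cI : #|I| = 0%N by apply: eq_card0 => i; case: (vI i).
split.
- by case=> [[k|[i ?]]|[v b]] /=; rewrite ?rev_ordK ?negbK //; case: (vI i).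
- by case=> [[k|[i ?]]|[v []]] //=; case: (O2 k) => ->.
- exact: (equivalence_label (f := @loop_in_cup_label I n)).
- by case=> [[k|[i ?]]|[v []]] //=; case: (O2 k) => ->.
- by [].
- by move=> i; case: (vI i).
- have conn s : connect (link_rel (loop_in_cup n)) s (spot_out n unit (@Ordinal 3 1 isT)).
    case: s => [[k|[i ?]]|[[] b]]; [|by case: (vI i)|].
      by apply/connect1; rewrite /link_rel /= eqxx orbT.
    apply: (@connect_trans _ _ (spot_node n 2 tt true)); apply/connect1.
      by rewrite /link_rel /= eqxx orbT.
    by rewrite /link_rel.
  move=> s t; apply: connect_trans (conn s) _.
  rewrite (sym_connect_sym (e := link_rel (loop_in_cup n))) // => u v.
  by rewrite /link_rel /= eq_sym [spot_vertex u == _]eq_sym.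
have -> : n_comp (same (loop_in_cup n)) predT = size [:: 0; 1; 2]%N.
  apply: (n_comp_labels (f := @loop_in_cup_label I n)) => // [s t|s|b].
  - by rewrite equivalence_connect //; exact: equivalence_label.
  - by case: s => [[k|[i ?]]|[v []]] //=; case: (_ == _).
  - rewrite !inE => /or3P[] /eqP->; [exists (spot_out n unit ord0)|exists (spot_node n 2 tt true)|exists (spot_node n 2 tt false)] => //.
have -> : n_comp (edge_rel (loop_in_cup n)) predT = size [:: inl None : vertex I unit; inr tt].
  apply: (n_comp_labels (f := fun u : vertex I unit => u)) => // [s t|s|s _]; last by exists s.
  - apply/idP/eqP => [|->]; last exact: connect0.
    apply: (connect_invariant (f := id)) => u v /existsP[[[k|[i ?]]|[w b]]]; [|by case: (vI i)|].
      by case/andP => /eqP<- /eqP<-.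
    by case/andP => /eqP<- /eqP<-.
  - by case: s => [[i|]|[]] //; case: (vI i).
rewrite card_vertex card_flag cI card_unit (_ : #|{: {i : I & 'I_(n i)}}| = 0%N) //.
by apply: eq_card0 => -[i ?]; case: (vI i).
Qed.

Lemma pocket_one : pocket_act one = cup.
Proof.
pose z (s : void + void) : P (compose_arity pocket_arity no_disk s) :=
  match no s with end.
have E : (fun _ => one) = compose_input 0 empty_tangle z.
  apply: functional_extensionality_dep => -[[]|] /=; rewrite /pa_one; congr (pa_act P _ _).
  by apply: functional_extensionality_dep => -[].
have pE : planar empty_tangle.
  have := @void_drawn 0 (strings [::]) (fun _ => 0%N) erefl ltac:(by vm_compute).
  move=> /drawn_planar; congr (planar _).
  by congr (based_tangle _ _); apply/funext => -[[[]|[[]]]|[[]]].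
rewrite /pocket_act E -(pa_compose hP z pocket_planar pE).
set C := compose pocket empty_tangle; pose nm := compose_arity pocket_arity no_disk.
pose f (i : void + void) : void := match no i with end.
have nE : nm = (fun i => no_disk (f i)) by apply/funext => i; case: (no i).
pose g (u : spot pocket_arity 2 void + spot no_disk 0 void) : bool :=
  match u with inl s => pocket_label s | inr _ => true end.
have CE s t : same C s t = (g (compose_spot s) == g (compose_spot t)).
  apply/idP/eqP.
    apply: (connect_invariant (f := g)) => -[u|u] [w|w] //=; [by move/eqP| |].
      by case/existsP => k /andP[/eqP-> _].
    by case/existsP => k /andP[/eqP-> _].
  have inT (u : spot nm 2 (node C)) : exists s', compose_spot (T := pocket) (S := empty_tangle) u = inl s'.
    case: u => [[k|[i ?]]|[[[[]|[]]|[]] []]] //; by exists (spot_out pocket_arity _ k).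
  rewrite /=; have [s' ->] := inT s; have [t' ->] := inT t.
  by move=> /= e; apply/connect1; rewrite /= e.
pose h (v : node C) : void :=
  match v with inl (inl v) => v | inl (inr v) => v | inr k => match notF (ltn_ord k) with end end.
rewrite (@void_relabel _ nm 2 cup_tangle C h no z (drawn_planar cup_drawn)) //.
- exists (fun v : void => match v with end) => [[[[]|[]]|[]//]|[]].
- case=> [[k|[i ?]]|[[[[]|[]]|[]//] ?]] //; by case: (no i).
- have lE (k k' : 'I_3) : same cup_tangle (spot_out no_disk void k) (spot_out no_disk void k')
    = (((k : nat) == 1%N) == ((k' : nat) == 1%N)).
    rewrite cup_labelled /=; case: k => -[|[|[|//]]] ?; case: k' => -[|[|[|//]]] ?; by vm_compute.
  move=> s t; rewrite CE; case: s => [[k|[i ?]]|[[[[]|[]]|[]//] ?]]; last by case: (no i).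
  case: t => [[k'|[i ?]]|[[[[]|[]]|[]//] ?]]; last by case: (no i).
  exact: lE.
Qed.

Lemma loop_in_cup_act (I : finType) (n : I -> nat) (x : forall i, P (n i)) : (I -> False) ->
  pa_act P (loop_in_cup n) x = ((pa_modulus P)%:C)%C *: cup.
Proof.
move=> vI; have vv : void -> False by case.
have pL := @loop_in_cup_planar void no_disk vv.
rewrite (@void_relabel _ n 2 (loop_in_cup no_disk) (loop_in_cup n) id vI x pL); first last.
- move=> s t; have E (u : spot n 2 unit) : loop_in_cup_label (void_spot id vI u) = loop_in_cup_label u.
    by case: u => [[k|[i ?]]|[v b]] //; case: (vI i).
  by rewrite /= !E.
- by case=> [[k|[i ?]]|[v b]] //; case: (vI i).
- by exists id.
pose z (s : void + void) : P (compose_arity pocket_arity no_disk s) :=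
  match no s with end.
have plo : planar loop_tangle by exact: (@loop_planar void no_disk vv).
rewrite -pocket_one -pocket_actZ.
have E : (fun _ => ((pa_modulus P)%:C)%C *: one) = compose_input 0 loop_tangle z.
  apply: functional_extensionality_dep => -[[]|] /=; rewrite -(pa_loop hP); congr (pa_act P _ _).
  by apply: functional_extensionality_dep => -[].
rewrite /pocket_act E -(pa_compose hP z pocket_planar plo).
set C := compose pocket loop_tangle; pose nm := compose_arity pocket_arity no_disk.
pose g (u : spot pocket_arity 2 void + spot no_disk 0 unit) : nat :=
  match u with inl s => pocket_label s | inr s => if inside s then 2%N else 1%N end.
have loE s t : same loop_tangle s t = (inside s == inside t) by exact: (loop_same (n := no_disk) vv).
have CE s t : same C s t = (g (compose_spot s) == g (compose_spot t)).
  apply/idP/eqP.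
    apply: (connect_invariant (f := g)) => -[u|u] [w|w].
    - by move/eqP => /= ->.
    - by case/existsP => k /andP[/eqP-> /eqP->].
    - by case/existsP => k /andP[/eqP-> /eqP->].
    - by move=> h; rewrite /= (eqP (etrans (esym (loE u w)) h)).
  rewrite /=; move: (compose_spot s) (compose_spot t) => {s t}.
  have mix s t : g (inl s) = g (inr t) ->
      connect (compose_glue (T := pocket) (S := loop_tangle)) (inl s) (inr t).
    move=> /= st; have /andP[ps it] : pocket_label s && ~~ inside t by case: (pocket_label s) (inside t) st => -[].
    apply: (@connect_trans _ _ (inl (@spot_in _ pocket_arity 2 void None ord0))).
      by apply/connect1; rewrite /= ps.
    apply: (@connect_trans _ _ (inr (spot_out no_disk unit ord0))).
      by apply/connect1/existsP; exists ord0; rewrite !eqxx.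
    apply/connect1; change (is_true (same loop_tangle (spot_out no_disk unit ord0) t)).
    by rewrite loE (negbTE it).
  have symC : connect_sym (compose_glue (T := pocket) (S := loop_tangle)).
    apply: sym_connect_sym => -[u|u] [w|w]; [exact: eq_sym|by []|by []|].
    change (same loop_tangle u w = same loop_tangle w u); by rewrite !loE eq_sym.
  move=> [u|u] [w|w] st.
  - apply/connect1/eqP; move: st => /=; by case: (pocket_label u); case: (pocket_label w).
  - exact: mix.
  - by rewrite symC; apply: mix.
  - apply/connect1; change (is_true (same loop_tangle u w)); rewrite loE.
    by move: st => /=; case: (inside u); case: (inside w).
pose h (v : node C) : unit := tt.
symmetry; apply: (@void_relabel _ nm 2 (loop_in_cup no_disk) C h no z pL).
- exists (fun _ => inl (inr tt)); first by case=> [[[]|[]]|[]//].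
  by case.
- case=> [[k|[i ?]]|[[[[]|[]]|[]//] b]] //; by case: (no i).
- move=> s t; rewrite CE /=.
  have gE u : loop_in_cup_label (void_spot (l := 2) h no u) = g (compose_spot u).
    by case: u => [[k|[i ?]]|[[[[]|[]]|[]//] []]] //; case: (no i).
  by rewrite !gE.
Qed.

Definition midcap_strings :=
  strings [:: ((2, 0), (0, 0)); ((2, 1), (2, 2)); ((2, 3), (0, 1))]%N.

(** Capping the middle points closes the inner string of the nested cups to a loop, which remains
    below the outer string and hence outside the marked region. *)
Lemma midcap_nest (v : P 2%N) :
  pic midcap_strings [:: 2]%N (fun _ => vec nest) v -> v = ((pa_modulus P)%:C)%C *: cup.
Proof.
pose n (_ : option void) := 4%N; pose c (_ : option void) := 2%N.
pose T := based_tangle (coded_mate (n := n) (l := 2) c midcap_strings) pred0.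
pose N d := if d == 0%N then 2%N else 4%N.
have dr := @small_drawable [:: 2]%N N midcap_strings N ltac:(by vm_compute) (fun _ _ => erefl).
have cs : perm_eq (map c (enum (option void : finType))) [:: 2]%N.
  apply: uniq_perm; [rewrite map_inj_uniq ?enum_uniq //; by case=> [[]|] [[]|]|by []|move=> d].
  rewrite inE; apply/seq.mapP/eqP => [[[[]|] _ ->]//|->].
  by exists None; rewrite ?mem_enum.
have [||||| dT lT] := dr (option void) n 2%N c; [by case=> [[]|] [[]|]|by []|exact: cs|by []|by []|].
rewrite -/T in dT lT.
have dS := nest_drawn; set S := nest_tangle in dS.
pose NS d := if d == 0%N then 4%N else 0%N.
have lS : labelled S code_void (small_label [::] NS nest_strings).
  have dr' := @small_drawable [::] NS nest_strings NS ltac:(by vm_compute) (fun _ _ => erefl).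
  by have [|||||_ h] := dr' void no_disk 4%N code_void; try (by case); rewrite ?enum_void.
pose z (s : void + void) : P (compose_arity n no_disk s) := match no s with end.
have vE : pic midcap_strings [:: 2]%N (fun _ => vec nest) (pa_act P T (compose_input 2 S z)).
  exists (option void), n, T, c, (compose_input 2 S z); split=> //.
  by case=> [[]|] /=; congr (vec (pa_act P _ _)); apply: functional_extensionality_dep => -[].
move=> /(pic_unique hP)/(_ vE)-> //.
rewrite -(pa_compose hP z (drawn_planar dT) (drawn_planar dS)).
set C := compose T S; pose nm := compose_arity n no_disk.
rewrite -(@loop_in_cup_act _ nm z no).
(* The depth of a gap below the two nested strings; it is a complete invariant of the regions. *)
pose lev (k : nat) : nat := match k with 1 => 1 | 2 => 2 | 3 => 1 | _ => 0 end%N.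
pose LT := small_label [:: 2]%N N midcap_strings; pose LS := small_label [::] NS nest_strings.
pose gT (s : spot n 2 void) : nat :=
  let: (d, k) := spot_code c s in if d == 0%N then ((k == 1) : nat)%N else lev k.
pose gS (s : spot no_disk 4 void) : nat := lev (spot_code code_void s).2.
pose g (u : spot n 2 void + spot no_disk 4 void) := match u with inl s => gT s | inr s => gS s end.
pose lab (s : spot nm 2 (node C)) := g (compose_spot s).
have gTE s t : same T s t = (gT s == gT t).
  pose r := [:: (0, 0); (0, 1); (0, 2); (2, 0); (2, 1); (2, 2); (2, 3); (2, 4)]%N.
  have sr (u : spot n 2 void) : spot_code c u \in r.
    by case: u => [[[[|[|[|k]]] //]|[i [[|[|[|[|[|k]]]]] //]]]|[[]]].
  have /allP/(_ _ (sr s))/allP/(_ _ (sr t))/eqP : all (fun a => all (fun b =>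
    (LT a == LT b) == ((if a.1 == 0%N then ((a.2 == 1) : nat)%N else lev a.2)
      == (if b.1 == 0%N then ((b.2 == 1) : nat)%N else lev b.2))) r) r by vm_compute.
  by rewrite lT -/LT /gT; case: (spot_code c s) => ? ?; case: (spot_code c t) => ? ?.
have gSE s t : same S s t = (gS s == gS t).
  pose r := [:: (0, 0); (0, 1); (0, 2); (0, 3); (0, 4)]%N.
  have sr (u : spot no_disk 4 void) : spot_code code_void u \in r.
    by case: u => [[[[|[|[|[|[|k]]]]] //]|[[]]]|[[]]].
  have /allP/(_ _ (sr s))/allP/(_ _ (sr t))/eqP : all (fun a => all (fun b =>
    (LS a == LS b) == (lev a.2 == lev b.2)) r) r by vm_compute.
  by rewrite lS.
have gTs s t : same T s t -> gT s = gT t by rewrite gTE => /eqP.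
have gSs s t : same S s t -> gS s = gS t by rewrite gSE => /eqP.
have CE s t : same C s t = (lab s == lab t).
  apply/idP/eqP.
    apply: (connect_invariant (f := g)) => -[u|u] [w|w] /=; [exact: gTs| | |exact: gSs].
      by case/existsP => k /andP[/eqP-> /eqP->].
    by case/existsP => k /andP[/eqP-> /eqP->].
  have inT (u : spot nm 2 (node C)) : exists s', compose_spot (T := T) (S := S) u = inl s'.
    case: u => [[k|[i ?]]|[[[[]|[]]|k] []]]; [by exists (spot_out n _ k)|by case: (no i)| |]; by eexists.
  rewrite /lab /=; have [s' ->] := inT s; have [t' ->] := inT t.
  move=> e; apply/connect1; change (is_true (same T s' t')); rewrite gTE; exact/eqP.
have O4 (Q : 'I_4 -> Prop) : Q ord0 -> Q (@Ordinal 4 1 isT) -> Q (@Ordinal 4 2 isT) -> Q ord_max -> forall k, Q k.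
  move=> q0 q1 q2 q3 [[|[|[|[|//]]]] lk].
  - by rewrite (_ : Ordinal lk = ord0) //; apply/val_inj.
  - by rewrite (_ : Ordinal lk = @Ordinal 4 1 isT) //; apply/val_inj.
  - by rewrite (_ : Ordinal lk = @Ordinal 4 2 isT) //; apply/val_inj.
  - by rewrite (_ : Ordinal lk = ord_max) //; apply/val_inj.
pose nd (k : 'I_4) b : flag nm 2 (node C) := inr (inr k, b).
have mS (k : 'I_4) : mate C (nd k false) = nd (rev_ord k) false.
  change (compose_flagS T (mate S (flag_out no_disk void k)) = nd (rev_ord k) false).
  suff -> : mate S (flag_out no_disk void k) = flag_out no_disk void (rev_ord k) by [].
  apply: (flag_code_inj (drawn_void dS) (drawn_inj dS) (drawn_pos dS)); rewrite (drawn_mate dS).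
  by move: k; apply: O4.
have mT p q : midcap_strings (flag_code c p) = flag_code c q -> mate T p = q.
  by move=> e; apply: (flag_code_inj (drawn_void dT) (drawn_inj dT) (drawn_pos dT)); rewrite (drawn_mate dT).
have mN p q : midcap_strings (flag_code c p) = flag_code c q ->
    mate C (compose_flagT S p) = compose_flagT S q.
  move=> e; rewrite -(mT _ _ e); case: p {e} => [[k|[[[]|] k]]|[[]]] //.
pose k1 : 'I_4 := @Ordinal 4 1 isT; pose k2 : 'I_4 := @Ordinal 4 2 isT.
pose out k : flag nm 2 (node C) := inl (inl k).
pose pin (k : 'I_4) := @flag_in _ n 2 void None k.
have mo0 : mate C (out ord0) = nd ord0 true by exact: (mN (flag_out n void ord0) (pin ord0) erefl).
have mo1 : mate C (out ord_max) = nd ord_max true by exact: (mN (flag_out n void ord_max) (pin ord_max) erefl).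
have mn0 : mate C (nd ord0 true) = out ord0 by exact: (mN (pin ord0) (flag_out n void ord0) erefl).
have mn3 : mate C (nd ord_max true) = out ord_max by exact: (mN (pin ord_max) (flag_out n void ord_max) erefl).
have mn1 : mate C (nd k1 true) = nd k2 true by exact: (mN (pin k1) (pin k2) erefl).
have mn2 : mate C (nd k2 true) = nd k1 true by exact: (mN (pin k2) (pin k1) erefl).
have r0 : rev_ord (ord0 : 'I_4) = ord_max by apply/val_inj.
have r3 : rev_ord (ord_max : 'I_4) = ord0 by apply/val_inj.
have r1 : rev_ord k1 = k2 by apply/val_inj.
have r2 : rev_ord k2 = k1 by apply/val_inj.
have O2 (k : 'I_2) : k = ord0 \/ k = ord_max.
  by case: k => -[|[|//]] lk; [left|right]; apply/val_inj.
have flagP (Q : flag nm 2 (node C) -> Prop) : Q (out ord0) -> Q (out ord_max) ->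
    (forall b, Q (nd ord0 b)) -> (forall b, Q (nd k1 b)) -> (forall b, Q (nd k2 b)) ->
    (forall b, Q (nd ord_max b)) -> forall p, Q p.
  move=> h1 h2 h3 h4 h5 h6 [[k|[i ?]]|[[[[]|[]]|k] b]]; [by case: (O2 k) => ->|by case: (no i)|].
  by move: k b; apply: O4.
pose e (p : flag nm 2 (node C)) : flag nm 2 unit :=
  match p with
  | inl (inl k) => flag_out nm unit (rev_ord k)
  | inr (inr k, b) =>
      match (k : nat), b with
      | 0, true => flag_out nm unit ord0 | 0, false => flag_out nm unit ord_max
      | 1, _ => flag_node nm 2 tt (~~ b)
      | 2, _ => flag_node nm 2 tt b
      | _, true => flag_out nm unit ord_max | _, false => flag_out nm unit ord0
      end%N
  | _ => flag_node nm 2 tt true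
  end.
pose rk (p : flag nm 2 (node C)) : nat :=
  match p with
  | inl _ => 2
  | inr (inr k, b) =>
      match (k : nat), b with 1, _ => 1 | 2, _ => 0 | _, true => 0 | _, false => 1 end
  | _ => 0 end%N.
(* One glued point on the loop is kept. The other one on the loop and the two on the outer string
   are erased. *)
pose inc (u : unit) : node C := inr k1.
have notin (k : 'I_4) : k != k1 -> (inr k : node C) \notin codom inc.
  by move=> kk; apply/negP => /codomP[[] [kE]]; rewrite kE eqxx in kk.
apply: (@reduction_act R P hP _ nm 2 (loop_in_cup nm) 3 C inc nat e rk lab) => //.
- exact: loop_in_cup_planar.
- split.
  + by move=> [] [].
  + apply: flagP => [||b|b|b|b]; rewrite ?mo0 ?mo1 ?mn0 ?mn3 //; case: b;
      by rewrite ?mS ?r0 ?r1 ?r2 ?r3 ?mn0 ?mn1 ?mn2 ?mn3 ?mo0 ?mo1 ?mS ?r0 ?r1 ?r2 ?r3.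
  + apply: flagP => [||b|b|b|b]; rewrite ?mo0 ?mo1 ?mn0 ?mn3 //; case: b;
      by rewrite ?mS ?r0 ?r1 ?r2 ?r3 ?mn0 ?mn1 ?mn2 ?mn3.
  + apply: flagP => [||[]|[]|[]|[]]; rewrite ?mo0 ?mo1 ?mS ?mn0 ?mn1 ?mn2 ?mn3 ?r0 ?r1 ?r2 ?r3.
    * by right; exists (inr ord0), true; split=> //; [exact: notin|congr inl; congr inl; apply/val_inj].
    * by right; exists (inr ord_max), true; split=> //; [exact: notin|congr inl; congr inl; apply/val_inj].
    * by left.
    * by right; exists (inr ord_max), false; split=> //; exact: notin.
    * by right; exists (inr k2), true; split=> //; exact: notin.
    * by right; exists (inr k2), false; split=> //; exact: notin.
    * by left.
    * by left.
    * by left.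
    * by right; exists (inr ord0), false; split=> //; exact: notin.
  + by case=> [[k|[i ?]]|[[] b]] //; case: (no i).
  + exact: CE.
  + have lE (u : spot nm 2 unit) : lab (@keep_spot _ nm 2 C (loop_in_cup nm) inc u) = loop_in_cup_label u.
      by case: u => [[k|[i ?]]|[u []]] //; case: (no i).
    by move=> s t; rewrite /= !lE.
  + apply: flagP => [||[]|[]|[]|[]]; rewrite ?mo0 ?mo1 ?mS ?mn0 ?mn1 ?mn2 ?mn3 ?r0 ?r1 ?r2 ?r3 //.
- by rewrite /C /= !card_sum !card_void card_ord card_unit.
Qed.

(** This loop separates [nest] from the multiples of two adjacent cups: the same operation with
    [pa_starj 0 4 cup cup] on the left forms no loop. *)
Lemma nest_nest : pa_starj 3 2 nest nest = ((pa_modulus P)%:C)%C *: cup.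
Proof.
pose N1 d := if d == 0%N then 2%N else 4%N.
have p1 := pic_star nest nest (isT : 3 <= 4)%N (isT : 3 <= 4)%N (erefl (2 + 3.*2)%N).
have p2 := pic_small (N := N1) (mt' := strings [:: ((1, 3), (2, 0)); ((1, 2), (2, 1));
  ((1, 1), (2, 2)); ((1, 0), (0, 0)); ((2, 3), (0, 1))]%N) p1.
apply: midcap_nest.
apply: (pic_small_glue hP (seam := [:: (0, 0); (0, 1); (2, 2); (0, 1); (0, 0)]%N) (fuel := 3)
    (NT := N1) (N := N1) (p2 _ _) (pic_nest _)) => //.
- by move=> d; rewrite !inE => /or3P[]/eqP->.
- by move=> d; rewrite !inE => /eqP->.
by move=> d; rewrite !inE => /or3P[]/eqP->.
Qed.

End NestedLoop.

(** * Hilbert spaces *)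

Section RealNorm.
Variables (R : realType) (V : normedZmodType R[i]).
Implicit Types x y : V.

(** Norms over the complex numbers take values in [R[i]]. Estimates are carried out in [R], where
    the order is total. *)
Definition nrm x : R := complex.Re `|x|.

Lemma nrmE x : `|x| = ((nrm x)%:C)%C.
Proof. by rewrite /nrm RRe_real // normr_real. Qed.

Lemma nrm_ge0 x : 0 <= nrm x.
Proof. by rewrite -(lecR 0) -nrmE normr_ge0. Qed.

Lemma nrm_eq0 x : (nrm x == 0) = (x == 0).
Proof. by rewrite -[RHS]normr_eq0 nrmE -(rmorph0 (real_complex R)) (inj_eq (@complexI R)). Qed.

Lemma nrm0 : nrm (0 : V) = 0.
Proof. by apply/eqP; rewrite nrm_eq0. Qed.

Lemma nrm_triangle x y : nrm (x + y) <= nrm x + nrm y.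
Proof. by rewrite -lecR rmorphD /= -!nrmE ler_normD. Qed.

Lemma nrmN x : nrm (- x) = nrm x.
Proof. by rewrite /nrm normrN. Qed.

Lemma nrmB x y : nrm (x - y) = nrm (y - x).
Proof. by rewrite -nrmN opprB. Qed.

Lemma nrm_sum (I : Type) (r : seq I) (Q : pred I) (F : I -> V) :
  nrm (\sum_(i <- r | Q i) F i) <= \sum_(i <- r | Q i) nrm (F i).
Proof.
elim/big_rec2: _ => [|i x y _ h]; first by rewrite nrm0.
by apply: le_trans (nrm_triangle _ _) _; rewrite lerD2l.
Qed.

Definition hlim (u : nat -> V) (l : V) : Prop :=
  forall e : R, 0 < e -> exists N, forall n, (N <= n)%N -> nrm (u n - l) < e.

Lemma hlim_unique (u : nat -> V) l l' : hlim u l -> hlim u l' -> l = l'.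
Proof.
move=> h h'; apply/eqP; rewrite -subr_eq0 -nrm_eq0; apply/eqP/le_anti.
rewrite nrm_ge0 andbT leNgt; apply/negP => e0.
have e2 : 0 < nrm (l - l') / 2 by rewrite divr_gt0.
have [[N hN] [N' hN']] := (h _ e2, h' _ e2).
have := nrm_triangle (u (maxn N N') - l') (l - u (maxn N N')).
rewrite addrC addrA subrK [nrm (l - u _)]nrmB.
by have := hN _ (leq_maxl N N'); have := hN' _ (leq_maxr N N'); lra.
Qed.

Lemma hlim_cst l : hlim (fun _ => l) l.
Proof. by move=> e e0; exists 0%N => n _; rewrite subrr nrm0. Qed.

Lemma hlimD (u v : nat -> V) l l' : hlim u l -> hlim v l' -> hlim (fun n => u n + v n) (l + l').
Proof.
move=> h h' e e0; have e2 : 0 < e / 2 by rewrite divr_gt0.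
have [[N hN] [N' hN']] := (h _ e2, h' _ e2); exists (maxn N N') => n nN.
have := nrm_triangle (u n - l) (v n - l'); rewrite opprD addrACA.
have := hN n (leq_trans (leq_maxl _ _) nN); have := hN' n (leq_trans (leq_maxr _ _) nN).
by move=> h1 h2 /le_lt_trans; apply; lra.
Qed.

Lemma hlim_nrm_le (u : nat -> V) l (B : R) : hlim u l -> (forall n, nrm (u n) <= B) -> nrm l <= B.
Proof.
move=> h hB; rewrite leNgt; apply/negP => lt; have [|N hN] := h (nrm l - B); first by rewrite subr_gt0.
have := nrm_triangle (u N) (l - u N); rewrite addrC subrK nrmB.
by have := hN N (leqnn N); have := hB N; lra.
Qed.

Lemma hlim_ext (u v : nat -> V) l : u =1 v -> hlim u l -> hlim v l.
Proof. by move=> uv h e /h[N hN]; exists N => n /hN; rewrite uv. Qed.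

End RealNorm.

Section RealNormScale.
Variables (R : realType).

Lemma nrmM (x y : R[i]) : nrm (x * y) = nrm x * nrm y.
Proof. by apply: (@complexI R); rewrite rmorphM /= -!nrmE normrM. Qed.

Lemma nrm_real (x : R) : nrm ((x%:C)%C : R[i]) = `|x|.
Proof. by apply: (@complexI R); rewrite -nrmE normc_def /= expr0n /= addr0 sqrtr_sqr. Qed.

Lemma nrm_conj (x : R[i]) : nrm x^* = nrm x.
Proof. by rewrite /nrm norm_conjC. Qed.

Lemma nrmZ (V : normedModType R[i]) (c : R[i]) (x : V) : nrm (c *: x) = nrm c * nrm x.
Proof. by apply: (@complexI R); rewrite rmorphM /= -!nrmE normrZ. Qed.

Lemma hlimZ (V : normedModType R[i]) (c : R[i]) (u : nat -> V) l :
  hlim u l -> hlim (fun n => c *: u n) (c *: l).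
Proof.
move=> h e e0; have c0 : 0 < nrm c + 1 by rewrite ltr_wpDl // nrm_ge0.
have [|N hN] := h (e / (nrm c + 1)); first by rewrite divr_gt0.
exists N => n /hN; rewrite -scalerBr nrmZ ltr_pdivlMr // mulrC => /(le_lt_trans _); apply.
by rewrite ler_wpM2r ?nrm_ge0 // lerDl.
Qed.

Lemma hlimB (V : normedModType R[i]) (u v : nat -> V) l l' :
  hlim u l -> hlim v l' -> hlim (fun n => u n - v n) (l - l').
Proof.
move=> h /(hlimZ (-1)) h'; rewrite -[- l']scaleN1r; apply: hlim_ext (hlimD h h') => n.
by rewrite scaleN1r.
Qed.

Lemma archi_geom (r e C : R) : 0 <= r < 1 -> 0 < e -> exists N, forall n, (N <= n)%N -> C * r ^+ n < e.
Proof.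
move=> /andP[r0 r1] e0; have [C0|C0] := leP C 0.
  by exists 0%N => n _; apply: le_lt_trans e0; rewrite mulr_le0_ge0 ?exprn_ge0.
have : (fun n => r ^+ n) @ \oo --> (0 : R) by apply: cvg_expr; rewrite ger0_norm.
move/cvgrPdist_lt => /(_ (e / C)) []; first by rewrite divr_gt0.
move=> N _ hN; exists N => n Nn; have := hN n Nn; rewrite /= sub0r normrN ger0_norm ?exprn_ge0 //.
by rewrite ltr_pdivlMr // mulrC.
Qed.

End RealNormScale.

(** [bounded_op] with a real bound in place of continuity, and for maps between two different
    spaces. *)
Definition bop (R : realType) (H K : hilbert R) (X : H -> K) : Prop :=
  linear X /\ exists C : R, forall x, nrm (X x) <= C * nrm x.

Section HilbertBasics.
Variables (R : realType) (H : hilbert R).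
Implicit Types x y z : H.

Lemma ip0l y : ip (0 : H) y = 0.
Proof. by have := ip_linear (-1) (0 : H) 0 y; rewrite scaler0 addr0 mulN1r addNr. Qed.

Lemma ipDl x y z : ip (x + y) z = ip x z + ip y z.
Proof. by rewrite -[x in LHS]scale1r ip_linear mul1r. Qed.

Lemma ipZl c x z : ip (c *: x) z = c * ip x z.
Proof. by rewrite -[c *: x]addr0 ip_linear ip0l addr0. Qed.

Lemma ip0r y : ip y (0 : H) = 0.
Proof. by rewrite ip_conj ip0l rmorph0. Qed.

Lemma ipDr x y z : ip x (y + z) = ip x y + ip x z.
Proof. by rewrite ip_conj ipDl rmorphD /= -!ip_conj. Qed.

Lemma ipZr c x z : ip x (c *: z) = c^* * ip x z.
Proof. by rewrite ip_conj ipZl rmorphM /= -ip_conj. Qed.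

Lemma ipNl x z : ip (- x) z = - ip x z.
Proof. by rewrite -scaleN1r ipZl mulN1r. Qed.

Lemma ipNr x z : ip x (- z) = - ip x z.
Proof. by rewrite -scaleN1r ipZr rmorphN rmorph1 mulN1r. Qed.

Lemma ipBl x y z : ip (x - y) z = ip x z - ip y z.
Proof. by rewrite ipDl ipNl. Qed.

Lemma ipBr x y z : ip x (y - z) = ip x y - ip x z.
Proof. by rewrite ipDr ipNr. Qed.

Lemma ip_suml (I : Type) (r : seq I) (Q : pred I) (F : I -> H) z :
  ip (\sum_(i <- r | Q i) F i) z = \sum_(i <- r | Q i) ip (F i) z.
Proof. by elim/big_rec2: _ => [|i x y _ <-]; rewrite ?ip0l ?ipDl. Qed.

Lemma ip_sumr (I : Type) (r : seq I) (Q : pred I) (F : I -> H) z :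
  ip z (\sum_(i <- r | Q i) F i) = \sum_(i <- r | Q i) ip z (F i).
Proof. by elim/big_rec2: _ => [|i x y _ <-]; rewrite ?ip0r ?ipDr. Qed.

Lemma ip_nrm x : ip x x = ((nrm x ^+ 2)%:C)%C.
Proof. by rewrite ip_norm nrmE rmorphXn. Qed.

Lemma ip_eq0 x : ip x x = 0 -> x = 0.
Proof. by rewrite ip_norm => /eqP; rewrite expf_eq0 normr_eq0 => /eqP. Qed.

Lemma nrm_sqD x y : nrm (x + y) ^+ 2 = nrm x ^+ 2 + nrm y ^+ 2 + 2 * complex.Re (ip x y).
Proof.
have E z : nrm z ^+ 2 = complex.Re (ip z z) by rewrite ip_nrm.
rewrite !E ipDl !ipDr [ip y x]ip_conj.
by case: (ip x x) (ip y y) (ip x y) => [a b] [a' b'] [c d] /=; lra.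
Qed.

Lemma pythagoras x y : ip x y = 0 -> nrm (x + y) ^+ 2 = nrm x ^+ 2 + nrm y ^+ 2.
Proof. by move=> h; rewrite nrm_sqD h mulr0 addr0. Qed.

Lemma cauchy_schwarz x y : nrm (ip x y) <= nrm x * nrm y.
Proof.
have [->|y0] := eqVneq y 0; first by rewrite ip0r nrm0 mulr_ge0 // nrm_ge0.
have ny : 0 < nrm y by rewrite lt_def nrm_eq0 y0 nrm_ge0.
pose t := ip x y / ip y y; have yy : ip y y != 0 by apply: contraNneq y0 => /ip_eq0->.
have orth : ip (x - t *: y) (t *: y) = 0.
  by rewrite ipZr ipBl ipZl divfK // subrr mulr0.
have := pythagoras orth; rewrite subrK nrmZ => e.
have te : nrm t * nrm y ^+ 2 = nrm (ip x y).
  apply: (@complexI R); rewrite -nrmE rmorphM /= -ip_nrm -nrmE /t normrM normfV.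
  by rewrite [`|ip y y|]ger0_norm ?divfK // ip_norm exprn_ge0.
rewrite -(ler_pXn2r (n := 2)) ?nnegrE ?mulr_ge0 ?nrm_ge0 // exprMn -te e mulrDl.
by have := sqr_ge0 (nrm (x - t *: y) * nrm y); lra.
Qed.

Lemma ip_ext x y : (forall z, ip x z = ip y z) -> x = y.
Proof. by move=> h; apply/eqP; rewrite -subr_eq0; apply/eqP/ip_eq0; rewrite ipBl h subrr. Qed.

Lemma hlim_ipl (u : nat -> H) l z : hlim u l -> hlim (fun n => ip (u n) z) (ip l z).
Proof.
move=> h e e0; have c0 : 0 < nrm z + 1 by rewrite ltr_wpDl // nrm_ge0.
have [|N hN] := h (e / (nrm z + 1)); first by rewrite divr_gt0.
exists N => n /hN; rewrite -ipBl ltr_pdivlMr // => h1; apply: le_lt_trans (cauchy_schwarz _ _) _.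
by apply: le_lt_trans h1; rewrite ler_wpM2l ?nrm_ge0 // lerDl.
Qed.

Lemma hlim_ipr (u : nat -> H) l z : hlim u l -> hlim (fun n => ip z (u n)) (ip z l).
Proof.
move=> /(hlim_ipl z) h e /h[N hN]; exists N => n /hN.
by rewrite ![ip z _]ip_conj -rmorphB nrm_conj.
Qed.

Lemma closureP (S : set H) x :
  closure S x <-> forall e : R, 0 < e -> exists2 y, S y & nrm (x - y) < e.
Proof.
split=> [h e e0|h B].
  have ec : 0 < ((e%:C)%C : R[i]) by rewrite ltcR.
  have [y [Sy]] := h _ (nbhsx_ballx x _ ec).
  by rewrite -ball_normE /= nrmE ltcR => yx; exists y.
rewrite -nbhs_ballE => -[e e0 eB].
have er : e = ((complex.Re e)%:C)%C by rewrite RRe_real // gtr0_real.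
have [|y Sy xy] := h (complex.Re e); first by rewrite -ltcR -er.
by exists y; split => //; apply: eB; rewrite -ball_normE /= nrmE er ltcR.
Qed.

Lemma closure_hlim (S : set H) (u : nat -> H) x : (forall n, S (u n)) -> hlim u x -> closure S x.
Proof.
by move=> Su h; apply/closureP => e /h[N hN]; exists (u N) => //; rewrite nrmB; apply: hN.
Qed.

Lemma closure_seq (S : set H) x : closure S x -> exists u, (forall n, S (u n)) /\ hlim u x.
Proof.
move=> /closureP h; have h' n : exists y, S y /\ nrm (x - y) < n.+1%:R^-1.
  by have [|y] := h n.+1%:R^-1; [rewrite invr_gt0 ltr0n|exists y].
pose u n := projT1 (cid (h' n)); exists u; split => [n|e e0]; first by case: (projT2 (cid (h' n))).
pose N := Num.truncn e^-1; exists N => n Nn; rewrite nrmB; apply: lt_le_trans (proj2 (projT2 (cid (h' n)))) _.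
have e1 : 0 <= e^-1 by rewrite invr_ge0 ltW.
have /andP[_ h1] := truncn_itv e1.
rewrite invf_ple ?posrE ?ltr0n //; apply: ltW; apply: lt_le_trans h1 _.
by rewrite ler_nat.
Qed.

Lemma hilbert_complete (u : nat -> H) :
  (forall e : R, 0 < e -> exists N, forall n m, (N <= n)%N -> (N <= m)%N -> nrm (u n - u m) < e) ->
  exists l, hlim u l.
Proof.
move=> cu; have : cvg (u @ \oo).
  apply/cauchy_cvgP/cauchyP => e e0.
  have er : e = ((complex.Re e)%:C)%C by rewrite RRe_real // gtr0_real.
  have [|N hN] := cu (complex.Re e); first by rewrite -ltcR -er.
  exists (u N); exists N => // n Nn /=; rewrite -ball_normE /= nrmE er ltcR.
  by apply: hN.
move=> cv; exists (lim (u @ \oo)) => e e0.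
have ec : 0 < ((e%:C)%C : R[i]) by rewrite ltcR.
have /cvgrPdist_lt/(_ _ ec) [N _ hN] := cv; exists N => n Nn.
by have := hN n Nn; rewrite /= nrmE ltcR nrmB.
Qed.

Lemma bopP (X : H -> H) : bounded_op X <-> bop X.
Proof.
split=> -[lX h]; split => //.
  pose f : {linear H -> H} := HB.pack X (GRing.isLinear.Build _ _ _ _ X lX).
  have /(linear_bounded_continuous f)/linear_boundedP : continuous f by [].
  move=> [M [Mr hM]]; have rM : M = ((complex.Re M)%:C)%C by rewrite RRe_real.
  have lt : M < (((complex.Re M + 1)%:C)%C : R[i]) by rewrite [X in X < _]rM ltcR ltrDl.
  by exists (complex.Re M + 1) => x; have := hM _ lt x; rewrite !nrmE -rmorphM lecR.
case: h => C hC; pose f : {linear H -> H} := HB.pack X (GRing.isLinear.Build _ _ _ _ X lX).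
suff : continuous f by [].
apply/(linear_bounded_continuous f)/linear_boundedP; exists ((C%:C)%C); split.
  by apply/complex_realP; exists C.
move=> r Cr x; rewrite nrmE; apply: le_trans (_ : ((C%:C)%C) * `|x| <= _).
  by rewrite nrmE -rmorphM lecR.
by rewrite ler_wpM2r // ltW.
Qed.

End HilbertBasics.

Section BopTheory.
Variables (R : realType).
Implicit Types H K L : hilbert R.

Section LinearFun.
Variables (U V : lmodType R[i]) (X : U -> V).
Hypothesis lX : linear X.

Lemma lin0 : X 0 = 0.
Proof. by have := lX (-1) 0 0; rewrite scaler0 addr0 scaleN1r addNr. Qed.

Lemma linD x y : X (x + y) = X x + X y.
Proof. by have := lX 1 x y; rewrite !scale1r. Qed.

Lemma linZ c x : X (c *: x) = c *: X x.
Proof. by rewrite -[c *: x]addr0 lX lin0 addr0. Qed.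

Lemma linN x : X (- x) = - X x.
Proof. by rewrite -scaleN1r linZ scaleN1r. Qed.

Lemma linB x y : X (x - y) = X x - X y.
Proof. by rewrite linD linN. Qed.

Lemma lin_sum (I : Type) (r : seq I) (Q : pred I) (F : I -> U) :
  X (\sum_(i <- r | Q i) F i) = \sum_(i <- r | Q i) X (F i).
Proof. by elim/big_rec2: _ => [|i x y _ <-]; rewrite ?lin0 ?linD. Qed.

End LinearFun.

Lemma bop_pos H K (X : H -> K) :
  bop X -> exists2 C : R, 0 < C & forall x, nrm (X x) <= C * nrm x.
Proof.
move=> [_ [C hC]]; exists (`|C| + 1) => [|x]; first by rewrite ltr_wpDl.
by apply: le_trans (hC x) _; rewrite ler_wpM2r ?nrm_ge0 // (le_trans (ler_norm C)) // lerDl.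
Qed.

Lemma bop_lim H K (X : H -> K) (u : nat -> H) l : bop X -> hlim u l -> hlim (fun n => X (u n)) (X l).
Proof.
move=> bX h e e0; have [C C0 hC] := bop_pos bX; have [lX _] := bX.
have [|N hN] := h (e / C); first by rewrite divr_gt0.
exists N => n /hN; rewrite ltr_pdivlMr // mulrC -(linB lX) => h1.
exact: le_lt_trans (hC _) h1.
Qed.

Lemma bop_id H : bop (fun x : H => x).
Proof. by split=> //; exists 1 => x; rewrite mul1r. Qed.

Lemma bop_comp H K L (X : K -> L) (Y : H -> K) : bop X -> bop Y -> bop (X \o Y).
Proof.
move=> bX bY; have [[lX _] [lY _]] := (bX, bY); split.
  by move=> c x y /=; rewrite lY lX.
have [[C C0 hC] [D D0 hD]] := (bop_pos bX, bop_pos bY); exists (C * D) => x /=.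
by apply: le_trans (hC _) _; rewrite -mulrA ler_pM2l.
Qed.

Lemma bopD H K (X Y : H -> K) : bop X -> bop Y -> bop (fun x => X x + Y x).
Proof.
move=> [lX [C hC]] [lY [D hD]]; split.
  by move=> c x y; rewrite lX lY scalerDr addrACA.
by exists (C + D) => x; apply: le_trans (nrm_triangle _ _) _; rewrite mulrDl lerD.
Qed.

Lemma bopZ H K c (X : H -> K) : bop X -> bop (fun x => c *: X x).
Proof.
move=> [lX [C hC]]; split.
  by move=> d x y; rewrite lX scalerDr !scalerA mulrC.
by exists (nrm c * C) => x; rewrite nrmZ -mulrA ler_wpM2l ?nrm_ge0.
Qed.

Lemma bop0 H K : bop (fun _ : H => 0 : K).
Proof. by split=> [c x y|]; [rewrite scaler0 addr0|exists 0 => x; rewrite nrm0 mul0r]. Qed.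

Lemma bopB H K (X Y : H -> K) : bop X -> bop Y -> bop (fun x => X x - Y x).
Proof.
move=> bX /(bopZ (-1)) bY; have := bopD bX bY.
by under eq_fun do rewrite scaleN1r.
Qed.

Lemma bop_sum H K (I : Type) (r : seq I) (Q : pred I) (F : I -> H -> K) :
  (forall i, Q i -> bop (F i)) -> bop (fun x => \sum_(i <- r | Q i) F i x).
Proof.
move=> h; elim: r => [|i r IH]; first by under eq_fun do rewrite big_nil; exact: bop0.
by case Qi: (Q i); under eq_fun do rewrite big_cons Qi; [apply: bopD; [exact: h|]|].
Qed.

Lemma closure_hspan_lin H (S : set H) c x y :
  closure (hspan S) x -> closure (hspan S) y -> closure (hspan S) (c *: x + y).
Proof.
have lin c' x' y' : hspan S x' -> hspan S y' -> hspan S (c' *: x' + y').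
  move=> [k [a [s [Ss ->]]]] [k' [a' [s' [Ss' ->]]]].
  exists (k + k')%N, (fun i => match fintype.split i with inl i => c' * a i | inr i => a' i end),
    (fun i => match fintype.split i with inl i => s i | inr i => s' i end); split.
    by move=> i; case: (fintype.split i).
  rewrite big_split_ord /= scaler_sumr; congr (_ + _); apply: eq_bigr => i _.
    by rewrite (unsplitK (inl i)) scalerA.
  by rewrite (unsplitK (inr i)).
move=> /closure_seq[u [Su lu]] /closure_seq[v [Sv lv]].
by apply: closure_hlim (hlimD (hlimZ c lu) lv) => n; apply: lin.
Qed.

Lemma hspan_sub H (S : set H) : S `<=` hspan S.
Proof. by move=> x Sx; exists 1%N, (fun _ => 1), (fun _ => x); split=> //; rewrite big_ord1 scale1r. Qed.

Lemma bop_ext H K (S : set H) (X Y : H -> K) : closure (hspan S) = setT -> bop X -> bop Y ->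
  (forall x, S x -> X x = Y x) -> forall x, X x = Y x.
Proof.
move=> dS bX bY XY x; have : closure (hspan S) x by rewrite dS.
have [[lX _] [lY _]] := (bX, bY).
move=> /closure_seq[u [Su lu]]; apply: hlim_unique (bop_lim bX lu) _.
apply: hlim_ext (bop_lim bY lu) => n; have [k [c [s [Ss ->]]]] := Su n.
by rewrite (lin_sum lX) (lin_sum lY); apply: eq_bigr => i _; rewrite (linZ lX) (linZ lY) XY.
Qed.

Lemma total_orth H (S : set H) x : closure (hspan S) = setT -> (forall y, S y -> ip x y = 0) -> x = 0.
Proof.
move=> dS h; apply: ip_eq0; have : closure (hspan S) x by rewrite dS.
move=> /closure_seq[u [Su lu]]; apply: hlim_unique (hlim_ipr x lu) _.
apply: hlim_ext (hlim_cst 0) => n; have [k [c [s [Ss ->]]]] := Su n.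
by rewrite ip_sumr big1 // => i _; rewrite ipZr h // mulr0.
Qed.

End BopTheory.

(** * Extension of bounded maps by density *)

Section Extension.
Variables (R : realType) (H K : hilbert R).

(* With [sg] the conjugation this extends anti-linear maps. *)
Lemma bounded_extend (sg : R[i] -> R[i]) (G : H -> K -> Prop) (C : R) : sg (-1) = -1 ->
  (forall c x y x' y', G x y -> G x' y' -> G (c *: x + x') (sg c *: y + y')) ->
  (forall x y, G x y -> nrm y <= C * nrm x) ->
  (forall x, closure [set x | exists y, G x y] x) ->
  exists X : H -> K, [/\ forall c x y, X (c *: x + y) = sg c *: X x + X y, forall x, nrm (X x) <= C * nrm x & forall x y, G x y -> X x = y].
Proof.
move=> sg1 linG bG dG.
have subG x y x' y' : G x y -> G x' y' -> G (x - x') (y - y').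
  by move=> g g'; have := linG (-1) _ _ _ _ g' g; rewrite sg1 !scaleN1r ![- _ + _]addrC.
clear sg1.
have cvgG (u : nat -> H) (v : nat -> K) x : (forall n, G (u n) (v n)) -> hlim u x ->
    exists y, hlim v y.
  move=> Guv hu; apply: hilbert_complete => e e0.
  have c0 : 0 < 2 * (`|C| + 1) by rewrite mulr_gt0 // ltr_wpDl.
  have [|N hN] := hu (e / (2 * (`|C| + 1))); first by rewrite divr_gt0.
  exists N => n m Nn Nm; apply: le_lt_trans (bG _ _ (subG _ _ _ _ (Guv n) (Guv m))) _.
  have := nrm_triangle (u n - x) (x - u m); rewrite addrA subrK [nrm (x - _)]nrmB => h.
  have := hN n Nn; have := hN m Nm; rewrite !ltr_pdivlMr // => h1 h2.
  have h3 : C * nrm (u n - u m) <= (`|C| + 1) * (nrm (u n - x) + nrm (u m - x)).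
    apply: le_trans (_ : (`|C| + 1) * nrm (u n - u m) <= _).
      by rewrite ler_wpM2r ?nrm_ge0 // (le_trans (ler_norm C)) // lerDl.
    by rewrite ler_wpM2l // addr_ge0.
  by apply: le_lt_trans h3 _; move: h1 h2; lra.
have exy x : exists y, exists u v, [/\ forall n, G (u n) (v n), hlim u x & hlim v y].
  have /closure_seq[u [Gu hu]] := dG x; pose v n := projT1 (cid (Gu n)).
  have Guv n : G (u n) (v n) by exact: (projT2 (cid (Gu n))).
  by have [y hy] := cvgG u v x Guv hu; exists y, u, v.
pose X x := projT1 (cid (exy x)).
have XP x : exists u v, [/\ forall n, G (u n) (v n), hlim u x & hlim v (X x)] by exact: (projT2 (cid (exy x))).
have bound u v x y : (forall n, G (u n) (v n)) -> hlim u x -> hlim v y -> nrm y <= C * nrm x.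
  move=> Guv hu hv; rewrite leNgt; apply/negP => lt.
  (* The margin is chosen so that the errors of [u], multiplied by the norm of [C], and of [v]
     together stay below the supposed excess. *)
  pose e := (nrm y - C * nrm x) / (2 * (`|C| + 1)).
  have c0 : 0 < `|C| + 1 by rewrite ltr_wpDl.
  have e0 : 0 < e by rewrite divr_gt0 ?subr_gt0 // mulr_gt0.
  have [N hN] := hu _ e0; have [|N' hN'] := hv (e * (`|C| + 1)); first by rewrite mulr_gt0.
  pose n := maxn N N'; have := bG _ _ (Guv n).
  have := nrm_triangle (v n) (y - v n); rewrite addrC subrK [nrm (y - _)]nrmB.
  have := nrm_triangle x (u n - x); rewrite addrC subrK.
  have := nrm_triangle (u n) (x - u n); rewrite addrC subrK [nrm (x - _)]nrmB.
  have := hN n (leq_maxl _ _); have := hN' n (leq_maxr _ _).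
  have eE : e * (`|C| + 1) * 2 = nrm y - C * nrm x by rewrite /e; field; lra.
  move: eE (nrm_ge0 (u n - x)); set a := nrm (u n - x); set b := nrm (v n - y).
  set f := nrm (u n); set g := nrm (v n); set X0 := nrm x; set Y := nrm y.
  move=> eE a0 h1 h2 h3 h4 h5 h6.
  have h7 : C * f <= C * X0 + `|C| * a.
    rewrite -lerBlDl -mulrBr; apply: le_trans (ler_norm _) _; rewrite normrM ler_wpM2l //.
    by rewrite ler_norml; apply/andP; split; lra.
  have h8 : `|C| * a <= `|C| * e by rewrite ler_wpM2l // ltW.
  by move: eE; rewrite mulrDr mulr1 [e * _]mulrC; lra.
have uniqG u v u' v' x y y' : (forall n, G (u n) (v n)) -> hlim u x -> hlim v y ->
    (forall n, G (u' n) (v' n)) -> hlim u' x -> hlim v' y' -> y = y'.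
  move=> g hu hv g' hu' hv'; apply/eqP; rewrite -subr_eq0 -nrm_eq0; apply/eqP/le_anti.
  rewrite nrm_ge0 andbT -(mulr0 C) -(nrm0 H) -(subrr x).
  apply: (bound (fun n => u n - u' n) (fun n => v n - v' n)) => [n||]; last 2 first.
  - exact: hlimB.
  - exact: hlimB.
  exact: subG.
exists X; split.
- move=> c x x'; have [u [v [g hu hv]]] := XP x; have [u' [v' [g' hu' hv']]] := XP x'.
  have [u2 [v2 [g2 hu2 hv2]]] := XP (c *: x + x').
  apply: (uniqG _ _ (fun n => c *: u n + u' n) (fun n => sg c *: v n + v' n) _ _ _ g2 hu2 hv2).
  + by move=> n; apply: linG.
  + exact: hlimD (hlimZ _ hu) hu'.
  + exact: hlimD (hlimZ _ hv) hv'.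
- by move=> x; have [u [v [g hu hv]]] := XP x; apply: bound g hu hv.
- move=> x y gxy; have [u [v [g hu hv]]] := XP x.
  apply: (uniqG _ _ (fun _ => x) (fun _ => y) _ _ _ g hu hv) => //; exact: hlim_cst.
Qed.

Lemma bop_extend (G : H -> K -> Prop) (C : R) :
  (forall c x y x' y', G x y -> G x' y' -> G (c *: x + x') (c *: y + y')) ->
  (forall x y, G x y -> nrm y <= C * nrm x) ->
  (forall x, closure [set x | exists y, G x y] x) ->
  exists2 X : H -> K, bop X & forall x y, G x y -> X x = y.
Proof.
move=> h1 h2 h3; have [X [lX bX gX]] := bounded_extend (sg := id) erefl h1 h2 h3.
by exists X => //; split=> //; exists C.
Qed.

End Extension.

(** * Projections, Riesz representation and adjoints *)

Section Projection.
Variables (R : realType) (H : hilbert R).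
Variable S : set H.
Hypothesis Slin : forall c x y, S x -> S y -> S (c *: x + y).
Hypothesis Scl : closure S `<=` S.
Hypothesis S0 : S 0.

Lemma parallelogram (x y : H) :
  nrm (x + y) ^+ 2 + nrm (x - y) ^+ 2 = 2 * nrm x ^+ 2 + 2 * nrm y ^+ 2.
Proof. by rewrite !nrm_sqD ipNr nrmN raddfN /=; lra. Qed.

(** A minimising sequence is Cauchy by the parallelogram identity, since midpoints stay in [S]. At a
    point of minimal distance, a correction along [z] cannot shorten the difference. *)
Lemma projection_ex (x : H) : exists2 y, S y & forall z, S z -> ip (x - y) z = 0.
Proof.
pose E := [set nrm (x - y) ^+ 2 | y in S].
have lbE : lbound E 0 by move=> _ [y _ <-]; rewrite sqr_ge0.
have E0 : E !=set0 by exists (nrm (x - 0) ^+ 2), 0.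
have hE : has_inf E by split=> //; exists 0.
pose d := inf E; have dle y : S y -> d <= nrm (x - y) ^+ 2.
  by move=> Sy; apply: ge_inf; [exists 0|exists y].
have near n : exists y, S y /\ nrm (x - y) ^+ 2 < d + n.+1%:R^-1.
  have := @inf_adherent _ E n.+1%:R^-1; rewrite invr_gt0 ltr0n => /(_ isT hE)[_ [y Sy <-] h].
  by exists y.
pose u n := projT1 (cid (near n)).
have [Su hu] : (forall n, S (u n)) /\ forall n, nrm (x - u n) ^+ 2 < d + n.+1%:R^-1.
  by split=> n; case: (projT2 (cid (near n))).
have half y z : S y -> S z -> nrm (y - z) ^+ 2 <= 2 * nrm (x - y) ^+ 2 + 2 * nrm (x - z) ^+ 2 - 4 * d.
  move=> Sy Sz; have := parallelogram (x - y) (x - z).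
  have -> : x - y - (x - z) = z - y by rewrite opprB addrC addrA subrK.
  rewrite [nrm (z - y)]nrmB.
  have -> : x - y + (x - z) = 2 *: (x - 2^-1 *: (y + z)).
    rewrite scalerBr scalerA divff ?scale1r ?pnatr_eq0 // scaler_nat mulr2n opprD !addrA.
    by congr (_ + _); rewrite addrAC.
  have Sm : S (2^-1 *: (y + z)).
    have Syz : S (y + z) by have := Slin 1 Sy Sz; rewrite scale1r.
    by have := Slin 2^-1 Syz S0; rewrite addr0.
  rewrite nrmZ exprMn; have -> : nrm (2 : R[i]) = 2.
    by rewrite -(rmorph_nat (real_complex R) 2) nrm_real ger0_norm.
  by have := dle _ Sm; lra.
have [y hy] : exists y, hlim u y.
  apply: hilbert_complete => e e0; have e1 : 0 <= 4 / e ^+ 2 by rewrite divr_ge0 ?sqr_ge0.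
  have /andP[_ ht] := truncn_itv e1; set N := Num.truncn _ in ht.
  exists N => n m Nn Nm; rewrite -(ltr_pXn2r (n := 2)) ?nnegrE ?nrm_ge0 ?ltW //.
  apply: le_lt_trans (half _ _ (Su n) (Su m)) _; have := hu n; have := hu m.
  have inv k : (N <= k)%N -> k.+1%:R^-1 < e ^+ 2 / 4.
    move=> Nk; rewrite invf_plt ?posrE ?ltr0n ?divr_gt0 ?exprn_gt0 // invf_div.
    by apply: lt_le_trans ht _; rewrite ler_nat.
  by have := inv _ Nn; have := inv _ Nm; move: (n.+1%:R^-1) (m.+1%:R^-1) => a b; lra.
have Sy : S y by apply: Scl; apply: closure_hlim hy.
have ny : nrm (x - y) ^+ 2 <= d.
  rewrite leNgt; apply/negP => lt.
  have d0 : 0 <= d by apply: lb_le_inf.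
  (* Its square is the midpoint between the minimum and the supposed larger value. The tail of the
     sequence is within distance [s] of [x], hence so is the limit. *)
  pose s := Num.sqrt ((nrm (x - y) ^+ 2 + d) / 2).
  have s2 : s ^+ 2 = (nrm (x - y) ^+ 2 + d) / 2.
    by rewrite sqr_sqrtr // divr_ge0 // addr_ge0 // sqr_ge0.
  have xs : nrm (x - y) <= s.
    have e0 : 0 < (nrm (x - y) ^+ 2 - d) / 2 by move: lt; lra.
    have /andP[_ ht] := truncn_itv (ltW (divr_gt0 ltr01 e0) : 0 <= 1 / ((nrm (x - y) ^+ 2 - d) / 2)).
    set N := Num.truncn _ in ht; apply: (hlim_nrm_le (u := fun n => x - u (n + N)%N)).
      apply: hlimB; first exact: hlim_cst.
      by move=> e /hy[M hM]; exists M => n Mn; apply: hM; rewrite (leq_trans Mn) // leq_addr.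
    move=> n; rewrite -(ler_pXn2r (n := 2)) ?nnegrE ?nrm_ge0 ?sqrtr_ge0 // s2.
    apply: ltW; apply: lt_le_trans (hu _) _.
    have : (n + N).+1%:R^-1 <= (nrm (x - y) ^+ 2 - d) / 2.
      rewrite invf_ple ?posrE ?ltr0n // -[X in X <= _]div1r; apply: ltW; apply: lt_le_trans ht _.
      by rewrite ler_nat ltnS leq_addl.
    by move: ((n + N).+1%:R^-1) => a; lra.
  have := dle y Sy; move: xs; rewrite -(ler_pXn2r (n := 2)) ?nnegrE ?nrm_ge0 ?sqrtr_ge0 // s2; lra.
exists y => // z Sz; have [->|z0] := eqVneq z 0; first by rewrite ip0r.
have zz : ip z z != 0 by apply: contraNneq z0 => /ip_eq0->.
pose t := ip (x - y) z / ip z z.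
have orth : ip (x - y - t *: z) (t *: z) = 0.
  by rewrite ipZr ipBl ipZl divfK // subrr mulr0.
have := pythagoras orth; rewrite subrK => e.
have Syt : S (t *: z + y) by apply: Slin.
have := dle _ Syt; rewrite opprD addrA addrAC => h.
have t0 : nrm (t *: z) ^+ 2 <= 0 by move: h e ny; rewrite addrAC; lra.
have {}t0 : t *: z = 0.
  apply/eqP; rewrite -nrm_eq0 -sqrf_eq0; apply/eqP/le_anti; by rewrite t0 sqr_ge0.
by move/eqP: t0; rewrite scaler_eq0 (negbTE z0) orbF mulf_eq0 invr_eq0 (negbTE zz) orbF => /eqP.
Qed.

Definition proj (x : H) : H := projT1 (cid2 (projection_ex x)).

Lemma proj_in x : S (proj x).
Proof. by rewrite /proj; case: cid2. Qed.

Lemma proj_orth x z : S z -> ip (x - proj x) z = 0.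
Proof. by rewrite /proj; case: cid2 => y Sy h; apply: h. Qed.

Lemma proj_unique x y : S y -> (forall z, S z -> ip (x - y) z = 0) -> proj x = y.
Proof.
move=> Sy h; have Sd : S (proj x - y).
  by have := Slin (-1) Sy (proj_in x); rewrite scaleN1r addrC.
apply/eqP; rewrite -subr_eq0; apply/eqP/ip_eq0.
have := h _ Sd; rewrite -[x - y](subrKA (proj x)) ipDl (proj_orth _ Sd) add0r.
by rewrite addrC.
Qed.

Lemma proj_id x : S x -> proj x = x.
Proof. by move=> Sx; apply: proj_unique => // z _; rewrite subrr ip0l. Qed.

Lemma proj_ip x y : ip (proj x) y = ip (proj x) (proj y).
Proof.
apply/eqP; rewrite -subr_eq0 -ipBr ip_conj (proj_orth y (proj_in x)) rmorph0 //.
Qed.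

Lemma proj_adjoint : is_adjoint proj proj.
Proof. by move=> x y; rewrite proj_ip [RHS]ip_conj [in RHS]proj_ip -ip_conj. Qed.

Lemma proj_bop : bop proj.
Proof.
split=> [c x y|].
  apply: proj_unique; first by apply: Slin; apply: proj_in.
  move=> z Sz; rewrite opprD addrACA -scalerBr ipDl ipZl !proj_orth //.
  by rewrite mulr0 addr0.
exists 1 => x; rewrite mul1r -(ler_pXn2r (n := 2)) ?nnegrE ?nrm_ge0 //.
have := pythagoras (proj_orth x (proj_in x)); rewrite subrK => ->.
by rewrite lerDr sqr_ge0.
Qed.

End Projection.

Section Riesz.
Variables (R : realType) (H : hilbert R).

Lemma riesz (f : H -> R[i]) (C : R) : (forall c x y, f (c *: x + y) = c * f x + f y) ->
  (forall x, nrm (f x) <= C * nrm x) -> exists y, forall x, f x = ip x y.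
Proof.
move=> lf bf; pose S := [set x | f x = 0].
have f0 : f 0 = 0 by have := lf (-1) 0 0; rewrite scaler0 addr0 mulN1r addNr.
have fB x y : f (x - y) = f x - f y.
  by have := lf (-1) y x; rewrite scaleN1r mulN1r [- y + x]addrC [- f y + _]addrC.
have fZ c x : f (c *: x) = c * f x by have := lf c x 0; rewrite !addr0 f0 addr0.
have Slin c x y : S x -> S y -> S (c *: x + y).
  by rewrite /S /= lf => -> ->; rewrite mulr0 addr0.
have Scl : closure S `<=` S.
  move=> x /closure_seq[u [Su hu]]; apply/eqP; rewrite -nrm_eq0; apply/eqP/le_anti.
  rewrite nrm_ge0 andbT leNgt; apply/negP => lt.
  have c0 : 0 < `|C| + 1 by rewrite ltr_wpDl.
  have [|N hN] := hu (nrm (f x) / (`|C| + 1)); first by rewrite divr_gt0.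
  have := hN N (leqnn N); rewrite ltr_pdivlMr // ltNge => /negP; apply.
  have : nrm (f (u N - x)) = nrm (f x) by rewrite fB Su sub0r nrmN.
  move=> <-; apply: le_trans (bf _) _; rewrite mulrC ler_wpM2l ?nrm_ge0 //.
  by rewrite (le_trans (ler_norm C)) // lerDl.
have [h|h] := pselect (forall x, f x = 0); first by exists 0 => x; rewrite h ip0r.
have {h} [w fw] : exists w, f w != 0.
  by apply: contrapT => n; apply: h => x; apply: contrapT => /eqP fx; apply: n; exists x.
have [y Sy hy] := projection_ex Slin Scl (f0 : S 0) w.
pose e := w - y; have fe : f e = f w by rewrite fB Sy subr0.
have ee : ip e e != 0.
  by apply: contraNneq fw => /ip_eq0 e0; rewrite -fe e0 f0.
exists ((f e / ip e e)^* *: e) => x.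
have Sx : S (x - (f x / f e) *: e) by rewrite /S /= fB fZ divfK ?subrr // fe.
have := hy _ Sx; rewrite -/e ip_conj ipBl ipZl => /(congr1 (fun z => z^*)).
rewrite conjCK rmorph0 => /eqP; rewrite subr_eq0 => /eqP xe.
by rewrite ipZr conjCK xe; field; rewrite ee fe fw.
Qed.

End Riesz.

Section Adjoint.
Variables (R : realType).

Lemma adjoint_ex (H K : hilbert R) (X : H -> K) : bop X ->
  exists Y : K -> H, bop Y /\ forall x y, ip (X x) y = ip x (Y y).
Proof.
move=> bX; have [C C0 hC] := bop_pos bX; have [lX _] := bX.
have rz y : exists z, forall x, ip (X x) y = ip x z.
  apply: (riesz (C := C * nrm y)) => [c x x'|x].
    by rewrite lX ip_linear.
  apply: le_trans (cauchy_schwarz _ _) _; rewrite mulrAC ler_wpM2r ?nrm_ge0 //.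
pose Y y := projT1 (cid (rz y)); have YP x y : ip (X x) y = ip x (Y y).
  exact: (projT2 (cid (rz y)) x).
exists Y; split=> //; split.
  move=> c x y; apply: ip_ext => z; rewrite ip_conj -YP ipDr ipZr rmorphD rmorphM /= conjCK -!ip_conj.
  by rewrite ip_linear; congr (_ * _ + _); rewrite ip_conj YP -ip_conj.
exists C => y; have [->|z0] := eqVneq (Y y) 0; first by rewrite nrm0 mulr_ge0 ?nrm_ge0 // ltW.
have n0 : 0 < nrm (Y y) by rewrite lt_def nrm_eq0 z0 nrm_ge0.
rewrite -(ler_pM2l n0) -expr2 mulrA [nrm _ * C]mulrC.
have -> : nrm (Y y) ^+ 2 = nrm (ip (X (Y y)) y).
  by rewrite YP ip_nrm nrm_real ger0_norm // sqr_ge0.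
by apply: le_trans (cauchy_schwarz _ _) _; rewrite ler_wpM2r ?nrm_ge0.
Qed.

Variable H : hilbert R.

Lemma adjoint_sym (X Y : H -> H) : is_adjoint X Y -> is_adjoint Y X.
Proof. by move=> h x y; rewrite ip_conj -h -ip_conj. Qed.

Definition star_closed (S : set (H -> H)) : Prop :=
  forall X, S X -> exists2 Y, S Y & is_adjoint X Y.

Lemma commutant_star_closed (S : set (H -> H)) : star_closed S -> star_closed (commutant S).
Proof.
move=> sS X [/bopP bX cX]; have [Y [bY YX]] := adjoint_ex bX; exists Y => //.
split; first exact/bopP.
move=> Z SZ; have [W SW ZW] := sS _ SZ; apply/funext => x; apply: ip_ext => y /=.
have cW u : X (W u) = W (X u) by have := congr1 (@^~ u) (cX W SW).
rewrite ip_conj -YX [RHS]ip_conj; congr (_^*).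
by rewrite -(adjoint_sym ZW) -cW YX -(adjoint_sym ZW).
Qed.

Lemma commutant_sub (S T : set (H -> H)) : S `<=` T -> commutant T `<=` commutant S.
Proof. by move=> ST X [bX cX]; split=> // Y /ST; apply: cX. Qed.

Lemma sub_bicommutant (S : set (H -> H)) : S `<=` (@bounded_op R H) -> S `<=` commutant (commutant S).
Proof. by move=> bS X SX; split; [exact: bS|move=> Y [_ cY]; rewrite cY]. Qed.

Lemma commutant_bounded (S : set (H -> H)) : commutant S `<=` (@bounded_op R H).
Proof. by move=> X []. Qed.

Lemma bicommutant_von_neumann (S : set (H -> H)) : star_closed S ->
  S `<=` (@bounded_op R H) -> von_neumann (commutant (commutant S)).
Proof.
move=> sS bS; split.
- exact: commutant_bounded.
- exact/commutant_star_closed/commutant_star_closed.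
- apply/seteqP; split; last exact/sub_bicommutant/commutant_bounded.
  apply: commutant_sub; apply: sub_bicommutant; exact: commutant_bounded.
Qed.

Lemma vn_generatedE (S : set (H -> H)) : star_closed S -> S `<=` (@bounded_op R H) ->
  vn_generated S = commutant (commutant S).
Proof.
move=> sS bS; apply/seteqP; split=> X.
  by apply; [exact: bicommutant_von_neumann|exact: sub_bicommutant].
move=> h M vM SM; rewrite -(vn_bicommutant vM).
by move: X h; apply: commutant_sub; apply: commutant_sub.
Qed.

End Adjoint.

(** * Neumann series and inverse square roots *)

Section InverseSqrt.
Variables (R : realType) (H : hilbert R).
Implicit Types X Y E : H -> H.

Definition commuting X Y := forall x, X (Y x) = Y (X x).

Lemma geom_limit (T : nat -> H -> H) (s : R) : 0 <= s < 1 ->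
  (forall n x, nrm (T n.+1 x - T n x) <= s ^+ n * nrm x) ->
  exists L : H -> H, forall x, hlim (fun n => T n x) (L x).
Proof.
move=> /andP[s0 s1] hT; suff lim x : exists l, hlim (fun n => T n x) l.
  by exists (fun x => projT1 (cid (lim x))) => x; case: (cid (lim x)).
have w0 : 0 < 1 - s by rewrite subr_gt0.
have far k n : nrm (T (n + k)%N x - T n x) <= s ^+ n * (nrm x / (1 - s)).
  suff : nrm (T (n + k)%N x - T n x) <= s ^+ n * (1 - s ^+ k) * (nrm x / (1 - s)).
    move/le_trans; apply; apply: ler_wpM2r; first by rewrite divr_ge0 ?nrm_ge0 // ltW.
    by rewrite ler_piMr ?exprn_ge0 // gerBl exprn_ge0.
  elim: k => [|k IH]; first by rewrite addn0 subrr nrm0 expr0 subrr mulr0 mul0r.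
  rewrite addnS -(subrKA (T (n + k)%N x)).
  apply: le_trans (nrm_triangle _ _) _; have h := hT (n + k)%N x.
  apply: le_trans (lerD h IH) _; rewrite exprD exprS le_eqVlt; apply/orP; left; apply/eqP.
  by field; lra.
apply: hilbert_complete => e e0.
have [N hN] := archi_geom (2 * (nrm x / (1 - s))) (introT andP (conj s0 s1)) e0.
exists N => n m Nn Nm; have tri := nrm_triangle (T n x - T N x) (T N x - T m x).
rewrite addrA subrK [nrm (T N x - _)]nrmB in tri.
have h1 := far (n - N)%N N; have h2 := far (m - N)%N N; rewrite subnKC // in h1; rewrite subnKC // in h2.
by apply: le_lt_trans (hN N (leqnn N)); move: tri h1 h2; lra.
Qed.

Lemma neumann_series Y (s : R) : bop Y -> 0 <= s < 1 -> (forall x, nrm (Y x) <= s * nrm x) ->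
  exists D, [/\ bop D, forall x, D x - Y (D x) = x, forall x, D (x - Y x) = x &
    (forall X, bop X -> commuting X Y -> commuting X D) /\ (is_adjoint Y Y -> is_adjoint D D)].
Proof.
move=> bY s01 hY; have [lY _] := bY; have /andP[s0 s1] := s01.
pose T := fix T n x := if n is n'.+1 then x + Y (T n' x) else 0 : H.
have dT n x : nrm (T n.+1 x - T n x) <= s ^+ n * nrm x.
  elim: n => [|n IH]; first by rewrite /= (lin0 lY) addr0 subr0 expr0 mul1r.
  rewrite -[T n.+2 x]/(x + Y (T n.+1 x)) -[X in _ - X]/(x + Y (T n x)) opprD addrACA subrr add0r.
  by rewrite -(linB lY) exprS -mulrA; apply: le_trans (hY _) _; rewrite ler_wpM2l.
have [D hD] := geom_limit s01 dT.
have DE x : D x = x + Y (D x).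
  apply: (hlim_unique (u := fun n => T n.+1 x)).
    by move=> e /(hD x)[N hN]; exists N => n Nn; apply: hN; apply: leq_trans Nn _.
  by apply: hlimD (hlim_cst _) _; apply: (bop_lim bY (hD x)).
have lT n : linear (T n).
  elim: n => [|n IH] c x y /=; first by rewrite scaler0 addr0.
  by rewrite IH lY scalerDr addrACA.
have lD : linear D.
  move=> c x y; apply: hlim_unique (hD _) _; apply: hlim_ext (hlimD (hlimZ c (hD x)) (hD y)) => n.
  by rewrite lT.
have bD : bop D.
  split=> //; exists (1 - s)^-1 => x; rewrite mulrC ler_pdivlMr ?subr_gt0 //.
  have := nrm_triangle x (Y (D x)); rewrite -DE.
  by have := hY (D x); lra.
have comm X : bop X -> commuting X Y -> commuting X D.
  move=> bX cX x; have [lX _] := bX; apply: hlim_unique (bop_lim bX (hD x)) _.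
  apply: hlim_ext (hD (X x)) => n; elim: n => [|n IH] /=; first by rewrite (lin0 lX).
  by rewrite (linD lX) cX IH.
have DK x : D x - Y (D x) = x by rewrite {1}DE addrK.
exists D; split=> //.
  by move=> x; rewrite (linB lD) -(comm Y bY) //; exact: DK.
split=> // aY x y; have aT n : forall x y, ip (T n x) y = ip x (T n y).
  elim: n => [|n IH] {}x {}y /=; first by rewrite ip0l ip0r.
  have cT z : T n (Y z) = Y (T n z).
    by elim: n {IH} => [|n IH] /=; rewrite ?(lin0 lY) // (linD lY) IH.
  by rewrite ipDl ipDr aY IH cT.
apply: (hlim_unique (u := fun n => ip (T n x) y)); first exact: hlim_ipl (hD x).
by apply: hlim_ext (hlim_ipr x (hD y)) => n; rewrite aT.
Qed.

(* The square root is [1 - Y] where [Y = (E + Y^2)/2], a contraction when [|E| < 1]. *)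
Lemma sqrt_one_sub E (r : R) : bop E -> 0 <= r < 1 -> (forall x, nrm (E x) <= r * nrm x) ->
  exists Y s, [/\ bop Y, 0 <= s < 1, forall x, nrm (Y x) <= s * nrm x,
    forall x, Y x + Y x - Y (Y x) = E x &
    (forall X, bop X -> commuting X E -> commuting X Y) /\ (is_adjoint E E -> is_adjoint Y Y)].
Proof.
move=> bE /andP[r0 r1] hE; have [lE _] := bE.
pose w := Num.sqrt (1 - r); have w0 : 0 < w by rewrite sqrtr_gt0 subr_gt0.
have w2 : w * w = 1 - r by rewrite -expr2 sqr_sqrtr // subr_ge0 ltW.
have w1 : w <= 1 by rewrite -sqrtr1 ler_wsqrtr // gerBl. 
(* The smaller root of [2 s = r + s^2]. If the current iterate has norm at most [s], so has the next
   one. *)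
pose s := 1 - w; have s01 : 0 <= s < 1 by rewrite /s; apply/andP; split; lra.
have /andP[s0 s1] := s01; have sE : r + s * s = 2 * s by rewrite /s; move: w2; lra.
pose half : R[i] := ((2^-1)%:C)%C.
have nhalf : nrm half = 2^-1 by rewrite nrm_real ger0_norm // invr_ge0.
have h2 : half + half = 1 by rewrite /half -rmorphD /= -[RHS](rmorph1 (real_complex R)); congr (_%:C)%C; lra.
pose y := fix y n x := if n is n'.+1 then half *: (E x + y n' (y n' x)) else 0 : H.
have yS n x : y n.+1 x = half *: (E x + y n (y n x)) by [].
have ly n : linear (y n).
  elim: n => [|n IH] c x x'; first by rewrite /= scaler0 addr0.
  by rewrite !yS lE !IH !scalerDr !scalerA mulrC addrACA.
have hy n x : nrm (y n x) <= s * nrm x.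
  elim: n x => [|n IH] x; first by rewrite /= nrm0 mulr_ge0 ?nrm_ge0.
  rewrite yS nrmZ nhalf; have := nrm_triangle (E x) (y n (y n x)).
  have := hE x; have := IH (y n x); have := ler_wpM2l s0 (IH x).
  rewrite mulrA => h3 h4 h5 h6; have : s * s * nrm x = (2 * s - r) * nrm x by rewrite -sE addrC addKr.
  by move: h3 h4 h5 h6; nra.
have by_ n : bop (y n) by split; [exact: ly|exists s].
have comm X n : bop X -> commuting X E -> commuting X (y n).
  move=> bX cX; have [lX _] := bX; elim: n => [|n IH] x; first by rewrite /= (lin0 lX).
  by rewrite !yS (linZ lX) (linD lX) cX !IH.
have cyE n : commuting (y n) E by move=> x; rewrite (comm E).
have dy n x : nrm (y n.+1 x - y n x) <= s ^+ n * nrm x.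
  elim: n x => [|n IH] x.
    rewrite /= subr0 addr0 nrmZ nhalf expr0 mul1r; have := hE x; have := nrm_ge0 x; nra.
  (* The iterates commute, so the difference of their squares factors as sum times difference. The
     sum has norm at most [2 s], and one half cancels the 2. *)
  have -> : y n.+2 x - y n.+1 x
      = half *: (y n.+1 (y n.+1 x - y n x) + y n (y n.+1 x - y n x)).
    rewrite [y n.+2 x]yS {2}[y n.+1 x]yS -scalerBr; congr (_ *: _).
    rewrite opprD addrACA subrr add0r (linB (ly n.+1)) (linB (ly n)).
    by rewrite (comm (y n.+1) n (by_ _) (cyE _)) addrA subrK.
  rewrite nrmZ nhalf exprS -mulrA.
  set d := y n.+1 x - y n x; have := nrm_triangle (y n.+1 d) (y n d).
  have := hy n.+1 d; have := hy n d; have := ler_wpM2l s0 (IH x); rewrite -/d; lra.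
have [Y hY] := geom_limit s01 dy.
have lY : linear Y.
  move=> c x x'; apply: hlim_unique (hY _) _; apply: hlim_ext (hlimD (hlimZ c (hY x)) (hY x')) => n.
  by rewrite ly.
have nY x : nrm (Y x) <= s * nrm x by apply: hlim_nrm_le (hY x) (fun n => hy n x).
have bY : bop Y by split=> //; exists s.
have yy x : hlim (fun n => y n (y n x)) (Y (Y x)).
  have h : hlim (fun n => y n (y n x - Y x)) 0.
    move=> e e0; have [N hN] := hY x e e0; exists N => n /hN; rewrite subr0 => h.
    apply: le_lt_trans (hy _ _) (le_lt_trans _ h).
    by rewrite ler_piMl ?nrm_ge0 // ltW.
  rewrite -[Y (Y x)]add0r; apply: hlim_ext (hlimD h (hY (Y x))) => n.
  by rewrite (linB (ly n)) subrK.
have YE x : Y x = half *: (E x + Y (Y x)).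
  apply: (hlim_unique (u := fun n => y n.+1 x)).
    by move=> e /(hY x)[N hN]; exists N => n Nn; apply: hN; apply: leq_trans Nn _.
  by apply: hlimZ; apply: hlimD (hlim_cst _) (yy x).
exists Y, s; split=> //.
  by move=> x; rewrite {1 2}YE -scalerDl h2 scale1r addrK.
split=> [X bX cX x|aE x x'].
  have [lX _] := bX; apply: hlim_unique (bop_lim bX (hY x)) _.
  by apply: hlim_ext (hY (X x)) => n; rewrite (comm X).
have ay n : forall u v, ip (y n u) v = ip u (y n v).
  elim: n => [|n IH] u v; first by rewrite /= ip0l ip0r.
  rewrite !yS ipZl ipZr ipDl ipDr aE !IH; congr (_ * _).
  by rewrite conj_Creal // /half complex_real.
apply: (hlim_unique (u := fun n => ip (y n x) x')); first exact: hlim_ipl (hY x).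
by apply: hlim_ext (hlim_ipr x (hY x')) => n; rewrite ay.
Qed.

(** For small [t > 0] the operator [E = 1 - t B] is a strict contraction. The square root of [t B]
    is then [1 - Y], which a Neumann series inverts, and [D] is this inverse times the root of [t].
    Limits of polynomials in [B] commute with whatever commutes with [B]. *)
Lemma inverse_sqrt (B : H -> H) (c : R) : bop B -> is_adjoint B B -> 0 < c ->
  (forall x, c * nrm x ^+ 2 <= complex.Re (ip (B x) x)) ->
  exists D, [/\ bop D, is_adjoint D D, forall x, D (D (B x)) = x &
    forall X, bop X -> commuting X B -> commuting X D].
Proof.
move=> bB aB c0 hB; have [lB _] := bB; have [C1 C10 hC1] := bop_pos bB.
(* Enlarging the bound by [c] ensures [c < C]. The squared norm of [E] is at most
   [1 - 2 t c + t^2 C^2], which is minimal at [t = c / C^2] and equals [q] there; [c < C] makes [q]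
   nonnegative. *)
pose C := C1 + c; have C0 : 0 < C by rewrite addr_gt0.
have cC : c < C by rewrite ltrDr.
have hC x : nrm (B x) <= C * nrm x.
  by apply: le_trans (hC1 x) _; rewrite ler_wpM2r ?nrm_ge0 // lerDl ltW.
pose t := c / C ^+ 2; have t0 : 0 < t by rewrite divr_gt0 // exprn_gt0.
pose tc : R[i] := ((t%:C)%C).
pose E x := x - tc *: B x.
have bE : bop E by apply: bopB; [exact: bop_id|exact: bopZ].
pose q := 1 - c ^+ 2 / C ^+ 2.
have q0 : 0 <= q.
  rewrite subr_ge0 ler_pdivrMr ?exprn_gt0 // mul1r ler_pXn2r ?nnegrE ?ltW //.
have q1 : q < 1 by rewrite gtrBl divr_gt0 // exprn_gt0.
have hE x : nrm (E x) <= Num.sqrt q * nrm x.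
  rewrite -(ler_pXn2r (n := 2)) ?nnegrE ?nrm_ge0 ?mulr_ge0 ?sqrtr_ge0 ?nrm_ge0 //.
  rewrite exprMn sqr_sqrtr // nrm_sqD nrmN nrmZ nrm_real (gtr0_norm t0) ipNr ipZr.
  have -> : complex.Re (- (tc^* * ip x (B x))) = - t * complex.Re (ip (B x) x).
    rewrite -aB /tc conj_Creal ?complex_real // -mulNr -rmorphN.
    by case: (ip (B x) x) => a b /=; rewrite mul0r subr0.
  have h1 : (t * nrm (B x)) ^+ 2 <= t * c * nrm x ^+ 2.
    have -> : t * c = (t * C) ^+ 2 by rewrite /t; field; lra.
    have h0 : t * nrm (B x) <= t * C * nrm x by rewrite -mulrA ler_pM2l.
    have hp : 0 <= t * nrm (B x) by rewrite mulr_ge0 ?nrm_ge0 // ltW.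
    by rewrite -exprMn ler_pXn2r ?nnegrE // (le_trans hp h0).
  have h2 := ler_wpM2l (ltW t0) (hB x).
  have qE : q = 1 - t * c by rewrite /q /t; field; lra.
  by rewrite qE mulrBl mul1r; move: h1 h2; lra.
have sq1 : 0 <= Num.sqrt q < 1.
  by rewrite sqrtr_ge0 /= -sqrtr1 ltr_sqrt.
have [Y [s [bY s01 hY YE [cY aY]]]] := sqrt_one_sub bE sq1 hE.
have [D0 [bD0 D0K D0K' [cD0 aD0]]] := neumann_series bY s01 hY.
have [lY _] := bY; have [lD0 _] := bD0.
have aE : is_adjoint E E.
  move=> x y; rewrite ipBl ipBr ipZl ipZr aB; congr (_ - _ * _).
  by rewrite conj_Creal // complex_real.
pose rt : R[i] := ((Num.sqrt t)%:C)%C.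
have rt2 : rt * rt = tc by rewrite -rmorphM /= -expr2 sqr_sqrtr // ltW.
have comm X : bop X -> commuting X B -> commuting X D0.
  move=> bX cX; apply: cD0 => //; apply: cY => // x; have [lX _] := bX.
  by rewrite /E (linB lX) (linZ lX) cX.
have EE x : D0 (D0 (x - E x)) = x.
  have -> : x - E x = (x - Y x) - Y (x - Y x).
    by rewrite -YE (linB lY) !opprB opprD !addrA; congr (_ - _); rewrite addrAC.
  by rewrite !D0K'.
exists (fun x => rt *: D0 x); split.
- exact: bopZ.
- move=> x y; rewrite ipZl ipZr (aD0 (aY aE)); congr (_ * _).
  by rewrite conj_Creal // complex_real.
- move=> x; rewrite (linZ lD0) scalerA rt2 -(linZ lD0) -[in RHS](EE x).
  by rewrite -(linZ lD0) /E opprB addrC subrK.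
- by move=> X bX cX x; have [lX _] := bX; rewrite (linZ lX) (comm X).
Qed.

End InverseSqrt.

(** * Closed subspaces as Hilbert spaces *)

Section ClosedSubspace.
Variable R : realType.

Record closed_subspace (H : hilbert R) := ClosedSubspace {
  cs_set : set H;
  cs_lin : forall c x y, cs_set x -> cs_set y -> cs_set (c *: x + y);
  cs_closed : closure cs_set `<=` cs_set;
  cs_zero : cs_set 0 }.

Variables (H : hilbert R) (S : closed_subspace H).

Definition cs_pred : {pred H} := fun x => `[< cs_set S x >].

Lemma cs_submod : submod_closed cs_pred.
Proof.
split=> [|c x y]; rewrite !unfold_in; first by apply/asboolP; exact: cs_zero.
by move=> /asboolP Sx /asboolP Sy; apply/asboolP; apply: cs_lin.
Qed.

HB.instance Definition _ := GRing.isSubmodClosed.Build R[i] H cs_pred cs_submod.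

Definition cs_type := {x : H | x \in cs_pred}.

HB.instance Definition _ := SubType.on cs_type.
HB.instance Definition _ := [Choice of cs_type by <:].
HB.instance Definition _ := [SubChoice_isSubLmodule of cs_type by <:].

Definition cs_norm (x : cs_type) : R[i] := `|val x|.

Lemma cs_normD x y : cs_norm (x + y) <= cs_norm x + cs_norm y.
Proof. by rewrite /cs_norm raddfD ler_normD. Qed.

Lemma cs_normZ (c : R[i]) x : cs_norm (c *: x) = `|c| * cs_norm x.
Proof. by rewrite /cs_norm linearZ normrZ. Qed.

Lemma cs_norm_eq0 x : cs_norm x = 0 -> x = 0.
Proof. by move=> /normr0_eq0 h; apply/val_inj; rewrite h raddf0. Qed.

HB.instance Definition _ := Lmodule_isNormed.Build R[i] cs_type cs_normD cs_normZ cs_norm_eq0.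

Lemma cs_normE (x y : cs_type) : `|x - y| = `|(val x - val y : H)|.
Proof. by rewrite -[LHS]/(cs_norm (x - y)) /cs_norm raddfB. Qed.

Lemma cs_complete (F : set_system cs_type) : ProperFilter F -> cauchy F -> cvg F.
Proof.
move=> FF cF; have cvF : cvg ((val : cs_type -> H) @ F).
  apply/cauchy_cvgP/cauchyP => e e0; have /cauchyP/(_ e e0)[x hx] := cF.
  exists (val x); change (F (fun y : cs_type => ball (val x : H) e (val y))).
  by apply: filterS hx => y; rewrite -!ball_normE /= cs_normE.
pose l := lim ((val : cs_type -> H) @ F).
have Sl : cs_set S l.
  apply: cs_closed; apply/closureP => e e0.
  have ec : 0 < ((e%:C)%C : R[i]) by rewrite ltcR.
  have /cvgrPdist_lt/(_ _ ec) hF := cvF; have [x /= hx] := filter_ex hF.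
  by exists (val x); [exact/asboolP/(valP x)|rewrite -ltcR -nrmE].
have Pl : l \in cs_pred by rewrite unfold_in; apply/asboolP.
apply/cvg_ex; exists (Sub l Pl : cs_type); apply/cvgrPdist_lt => e e0.
have /cvgrPdist_lt/(_ _ e0) := cvF; apply: filterS => x.
by rewrite cs_normE SubK.
Qed.

HB.instance Definition _ := Uniform_isComplete.Build cs_type cs_complete.

Definition sub_ip (x y : cs_type) : R[i] := ip (val x) (val y).

Lemma sub_ip_linear (c : R[i]) x y z : sub_ip (c *: x + y) z = c * sub_ip x z + sub_ip y z.
Proof. by rewrite /sub_ip linearP ip_linear. Qed.

Lemma sub_ip_conj x y : sub_ip y x = (sub_ip x y)^*.
Proof. exact: ip_conj. Qed.

Lemma sub_ip_norm x : sub_ip x x = `|x| ^+ 2.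
Proof. exact: ip_norm. Qed.

Definition sub_hilbert : hilbert R := Hilbert sub_ip_linear sub_ip_conj sub_ip_norm.

Definition sub_inc (x : sub_hilbert) : H := val (x : cs_type).

Lemma sub_inc_isometric : isometric sub_inc.
Proof. by split=> // c x y; rewrite /sub_inc linearP. Qed.

Lemma sub_inc_in x : cs_set S (sub_inc x).
Proof. exact/asboolP/(valP (x : cs_type)). Qed.

Lemma sub_inc_inj : injective sub_inc.
Proof. exact: val_inj. Qed.

Lemma sub_inc_ex y : cs_set S y -> exists x, sub_inc x = y.
Proof.
move=> Sy; have Py : y \in cs_pred by rewrite unfold_in; apply/asboolP.
by exists (Sub y Py : cs_type); rewrite /sub_inc SubK.
Qed.

Definition sub_prj (y : H) : sub_hilbert :=
  projT1 (cid (sub_inc_ex (proj_in (@cs_lin _ S) (@cs_closed _ S) (cs_zero S) y))).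

Lemma sub_prjE y : sub_inc (sub_prj y) = proj (@cs_lin _ S) (@cs_closed _ S) (cs_zero S) y.
Proof. by rewrite /sub_prj; case: cid. Qed.

Lemma sub_prjK : cancel sub_inc sub_prj.
Proof. by move=> x; apply: sub_inc_inj; rewrite sub_prjE proj_id //; exact: sub_inc_in. Qed.

Lemma sub_incK y : cs_set S y -> sub_inc (sub_prj y) = y.
Proof. by move=> Sy; rewrite sub_prjE proj_id. Qed.

End ClosedSubspace.

(** * The completion of the graded algebra *)

Section FiniteDegree.
Variables (R : realType) (P : planar_data R).
Hypothesis hP : is_planar_algebra P.
Implicit Types (n m k j l : nat).

Lemma pa_scalarD (c : R[i]) (x y : P 0%N) : pa_scalar (c *: x + y) = c * pa_scalar x + pa_scalar y.
Proof. by rewrite /pa_scalar linearP. Qed.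

(** The bilinear companion of the inner product. It is symmetric, and identities between diagrams
    apply to it without tracking the involution. *)
Definition pa_pair n (a b : P n) : R[i] := pa_scalar (pa_starj n 0 a b).

Lemma pa_pairPl n c (a a' b : P n) : pa_pair (c *: a + a') b = c * pa_pair a b + pa_pair a' b.
Proof. by rewrite /pa_pair (pa_starjPl hP) ?pa_scalarD // addnn. Qed.

Lemma pa_pairPr n c (a b b' : P n) : pa_pair a (c *: b + b') = c * pa_pair a b + pa_pair a b'.
Proof. by rewrite /pa_pair (pa_starjPr hP) ?pa_scalarD // addnn. Qed.

Lemma pa_pairC n (a b : P n) : pa_pair a b = pa_pair b a.
Proof. by rewrite /pa_pair (starj_trace hP). Qed.

Lemma pa_ipE n (a b : P n) : pa_ip a b = pa_pair a (pa_star b).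
Proof. by []. Qed.

Lemma pa_pair_eq0 n (a : P n) : (forall b, pa_pair a b = 0) -> a = 0.
Proof. by move=> h; apply: (pa_ip_eq0 hP); rewrite pa_ipE h. Qed.

(** A closed diagram on three disks may be read starting from any of them. Its strings number [j]
    between [a] and [b], [n - j] between [a] and [c], and [m - j] between [b] and [c]. *)
Lemma pa_pair_starj n m l j (a : P n) (b : P m) (c : P l) :
  (j <= n)%N -> (j <= m)%N -> (l + j.*2 = n + m)%N ->
  pa_pair (pa_starj j l a b) c = pa_pair b (pa_starj (n - j) m c a).
Proof.
move=> h1 h2 h3; rewrite pa_pairC [RHS]pa_pairC /pa_pair; congr pa_scalar.
have h := @starjA _ _ hP l n m 0 m l (n - j) (m - j) j c a b.
have [e1 [e2 e3]] : (m - j + j = m)%N /\ (n - j + j = n)%N /\ (n - j + (m - j) = l)%N by lia.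
by rewrite e1 e2 e3 in h; rewrite h //; lia.
Qed.

Lemma pa_ip_starj n m l j (a : P n) (b : P m) (c : P l) :
  (j <= n)%N -> (j <= m)%N -> (l + j.*2 = n + m)%N ->
  pa_ip (pa_starj j l a b) c = pa_ip b (pa_starj (n - j) m (pa_star a) c).
Proof.
move=> h1 h2 h3; rewrite !pa_ipE pa_pair_starj // (pa_star_starj hP) ?(pa_starK hP) //; lia.
Qed.

(** The map sending [x] to its pairings with a basis is injective, as the pairing is nondegenerate,
    hence surjective for reasons of dimension. *)
Lemma pa_riesz n (f : P n -> R[i]) : (forall c a b, f (c *: a + b) = c * f a + f b) ->
  exists x, forall a, f a = pa_pair a x.
Proof.
move=> lf; pose N := \dim {: P n}; pose e := vbasis {: P n}.
pose g (x : P n) : 'rV[R[i]]_N := \row_i pa_pair e`_i x.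
have lg : linear g.
  by move=> c x y; apply/rowP => i; rewrite !mxE pa_pairPr.
pose G : 'Hom(P n, 'rV[R[i]]_N) := linfun (HB.pack_for {linear P n -> 'rV[R[i]]_N} g (GRing.isLinear.Build _ _ _ _ g lg)).
have GE x : G x = g x by rewrite lfunE.
have span a : a = \sum_(i < N) coord e i a *: e`_i.
  by rewrite {1}(coord_vbasis (memvf a)).
have pair_span a x : pa_pair a x = \sum_(i < N) coord e i a * pa_pair e`_i x.
  rewrite {1}[a]span; elim/big_rec2: _ => [|i y z _ <-]; last by rewrite pa_pairPl.
  by have := pa_pairPl (-1) (0 : P n) 0 x; rewrite scaler0 addr0 mulN1r addNr.
have ker0 : lker G = 0%VS.
  apply/eqP/lker0P => x y; rewrite !GE => gxy.
  apply/eqP; rewrite -subr_eq0; apply/eqP/pa_pair_eq0 => b.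
  rewrite pa_pairC -[x - y]addrC -scaleN1r pa_pairPr mulN1r addrC; apply/eqP; rewrite subr_eq0; apply/eqP.
  rewrite !pair_span; apply: eq_bigr => i _; congr (_ * _).
  by have := congr1 (fun v : 'rV[R[i]]_N => v ord0 i) gxy; rewrite !mxE.
have full : limg G = fullv.
  apply/eqP; rewrite eqEdim subvf limg_dim_eq ?ker0 ?capv0 //.
  by rewrite /= [X in (X <= _)%N]dimvf /dim /= mul1n.
have /memv_imgP[x _ xE] : (\row_i f e`_i : 'rV[R[i]]_N) \in limg G by rewrite full memvf.
exists x => a; rewrite pair_span {1}[a]span.
have fs (r : seq 'I_N) : f (\sum_(i <- r) coord e i a *: e`_i) = \sum_(i <- r) coord e i a * f e`_i.
  elim/big_rec2: _ => [|i y z _ <-]; last by rewrite lf.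
  by have := lf (-1) 0 0; rewrite scaler0 addr0 mulN1r addNr.
rewrite fs; apply: eq_bigr => i _; congr (_ * _).
by have := congr1 (fun v : 'rV[R[i]]_N => v ord0 i) xE; rewrite GE !mxE.
Qed.

Lemma pa_starjDl n m j l (a a' : P n) (b : P m) : (j <= n)%N -> (j <= m)%N -> (l + j.*2 = n + m)%N ->
  pa_starj j l (a + a') b = pa_starj j l a b + pa_starj j l a' b.
Proof. by move=> h1 h2 h3; rewrite -[a]scale1r (pa_starjPl hP) // !scale1r. Qed.

Lemma pa_starj0l n m j l (b : P m) : (j <= n)%N -> (j <= m)%N -> (l + j.*2 = n + m)%N ->
  pa_starj j l (0 : P n) b = 0.
Proof.
move=> h1 h2 h3; have := pa_starjPl hP (-1) (0 : P n) 0 b h1 h2 h3.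
by rewrite scaler0 addr0 scaleN1r addNr.
Qed.

Lemma pa_starjZl n m j l c (a : P n) (b : P m) : (j <= n)%N -> (j <= m)%N -> (l + j.*2 = n + m)%N ->
  pa_starj j l (c *: a) b = c *: pa_starj j l a b.
Proof. by move=> h1 h2 h3; rewrite -[c *: a]addr0 (pa_starjPl hP) // pa_starj0l // addr0. Qed.

Lemma pa_starj0r n m j l (a : P n) : (j <= n)%N -> (j <= m)%N -> (l + j.*2 = n + m)%N ->
  pa_starj j l a (0 : P m) = 0.
Proof.
move=> h1 h2 h3; have := pa_starjPr hP (-1) a (0 : P m) 0 h1 h2 h3.
by rewrite scaler0 addr0 scaleN1r addNr.
Qed.

Lemma pa_starjZr n m j l c (a : P n) (b : P m) : (j <= n)%N -> (j <= m)%N -> (l + j.*2 = n + m)%N ->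
  pa_starj j l a (c *: b) = c *: pa_starj j l a b.
Proof. by move=> h1 h2 h3; rewrite -[c *: b]addr0 (pa_starjPr hP) // pa_starj0r // addr0. Qed.

Lemma pa_starj_suml n m j l (I : Type) (r : seq I) (F : I -> P n) (b : P m) :
  (j <= n)%N -> (j <= m)%N -> (l + j.*2 = n + m)%N ->
  pa_starj j l (\sum_(i <- r) F i) b = \sum_(i <- r) pa_starj j l (F i) b.
Proof. by move=> h1 h2 h3; elim/big_rec2: _ => [|i y z _ <-]; rewrite ?pa_starj0l ?pa_starjDl. Qed.

Lemma pa_starj_sumr n m j l (I : Type) (r : seq I) (F : I -> P m) (a : P n) :
  (j <= n)%N -> (j <= m)%N -> (l + j.*2 = n + m)%N ->
  pa_starj j l a (\sum_(i <- r) F i) = \sum_(i <- r) pa_starj j l a (F i).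
Proof.
move=> h1 h2 h3; elim/big_rec2: _ => [|i y z _ <-]; first by rewrite pa_starj0r.
by rewrite -[F i]scale1r (pa_starjPr hP) // !scale1r.
Qed.

Lemma pa_star0 n : pa_star (0 : P n) = 0.
Proof. by have := pa_star_antilinear hP (-1) (0 : P n) 0; rewrite scaler0 addr0 rmorphN rmorph1 scaleN1r addNr. Qed.

Lemma pa_ip_star n (a b : P n) : pa_ip (pa_star a) (pa_star b) = pa_ip b a.
Proof. by rewrite !pa_ipE (pa_starK hP) pa_pairC. Qed.

End FiniteDegree.

Section Completion.
Variables (R : realType) (P : planar_data R).
Hypothesis hP : is_planar_algebra P.
Variables (H : hilbert R) (iota : (forall n : nat, P n) -> H).
Hypothesis hH : is_completion iota.
Implicit Types (n m k j l : nat).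

Definition deg n (x : P n) : H := iota (gr_hom x).

Lemma gr_homP n (x : P n) : Gr (gr_hom x).
Proof.
exists n.+1 => k nk; rewrite /gr_hom dfwithout //.
by apply: contraTneq nk => ->; rewrite ltnn.
Qed.

Lemma gr_hom_in n (x : P n) : gr_hom x n = x.
Proof. by rewrite /gr_hom dfwithin. Qed.

Lemma gr_hom_out n (x : P n) k : n != k -> gr_hom x k = 0.
Proof. by move=> nk; rewrite /gr_hom dfwithout. Qed.

Lemma Gr_lin (c : R[i]) (a b : forall n, P n) : Gr a -> Gr b -> Gr (fun n => c *: a n + b n).
Proof.
move=> [N hN] [M hM]; exists (maxn N M) => n; rewrite geq_max => /andP[nN nM].
by rewrite hN // hM // scaler0 addr0.
Qed.

Lemma iota_lin (c : R[i]) (a b : forall n, P n) : Gr a -> Gr b ->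
  iota (fun n => c *: a n + b n) = c *: iota a + iota b.
Proof. by have [h _ _] := hH; apply: h. Qed.

Lemma Gr0 : Gr (fun n => 0 : P n).
Proof. by exists 0%N. Qed.

Lemma iota0 : iota (fun n => 0 : P n) = 0.
Proof.
have := iota_lin (-1) Gr0 Gr0; rewrite scaleN1r addNr => <-; congr iota.
by apply: functional_extensionality_dep => n; rewrite scaler0 addr0.
Qed.

Lemma iota_sum (I : Type) (r : seq I) (F : I -> forall n, P n) : (forall i, Gr (F i)) ->
  Gr (fun n => \sum_(i <- r) F i n) /\ iota (fun n => \sum_(i <- r) F i n) = \sum_(i <- r) iota (F i).
Proof.
move=> GF; elim: r => [|i r [G E]].
  have -> : (fun n => \sum_(i <- [::]) F i n) = (fun n => 0).
    by apply: functional_extensionality_dep => n; rewrite big_nil.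
  by rewrite big_nil iota0; split=> //; exact: Gr0.
have -> : (fun n => \sum_(i <- i :: r) F i n) = (fun n => 1 *: F i n + \sum_(i <- r) F i n).
  by apply: functional_extensionality_dep => n; rewrite big_cons scale1r.
by split; [exact: Gr_lin|rewrite iota_lin // big_cons scale1r E].
Qed.

Lemma degP n c (x y : P n) : deg (c *: x + y) = c *: deg x + deg y.
Proof.
rewrite /deg -iota_lin; [|exact: gr_homP|exact: gr_homP]; congr iota.
apply: functional_extensionality_dep => k; have [nk|nk] := eqVneq n k.
  by move: x y; rewrite nk => x y; rewrite !gr_hom_in.
by rewrite !gr_hom_out // scaler0 addr0.
Qed.

Lemma deg0 n : deg (0 : P n) = 0.
Proof. by have := degP (-1) (0 : P n) 0; rewrite scaler0 addr0 scaleN1r addNr. Qed.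

Lemma degZ n c (x : P n) : deg (c *: x) = c *: deg x.
Proof. by rewrite -[c *: x]addr0 degP deg0 addr0. Qed.

Lemma degD n (x y : P n) : deg (x + y) = deg x + deg y.
Proof. by rewrite -[x]scale1r degP !scale1r. Qed.

Lemma deg_sum n (I : Type) (r : seq I) (F : I -> P n) :
  deg (\sum_(i <- r) F i) = \sum_(i <- r) deg (F i).
Proof. by elim/big_rec2: _ => [|i y z _ <-]; rewrite ?deg0 ?degD. Qed.

Lemma deg_decomp (b : forall n, P n) N : (forall n, (N <= n)%N -> b n = 0) ->
  iota b = \sum_(m < N) deg (b m).
Proof.
move=> hN; have [_ <-] := iota_sum (index_enum 'I_N) (F := fun i => gr_hom (b i)) (fun i => gr_homP _).
congr iota; apply: functional_extensionality_dep => k; have [kN|kN] := ltnP k N.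
  rewrite (bigD1 (Ordinal kN)) //= gr_hom_in big1 ?addr0 // => i ik.
  by rewrite gr_hom_out //; apply: contraNneq ik => ik; apply/eqP/val_inj.
rewrite hN // big1 // => i _; rewrite gr_hom_out //.
by apply: contraTneq kN => <-; rewrite -ltnNge.
Qed.

Lemma pa_ip0l n (b : P n) : pa_ip 0 b = 0.
Proof. by have := pa_pairPl hP (-1) 0 0 (pa_star b); rewrite scaler0 addr0 mulN1r addNr. Qed.

Lemma deg_ip n (x y : P n) : ip (deg x) (deg y) = pa_ip x y.
Proof.
have [_ E _] := hH; rewrite E; [|exact: gr_homP|exact: gr_homP].
rewrite /gr_ip -(fsbig_widen [set n] setT) //=.
  by rewrite fsbig_set1 !gr_hom_in.
by move=> k [_ /= /eqP nk]; rewrite gr_hom_out ?pa_ip0l // eq_sym.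
Qed.

Lemma deg_orth n m (x : P n) (y : P m) : n != m -> ip (deg x) (deg y) = 0.
Proof.
move=> nm; have [_ E _] := hH; rewrite E; [|exact: gr_homP|exact: gr_homP].
rewrite /gr_ip fsbig1 // => k _; have [nk|nk] := eqVneq n k; last by rewrite gr_hom_out ?pa_ip0l.
have mk : m != k by rewrite -nk eq_sym.
rewrite (gr_hom_out y mk) pa_ipE pa_star0 // /pa_pair.
by have := pa_pairPr hP (-1) (gr_hom x k) 0 0; rewrite scaler0 addr0 mulN1r addNr.
Qed.

Lemma deg_inj n (x : P n) : deg x = 0 -> x = 0.
Proof. by move=> h; apply: (pa_ip_eq0 hP); rewrite -deg_ip h ip0l. Qed.

Definition homogeneous : set H := [set v | exists n (x : P n), v = deg x].

Lemma deg_total : closure (hspan homogeneous) = setT.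
Proof.
have [_ _ dH] := hH; apply/seteqP; split=> // x _.
have : closure (iota @` Gr (P := P)) x by rewrite dH.
apply: closure_subset => _ [b [N hN] <-]; rewrite (deg_decomp hN).
exists N, (fun _ => 1), (fun i => deg (b i)); split; first by move=> i; exists i, (b i).
by apply: eq_bigr => i _; rewrite scale1r.
Qed.

Lemma deg_ext (K : hilbert R) (X Y : H -> K) : bop X -> bop Y ->
  (forall n (x : P n), X (deg x) = Y (deg x)) -> forall v, X v = Y v.
Proof. by move=> bX bY XY; apply: (bop_ext deg_total bX bY) => _ [n [x ->]]. Qed.

Lemma deg_orth_ext v : (forall n (x : P n), ip v (deg x) = 0) -> v = 0.
Proof. by move=> h; apply: (total_orth deg_total) => _ [n [x ->]]. Qed.

End Completion.

(* Iterating, [t_0^(2^k) <= t_k B^(2^k - 1)] while [u_k] is at most [(K u_0)^(2^k) / K]; now let [k]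
   tend to infinity. *)
Lemma squaring_bound (R : realType) (t u : nat -> R) (B G K : R) :
  0 < K -> 0 <= B -> (forall k, 0 <= t k) -> (forall k, 0 <= u k) ->
  (forall k, t k ^+ 2 <= t k.+1 * B) -> (forall k, t k <= G * u k) ->
  (forall k, u k.+1 <= K * u k ^+ 2) -> t 0%N <= K * u 0%N * B.
Proof.
move=> K0 B0 t0 u0 tt tu uu; rewrite leNgt; apply/negP => lt.
have BP : 0 < B.
  rewrite lt_def B0 andbT; apply: contraTneq lt => BE; rewrite BE mulr0 -leNgt.
  by have := tt 0%N; rewrite BE mulr0 => h; have := sqr_ge0 (t 0%N); have := t0 0%N; nra.
pose rr k := t k / B; pose w k := K * u k.
have rP k : rr 0%N ^+ (2 ^ k) <= rr k.
  elim: k => [|k IH]; first by rewrite expr1.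
  rewrite expnSr exprM; apply: le_trans (_ : rr k ^+ 2 <= _).
    by rewrite ler_pXn2r ?nnegrE ?exprn_ge0 ?divr_ge0.
  rewrite /rr expr_div_n ler_pdivrMr ?exprn_gt0 //.
  by have -> : t k.+1 / B * B ^+ 2 = t k.+1 * B by field; rewrite gt_eqF.
have wP k : w k <= w 0%N ^+ (2 ^ k).
  elim: k => [|k IH]; first by rewrite expr1.
  rewrite expnSr exprM; apply: le_trans (_ : w k ^+ 2 <= _); last first.
    by rewrite ler_pXn2r ?nnegrE ?exprn_ge0 ?mulr_ge0 // ltW.
  by rewrite /w exprMn expr2 -mulrA ler_pM2l // uu.
have w0 : 0 <= w 0%N by rewrite mulr_ge0 // ltW.
have lt' : w 0%N < rr 0%N by rewrite ltr_pdivlMr.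
have r0 : 0 < rr 0%N by apply: le_lt_trans lt'.
pose C := G / (K * B).
have main k : rr 0%N ^+ (2 ^ k) <= C * w 0%N ^+ (2 ^ k).
  apply: le_trans (rP k) _; have [C0|C0] := leP 0 C.
    apply: le_trans (_ : C * w k <= _); last by rewrite ler_wpM2l.
    by rewrite /rr ler_pdivrMr // /C /w; apply: le_trans (tu k) _; rewrite le_eqVlt; apply/orP; left; apply/eqP; field; lra.
  exfalso; have : t k <= 0.
    have KB : 0 < K * B by rewrite mulr_gt0.
    have GE : G = C * (K * B) by rewrite /C divfK // gt_eqF.
    by apply: le_trans (tu k) _; rewrite mulr_le0_ge0 // ltW // GE nmulr_rlt0.
  by have := rP k; rewrite /rr => h h2; have : 0 < t k / B := lt_le_trans (exprn_gt0 _ r0) h; rewrite pmulr_lgt0 ?invr_gt0 //; lra.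
have q01 : 0 <= w 0%N / rr 0%N < 1 by rewrite divr_ge0 ?(ltW r0) //= ltr_pdivrMr // mul1r.
have [N hN] := archi_geom C q01 ltr01.
have := hN (2 ^ N)%N (ltnW (ltn_expl N (isT : 1 < 2)%N)).
rewrite ltNge expr_div_n mulrA => /negP; apply.
by rewrite ler_pdivlMr ?exprn_gt0 // mul1r.
Qed.

(** * Boundedness of left multiplication *)

Section LeftMultiplication.
Variables (R : realType) (P : planar_data R).
Hypothesis hP : is_planar_algebra P.
Variables (H : hilbert R) (iota : (forall n : nat, P n) -> H).
Hypothesis hH : is_completion iota.
Implicit Types (n m k j l : nat).

Notation deg := (deg iota).

Lemma coord_bound n (i : 'I_(\dim {: P n})) :
  exists2 C : R, 0 <= C & forall y : P n, nrm (coord (vbasis {: P n}) i y) <= C * nrm (deg y).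
Proof.
have [|x hx] := pa_riesz hP (n := n) (f := coord (vbasis {: P n}) i).
  by move=> c a b; rewrite linearP.
exists (nrm (deg (pa_star x))) => [|y]; first exact: nrm_ge0.
by rewrite hx -{1}(pa_starK hP x) -pa_ipE -(deg_ip hP hH) mulrC cauchy_schwarz.
Qed.

(** The space of degree [2 j] is finite dimensional and the product bilinear. The constant depends
    on [j] alone, which makes it available uniformly along the iteration in [starj_bound]. *)
Lemma self_product_bound j :
  exists2 K : R, 0 < K & forall y : P (j.*2)%N, nrm (deg (pa_starj j j.*2 y y)) <= K * nrm (deg y) ^+ 2.
Proof.
set N := \dim {: P j.*2}; pose e := vbasis {: P j.*2}.
have ex i : exists c : R, 0 <= c /\ forall y : P j.*2, nrm (coord e i y) <= c * nrm (deg y).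
  by have [c c0 hc] := coord_bound (n := j.*2) i; exists c.
pose C i := projT1 (cid (ex i)).
have [C0 hC] : (forall i, 0 <= C i) /\ forall i y, nrm (coord e i y) <= C i * nrm (deg y).
  by split=> i; have [] := projT2 (cid (ex i)).
pose K := \sum_(i < N) \sum_(k < N) C i * C k * nrm (deg (pa_starj j j.*2 e`_i e`_k)).
have K0 : 0 <= K by do 2!(apply: sumr_ge0 => ? _); rewrite !mulr_ge0 // nrm_ge0.
exists (K + 1) => [|y]; first by rewrite ltr_wpDl.
have jj : (j.*2 + j.*2 = j.*2 + j.*2)%N by [].
have j2 : (j <= j.*2)%N by rewrite -addnn leq_addr.
have yE : y = \sum_(i < N) coord e i y *: e`_i by rewrite {1}(coord_vbasis (memvf y)).
apply: le_trans (_ : K * nrm (deg y) ^+ 2 <= _); last by rewrite ler_wpM2r ?sqr_ge0 // lerDl.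
rewrite {1}yE (pa_starj_suml hP) // (deg_sum hH); apply: le_trans (nrm_sum _ _ _) _.
rewrite /K mulr_suml; apply: ler_sum => i _.
rewrite [X in pa_starj _ _ _ X]yE (pa_starj_sumr hP) // (deg_sum hH); apply: le_trans (nrm_sum _ _ _) _.
rewrite mulr_suml; apply: ler_sum => k _.
rewrite (pa_starjZl hP) // (pa_starjZr hP) // !(degZ hH) !nrmZ mulrA.
rewrite [X in _ <= X]mulrAC ler_wpM2r ?nrm_ge0 //.
rewrite expr2 mulrACA; apply: ler_pM; rewrite ?nrm_ge0 //; exact: hC.
Qed.

(** The squared norm of [pa_starj j l a b] is the matrix coefficient at [b] of [X], an element of
    degree [2 j] built from [a] and its adjoint. On degree [2 j] the product with [j] strings is
    associative and acts on [b]. Cauchy-Schwarz replaces [y k] by its square [y k.+1], as in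
    [squaring_bound]. Only the constant [G] there depends on [b] beyond its norm, and it disappears
    in the limit. *)
Lemma starj_bound n j (a : P n) : (j <= n)%N ->
  exists2 C : R, 0 <= C & forall m l (b : P m), (j <= m)%N -> (l + j.*2 = n + m)%N ->
    nrm (deg (pa_starj j l a b)) <= C * nrm (deg b).
Proof.
move=> jn; have [K K0 hK] := self_product_bound j.
pose X := pa_starj (n - j) j.*2 (pa_star a) a.
have XS : pa_star X = X.
  by rewrite /X (pa_star_starj hP) ?(pa_starK hP) //; lia.
have C0 : 0 <= K * nrm (deg X) by rewrite mulr_ge0 ?nrm_ge0 // ltW.
exists (Num.sqrt (K * nrm (deg X))) => [|m l b jm lE]; first exact: sqrtr_ge0.
rewrite -(ler_pXn2r (n := 2)) ?nnegrE ?nrm_ge0 ?mulr_ge0 ?sqrtr_ge0 ?nrm_ge0 //.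
rewrite exprMn sqr_sqrtr //.
have assoc d (y : P d) (z : P n) : (n - j <= d)%N -> (d + n = j.*2 + (n - j).*2)%N -> 
    pa_starj j m (pa_starj (n - j) j.*2 y z) b = pa_starj (n - j) m y (pa_starj j l z b).
  move=> h1 h2; have := @starjA _ _ hP d n m m j.*2 l (n - j) 0 j y z b.
  by rewrite !add0n !addn0 => -> //; lia.
have sq d j' l' (y : P d) : (j' <= d)%N -> (j' <= m)%N -> (l' + j'.*2 = d + m)%N ->
    ((nrm (deg (pa_starj j' l' y b)) ^+ 2)%:C)%C
    = ip (deg b) (deg (pa_starj (d - j') m (pa_star y) (pa_starj j' l' y b))).
  by move=> h1 h2 h3; rewrite -ip_nrm !(deg_ip hP hH) (pa_ip_starj hP).
pose y := fix y k : P j.*2 := if k is k'.+1 then pa_starj j j.*2 (y k') (y k') else X.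
have yS k : pa_star (y k) = y k.
  elim: k => [|k IH] /=; first exact: XS.
  by rewrite (pa_star_starj hP) ?IH // -addnn ?leq_addr.
pose t k := nrm (ip (deg b) (deg (pa_starj j m (y k) b))).
have j2 : (j <= j.*2)%N by rewrite -addnn leq_addr.
have sqy k : nrm (deg (pa_starj j m (y k) b)) ^+ 2 = t k.+1.
  apply: (@complexI R); rewrite sq //; last by lia.
  have -> : pa_starj (j.*2 - j) m (pa_star (y k)) (pa_starj j m (y k) b) = pa_starj j m (y k.+1) b.
    rewrite yS (_ : j.*2 - j = j)%N; last lia.
    have := @starjA _ _ hP j.*2 j.*2 m m j.*2 m j 0 j (y k) (y k) b.
    by rewrite !add0n !addn0 => -> //; lia.
  rewrite /t -nrmE ger0_norm // -[y k.+1]yS.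
  have := sq j.*2 j m (y k) j2 jm; rewrite (_ : j.*2 - j = j)%N; last lia.
  have -> : pa_starj j m (pa_star (y k)) (pa_starj j m (y k) b) = pa_starj j m (pa_star (y k.+1)) b.
    rewrite !yS; have := @starjA _ _ hP j.*2 j.*2 m m j.*2 m j 0 j (y k) (y k) b.
    by rewrite !add0n !addn0 => -> //; lia.
  by move=> <-; [rewrite lecR sqr_ge0|lia].
have tE : nrm (deg (pa_starj j l a b)) ^+ 2 = t 0%N.
  rewrite /t -[y 0%N]/X /X (assoc n) //; [|lia|lia].
  by rewrite -(sq n j l a) // nrm_real ger0_norm // sqr_ge0.
rewrite tE; apply: (squaring_bound (u := fun k => nrm (deg (y k)))
  (G := nrm (deg (pa_star (pa_starj (m - j) j.*2 b (pa_star b)))))) => //; [exact: sqr_ge0|move=> k|move=> k|move=> k|move=> k|move=> k].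
- exact: nrm_ge0.
- exact: nrm_ge0.
- rewrite -sqy /t mulrC -exprMn ler_pXn2r ?nnegrE ?mulr_ge0 ?nrm_ge0 //; exact: cauchy_schwarz.
(* Bending strings turns the matrix coefficient into an inner product of [y k] with a fixed element
   built from [b] and its adjoint, whose norm is [G]. *)
- rewrite /t ip_conj nrm_conj (deg_ip hP hH) pa_ipE /pa_pair.
  have -> : pa_starj m 0 (pa_starj j m (y k) b) (pa_star b)
      = pa_starj j.*2 0 (y k) (pa_starj (m - j) j.*2 b (pa_star b)).
    have := @starjA _ _ hP j.*2 m m 0 m j.*2 j j (m - j) (y k) b (pa_star b).
    by rewrite addnn subnKC // => -> //; lia.
  rewrite -{1}[pa_starj (m - j) _ _ _](pa_starK hP) -/(pa_pair _ _) -pa_ipE -(deg_ip hP hH) mulrC.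
  exact: cauchy_schwarz.
- exact: hK.
Qed.

Lemma orth_sum_nrm N (v : nat -> H) : (forall i k, i != k -> ip (v i) (v k) = 0) ->
  nrm (\sum_(i < N) v i) ^+ 2 = \sum_(i < N) nrm (v i) ^+ 2.
Proof.
move=> ov; elim: N => [|N IH]; first by rewrite !big_ord0 nrm0 expr0n.
rewrite !big_ord_recr /= pythagoras ?IH // ip_suml big1 // => i _.
by apply: ov; rewrite ltn_eqF.
Qed.

(** With [j] fixed, different degrees [m] have different target degrees [n + m - 2 j], so the images
    are orthogonal and a bound in each degree suffices. Outside the range [j <= n] the operator is a
    default value. *)
Lemma lmul_ex n (a : P n) j : exists X : H -> H, bop X /\ ((j <= n)%N ->
  (forall m l (b : P m), (j <= m)%N -> (l + j.*2 = n + m)%N -> X (deg b) = deg (pa_starj j l a b)) /\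
  (forall m (b : P m), (m < j)%N -> X (deg b) = 0)).
Proof.
have [jn|jn] := leqP j n; last by exists (fun _ => 0); split=> //; exact: bop0.
have [C C0 hC] := starj_bound a jn.
pose F m (b : P m) : H := if (j <= m)%N then deg (pa_starj j (n + m - j.*2) a b) else 0.
have lF m c (b b' : P m) : F m (c *: b + b') = c *: F m b + F m b'.
  rewrite /F; case: ifP => jm; last by rewrite scaler0 addr0.
  by rewrite (pa_starjPr hP) ?(degP hH) //; lia.
have F0 m : F m 0 = 0.
  by have := lF m (-1) 0 0; rewrite scaler0 addr0 scaleN1r addNr.
have bF m (b : P m) : nrm (F m b) <= C * nrm (deg b).
  rewrite /F; case: ifP => jm; last by rewrite nrm0 mulr_ge0 ?nrm_ge0.
  by apply: hC => //; lia.
have oF m m' (b : P m) (b' : P m') : m != m' -> ip (F m b) (F m' b') = 0.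
  move=> mm; rewrite /F; case: ifP => jm; last by rewrite ip0l.
  case: ifP => jm'; last by rewrite ip0r.
  by apply: (deg_orth hP hH); apply: contraNneq mm => h; apply/eqP; lia.
pose sums (f : forall m, P m -> H) (b : forall m, P m) N := \sum_(m < N) f m (b m).
have widen (f : forall m, P m -> H) b N M : (forall m, f m 0 = 0) -> (forall m, (N <= m)%N -> b m = 0) ->
    (N <= M)%N -> sums f b M = sums f b N.
  move=> f0 b0 NM; rewrite /sums (big_ord_widen M (fun m => f m (b m)) NM) [RHS]big_mkcond.
  by apply: eq_bigr => i _; case: ltnP => // h; rewrite b0 ?f0.
pose G x y := exists b N, [/\ forall m, (N <= m)%N -> b m = 0, x = sums (fun m b => deg b) b N & y = sums F b N].
have deg00 m : deg (0 : P m) = 0 by exact: deg0.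
have [|||X bX XG] := @bop_extend _ H H G C.
- move=> c x y x' y' [b [N [b0 -> ->]]] [b' [N' [b0' -> ->]]].
  exists (fun m => c *: b m + b' m), (maxn N N'); split.
  + by move=> m; rewrite geq_max => /andP[h h']; rewrite b0 // b0' // scaler0 addr0.
  + rewrite -(widen _ b N (maxn N N')) ?leq_maxl // -(widen _ b' N' (maxn N N')) ?leq_maxr //.
    by rewrite /sums scaler_sumr -big_split; apply: eq_bigr => i _; rewrite (degP hH).
  + rewrite -(widen _ b N (maxn N N')) ?leq_maxl // -(widen _ b' N' (maxn N N')) ?leq_maxr //.
    by rewrite /sums scaler_sumr -big_split; apply: eq_bigr => i _; rewrite lF.
- move=> x y [b [N [b0 -> ->]]].
  rewrite -(ler_pXn2r (n := 2)) ?nnegrE ?nrm_ge0 ?mulr_ge0 ?nrm_ge0 // exprMn.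
  rewrite (orth_sum_nrm N (v := fun m => F m (b m))); last by move=> i k; apply: oF.
  rewrite (orth_sum_nrm N (v := fun m => deg (b m))); last by move=> i k; apply: (deg_orth hP hH).
  rewrite mulr_sumr; apply: ler_sum => i _; rewrite -exprMn ler_pXn2r ?nnegrE ?nrm_ge0 ?mulr_ge0 ?nrm_ge0 //.
- move=> x; have [_ _ dH] := hH; have : closure (iota @` Gr (P := P)) x by rewrite dH.
  apply: closure_subset => _ [b [N b0] <-]; exists (sums F b N), b, N; split=> //.
  exact: (deg_decomp hH b0).
have XF m (b : P m) : X (deg b) = F m b.
  apply: XG; exists (gr_hom b), m.+1; split.
  - by move=> k mk; rewrite gr_hom_out // ltn_eqF.
  - rewrite /sums big_ord_recr /= gr_hom_in big1 ?add0r // => i _.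
    by rewrite gr_hom_out ?deg00 // eq_sym ltn_eqF.
  - rewrite /sums big_ord_recr /= gr_hom_in big1 ?add0r // => i _.
    by rewrite gr_hom_out ?F0 // eq_sym ltn_eqF.
exists X; split=> // _; split.
- move=> m l b jm lE; rewrite XF /F jm; have -> : (n + m - j.*2 = l)%N by lia.
  by [].
- by move=> m b mj; rewrite XF /F leqNgt mj.
Qed.

Definition lmul n (a : P n) j : H -> H := projT1 (cid (lmul_ex a j)).

Lemma lmul_bop n (a : P n) j : bop (lmul a j).
Proof. by rewrite /lmul; case: cid => X []. Qed.

Lemma lmul_deg n (a : P n) j m l (b : P m) : (j <= n)%N -> (j <= m)%N -> (l + j.*2 = n + m)%N ->
  lmul a j (deg b) = deg (pa_starj j l a b).
Proof. by move=> jn; rewrite /lmul; case: cid => X [bX hX] /=; have [h _] := hX jn; exact: h. Qed.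

Lemma lmul_deg0 n (a : P n) j m (b : P m) : (j <= n)%N -> (m < j)%N -> lmul a j (deg b) = 0.
Proof. by move=> jn; rewrite /lmul; case: cid => X [bX hX] /=; have [_ h] := hX jn; exact: h. Qed.

Lemma adjoint_on_deg (X Y : H -> H) : bop X -> bop Y ->
  (forall n m (b : P n) (c : P m), ip (X (deg b)) (deg c) = ip (deg b) (Y (deg c))) -> is_adjoint X Y.
Proof.
move=> bX bY XY; have [Z [bZ XZ]] := adjoint_ex bX.
suff ZY y : Z y = Y y by move=> x y; rewrite XZ ZY.
apply: (deg_ext hH bZ bY) => m c; apply/eqP; rewrite -subr_eq0; apply/eqP.
apply: (deg_orth_ext hH) => n b; rewrite ipBl; apply/eqP; rewrite subr_eq0; apply/eqP.
by rewrite ip_conj -XZ XY -ip_conj.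
Qed.

Lemma lmul_adjoint n (a : P n) j : (j <= n)%N -> is_adjoint (lmul a j) (lmul (pa_star a) (n - j)).
Proof.
move=> jn; apply: adjoint_on_deg; [exact: lmul_bop|exact: lmul_bop|move=> m l b c].
have jn' : (n - j <= n)%N by lia.
have [lE|lE] := eqVneq (l + j.*2)%N (n + m)%N.
  have [jm|jm] := leqP j m; last first.
    by rewrite (lmul_deg0 _ b jn jm) (lmul_deg0 _ c jn') ?ip0l ?ip0r //; lia.
  rewrite (lmul_deg a b jn jm lE) (@lmul_deg _ (pa_star a) _ _ m c) //; [|lia|lia].
  by rewrite !(deg_ip hP hH) (pa_ip_starj hP).
have [jm|jm] := leqP j m; last first.
  rewrite (lmul_deg0 _ b jn jm) ip0l; have [jl|jl] := leqP (n - j) l.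
    rewrite (@lmul_deg _ (pa_star a) _ _ (l + j.*2 - n) c) //; last by lia.
    by rewrite (deg_orth hP hH) //; apply: contraNneq lE => ?; apply/eqP; lia.
  by rewrite (lmul_deg0 _ c jn' jl) ip0r.
rewrite (@lmul_deg _ a _ _ (n + m - j.*2) b) //; last by lia.
rewrite (deg_orth hP hH); last by apply: contraNneq lE => ?; apply/eqP; lia.
have [jl|jl] := leqP (n - j) l; last by rewrite (lmul_deg0 _ c jn' jl) ip0r.
rewrite (@lmul_deg _ (pa_star a) _ _ (l + j.*2 - n) c) //; last by lia.
by rewrite (deg_orth hP hH) //; apply: contraNneq lE => ?; apply/eqP; lia.
Qed.

End LeftMultiplication.

(** * The left and right representations *)

Section Representation.
Variables (R : realType) (P : planar_data R).
Hypothesis hP : is_planar_algebra P.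
Variables (H : hilbert R) (iota : (forall n : nat, P n) -> H).
Hypothesis hH : is_completion iota.
Implicit Types (n m k j l : nat).

Notation deg := (deg iota).
Notation lmul a j := (lmul hP hH a j).

Lemma conj_ex : exists J : H -> H, [/\ forall c x y, J (c *: x + y) = c^* *: J x + J y,
  forall x, nrm (J x) <= nrm x & forall n (x : P n), J (deg x) = deg (pa_star x)].
Proof.
pose st (b : forall n, P n) n : P n := pa_star (b n).
have Gst b : Gr b -> Gr (st b) by move=> [N hN]; exists N => n /hN; rewrite /st => ->; exact: pa_star0.
pose G x y := exists2 b, Gr b & x = iota b /\ y = iota (st b).
have [|||| J [lJ bJ JG]] := @bounded_extend _ H H (fun c => c^*) G 1.
- by rewrite rmorphN rmorph1.
- move=> c x y x' y' [b Gb [-> ->]] [b' Gb' [-> ->]].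
  exists (fun n => c *: b n + b' n); first exact: Gr_lin.
  rewrite -!(iota_lin hH) //; try exact: Gst; split=> //; congr iota.
  by apply: functional_extensionality_dep => n; rewrite /st (pa_star_antilinear hP).
- move=> x y [b Gb [-> ->]]; rewrite mul1r -(ler_pXn2r (n := 2)) ?nnegrE ?nrm_ge0 // le_eqVlt.
  apply/orP; left; apply/eqP/(@complexI R); rewrite -!ip_nrm.
  have [_ E _] := hH; rewrite !E //; try exact: Gst.
  by rewrite /gr_ip; apply: eq_fsbigr => n _; rewrite pa_ip_star.
- move=> x; have [_ _ dH] := hH; have : closure (iota @` Gr (P := P)) x by rewrite dH.
  by apply: closure_subset => _ [b Gb <-]; exists (iota (st b)), b.
exists J; split=> // [x|n x]; first by rewrite -[nrm x]mul1r.
rewrite (JG _ (iota (st (gr_hom x)))); last by exists (gr_hom x) => //; exact: gr_homP.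
congr iota; apply: functional_extensionality_dep => k; rewrite /st.
have [nk|nk] := eqVneq n k; first by move: x; rewrite nk => x; rewrite !gr_hom_in.
by rewrite !gr_hom_out // pa_star0.
Qed.

Definition conj : H -> H := projT1 (cid conj_ex).

Lemma conjP c x y : conj (c *: x + y) = c^* *: conj x + conj y.
Proof. by rewrite /conj; case: cid => J []. Qed.

Lemma conj_le x : nrm (conj x) <= nrm x.
Proof. by rewrite /conj; case: cid => J []. Qed.

Lemma conj_deg n (x : P n) : conj (deg x) = deg (pa_star x).
Proof. by rewrite /conj; case: cid => J [_ _ h] /=. Qed.

Lemma conj0 : conj 0 = 0.
Proof. by have := conjP (-1) 0 0; rewrite scaler0 addr0 rmorphN rmorph1 scaleN1r addNr. Qed.

Lemma conjD x y : conj (x + y) = conj x + conj y.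
Proof. by have := conjP 1 x y; rewrite rmorph1 !scale1r. Qed.

Lemma conjZ c x : conj (c *: x) = c^* *: conj x.
Proof. by rewrite -[c *: x]addr0 conjP conj0 addr0. Qed.

Lemma conj_sum (I : Type) (r : seq I) (Q : pred I) (F : I -> H) :
  conj (\sum_(i <- r | Q i) F i) = \sum_(i <- r | Q i) conj (F i).
Proof. by elim/big_rec2: _ => [|i y z _ <-]; rewrite ?conj0 ?conjD. Qed.

Lemma bop_conj X : bop X -> bop (conj \o X \o conj).
Proof.
move=> bX; have [lX _] := bX; have [C C0 hC] := bop_pos bX; split.
  by move=> c x y /=; rewrite conjP lX conjP conjCK.
exists C => x /=; apply: le_trans (conj_le _) _; apply: le_trans (hC _) _.
by rewrite ler_pM2l // conj_le.
Qed.

Lemma conjK : involutive conj.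
Proof.
have b1 := bop_conj (bop_id H).
by apply: (deg_ext hH b1 (bop_id H)) => n x /=; rewrite !conj_deg (pa_starK hP).
Qed.

Lemma conj_nrm x : nrm (conj x) = nrm x.
Proof. by apply/le_anti; rewrite conj_le -{1}[x]conjK conj_le. Qed.

(** Preservation of norms gives the real parts by polarisation. The imaginary parts follow on
    replacing [x] by its multiple by the imaginary unit. *)
Lemma conj_ip x y : ip (conj x) (conj y) = ip y x.
Proof.
have re u v : complex.Re (ip (conj u) (conj v)) = complex.Re (ip u v).
  have := nrm_sqD (conj u) (conj v); rewrite -conjD !conj_nrm nrm_sqD.
  by move=> /addrI/mulfI->//; rewrite pnatr_eq0.
have h1 := re x y; have := re ('i%C *: x) y; rewrite conjZ !ipZl => h2; rewrite [RHS]ip_conj.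
move: h1 h2; case: (ip (conj x) (conj y)) (ip x y) => [a b] [c d] /= -> h.
by apply/eqP; rewrite eq_complex /= eqxx /=; apply/eqP; move: h; lra.
Qed.

Lemma conj_lim (u : nat -> H) v : hlim u v -> hlim (fun n => conj (u n)) (conj v).
Proof.
move=> h e /h[N hN]; exists N => n /hN; rewrite -conj_nrm conjD -scaleN1r conjZ.
by rewrite rmorphN rmorph1 scaleN1r.
Qed.

Lemma conj_adjoint X Y : is_adjoint X Y -> is_adjoint (conj \o X \o conj) (conj \o Y \o conj).
Proof. by move=> h x y /=; rewrite -{1}[y]conjK conj_ip -[in RHS](conjK x) conj_ip (adjoint_sym h). Qed.

Definition lrep n (a : P n) (x : H) : H := \sum_(j < n.+1) lmul a j x.

(** Right multiplication is conjugated from left multiplication by the involution, so that its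
    boundedness and its adjoint come for free. *)
Definition rrep n (a : P n) : H -> H := conj \o lrep (pa_star a) \o conj.

Lemma lrep_bop n (a : P n) : bop (lrep a).
Proof. by apply: bop_sum => j _; apply: lmul_bop. Qed.

Lemma rrep_bop n (a : P n) : bop (rrep a).
Proof. exact/bop_conj/lrep_bop. Qed.

Lemma lrep_adjoint n (a : P n) : is_adjoint (lrep a) (lrep (pa_star a)).
Proof.
move=> x y; rewrite ip_suml ip_sumr (reindex_inj rev_ord_inj) /=; apply: eq_bigr => j _.
rewrite lmul_adjoint; last by rewrite subSS leq_subr.
by rewrite subSS subKn // -ltnS.
Qed.

Lemma lrep_deg n (a : P n) m (b : P m) :
  lrep a (deg b) = \sum_(j < n.+1 | (j <= m)%N) deg (pa_starj j (n + m - j.*2) a b).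
Proof.
rewrite [RHS]big_mkcond; apply: eq_bigr => j _; have jn : (j <= n)%N by rewrite -ltnS.
by case: leqP => jm; [rewrite (@lmul_deg _ _ _ _ _ _ _ _ _ _ (n + m - j.*2)) //; lia|rewrite lmul_deg0].
Qed.

Lemma rrep_deg n (a : P n) m (b : P m) :
  rrep a (deg b) = \sum_(j < n.+1 | (j <= m)%N) deg (pa_starj j (n + m - j.*2) b a).
Proof.
rewrite /rrep /= conj_deg lrep_deg conj_sum; apply: eq_bigr => j jm.
have jn : (j <= n)%N by rewrite -ltnS.
by rewrite conj_deg (pa_star_starj hP) ?(pa_starK hP) //; lia.
Qed.

Lemma starj_deg_eq n m j l l' (a : P n) (b : P m) : l = l' ->
  deg (pa_starj j l a b) = deg (pa_starj j l' a b).
Proof. by move=> ->. Qed.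

(* Both sides are sums over the configurations of three bundles of strings joining [a], [b] and
   [c] in pairs. *)
Lemma lrep_rrep n (a : P n) k (c : P k) x : lrep a (rrep c x) = rrep c (lrep a x).
Proof.
have bl := lrep_bop a; have br := rrep_bop c.
apply: (deg_ext hH (bop_comp bl br) (bop_comp br bl)) => m b /=.
rewrite rrep_deg lrep_deg (lin_sum (proj1 bl)) (lin_sum (proj1 br)).
pose B := (n + m + k).+1.
pose F (t : 'I_B * 'I_B) : H := deg (pa_starj t.2 (n + m - (t.1 : nat).*2 + k - (t.2 : nat).*2)
   (pa_starj t.1 (n + m - (t.1 : nat).*2) a b) c).
pose G (t : 'I_B * 'I_B) : H := deg (pa_starj t.2 (n + (m + k - (t.1 : nat).*2) - (t.2 : nat).*2) a
   (pa_starj t.1 (m + k - (t.1 : nat).*2) b c)).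
pose vF (t : 'I_B * 'I_B) : bool :=
  [&& t.1 <= n, t.1 <= m, t.2 <= k & t.2 <= n + m - (t.1 : nat).*2]%N.
pose vG (t : 'I_B * 'I_B) : bool :=
  [&& t.1 <= m, t.1 <= k, t.2 <= n & t.2 <= m + k - (t.1 : nat).*2]%N.
transitivity (\sum_(t | vG t) G t).
  transitivity (\sum_(r < B | (r <= m)%N && (r <= k)%N)
      \sum_(s < B | (s <= n)%N && (s <= m + k - (r : nat).*2)%N) G (r, s)); last first.
    by rewrite pair_big_dep; apply: eq_big => [[r s]|[r s] _] //; rewrite /vG /= -andbA.
  rewrite (big_ord_widen_cond B (fun j => (j <= m)%N) (fun j => lrep a (deg (pa_starj j (k + m - j.*2) b c)))); last by rewrite /B; lia.
  apply: eq_big => [r|r /andP[rm rk]]; first by rewrite ltnS.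
  rewrite ltnS in rk; rewrite lrep_deg.
  rewrite (big_ord_widen_cond B (fun j => (j <= k + m - r.*2)%N)
    (fun j => deg (pa_starj j (n + (k + m - r.*2) - j.*2) a (pa_starj r (k + m - r.*2) b c)))); last by rewrite /B; lia.
  rewrite [(k + m)%N]addnC; apply: eq_bigl => s; by rewrite ltnS andbC.
transitivity (\sum_(t | vF t) F t); last first.
  transitivity (\sum_(r < B | (r <= n)%N && (r <= m)%N)
      \sum_(s < B | (s <= k)%N && (s <= n + m - (r : nat).*2)%N) F (r, s)).
    by rewrite pair_big_dep; apply: eq_big => [[r s]|[r s] _] //; rewrite /vF /= andbA.
  rewrite (big_ord_widen_cond B (fun j => (j <= m)%N) (fun j => rrep c (deg (pa_starj j (n + m - j.*2) a b)))); last by rewrite /B; lia.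
  symmetry; apply: eq_big => [r|r /andP[rm rk]]; first by rewrite ltnS andbC.
  rewrite ltnS in rk; rewrite rrep_deg.
  rewrite (big_ord_widen_cond B (fun j => (j <= n + m - r.*2)%N)
    (fun j => deg (pa_starj j (k + (n + m - r.*2) - j.*2) (pa_starj r (n + m - r.*2) a b) c))); last by rewrite /B; lia.
  apply: eq_big => [s|s _]; first by rewrite ltnS andbC.
  by apply: starj_deg_eq; rewrite addnC.
(* When [r] strings join [a] to [b], the [s] strings of [c] first meet the [m - r] points left on
   [b]: [min(s, m - r)] of them end on [b] and the others on [a]. The recipe is symmetric, so the
   same [phi] inverts itself. *)
pose phi (t : 'I_B * 'I_B) : 'I_B * 'I_B :=
  (inord (minn (t.1 + t.2) m - t.1), inord (t.1 + t.2 - (minn (t.1 + t.2) m - t.1)))%N.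
have phiE t : vF t || vG t -> ((phi t).1 : nat) = (minn (t.1 + t.2) m - t.1)%N /\
    ((phi t).2 : nat) = (t.1 + t.2 - (minn (t.1 + t.2) m - t.1))%N.
  case: t => r s; rewrite /vF /vG /= => h.
  split; rewrite inordK //; move: h; rewrite /B; move: (r : nat) (s : nat); clear; lia.
have phiV t : vF t -> vG (phi t).
  move=> v; have [e1 e2] := phiE t ltac:(by rewrite v).
  rewrite /vG e1 e2; move: v; rewrite /vF; move: (t.1 : nat) (t.2 : nat); clear; lia.
have phiV' t : vG t -> vF (phi t).
  move=> v; have [e1 e2] := phiE t ltac:(by rewrite v orbT).
  rewrite /vF e1 e2; move: v; rewrite /vG; move: (t.1 : nat) (t.2 : nat); clear; lia.
have phiK t : vF t || vG t -> phi (phi t) = t.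
  move=> v; have [e1 e2] := phiE t v; have [|f1 f2] := phiE (phi t).
    by case/orP: v => [/phiV->|/phiV'->]; rewrite ?orbT.
  rewrite [LHS]surjective_pairing [RHS]surjective_pairing; congr pair; apply: val_inj.
    rewrite [LHS]f1 e1 e2; move: v; rewrite /vF /vG /=; move: (t.1 : nat) (t.2 : nat); clear; lia.
  rewrite [LHS]f2 e1 e2; move: v; rewrite /vF /vG /=; move: (t.1 : nat) (t.2 : nat); clear; lia.
rewrite (reindex_onto phi phi) => [|t v]; last by rewrite phiK ?v ?orbT.
apply: eq_big => [t|t /andP[v1 /eqP v2]].
  apply/andP/idP => [[v /eqP e]|v]; first by rewrite -e phiV'.
  by rewrite phiV // phiK ?v ?eqxx.
have v : vF t by rewrite -v2 phiV'.
have [e1 e2] := phiE t ltac:(by rewrite v).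
rewrite /G /F e1 e2; move: v; rewrite /vF; case: t {v1 v2 e1 e2} => r s /=.
move: (r : nat) (s : nat) => {}r {}s /and4P[h1 h2 h3 h4].
set r' := (minn (r + s) m - r)%N; set q := (s - r')%N.
have [er eq] : (s = q + r' /\ r + s - r' = r + q)%N by rewrite /q /r'; lia.
have fl : q = 0%N \/ (r + r')%N = m by rewrite /q /r'; lia.
have hq : (r + q <= n)%N by rewrite /q /r'; lia.
have hr : (r + r' <= m)%N by rewrite /r'; lia.
rewrite eq er (starj_deg_eq _ (l' := n + m - r.*2 + k - (q + r').*2)%N); last by lia.
rewrite -(@starjA _ _ hP n m k _ (n + m - r.*2) (m + k - r'.*2) r q r' a b c) //; lia.
Qed.

(** Only triples with [n < N], [m < M] and [j <= n] contribute to the infinite sum in [gr_mul],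
    which is thus a sum over ordinals. *)
Lemma gr_mul_iota (a b : forall n, P n) N : (forall n, (N <= n)%N -> a n = 0) -> Gr b ->
  iota (gr_mul a b) = \sum_(n < N) lrep (a n) (iota b).
Proof.
move=> aN [M bM]; rewrite (deg_decomp hH bM).
pose T := ('I_N * 'I_M * 'I_N)%type.
pose ok (t : T) : bool := ((t.2 : nat) <= minn t.1.1 t.1.2)%N.
pose F (t : T) (l : nat) : P l := if ok t then
  gr_hom (pa_starj t.2 (t.1.1 + t.1.2 - (t.2 : nat).*2) (a t.1.1) (b t.1.2)) l else 0.
have GF t : Gr (F t).
  case E: (ok t); last by exists 0%N => l _; rewrite /F E.
  have [N' h] := gr_homP (pa_starj t.2 (t.1.1 + t.1.2 - (t.2 : nat).*2) (a t.1.1) (b t.1.2)).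
  by exists N' => l /h; rewrite /F E.
have -> : gr_mul a b = (fun l => \sum_(t : T) F t l).
  apply: functional_extensionality_dep => l; rewrite /gr_mul.
  pose v (t : T) : nat * nat * nat := (t.1.1 : nat, t.1.2 : nat, t.2 : nat).
  have vI : injective v.
    move=> [[n m] j] [[n' m'] j'] [/val_inj-> /val_inj-> /val_inj->] //.
  pose A := [set t : nat * nat * nat | let: (n, m, j) := t in
                (j <= minn n m)%N /\ (l + j.*2 = n + m)%N].
  pose okl (t : T) : bool := ok t && (l + (t.2 : nat).*2 == t.1.1 + t.1.2)%N.
  rewrite (fsbigE (map v (enum okl))); last 3 first.
  - by rewrite map_inj_uniq ?enum_uniq.
  - move=> y /= /seq.mapP[t]; rewrite mem_enum => /andP[h1 /eqP h2] ->.
    by split.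
  - move=> [[n m] j] [jm lE] /negP nin.
    have lz1 : a n = 0 -> pa_starj j l (a n) (b m) = 0.
      by move=> ->; rewrite (pa_starj0l hP) //; lia.
    have lz2 : b m = 0 -> pa_starj j l (a n) (b m) = 0.
      by move=> ->; rewrite (pa_starj0r hP) //; lia.
    have [nN|/aN/lz1//] := ltnP n N; have [mM|/bM/lz2//] := ltnP m M.
    have jN : (j < N)%N by lia.
    case: nin; apply/seq.mapP; exists (Ordinal nN, Ordinal mM, Ordinal jN) => //.
    by rewrite mem_enum; apply/andP; split => //; apply/eqP.
  rewrite big_map big_seq_cond [RHS](bigID okl) /= [X in _ + X]big1 ?addr0; last first.
    move=> t; rewrite /okl /F; case: ifP => // okt /= h; rewrite gr_hom_out //.
    by apply: contraNneq h => <-; apply/eqP; move: okt; rewrite /ok; lia.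
  transitivity (\sum_(t <- enum okl) F t l); last by rewrite big_enum; apply: eq_bigl.
  rewrite [RHS]big_seq_cond.
  apply: eq_big => [[[n m] j]|[[n m] j]].
    rewrite !mem_enum andbT; case E: (_ \in okl) => //=; move: E; rewrite unfold_in => /andP[h1 /eqP h2].
    by apply/asboolP.
  rewrite mem_enum => /andP[/andP[h1 /eqP h2] _]; rewrite /F h1 /=.
  have lE : (n + m - (j : nat).*2 = l)%N by move: h1 h2; rewrite /ok /=; lia.
  by rewrite lE gr_hom_in.
have [_ ->] := iota_sum hH (index_enum T) GF.
transitivity (\sum_(n < N) \sum_(m < M) \sum_(j < N) iota (F (n, m, j))).
  by rewrite !pair_bigA; apply: eq_bigr => [[[n m] j]] _.
apply: eq_bigr => n _; rewrite (lin_sum (proj1 (lrep_bop _))); apply: eq_bigr => m _.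
rewrite lrep_deg (big_ord_widen_cond N (fun j => (j <= m)%N)
  (fun j => deg (pa_starj j (n + m - j.*2) (a n) (b m)))) // [RHS]big_mkcond; apply: eq_bigr => j _.
rewrite /F /ok /= ltnS leq_min andbC; case: ifP => // _; exact: (iota0 hH).
Qed.

Definition left_ops : set (H -> H) := [set X | exists2 a, Gr a & is_pi iota a X].

Lemma is_piP (a : forall n, P n) X N : (forall n, (N <= n)%N -> a n = 0) ->
  is_pi iota a X <-> X = (fun x => \sum_(n < N) lrep (a n) x).
Proof.
move=> aN; have bS : bop (fun x => \sum_(n < N) lrep (a n) x).
  by apply: bop_sum => n _; apply: lrep_bop.
split=> [[/bopP bX Xb]|->].
  apply/funext; apply: (deg_ext hH bX bS) => n b.
  by rewrite Xb ?(gr_mul_iota aN) //; exact: gr_homP.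
by split=> [|b Gb]; [exact/bopP|rewrite (gr_mul_iota aN Gb)].
Qed.

Lemma left_ops_lrep n (a : P n) : left_ops (lrep a).
Proof.
exists (gr_hom a); first exact: gr_homP.
have hN k : (n.+1 <= k)%N -> gr_hom a k = 0 by move=> nk; rewrite gr_hom_out // ltn_eqF.
apply/(is_piP _ hN).
apply/funext => x; rewrite big_ord_recr /= gr_hom_in big1 ?add0r // => i _.
rewrite gr_hom_out; last by rewrite eq_sym ltn_eqF.
have bl := lrep_bop (0 : P i); apply: (deg_ext hH bl (bop0 H H)) => m b.
rewrite lrep_deg big1 // => j jm; have ji := ltn_ord j; rewrite ltnS in ji.
by rewrite (pa_starj0l hP) ?(deg0 hH) //; lia.
Qed.

Lemma left_ops_star : star_closed left_ops.
Proof.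
move=> X [a [N aN] /(is_piP _ aN)->].
pose s n : P n := pa_star (a n).
have sN n : (N <= n)%N -> s n = 0 by move=> /aN; rewrite /s => ->; exact: pa_star0.
exists (fun x => \sum_(n < N) lrep (s n) x).
  by exists s; [exists N|apply/(is_piP _ sN)].
move=> x y; rewrite ip_suml ip_sumr; apply: eq_bigr => n _; exact: lrep_adjoint.
Qed.

Lemma left_ops_bounded : left_ops `<=` @bounded_op R H.
Proof. by move=> X [a _ []]. Qed.

Lemma planar_vnE : planar_vn iota = commutant (commutant left_ops).
Proof. by apply: vn_generatedE; [exact: left_ops_star|exact: left_ops_bounded]. Qed.

End Representation.

(** * The algebra on its vacuum vector and the trace *)

Section AlgebraAndTrace.
Variables (R : realType) (P : planar_data R).
Hypothesis hP : is_planar_algebra P.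
Variables (H : hilbert R) (iota : (forall n : nat, P n) -> H).
Hypothesis hH : is_completion iota.
Implicit Types (n m k j l : nat).

Notation deg := (deg iota).
Notation lrep a := (lrep hP hH a).
Notation rrep a := (rrep hP hH a).
Notation conj := (conj hP hH).
Notation M := (planar_vn iota).
Notation Om := (vacuum iota).

Lemma vacE : Om = deg (pa_one P).
Proof. by []. Qed.

Lemma conj_vac : conj Om = Om.
Proof. by rewrite vacE conj_deg (star_one hP). Qed.

Lemma lrep_vac n (a : P n) : lrep a Om = deg a.
Proof.
rewrite vacE lrep_deg big_mkcond big_ord_recl /= big1 // addr0.
by rewrite addn0 subn0 (starj_one hP).
Qed.

Lemma rrep_vac n (a : P n) : rrep a Om = deg a.
Proof. by change (conj (lrep (pa_star a) (conj Om)) = deg a); rewrite conj_vac lrep_vac conj_deg (pa_starK hP). Qed.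

Lemma vac_nrm : ip Om Om = 1.
Proof. by rewrite vacE (deg_ip hP hH) pa_ipE (star_one hP) /pa_pair (starj_one hP) // pa_scalar_one. Qed.

Lemma commutant_comp (S : set (H -> H)) X Y : commutant S X -> commutant S Y -> commutant S (X \o Y).
Proof.
move=> [/bopP bX cX] [/bopP bY cY]; split; first exact/bopP/bop_comp.
by move=> Z SZ; rewrite -compA (cY _ SZ) compA (cX _ SZ) compA.
Qed.

Lemma commutant_lin (S : set (H -> H)) c X Y : S `<=` @bounded_op R H -> commutant S X -> commutant S Y ->
  commutant S (fun x => c *: X x + Y x).
Proof.
move=> bS [/bopP bX cX] [/bopP bY cY]; split; first by apply/bopP/bopD => //; exact: bopZ.
move=> Z SZ; have /bopP[lZ _] := bS _ SZ; apply/funext => x /=; rewrite lZ.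
by have /(congr1 (@^~ x)) /= -> := cX _ SZ; have /(congr1 (@^~ x)) /= -> := cY _ SZ.
Qed.

Lemma planar_von_neumann : von_neumann M.
Proof.
rewrite (planar_vnE hP hH); apply: bicommutant_von_neumann; [exact: left_ops_star|exact: left_ops_bounded].
Qed.

Lemma planar_bop X : M X -> bop X.
Proof. by move=> /(vn_bounded planar_von_neumann)/bopP. Qed.

Lemma planar_comp X Y : M X -> M Y -> M (X \o Y).
Proof. rewrite -(vn_bicommutant planar_von_neumann); exact: commutant_comp. Qed.

Lemma planar_lrep n (a : P n) : M (lrep a).
Proof.
rewrite (planar_vnE hP hH); apply: sub_bicommutant; first exact: left_ops_bounded.
exact: left_ops_lrep.
Qed.

Lemma planar_rrep n (a : P n) : commutant M (rrep a).
Proof.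
rewrite (planar_vnE hP hH); apply: (sub_bicommutant (@commutant_bounded _ _ _)).
split; first exact/bopP/rrep_bop.
move=> X [b [N bN] /(is_piP hP hH _ bN)->]; apply/funext => x /=.
rewrite (lin_sum (proj1 (rrep_bop hP hH a))); apply: eq_bigr => m _; by rewrite lrep_rrep.
Qed.

Lemma planar_rrepE X n (a : P n) x : M X -> X (rrep a x) = rrep a (X x).
Proof. by move=> MX; have [_ /(_ X MX)/(congr1 (@^~ x))] := planar_rrep a. Qed.

Lemma planar_deg X n (a : P n) : M X -> X (deg a) = rrep a (X Om).
Proof. by move=> MX; rewrite -(rrep_vac a) planar_rrepE. Qed.

Lemma planar_ext (X Y : H -> H) : M X -> M Y -> X Om = Y Om -> X = Y.
Proof.
move=> MX MY E; apply/funext; apply: (deg_ext hH); [exact: planar_bop|exact: planar_bop|move=> n b].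
by rewrite (planar_deg b MX) (planar_deg b MY) E.
Qed.

Lemma vac_cyclic (K : hilbert R) (X Y : H -> K) : bop X -> bop Y ->
  (forall Z, M Z -> X (Z Om) = Y (Z Om)) -> X = Y.
Proof.
move=> bX bY h; apply/funext; apply: (deg_ext hH bX bY) => n b.
by rewrite -(lrep_vac b) h //; exact: planar_lrep.
Qed.

Lemma rrep_adjoint n (a : P n) : is_adjoint (rrep a) (rrep (pa_star a)).
Proof. by apply: conj_adjoint; exact: lrep_adjoint. Qed.

(** The modular conjugation is the involution [conj]. Tested against [deg b], which is a right
    multiplication applied to the vacuum, the claim follows because right multiplications commute
    with [M]. *)
Lemma adjoint_vac X Y : M X -> is_adjoint X Y -> Y Om = conj (X Om).
Proof.
move=> MX XY; apply/eqP; rewrite -subr_eq0; apply/eqP/(deg_orth_ext hH) => n b.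
apply/eqP; rewrite ipBl subr_eq0; apply/eqP.
rewrite (adjoint_sym XY) -(rrep_vac b) planar_rrepE // -(adjoint_sym (rrep_adjoint b)).
by rewrite !rrep_vac -[X Om in LHS](conjK hP hH) -conj_deg conj_ip.
Qed.

Lemma planar_adjoint X : M X -> exists Y, [/\ M Y, is_adjoint X Y & Y Om = conj (X Om)].
Proof.
by move=> MX; have [Y MY XY] := vn_adjoint planar_von_neumann MX; exists Y; split=> //; exact: adjoint_vac XY.
Qed.

Definition trace (X : H -> H) : R[i] := ip (X Om) Om.

Lemma trace_comm X Y : M X -> M Y -> trace (X \o Y) = trace (Y \o X).
Proof.
move=> MX MY; have [X' [_ XX eX]] := planar_adjoint MX; have [Y' [_ YY eY]] := planar_adjoint MY.
by rewrite /trace /= XX [RHS]YY eX eY -{1}(conjK hP hH (Y Om)) conj_ip.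
Qed.

Lemma trace_faithful_normal : faithful_normal_trace M trace.
Proof.
have gramE X Y : is_adjoint X Y -> trace (Y \o X) = ip (X Om) (X Om).
  by move=> /adjoint_sym h; rewrite /trace /= h.
split.
- by move=> c X Y _ _; rewrite /trace ipDl ipZl.
- exact: vac_nrm.
- by move=> X Y _ _ /gramE->; rewrite ip_nrm lecR exprn_ge0 // nrm_ge0.
- move=> X Y MX MY /gramE-> /ip_eq0 h; apply/funext; apply: (deg_ext hH (planar_bop MX) (bop0 H H)) => n b.
  by rewrite (planar_deg b MX) h (lin0 (proj1 (rrep_bop hP hH b))).
- exact: trace_comm.
(* The trace is a vector functional, so a single nonzero term gives normality. *)
- pose xi k : H := if k is 0%N then Om else 0; exists xi, xi.
  have bd : exists B : R[i], forall N, \sum_(k < N) `|xi k| ^+ 2 <= B.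
    exists 1 => -[|N]; first by rewrite big_ord0.
    by rewrite big_ord_recl big1 ?addr0 => [|i _]; rewrite /= ?normr0 ?expr0n // -ip_norm vac_nrm.
  split=> // X MX e e0; exists 1%N => -[//|N] _.
  rewrite big_ord_recl big1 => [|i _]; last by rewrite /= ip0r.
  by rewrite /trace /= addr0 subrr normr0.
Qed.

Lemma conj_op_vac X Y : M X -> M Y -> conj (X (conj (Y Om))) = Y (conj (X Om)).
Proof.
move=> MX MY; have [X' [MX' XX eX]] := planar_adjoint MX; have [Y' [MY' YY eY]] := planar_adjoint MY.
have XY : is_adjoint (X \o Y') (Y \o X') by move=> x y /=; rewrite XX (adjoint_sym YY).
by rewrite -eY -eX -(adjoint_vac (planar_comp MX MY') XY).
Qed.

(** The right action of [X] is its adjoint conjugated by [conj]. As the vacuum is cyclic, only one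
    bounded operator satisfies the requirement in [right_op], so the choice made there is this
    one. *)
Lemma right_opE X Y : M X -> M Y -> is_adjoint X Y -> right_op M Om X = conj \o Y \o conj.
Proof.
move=> MX MY XY; have bJ := bop_conj hP hH (planar_bop MY).
have E Z : M Z -> (conj \o Y \o conj) (Z Om) = Z (X Om).
  by move=> MZ /=; rewrite (conj_op_vac MY MZ) (adjoint_vac MX XY) conjK.
apply: xget_unique => [|Z [/bopP bZ h]]; first by split; [exact/bopP|].
by apply: vac_cyclic => // W MW; rewrite E // h.
Qed.

End AlgebraAndTrace.

(** * Orthonormal families and polar decomposition *)

Section ClosedSpan.
Variables (R : realType).
Implicit Types H K : hilbert R.

Lemma closure_hspan0 H (S : set H) : closure (hspan S) 0.
Proof.
apply: subset_closure; exists 0%N, (fun _ => 0), (fun _ => 0).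
by split=> [[]//|]; rewrite big_ord0.
Qed.

Definition cspan H (S : set H) : closed_subspace H :=
  ClosedSubspace (@closure_hspan_lin _ _ S) (@closed_closure _ (hspan S)) (closure_hspan0 S).

Lemma cspan_sub H (S : set H) x : S x -> cs_set (cspan S) x.
Proof. by move=> Sx; apply/subset_closure/hspan_sub. Qed.

Lemma cs_sum H (T : closed_subspace H) (I : Type) (r : seq I) (F : I -> H) :
  (forall i, cs_set T (F i)) -> cs_set T (\sum_(i <- r) F i).
Proof.
move=> h; elim/big_rec: _ => [|i x _ Tx]; first exact: cs_zero.
by rewrite -[F i]scale1r; apply: cs_lin.
Qed.

Lemma cspan_pre H K (X : H -> K) (S : set H) (T : closed_subspace K) : bop X ->
  (forall x, S x -> cs_set T (X x)) -> forall x, cs_set (cspan S) x -> cs_set T (X x).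
Proof.
move=> bX h x /closure_seq[u [Su lu]]; apply: (@cs_closed _ _ T).
apply: closure_hlim (bop_lim bX lu) => n; have [k [c [s [Ss ->]]]] := Su n.
rewrite (lin_sum (proj1 bX)); apply: cs_sum => i; rewrite (linZ (proj1 bX)) -[_ *: _]addr0.
by apply: cs_lin; [exact: h|exact: cs_zero].
Qed.

Lemma cspan_eq H K (X Y : H -> K) (S : set H) : bop X -> bop Y -> (forall x, S x -> X x = Y x) ->
  forall x, cs_set (cspan S) x -> X x = Y x.
Proof.
move=> bX bY XY x /closure_seq[u [Su lu]].
apply: hlim_unique (bop_lim bX lu) _; apply: hlim_ext (bop_lim bY lu) => n.
have [k [c [s [Ss ->]]]] := Su n.
by rewrite (lin_sum (proj1 bX)) (lin_sum (proj1 bY)); apply: eq_bigr => i _; rewrite (linZ (proj1 bX)) (linZ (proj1 bY)) XY.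
Qed.

Lemma cspan_orth H (S : set H) z : (forall y, S y -> ip z y = 0) -> forall x, cs_set (cspan S) x -> ip z x = 0.
Proof.
move=> h x /closure_seq[u [Su lu]]; apply: hlim_unique (hlim_ipr z lu) _.
apply: hlim_ext (hlim_cst 0) => n; have [k [c [s [Ss ->]]]] := Su n.
by rewrite ip_sumr big1 // => i _; rewrite ipZr h // mulr0.
Qed.

Definition cs_proj H (T : closed_subspace H) : H -> H := proj (@cs_lin _ _ T) (@cs_closed _ _ T) (cs_zero T).

Section Projection.
Variables (H : hilbert R) (T : closed_subspace H).

Lemma cs_proj_in x : cs_set T (cs_proj T x). Proof. exact: proj_in. Qed.

Lemma cs_proj_id x : cs_set T x -> cs_proj T x = x. Proof. exact: proj_id. Qed.

Lemma cs_proj_idem x : cs_proj T (cs_proj T x) = cs_proj T x.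
Proof. exact/cs_proj_id/cs_proj_in. Qed.

Lemma cs_proj_adjoint : is_adjoint (cs_proj T) (cs_proj T). Proof. exact: proj_adjoint. Qed.

Lemma cs_proj_bop : bop (cs_proj T). Proof. exact: proj_bop. Qed.

Lemma cs_proj_orth x : (forall z, cs_set T z -> ip x z = 0) -> cs_proj T x = 0.
Proof. by move=> h; apply: proj_unique => [|z Tz]; [exact: cs_zero|rewrite subr0 h]. Qed.

Lemma cs_proj_comm X Y : bop X -> is_adjoint X Y -> (forall x, cs_set T x -> cs_set T (X x)) ->
  (forall x, cs_set T x -> cs_set T (Y x)) -> commuting (cs_proj T) X.
Proof.
move=> bX XY hX hY x; apply: proj_unique; first exact/hX/cs_proj_in.
by move=> z Tz; rewrite -(linB (proj1 bX)) XY proj_orth //; exact: hY.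
Qed.

End Projection.

Lemma orth_total H (S : set H) : (forall x, (forall y, S y -> ip x y = 0) -> x = 0) ->
  closure (hspan S) = setT.
Proof.
move=> h; apply/seteqP; split=> // x _; have E : x - cs_proj (cspan S) x = 0.
  by apply: h => y Sy; apply: proj_orth; exact: (@cspan_sub _ S).
by move/eqP: E; rewrite subr_eq0 => /eqP->; exact: (cs_proj_in (cspan S)).
Qed.

Lemma isometric_nrm H K (X : H -> K) x : isometric X -> nrm (X x) = nrm x.
Proof.
move=> [_ h]; apply/eqP; rewrite -(eqrXn2 (n := 2)) ?nrm_ge0 //; apply/eqP/(@complexI R).
by rewrite -!ip_nrm h.
Qed.

Lemma isometric_bop H K (X : H -> K) : isometric X -> bop X.
Proof. by move=> iX; split; [case: iX|exists 1 => x; rewrite mul1r isometric_nrm]. Qed.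

Lemma sub_prj_bop H (T : closed_subspace H) : bop (@sub_prj _ _ T).
Proof.
have [lp [C hC]] := cs_proj_bop T; have iT := sub_inc_isometric T; split=> [c x y|].
  by apply: sub_inc_inj; rewrite (proj1 iT) !sub_prjE; exact: lp.
by exists C => x; rewrite -(isometric_nrm _ iT) sub_prjE; exact: hC.
Qed.

(** [V] kills the part of [x] orthogonal to [T], whose image has norm zero by the hypothesis on
    inner products. *)
Lemma partial_isometry_proj H K (T : closed_subspace H) (V : H -> K) : bop V ->
  (forall x y, ip (V x) (V y) = ip (cs_proj T x) y) -> forall x, V (cs_proj T x) = V x.
Proof.
move=> bV VV x; apply/eqP; rewrite -subr_eq0 -(linB (proj1 bV)); apply/eqP/ip_eq0.
by rewrite VV (linB (proj1 (cs_proj_bop T))) cs_proj_idem subrr ip0l.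
Qed.

Lemma sesqui_ext H K (S : set H) (X Y : H -> K) (k : R[i]) : closure (hspan S) = setT -> bop X -> bop Y ->
  (forall x y, S x -> S y -> ip (X x) (Y y) = k * ip x y) -> forall x y, ip (X x) (Y y) = k * ip x y.
Proof.
move=> tS bX bY h x y; have [Z [bZ YZ]] := adjoint_ex bY.
have ZY u v : ip u (Y v) = ip (Z u) v by rewrite ip_conj YZ -ip_conj.
rewrite ZY -ipZl; congr ip; have bZX := bop_comp bZ bX.
apply: (bop_ext tS bZX (bopZ k (bop_id H))) => {}x Sx /=.
apply/eqP; rewrite -subr_eq0; apply/eqP/(total_orth tS) => z Sz.
by rewrite ipBl -ZY h // ipZl subrr.
Qed.

End ClosedSpan.

Section Orthonormal.
Variables (R : realType) (I : choiceType).

Definition orthonormal (H : hilbert R) (e : I -> H) : Prop := forall i j, ip (e i) (e j) = (i == j)%:R.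

Lemma orth_seq_nrm (H : hilbert R) (g : I -> H) r : uniq r -> (forall i j, i != j -> ip (g i) (g j) = 0) ->
  nrm (\sum_(i <- r) g i) ^+ 2 = \sum_(i <- r) nrm (g i) ^+ 2.
Proof.
move=> + og; elim: r => [|i r IH] /=; first by rewrite !big_nil nrm0 expr0n.
move=> /andP[ir ur]; rewrite !big_cons pythagoras ?IH // ip_sumr big_seq big1 // => j jr.
by apply: og; apply: contraNneq ir => ->.
Qed.

Lemma sum_support (V : nmodType) (F : I -> V) r r' : uniq r -> uniq r' -> {subset r <= r'} ->
  (forall i, i \notin r -> F i = 0) -> \sum_(i <- r) F i = \sum_(i <- r') F i.
Proof.
move=> ur ur' sr h; rewrite [RHS](bigID (mem r)) /= [X in _ + X]big1 // addr0 -[RHS]big_filter.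
apply: perm_big; apply: uniq_perm => //; first exact: filter_uniq.
by move=> i; rewrite mem_filter andb_idr // => /sr.
Qed.

Lemma orthonormal_map (H K : hilbert R) (e : I -> H) (z : I -> K) (c C : R) :
  closure (hspan (range e)) = setT -> orthonormal e -> (forall i j, i != j -> ip (z i) (z j) = 0) ->
  0 <= c -> (forall i, c <= nrm (z i) <= C) ->
  exists Z, [/\ bop Z, forall i, Z (e i) = z i & forall x, c * nrm x <= nrm (Z x)].
Proof.
move=> te oe oz c0 hz; have z1 i : c <= nrm (z i) by case/andP: (hz i).
have z2 i : nrm (z i) <= C by case/andP: (hz i).
pose G x y := exists r (a : I -> R[i]), [/\ uniq r, forall i, i \notin r -> a i = 0,
  x = \sum_(i <- r) a i *: e i & y = \sum_(i <- r) a i *: z i].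
have Glin k x y x' y' : G x y -> G x' y' -> G (k *: x + x') (k *: y + y').
  move=> [r [a [ur ha -> ->]]] [r' [a' [ur' ha' -> ->]]].
  have us := undup_uniq (r ++ r').
  have rs : {subset r <= undup (r ++ r')} by move=> i ir; rewrite mem_undup mem_cat ir.
  have rs' : {subset r' <= undup (r ++ r')} by move=> i ir; rewrite mem_undup mem_cat ir orbT.
  exists (undup (r ++ r')), (fun i => k * a i + a' i); split=> // [i| |].
  - rewrite mem_undup mem_cat negb_or => /andP[/ha-> /ha'->]; by rewrite mulr0 addr0.
  - rewrite (sum_support (r' := undup (r ++ r')) ur us rs) => [|i /ha->]; last by rewrite scale0r.
    rewrite (sum_support (r' := undup (r ++ r')) ur' us rs') => [|i /ha'->]; last by rewrite scale0r.
    by rewrite scaler_sumr -big_split; apply: eq_bigr => i _; rewrite scalerDl scalerA.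
  - rewrite (sum_support (r' := undup (r ++ r')) ur us rs) => [|i /ha->]; last by rewrite scale0r.
    rewrite (sum_support (r' := undup (r ++ r')) ur' us rs') => [|i /ha'->]; last by rewrite scale0r.
    by rewrite scaler_sumr -big_split; apply: eq_bigr => i _; rewrite scalerDl scalerA.
have G0 : G 0 0 by exists [::], (fun _ => 0); split=> //; rewrite big_nil.
have Ge i : G (e i) (z i).
  exists [:: i], (fun j => (j == i)%:R); split=> // [j| |].
  - by rewrite inE => /negbTE->.
  - by rewrite big_seq1 eqxx scale1r.
  - by rewrite big_seq1 eqxx scale1r.
have nG x y : G x y -> nrm x ^+ 2 * c ^+ 2 <= nrm y ^+ 2 <= nrm x ^+ 2 * C ^+ 2.
  move=> [r [a [ur _ -> ->]]]; rewrite !orth_seq_nrm // => [|i j ij|i j ij]; last 2 first.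
  - by rewrite ipZl ipZr oz // !mulr0.
  - by rewrite ipZl ipZr oe (negbTE ij) !mulr0.
  have e1 i : nrm (e i) ^+ 2 = 1 by apply: (@complexI R); rewrite -ip_nrm oe eqxx.
  rewrite !mulr_suml; apply/andP; split; apply: ler_sum => i _; rewrite !nrmZ !exprMn e1 mulr1.
    by rewrite ler_wpM2l ?sqr_ge0 // ler_pXn2r ?nnegrE ?nrm_ge0.
  by rewrite ler_wpM2l ?sqr_ge0 // ler_pXn2r ?nnegrE ?nrm_ge0 // (le_trans c0) // (le_trans (z1 i)).
pose D := `|C|.
have nG1 x y : G x y -> nrm y <= D * nrm x.
  move=> /nG/andP[_ h]; rewrite -(ler_pXn2r (n := 2)) ?nnegrE ?nrm_ge0 ?mulr_ge0 ?nrm_ge0 ?normr_ge0 //.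
  by rewrite exprMn mulrC real_normK ?num_real.
have nG2 x y : G x y -> c * nrm x <= nrm y.
  move=> /nG/andP[h _]; rewrite -(ler_pXn2r (n := 2)) ?nnegrE ?nrm_ge0 ?mulr_ge0 ?nrm_ge0 //.
  by rewrite exprMn mulrC.
have dG x : closure [set x | exists y, G x y] x.
  have : closure (hspan (range e)) x by rewrite te.
  apply: closure_subset => _ [k [a [s [Ss ->]]]].
  elim/big_rec: _ => [|i x' _ [y' Gy]]; first by exists 0.
  by have [j _ <-] := Ss i; exists (a i *: z j + y'); apply: Glin.
have [Z bZ ZG] := bop_extend Glin nG1 dG; exists Z; split=> [//|i|x]; first exact: ZG.
have /closure_seq[u [Gu lu]] := dG x.
rewrite -subr_le0; apply/ler_addgt0Pl => d d0; rewrite addr0.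
have [B B0 hB] := bop_pos bZ.
have k0 : 0 < c + B by rewrite ltr_wpDl.
have [|N hN] := lu (d / (c + B)); first by rewrite divr_gt0.
have := hN N (leqnn _); rewrite ltr_pdivlMr // => h.
have [y Gy] := Gu N; have := nG2 _ _ Gy; rewrite -(ZG _ _ Gy) => h1.
have h2 := hB (u N - x); rewrite (linB (proj1 bZ)) in h2.
have h3 := nrm_triangle (u N) (x - u N); rewrite addrC subrK nrmB in h3.
have h4 := nrm_triangle (Z x) (Z (u N) - Z x); rewrite addrC subrK in h4.
have h5 := ler_wpM2l c0 h3; move: h h1 h2 h4 h5; clear; nra.
Qed.

End Orthonormal.
Section Polar.
Variables (R : realType) (H : hilbert R).

(* [V = Q B^(-1/2)] where [B = Q* Q + 1 - p] is bounded below. *)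
Lemma polar (Q p : H -> H) (c : R) : bop Q -> bop p -> is_adjoint p p -> (forall x, p (p x) = p x) ->
  (forall x, Q (p x) = Q x) -> 0 < c -> (forall x, c * nrm (p x) <= nrm (Q x)) ->
  exists V, [/\ bop V, forall x y, ip (V x) (V y) = ip (p x) y,
    forall x, exists x', Q x = V x', forall x, exists x', V x = Q x' &
    forall X Y, bop X -> is_adjoint X X -> is_adjoint Y Y ->
      (forall x, Q (X x) = Y (Q x)) -> commuting p X -> forall x, V (X x) = Y (V x)].
Proof.
move=> bQ bp sp pp Qp c0 hQ; have [Q' [bQ' QQ]] := adjoint_ex bQ.
have [lQ _] := bQ; have [lp _] := bp; have [lQ' _] := bQ'.
have pQ x : p (Q' x) = Q' x.
  by apply: ip_ext => y; rewrite sp ip_conj -QQ Qp QQ -ip_conj.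
pose B x := Q' (Q x) + (x - p x).
have bB : bop B by apply: bopD; [exact: bop_comp|apply: bopB => //; exact: bop_id].
have sB : is_adjoint B B.
  move=> x y; rewrite /B [LHS]ipDl [RHS]ipDr [ip (x - _) _]ipBl [ip _ (y - _)]ipBr sp -QQ; congr (_ + _).
  by rewrite ip_conj -QQ -ip_conj.
have pB : commuting p B.
  by move=> x; rewrite /B (linD lp) pQ (linB lp) !pp Qp subrr.
have kB x : Num.min (c ^+ 2) 1 * nrm x ^+ 2 <= complex.Re (ip (B x) x).
  rewrite ipDl [ip (Q' _) _]ip_conj -QQ ip_nrm.
  have o : ip (p x) (x - p x) = 0 by rewrite ipBr [ip (p x) (p x)]sp pp sp subrr.
  have -> : ip (x - p x) x = ((nrm (x - p x) ^+ 2)%:C)%C.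
    by rewrite -ip_nrm [RHS]ipBr [ip (x - p x) (p x)]ip_conj o rmorph0 subr0.
  have -> : nrm x ^+ 2 = nrm (p x) ^+ 2 + nrm (x - p x) ^+ 2.
    by rewrite -pythagoras // addrC subrK.
  have h := hQ x; have h' : (c * nrm (p x)) ^+ 2 <= nrm (Q x) ^+ 2.
    by rewrite ler_pXn2r ?nnegrE ?nrm_ge0 // mulr_ge0 ?nrm_ge0 // ltW.
  rewrite exprMn in h'; rewrite /= mulrDr lerD //.
    by apply: le_trans h'; rewrite ler_wpM2r ?sqr_ge0 // ge_min lexx.
  by rewrite ler_piMl ?sqr_ge0 // ge_min lexx orbT.
have m0 : 0 < Num.min (c ^+ 2) 1 by rewrite lt_min ltr01 exprn_gt0.
have [D [bD sD DDB Dc]] := inverse_sqrt bB sB m0 kB.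
have BD : commuting B D by apply: Dc.
have pD : commuting p D by apply: Dc.
have Bp x : Q' (Q x) = B (p x) by rewrite /B pp subrr addr0 Qp.
exists (Q \o D); split.
- exact: bop_comp.
- by move=> x y /=; rewrite QQ Bp pD BD sD DDB sp.
- by move=> x; exists (D (B (p x))) => /=; rewrite DDB Qp.
- by move=> x; exists (D x).
- move=> X Y bX sX sY XY pX x /=.
  (* Since [X] and [Y] are self-adjoint, the adjoint of [Q] intertwines them in the other direction.
     Therefore [X] commutes with [B], and with its inverse square root. *)
  have Q'Y y : Q' (Y y) = X (Q' y).
    by apply: ip_ext => z; rewrite sX [LHS]ip_conj -QQ -sY -XY QQ -ip_conj.
  have XB : commuting X B.
    by move=> y; rewrite /B (linD (proj1 bX)) (linB (proj1 bX)) -Q'Y -XY pX.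
  by rewrite -(Dc _ bX XB) XY.
Qed.

End Polar.

Section Tensor.
Variables (R : realType) (K W : hilbert R) (b : nat -> K) (f : nat * nat -> W).
Hypotheses (ob : orthonormal b) (tb : closure (hspan (range b)) = setT).
Hypotheses (onf : orthonormal f) (tf : closure (hspan (range f)) = setT).

(** Built one variable at a time: [U j] extends [b i |-> f (i, j)], and [t x] extends
    [b j |-> U j x]. *)
Lemma tensor_of_basis : exists t : K -> K -> W, [/\ is_hilbert_tensor t,
  forall i j, t (b i) (b j) = f (i, j), forall y, bop (t^~ y) & forall x, bop (t x)].
Proof.
have row j : exists U : K -> W, bop U /\ forall i, U (b i) = f (i, j).
  have [||i|U [bU Ub _]] := @orthonormal_map _ _ K W b (fun i => f (i, j)) 0 1 tb ob.
  - by move=> i i' ii'; rewrite onf xpair_eqE (negbTE ii').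
  - by [].
  - rewrite nrm_ge0 -(expr_le1 (n := 2)) ?nrm_ge0 //= -lecR -ip_nrm onf eqxx //.
  - by exists U.
pose U j := projT1 (cid (row j)).
have bU j : bop (U j) by rewrite /U; case: cid => ? [].
have Ub i j : U j (b i) = f (i, j) by rewrite /U; case: cid => ? [].
have UU i j x y : ip (U i x) (U j y) = (i == j)%:R * ip x y.
  apply: (sesqui_ext tb (bU i) (bU j)) => _ _ [k _ <-] [l _ <-].
  by rewrite !Ub onf ob xpair_eqE -natrM mulnb andbC.
have Unrm j x : nrm (U j x) = nrm x.
  apply/eqP; rewrite -(eqrXn2 (n := 2)) ?nrm_ge0 //; apply/eqP/(@complexI R).
  by rewrite -!ip_nrm UU eqxx mul1r.
have col x : exists T : K -> W, bop T /\ forall j, T (b j) = U j x.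
  have [||i|T [bT Tb _]] := @orthonormal_map _ _ K W b (fun j => U j x) 0 (nrm x) tb ob.
  - by move=> i i' ii'; rewrite UU (negbTE ii') mul0r.
  - by [].
  - by rewrite nrm_ge0 Unrm lexx.
  - by exists T.
pose t x := projT1 (cid (col x)).
have bt x : bop (t x) by rewrite /t; case: cid => ? [].
have tU x j : t x (b j) = U j x by rewrite /t; case: cid => ? [].
have tt x x' y y' : ip (t x y) (t x' y') = ip x x' * ip y y'.
  apply: (sesqui_ext tb (bt x) (bt x')) => _ _ [k _ <-] [l _ <-].
  by rewrite !tU UU ob mulrC.
have tl y : linear (t^~ y).
  move=> c x x'; have b2 := bopD (bopZ c (bt x)) (bt x').
  apply: (bop_ext tb (bt (c *: x + x')) b2 _ y) => _ [j _ <-].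
  by rewrite !tU (proj1 (bU j)).
exists t; split.
- split=> //; first by move=> x; case: (bt x).
  apply/seteqP; split=> // w _; have : closure (hspan (range f)) w by rewrite tf.
  apply: closure_subset => _ [k [c [s [Ss ->]]]]; exists k, c, s; split=> // i.
  by have [[m n] _ <-] := Ss i; exists (b m), (b n); rewrite tU Ub.
- by move=> i j; rewrite tU Ub.
- move=> y; split=> //; exists (nrm y) => x; rewrite le_eqVlt; apply/orP; left.
  rewrite -(eqrXn2 (n := 2)) ?mulr_ge0 ?nrm_ge0 //; apply/eqP/(@complexI R).
  by rewrite exprMn -ip_nrm tt !ip_nrm mulrC -rmorphM.
- exact: bt.
Qed.

End Tensor.

(** * Ladders *)

Section SubspaceProjection.
Variables (R : realType) (H : hilbert R) (T : closed_subspace H).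

Lemma sub_prjp x : sub_inc (sub_prj T x) = cs_proj T x. Proof. exact: sub_prjE. Qed.

Lemma sub_prj_proj x : sub_prj T (cs_proj T x) = sub_prj T x.
Proof. by rewrite -sub_prjp sub_prjK. Qed.

Lemma sub_prj_nrm x : nrm (sub_prj T x) = nrm (cs_proj T x).
Proof. by rewrite -sub_prjp (isometric_nrm _ (sub_inc_isometric T)). Qed.

End SubspaceProjection.

Section SubspaceBasis.
Variables (R : realType) (H : hilbert R) (I : choiceType) (e : I -> H).
Notation S := (cspan (range e)).

Lemma sub_prj_ip (x y : H) : cs_set S x -> cs_set S y -> ip (@sub_prj _ _ S x) (@sub_prj _ _ S y) = ip x y.
Proof. by move=> Sx Sy; rewrite -(proj2 (sub_inc_isometric S)) !sub_incK. Qed.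

Lemma cspan_range i : cs_set S (e i).
Proof. by apply: cspan_sub; exists i. Qed.

Lemma sub_total : closure (hspan (range (fun i => @sub_prj _ _ S (e i)))) = setT.
Proof.
apply: orth_total => x h; apply: sub_inc_inj; rewrite (lin0 (proj1 (sub_inc_isometric S))).
apply: ip_eq0; apply: cspan_orth (sub_inc_in x) => _ [i _ <-].
by rewrite -[e i](sub_incK (@cspan_range i)) (proj2 (sub_inc_isometric S)) h //; exists i.
Qed.

Lemma sub_orthonormal : orthonormal e -> orthonormal (fun i => @sub_prj _ _ S (e i)).
Proof. by move=> oe i j; rewrite sub_prj_ip //; exact: cspan_range. Qed.

End SubspaceBasis.

Section Ladder.
Variables (R : realType) (H : hilbert R) (U U' W W' : H -> H).
Hypotheses (bU : bop U) (bU' : bop U') (bW : bop W) (bW' : bop W').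
Hypotheses (UU : is_adjoint U U') (WW : is_adjoint W W').
Hypotheses (UK : forall x, U' (U x) = x) (WK : forall x, W' (W x) = x) (UW : commuting U W).
Implicit Types (i j k l : nat) (v x : H) (s : R).

(** A unit vector killed by both caps, from which two commuting isometries [U] and [W] generate a
    lattice of vectors. The parameter [s] measures how far a cap from one side reaches the first cup
    on the other side. It is 0 in the orthonormal model. *)
Record ladder s v := Ladder {
  ladderU : U' v = 0;
  ladderW : W' v = 0;
  ladderUW : forall j, U' (iter j.+1 W v) = ((s%:C)%C) *: iter j W v;
  ladderWU : forall i, W' (iter i.+1 U v) = ((s%:C)%C) *: iter i U v;
  ladder1 : ip v v = 1 }.

Definition rung v i j : H := iter i U (iter j W v).
Arguments rung : simpl never.

Let lU := proj1 bU. Let lU' := proj1 bU'. Let lW := proj1 bW. Let lW' := proj1 bW'.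

Lemma coisometry_le (X Y : H -> H) : is_adjoint X Y -> (forall x, Y (X x) = x) ->
  (forall x, nrm (X x) = nrm x) /\ (forall x, nrm (Y x) <= nrm x).
Proof.
move=> XY XK; have iX x : nrm (X x) = nrm x.
  apply/eqP; rewrite -(eqrXn2 (n := 2)) ?nrm_ge0 //; apply/eqP/(@complexI R).
  by rewrite -!ip_nrm XY XK.
split=> // x; have [/eqP|y0] := eqVneq (nrm (Y x)) 0; first by move=> /eqP->; exact: nrm_ge0.
have y1 : 0 < nrm (Y x) by rewrite lt_def y0 nrm_ge0.
rewrite -(ler_pM2l y1) -[nrm (Y x) in leRHS]iX; apply: le_trans (cauchy_schwarz _ _).
by rewrite XY ip_nrm nrm_real ger0_norm ?sqr_ge0 // expr2.
Qed.

Lemma rungU v i j : U (rung v i j) = rung v i.+1 j. Proof. by []. Qed.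

Lemma rungW v i j : W (rung v i j) = rung v i j.+1.
Proof. by rewrite /rung; elim: i => //= i IH; rewrite -UW IH. Qed.

Lemma rungU' v i j : U' (rung v i.+1 j) = rung v i j. Proof. exact: UK. Qed.

Lemma rungW' v i j : W' (rung v i j.+1) = rung v i j.
Proof. by rewrite -rungW WK. Qed.

Section OneLadder.
Variables (s : R) (v : H).
Hypothesis hv : ladder s v.
Notation S := ((s%:C)%C).
Notation u := (rung v).

Lemma rungU0 j : U' (u 0 j) = if j is j'.+1 then S *: u 0 j' else 0.
Proof. by case: j => [|j]; [exact: (ladderU hv)|exact: (ladderUW hv)]. Qed.

Lemma rungW0 i : W' (u i 0) = if i is i'.+1 then S *: u i' 0 else 0.
Proof. by case: i => [|i]; [exact: (ladderW hv)|exact: (ladderWU hv)]. Qed.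

Lemma rung0_ip j l : ip (u 0 j) (u 0 l) = (j == l)%:R.
Proof.
elim: j l => [|j IH] [|l].
- exact: (ladder1 hv).
- by rewrite -rungW ip_conj WW (ladderW hv) ip0r rmorph0.
- by rewrite -rungW WW (ladderW hv) ip0r.
- by rewrite -[u 0 j.+1]rungW WW rungW' IH.
Qed.

(** Gram-Schmidt applied to the rungs. The overlap of [u i.+1 j] with the rungs of smaller first
    index is removed by a single term, and the squared norm becomes [1 - s^2]. *)
Definition rungz (p : nat * nat) : H := if p.1 is i.+1 then u i.+1 p.2 - S *: u i p.2.+1 else u 0 p.2.

Lemma rungzU i j : U (rungz (i.+1, j)) = rungz (i.+2, j).
Proof. by rewrite /rungz /= (linB lU) (linZ lU). Qed.

Lemma S_conj : S^* = S.
Proof. by apply/eqP; rewrite eq_complex /= oppr0 !eqxx. Qed.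

Lemma rungz_u i j l : ip (rungz (i.+1, j)) (u 0 l) = 0.
Proof.
elim: i l => [|i IH] l.
  rewrite /rungz /= ipBl ipZl UU rungU0; case: l => [|l].
    by rewrite ip0r sub0r rung0_ip mulr0 oppr0.
  by rewrite ipZr S_conj !rung0_ip eqSS subrr.
rewrite -rungzU UU rungU0; case: l => [|l]; first by rewrite ip0r.
by rewrite ipZr IH mulr0.
Qed.

Lemma rungz_lt i j m l : ip (rungz (i.+1, j)) (rungz ((i + m).+2, l)) = 0.
Proof.
elim: i => [|i IH]; last by rewrite addSn -(rungzU i) -(rungzU (i + m).+1) UU UK IH.
rewrite add0n {1}/rungz /= ipBl ipZl -[rungz (m.+2, l)]rungzU.
have e k : ip (u 0 k) (rungz (m.+1, l)) = 0 by rewrite ip_conj rungz_u rmorph0.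
by rewrite -rungU UU UK e sub0r rungzU ip_conj rungz_u rmorph0 mulr0 oppr0.
Qed.

Lemma rungz_eq i j l : ip (rungz (i.+1, j)) (rungz (i.+1, l)) = (((1 - s ^+ 2)%:C)%C) *+ (j == l).
Proof.
elim: i => [|i IH]; last by rewrite -!rungzU UU UK IH.
rewrite {1}/rungz /= ipBl ipZl [X in _ * X]ip_conj rungz_u rmorph0 mulr0 subr0 UU.
rewrite /rungz /= (linB lU') (linZ lU') rungU' rungU0 ipBr !ipZr !S_conj rung0_ip.
case: (j == l); last by rewrite !mulr0 subrr.
by rewrite mulr1 mulr1n rmorphB expr2 rmorphM rmorph1.
Qed.

Lemma rungz_orth p q : p != q -> ip (rungz p) (rungz q) = 0.
Proof.
case: p q => [i j] [k l]; wlog ik : i j k l / (i <= k)%N.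
  have [ik|/ltnW ki] := leqP i k; first by apply.
  by move=> h ne; rewrite ip_conj h ?rmorph0 // eq_sym.
rewrite xpair_eqE; case: i ik => [|i]; case: k => [|k] //=.
- by move=> _ /negbTE jl; rewrite rung0_ip jl.
- by move=> _ _; rewrite ip_conj rungz_u rmorph0.
rewrite ltnS eqSS leq_eqVlt => /orP[/eqP->|ik].
  by rewrite eqxx /= => /negbTE jl; rewrite rungz_eq jl.
by move=> _; rewrite -(subnKC ik) addSn; exact: rungz_lt.
Qed.

Lemma rungz_nrm p : 0 <= s < 1 -> 1 - s ^+ 2 <= nrm (rungz p) <= 1.
Proof.
move=> /andP[s0 s1]; have s2 : 0 < 1 - s ^+ 2 by rewrite subr_gt0 expr_lt1.
have s3 : 1 - s ^+ 2 <= 1 by rewrite lerBlDr lerDl sqr_ge0.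
have : nrm (rungz p) ^+ 2 = if p.1 is _.+1 then 1 - s ^+ 2 else 1.
  apply: (@complexI R); rewrite -ip_nrm; case: p => -[|i] j /=; first by rewrite rung0_ip eqxx.
  by rewrite rungz_eq eqxx.
have := nrm_ge0 (rungz p); move: s2 s3; set a := 1 - s ^+ 2; set b := nrm _.
by case: p.1 => [|_] a0 a1 b0 e; apply/andP; split; nra.
Qed.

Lemma rung_orthonormal : s = 0 -> orthonormal (fun p : nat * nat => u p.1 p.2).
Proof.
move=> s0 p p'; have E r : u r.1 r.2 = rungz r.
  by case: r => [[|i] j]; rewrite /rungz //= s0 scale0r subr0.
rewrite !E; have [<-|/rungz_orth//] := eqVneq p p'.
case: p => [[|i] j]; first by rewrite /rungz /= rung0_ip eqxx.
by rewrite rungz_eq eqxx s0 expr0n subr0.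
Qed.

(* The Chebyshev basis: [U + U'] and [W + W'] act on the indices as on the free Fock space. *)
Fixpoint cheb i j : H :=
  match i, j with
  | i'.+1, j'.+1 => u i j + S *: cheb i' j'
  | _, _ => u i j
  end.

Lemma cheb0 j : cheb 0 j = u 0 j. Proof. by []. Qed.

Lemma chebi0 i : cheb i 0 = u i 0. Proof. by case: i. Qed.

Lemma chebS i j : cheb i.+1 j.+1 = u i.+1 j.+1 + S *: cheb i j. Proof. by []. Qed.

Lemma chebU i j : U (cheb i j) + U' (cheb i j) = cheb i.+1 j + if i is i'.+1 then cheb i' j else 0.
Proof.
elim: i j => [|i IH] [|j].
- by rewrite !chebi0 rungU0 rungU.
- by rewrite cheb0 rungU0 rungU chebS addr0.
- by rewrite !chebi0 rungU' rungU.
rewrite chebS (linD lU) (linD lU') (linZ lU) (linZ lU') rungU rungU' addrACA -scalerDr IH scalerDr.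
rewrite chebS -addrA -[RHS]addrA; congr (_ + _); rewrite addrCA; congr (_ + _).
by case: i {IH} => [|i]; rewrite ?scaler0 ?addr0 ?cheb0 ?chebS.
Qed.

Lemma chebW i j : W (cheb i j) + W' (cheb i j) = cheb i j.+1 + if j is j'.+1 then cheb i j' else 0.
Proof.
elim: i j => [|i IH] [|j].
- by rewrite !cheb0 rungW0 rungW.
- by rewrite !cheb0 rungW' rungW.
- by rewrite !chebi0 rungW0 rungW chebS chebi0 addr0.
rewrite chebS (linD lW) (linD lW') (linZ lW) (linZ lW') rungW rungW' addrACA -scalerDr IH scalerDr.
rewrite chebS -addrA -[RHS]addrA; congr (_ + _); rewrite addrCA; congr (_ + _).
by case: j => [|j]; rewrite ?scaler0 ?addr0 ?chebi0 ?chebS.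
Qed.

Definition rung_space : closed_subspace H := cspan (range (fun p => u p.1 p.2)).

Lemma rung_in i j : cs_set rung_space (u i j).
Proof. exact: (@cspan_range _ _ _ (fun p => u p.1 p.2) (i, j)). Qed.

Lemma cheb_in i j : cs_set rung_space (cheb i j).
Proof.
elim: i j => [|i IH] [|j]; try exact: rung_in.
by rewrite chebS addrC; apply: cs_lin; [exact: IH|exact: rung_in].
Qed.

Lemma rung_reducing :
  [/\ commuting (cs_proj rung_space) U, commuting (cs_proj rung_space) U',
      commuting (cs_proj rung_space) W & commuting (cs_proj rung_space) W'].
Proof.
have T0 : cs_set rung_space 0 by exact: cs_zero.
have TZ x : cs_set rung_space x -> cs_set rung_space (S *: x).
  by move=> Tx; rewrite -[_ *: _]addr0; apply: cs_lin.
have tU x : cs_set rung_space x -> cs_set rung_space (U x).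
  by apply: cspan_pre => // _ [[i j] _ <-]; rewrite rungU; exact: rung_in.
have tW x : cs_set rung_space x -> cs_set rung_space (W x).
  by apply: cspan_pre => // _ [[i j] _ <-]; rewrite rungW; exact: rung_in.
have tU' x : cs_set rung_space x -> cs_set rung_space (U' x).
  apply: cspan_pre => // _ [[[|i] j] _ <-] /=; last by rewrite rungU'; exact: rung_in.
  by rewrite rungU0; case: j => // j; apply: TZ; exact: rung_in.
have tW' x : cs_set rung_space x -> cs_set rung_space (W' x).
  apply: cspan_pre => // _ [[i [|j]] _ <-] /=; last by rewrite rungW'; exact: rung_in.
  by rewrite rungW0; case: i => // i; apply: TZ; exact: rung_in.
by split; [apply: cs_proj_comm tU tU'|apply: cs_proj_comm tU' tU|apply: cs_proj_comm tW tW'|apply: cs_proj_comm tW' tW] => //; exact: adjoint_sym.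
Qed.

End OneLadder.

Lemma rung0_orth v w : W' v = 0 -> W' w = 0 -> ip v w = 0 ->
  forall j l, ip (rung v 0 j) (rung w 0 l) = 0.
Proof.
move=> hv hw vw; elim=> [|j IH] [|l] //.
- by rewrite -rungW ip_conj WW [W' _]hv ip0r rmorph0.
- by rewrite -rungW WW [W' _]hw ip0r.
- by rewrite -!rungW WW WK IH.
Qed.

Lemma rung_orth s t v w : ladder s v -> ladder t w -> ip v w = 0 ->
  forall i j k l, ip (rung v i j) (rung w k l) = 0.
Proof.
move=> hv hw vw; have o0 := rung0_orth (ladderW hv) (ladderW hw) vw.
have o1 i j l : ip (rung v i j) (rung w 0 l) = 0.
  elim: i l => [|i IH] l //; rewrite -rungU UU (rungU0 hw); case: l => [|l]; first by rewrite ip0r.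
  by rewrite ipZr IH mulr0.
have o2 k j l : ip (rung v 0 j) (rung w k l) = 0.
  elim: k j => [|k IH] j //; rewrite -rungU -(adjoint_sym UU) (rungU0 hv); case: j => [|j]; first by rewrite ip0l.
  by rewrite ipZl IH mulr0.
elim=> [|i IH] j [|k] l //; by rewrite -!rungU UU UK IH.
Qed.

(** [D] is the inverse of [1 - X], an operator of norm at most 2; hence the lower bound on [D]. *)
Lemma neumann_expand (X : H -> H) s : bop X -> 0 <= s < 1 -> (forall x, nrm (X x) <= s * nrm x) ->
  exists D, [/\ bop D, forall x, D (x - X x) = x, forall x, nrm x <= 2 * nrm (D x) &
    forall Y, bop Y -> commuting Y X -> commuting Y D].
Proof.
move=> bX s01 hX; have [D [bD h1 h2 [h3 _]]] := neumann_series bX s01 hX.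
exists D; split=> // x; rewrite -{1}[x]h1; apply: le_trans (nrm_triangle _ _) _.
rewrite nrmN; have := hX (D x); have := nrm_ge0 (D x); case/andP: s01; nra.
Qed.

(* [v0] generates a copy of the coarse correspondence. The map sending its orthonormal basis to the
   Chebyshev basis of [v] is bounded with bounded inverse, and is straightened by polar decomposition. *)
Lemma ladder_isometry (s : R) (v0 v : H) : 0 <= s < 1 -> ladder 0 v0 -> ladder s v ->
  exists V, [/\ bop V, forall x y, ip (V x) (V y) = ip (cs_proj (rung_space v0) x) y,
    (forall x, V (U x + U' x) = U (V x) + U' (V x)) /\ (forall x, V (W x + W' x) = W (V x) + W' (V x)),
    forall x, cs_set (rung_space v) (V x) & forall i j, exists x, rung v i j = V x].
Proof.
(* The factor 1/4 pays for two Neumann inverses, each of which shrinks norms at most by half. *)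
have arith (a n1 n2 n3 n4 : R) : 0 < a -> a * n3 <= n4 -> n1 <= 2 * n2 -> n2 <= 2 * n3 -> a / 4 * n1 <= n4 by nra.
move=> s01 h0 hv; have /andP[s0 s1] := s01; have s2 : 0 < 1 - s ^+ 2 by rewrite subr_gt0 expr_lt1.
pose S : R[i] := (s%:C)%C; pose T := rung_space v0; pose u := rung v0; pose p := cs_proj T.
have bp : bop p := cs_proj_bop T; have lp := proj1 bp.
have [pU pU' pW pW'] := rung_reducing h0; rewrite -/T -/p in pU pU' pW pW'.
have uU0 j : U' (u 0 j) = 0.
  by rewrite /u (rungU0 h0); case: j => // j; rewrite scale0r.
have uW0 i : W' (u i 0) = 0.
  by rewrite /u (rungW0 h0); case: i => // i; rewrite scale0r.
have Tu i j : cs_set T (u i j) := @rung_in v0 i j.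
have uo : orthonormal (fun q : nat * nat => u q.1 q.2) := rung_orthonormal h0 erefl.
have [||q|Z [bZ Zu Zge]] := @orthonormal_map _ _ _ H _ (rungz s v) (1 - s ^+ 2) 1
    (sub_total (fun q => u q.1 q.2)) (sub_orthonormal uo).
- exact: rungz_orth hv.
- exact: ltW.
- exact: rungz_nrm hv _ s01.
have Zuij i j : Z (sub_prj T (u i j)) = rungz s v (i, j) := Zu (i, j).
have [nU nU'] := coisometry_le UU UK; have [nW nW'] := coisometry_le WW WK.
have nS : nrm S = s by rewrite nrm_real ger0_norm.
(* On the orthonormal rungs of [v0], with factor [s], the operators [E] and [G] shift the indices by
   [(-1, -1)] and [(-1, +1)]. Hence the inverse of [1 - G] followed by [Z] undoes the
   orthogonalisation and yields the rungs of [v], while the inverse of [1 - E] forms Chebyshev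
   combinations. Together they send [u i j] to the Chebyshev vector of [v]. *)
pose E x := S *: U' (W' x); pose G x := S *: U' (W x).
have bE : bop E by apply/bopZ/bop_comp.
have bG : bop G by apply/bopZ/bop_comp.
have [|DE [bDE DEK DEge cDE]] := neumann_expand bE s01.
  by move=> x; rewrite nrmZ nS ler_wpM2l // (le_trans (nU' _)).
have [|DG [bDG DGK DGge cDG]] := neumann_expand bG s01.
  by move=> x; rewrite nrmZ nS ler_wpM2l // (le_trans (nU' _)) // nW.
have pDE : commuting p DE by apply: cDE => // x; rewrite /E (linZ lp) pU' pW'.
have pDG : commuting p DG by apply: cDG => // x; rewrite /G (linZ lp) pU' pW.
have prjp x : sub_prj T (p x) = sub_prj T x := sub_prj_proj T x.
have bprj := sub_prj_bop T.
pose Q1 x := Z (sub_prj T (DG x)); pose Q x := Q1 (DE x).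
have bQ1 : bop Q1 by apply: bop_comp => //; apply: bop_comp.
have bQ : bop Q by apply: bop_comp.
have lQ1 := proj1 bQ1; have lQ := proj1 bQ; have lZ := proj1 bZ; have lprj := proj1 bprj.
have Qp x : Q (p x) = Q x by rewrite /Q /Q1 -pDE -pDG prjp.
have Q1u i j : Q1 (u i j) = rung v i j.
  pose psi := fix psi i j := u i j + if i is i'.+1 then S *: psi i' j.+1 else 0.
  have psiE i' j' : psi i' j' - G (psi i' j') = u i' j'.
    elim: i' j' => [|i' IH] j' /=; first by rewrite addr0 /G rungW -/(u 0 _) uU0 scaler0 subr0.
    rewrite (linD (proj1 bG)) (linZ (proj1 bG)) {1}/G rungW rungU' -/(u _ _).
    by rewrite -scalerDr -IH subrK addrK.
  rewrite /Q1 -psiE DGK.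
  elim: i j => [|i IH] j /=; first by rewrite addr0 Zuij.
  by rewrite (linD lprj) (linZ lprj) (linD lZ) (linZ lZ) IH Zuij /rungz /= subrK.
have Qu i j : Q (u i j) = cheb s v i j.
  have chebE i' j' : cheb s v0 i' j' - E (cheb s v0 i' j') = u i' j'.
    elim: i' j' => [|i' IH] [|j'] /=; rewrite -/u -/S.
    - by rewrite /E uW0 (lin0 lU') scaler0 subr0.
    - by rewrite /E rungW' -/(u _ _) uU0 scaler0 subr0.
    - by rewrite /E uW0 (lin0 lU') scaler0 subr0.
    rewrite (linD (proj1 bE)) (linZ (proj1 bE)) {1}/E rungW' rungU' -/(u _ _).
    by rewrite -scalerDr -[u i' j']IH subrK addrK.
  rewrite /Q -chebE DEK; elim: i j => [|i IH] [|j] /=; rewrite -/u -/S ?Q1u //.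
  by rewrite (linD lQ1) (linZ lQ1) IH Q1u.
have Qge x : (1 - s ^+ 2) / 4 * nrm (p x) <= nrm (Q x).
  have := Zge (sub_prj T (DG (DE x))); rewrite -/(Q1 _) -/(Q _).
  rewrite sub_prj_nrm -/p pDG pDE => h.
  exact: arith s2 h (DEge (p x)) (DGge (DE (p x))).
have QF X Y : bop X -> bop Y -> commuting p X -> (forall i j, Q (X (u i j)) = Y (cheb s v i j)) ->
    forall x, Q (X x) = Y (Q x).
  move=> bX bY pX h x; rewrite -Qp pX -[Q x]Qp; have := cs_proj_in T x.
  have := cspan_eq (bop_comp bQ bX) (bop_comp bY bQ); apply => _ [[i j] _ <-] /=.
  by rewrite h Qu.
have cheb_u i j : cheb 0 v0 i j = u i j by case: i j => [|i] [|j] //=; rewrite scale0r addr0.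
have chU i j : Q (U (u i j) + U' (u i j)) = U (cheb s v i j) + U' (cheb s v i j).
  rewrite -cheb_u (chebU h0) (chebU hv) !cheb_u (linD lQ) Qu; congr (_ + _).
  by case: i => [|i]; rewrite ?(lin0 lQ) // cheb_u Qu.
have chW i j : Q (W (u i j) + W' (u i j)) = W (cheb s v i j) + W' (cheb s v i j).
  rewrite -cheb_u (chebW h0) (chebW hv) !cheb_u (linD lQ) Qu; congr (_ + _).
  by case: j => [|j]; rewrite ?(lin0 lQ) // cheb_u Qu.
have k0 : 0 < (1 - s ^+ 2) / 4 by rewrite divr_gt0.
have [V [bV VV QV VQ VF]] := polar bQ bp (cs_proj_adjoint T) (cs_proj_idem T) Qp k0 Qge.
have sF (X Y : H -> H) : is_adjoint X Y -> is_adjoint (fun x => X x + Y x) (fun x => X x + Y x).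
  by move=> XY x y; rewrite ipDl ipDr XY (adjoint_sym XY) addrC.
exists V; split=> //.
- split.
    apply: (VF (fun x => U x + U' x) (fun x => U x + U' x)); try exact: sF.
    + exact: bopD.
    + by apply: (QF (fun x => U x + U' x) (fun x => U x + U' x)); [exact: bopD|exact: bopD|move=> x; rewrite (linD lp) pU pU'|].
    + by move=> x; rewrite (linD lp) pU pU'.
  apply: (VF (fun x => W x + W' x) (fun x => W x + W' x)); try exact: sF.
  + exact: bopD.
  + by apply: (QF (fun x => W x + W' x) (fun x => W x + W' x)); [exact: bopD|exact: bopD|move=> x; rewrite (linD lp) pW pW'|].
  + by move=> x; rewrite (linD lp) pW pW'.
- move=> x; have [x' ->] := VQ x; rewrite -Qp; have := cs_proj_in T x'.
  by apply: cspan_pre => // _ [[i j] _ <-] /=; rewrite Qu; exact: cheb_in.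
- move=> i j; suff [x ->] : exists x, rung v i j = Q x by exact: QV.
  case: i j => [|i] [|j]; try by [exists (u 0 0); rewrite Qu|exists (u 0 j.+1); rewrite Qu|exists (u i.+1 0); rewrite Qu].
  exists (u i.+1 j.+1 - S *: u i j); by rewrite (linB lQ) (linZ lQ) !Qu chebS addrK.
Qed.

End Ladder.

(** * The cup subalgebra *)

Section CupOperators.
Variables (R : realType) (P : planar_data R).
Hypothesis hP : is_planar_algebra P.
Variables (H : hilbert R) (iota : (forall n : nat, P n) -> H).
Hypothesis hH : is_completion iota.
Implicit Types (n m k j l i : nat).

Notation deg := (deg iota).
Notation lmul a j := (lmul hP hH a j).
Notation conj := (conj hP hH).
Notation M := (planar_vn iota).
Notation A := (cup_vn iota).
Notation Om := (vacuum iota).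
Notation cup := (pa_cup P).

(** The norm of the cup. Dividing by it makes the placement of a cup isometric. *)
Definition sqrt_mod : R[i] := ((Num.sqrt (pa_modulus P))%:C)%C.
Notation q := sqrt_mod.

Lemma mod_gt0 : 0 < pa_modulus P.
Proof. by apply: lt_trans (pa_modulus_gt1 hP). Qed.

Lemma sqrt_mod_sq : q * q = ((pa_modulus P)%:C)%C.
Proof. by rewrite /q -rmorphM -expr2 sqr_sqrtr // ltW // mod_gt0. Qed.

Lemma sqrt_mod_neq0 : q != 0.
Proof. by rewrite /q (inj_eq (@complexI R)) sqrtr_eq0 -ltNge mod_gt0. Qed.

Lemma sqrt_modV_conj : (q^-1)^* = q^-1.
Proof. by rewrite fmorphV /=; congr (_^-1); apply/eqP; rewrite eq_complex /= oppr0 !eqxx. Qed.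

Definition cupL (x : H) : H := q^-1 *: lmul cup 0 x.
Definition capL (x : H) : H := q^-1 *: lmul cup 2 x.
Definition cupR : H -> H := conj \o cupL \o conj.
Definition capR : H -> H := conj \o capL \o conj.

Lemma cupL_bop : bop cupL. Proof. exact/bopZ/lmul_bop. Qed.
Lemma capL_bop : bop capL. Proof. exact/bopZ/lmul_bop. Qed.
Lemma cupR_bop : bop cupR. Proof. exact/bop_conj/cupL_bop. Qed.
Lemma capR_bop : bop capR. Proof. exact/bop_conj/capL_bop. Qed.

Lemma cupL_deg n (b : P n) : cupL (deg b) = q^-1 *: deg (pa_starj 0 n.+2 cup b).
Proof. by rewrite /cupL (lmul_deg _ _ _ (l := n.+2)) //; lia. Qed.

Lemma capL_deg n (b : P n.+2) : capL (deg b) = q^-1 *: deg (pa_starj 2 n cup b).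
Proof. by rewrite /capL (lmul_deg _ _ _ (l := n)) // addn4 add2n. Qed.

Lemma capL_deg0 n (b : P n) : (n < 2)%N -> capL (deg b) = 0.
Proof. by move=> n2; rewrite /capL lmul_deg0 // scaler0. Qed.

Lemma cupR_deg n (b : P n) : cupR (deg b) = q^-1 *: deg (pa_starj 0 n.+2 b cup).
Proof.
rewrite /cupR /= conj_deg cupL_deg conjZ sqrt_modV_conj conj_deg (pa_star_starj hP) //; last by rewrite addn0 add2n.
by rewrite (pa_starK hP) (star_cup hP).
Qed.

Lemma cupL_adjoint : is_adjoint cupL capL.
Proof.
move=> x y; rewrite /cupL /capL ipZl ipZr sqrt_modV_conj; congr (_ * _).
by rewrite lmul_adjoint // (star_cup hP).
Qed.

Lemma cupR_adjoint : is_adjoint cupR capR.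
Proof. exact/conj_adjoint/cupL_adjoint. Qed.

Lemma cupLK x : capL (cupL x) = x.
Proof.
apply: (deg_ext hH (bop_comp capL_bop cupL_bop) (bop_id H)) => n b /=.
rewrite cupL_deg (linZ (proj1 capL_bop)) capL_deg scalerA -invfM sqrt_mod_sq.
rewrite -(@starjA _ _ hP 2 2 n n 0 n.+2 2 0 0 cup cup b ltac:(lia) ltac:(lia) ltac:(lia)
  (or_introl erefl) ltac:(lia) ltac:(lia) ltac:(lia)).
rewrite addn0 (cup_cup hP) (pa_starjZl hP) //; last by rewrite addn0.
rewrite (one_starj hP) degZ // scalerA mulVf ?scale1r //.
by rewrite -sqrt_mod_sq mulf_neq0 // sqrt_mod_neq0.
Qed.

Lemma cupRK x : capR (cupR x) = x.
Proof. by rewrite /capR /cupR /= conjK cupLK conjK. Qed.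

Lemma cup_comm : commuting cupL cupR.
Proof.
apply: (deg_ext hH (bop_comp cupL_bop cupR_bop) (bop_comp cupR_bop cupL_bop)) => n b /=.
rewrite cupL_deg cupR_deg (linZ (proj1 cupL_bop)) (linZ (proj1 cupR_bop)) cupL_deg cupR_deg.
by rewrite -(@starjA _ _ hP 2 n 2 n.+4 n.+2 n.+2 0 0 0 cup b cup ltac:(lia) ltac:(lia) ltac:(lia)
  (or_introl erefl) ltac:(lia) ltac:(lia) ltac:(lia)).
Qed.

Lemma cup_vac : cupL Om = cupR Om.
Proof. by rewrite vacE cupL_deg cupR_deg (starj_one hP) (one_starj hP). Qed.

Lemma capL_vac : capL Om = 0.
Proof. by rewrite capL_deg0. Qed.

Lemma capR_vac : capR Om = 0.
Proof. by rewrite /capR /= conj_vac capL_vac conj0. Qed.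

Lemma capL_cupR n (b : P n) : (1 < n)%N -> capL (cupR (deg b)) = cupR (capL (deg b)).
Proof.
case: n b => [|[|n]] // b _.
rewrite cupR_deg capL_deg (linZ (proj1 capL_bop)) (linZ (proj1 cupR_bop)) capL_deg cupR_deg.
by rewrite -(@starjA _ _ hP 2 n.+2 2 n.+2 n n.+4 2 0 0 cup b cup ltac:(lia) ltac:(lia) ltac:(lia)
  (or_introl erefl) ltac:(lia) ltac:(lia) ltac:(lia)).
Qed.

(** The cap is joined to the single point of [b] and to the near end of the cup. This zigzag
    straightens to the string of [b] without closing a loop, and the two normalising factors are
    left over. *)
Lemma capL_cupR1 (b : P 1) : capL (cupR (deg b)) = (((pa_modulus P)^-1)%:C)%C *: deg b.
Proof.
rewrite cupR_deg (linZ (proj1 capL_bop)) capL_deg scalerA -invfM sqrt_mod_sq fmorphV; congr (_ *: _).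
rewrite -(@starjA _ _ hP 2 1 2 1 1 3 1 1 0 cup b cup ltac:(lia) ltac:(lia) ltac:(lia)
  (or_intror erefl) ltac:(lia) ltac:(lia) ltac:(lia)).
by rewrite (cup_starj hP) // (starj_cup hP).
Qed.

(** A cup joined by one string changes nothing in positive degree, and there is no string to join in
    degree 0. This is the source of the rank one perturbation. *)
Lemma lmul_cup1 x : lmul cup 1 x = x - ip x Om *: Om.
Proof.
have bO : bop (fun x : H => ip x Om *: Om).
  split; first by move=> c u v; rewrite ipDl ipZl scalerDl scalerA.
  exists (nrm Om * nrm Om) => u; rewrite nrmZ mulrAC; apply: ler_wpM2r; first exact: nrm_ge0.
  by rewrite mulrC; exact: cauchy_schwarz.
apply: (deg_ext hH (lmul_bop hP hH cup 1) (bopB (bop_id H) bO)) => -[|n] b.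
  rewrite lmul_deg0 // [b](pa_scalarE hP) degZ // -(vacE iota) ipZl vac_nrm // mulr1.
  by rewrite subrr.
rewrite (lmul_deg _ _ _ (l := n.+1)) //; last by rewrite addnC.
rewrite (cup_starj hP) // vacE (deg_orth hP hH) //.
by rewrite scale0r subr0.
Qed.

Notation XL := (lrep hP hH cup).

Lemma lrep_cup x : XL x = q *: (cupL x + capL x) + (x - ip x Om *: Om).
Proof.
rewrite /lrep !big_ord_recl big_ord0 /= addr0 lmul_cup1 scalerDr !scalerA divff ?sqrt_mod_neq0 //.
by rewrite !scale1r addrA addrAC.
Qed.

Notation XR := (rrep hP hH cup).

Lemma XR_E x : XR x = q *: (cupR x + capR x) + (x - ip x Om *: Om).
Proof.
change (XR x) with (conj (lrep hP hH (pa_star cup) (conj x))).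
have qc : q^* = q by apply/eqP; rewrite eq_complex /= oppr0 !eqxx.
rewrite (star_cup hP) lrep_cup conjD (conjZ hP hH q) qc conjD -scaleN1r conjD conjK !(conjZ hP hH _ (_ *: _)).
rewrite (conjZ hP hH _ Om) conj_vac rmorphN rmorph1 scaleN1r -[ip (conj x) Om](conj_ip hP hH) conjK conj_vac.
by rewrite -ip_conj.
Qed.

Lemma commuting_XL T : bop T -> T Om = 0 -> (forall x, ip (T x) Om = 0) ->
  (forall x, T (cupL x + capL x) = cupL (T x) + capL (T x)) -> commuting T XL.
Proof.
move=> [lT _] T0 TO h x; rewrite !lrep_cup (linD lT) (linZ lT) (linB lT) (linZ lT) h T0 TO.
by rewrite scaler0 scale0r.
Qed.

Lemma commuting_XR T : bop T -> T Om = 0 -> (forall x, ip (T x) Om = 0) ->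
  (forall x, T (cupR x + capR x) = cupR (T x) + capR (T x)) -> commuting T XR.
Proof.
move=> [lT _] T0 TO h x; rewrite !XR_E (linD lT) (linZ lT) (linB lT) (linZ lT) h T0 TO.
by rewrite scaler0 scale0r.
Qed.

Lemma XL_adjoint : is_adjoint XL XL.
Proof. by have := lrep_adjoint hP hH cup; rewrite (star_cup hP). Qed.

Lemma cup_vnE : A = commutant (commutant [set XL]).
Proof.
have -> : A = vn_generated [set XL].
  rewrite /cup_vn; congr vn_generated; apply/seteqP.
  have hN n : (3 <= n)%N -> gr_cup P n = 0 by move=> n3; rewrite /gr_cup gr_hom_out // ltn_eqF.
  have E : (fun x => \sum_(n < 3) lrep hP hH (gr_cup P n) x) = XL.
    apply/funext => x; rewrite !big_ord_recr big_ord0 /= add0r.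
    have z n : gr_cup P n = 0 -> lrep hP hH (gr_cup P n) x = 0.
      move=> ->; apply: (deg_ext hH (lrep_bop hP hH (0 : P n)) (bop0 H H)) => m b.
      rewrite lrep_deg big1 // => j jm; rewrite (pa_starj0l hP) ?(deg0 hH) //.
        by rewrite -ltnS.
      by move: (ltn_ord j) jm; lia.
    rewrite (z 0%N) ?(z 1%N) ?add0r; [|exact: gr_hom_out|exact: gr_hom_out].
    by rewrite /gr_cup gr_hom_in.
  by split=> X; [move/(is_piP hP hH X hN); rewrite E|move=> ->; apply/(is_piP hP hH _ hN); rewrite E].
apply: vn_generatedE => [X ->|X ->]; first by exists XL => //; exact: XL_adjoint.
exact/bopP/lrep_bop.
Qed.

Lemma cup_von_neumann : von_neumann A.
Proof.
rewrite cup_vnE; apply: bicommutant_von_neumann => [X ->|X ->].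
  by exists XL => //; exact: XL_adjoint.
exact/bopP/lrep_bop.
Qed.

Lemma cup_sub_commutant : A `<=` commutant [set XL].
Proof.
rewrite cup_vnE; apply: commutant_sub => X ->; split; first exact/bopP/lrep_bop.
by move=> _ ->.
Qed.

Lemma cup_abelian : abelian_ops A.
Proof.
move=> X Y /cup_sub_commutant cX; rewrite cup_vnE => -[_ h]; by rewrite (h _ cX).
Qed.

Lemma XL_cup : A XL.
Proof.
by rewrite cup_vnE; apply: sub_bicommutant => // _ ->; exact/bopP/lrep_bop.
Qed.

Lemma cup_sub : A `<=` M.
Proof.
rewrite cup_vnE (planar_vnE hP hH); apply: commutant_sub; apply: commutant_sub => _ ->.
exact: left_ops_lrep.
Qed.

(** As [A] is the double commutant of [XL], the commutation with all of [A] is decided by one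
    operator. *)
Lemma cup_commuting T a : bop T -> commuting T XL -> A a -> commuting T a.
Proof.
move=> bT cT; rewrite cup_vnE => -[_ h] x; have /(congr1 (@^~ x)) /= -> // : a \o T = T \o a.
apply: h; split; first exact/bopP.
by move=> _ ->; apply/funext => y /=; exact: cT.
Qed.

(** Conjugation by [conj] exchanges [XR] with [XL] and the right action of [a] with its adjoint,
    which reduces this to the left-hand statement. *)
Lemma cup_right_commuting T a : bop T -> commuting T XR -> A a -> commuting T (right_op M Om a).
Proof.
move=> bT cT Aa; have [a' Aa' aa] := vn_adjoint cup_von_neumann Aa.
rewrite (right_opE hP hH (cup_sub Aa) (cup_sub Aa') aa) => x /=.
have h : commuting (conj \o T \o conj) a'.
  apply: cup_commuting => //; first exact: bop_conj.
  move=> y /=; have := cT (conj y).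
  change (XR (conj y)) with (conj (lrep hP hH (pa_star cup) (conj (conj y)))).
  change (XR (T (conj y))) with (conj (lrep hP hH (pa_star cup) (conj (T (conj y))))).
  by rewrite (star_cup hP) !conjK => ->; rewrite conjK.
by have := congr1 conj (h (conj x)); rewrite /= !conjK.
Qed.

Lemma cup_comp a b : A a -> A b -> A (a \o b).
Proof. by rewrite cup_vnE; apply: commutant_comp. Qed.

Lemma cup_lin c a b : A a -> A b -> A (fun x => c *: a x + b x).
Proof. by rewrite cup_vnE; apply: commutant_lin; exact: commutant_bounded. Qed.

Lemma cup_id : A id.
Proof. by rewrite cup_vnE; split; [apply/bopP; exact: bop_id|]. Qed.

Lemma cup_scale c : A (fun x => c *: x).
Proof.
have -> : (fun x => c *: x) = (fun x : H => (c - 1) *: id x + id x).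
  by apply/funext => x; rewrite scalerBl scale1r subrK.
by apply: cup_lin; exact: cup_id.
Qed.

Definition cup_power i : H := iter i cupL Om.
Notation e := cup_power.

Lemma cupR_power i : cupR (e i) = e i.+1.
Proof. by elim: i => [|i IH]; [rewrite -cup_vac|rewrite [in LHS]/= -cup_comm IH]. Qed.

Lemma capL_power i : capL (e i) = if i is i'.+1 then e i' else 0.
Proof. by case: i => [|i]; [exact: capL_vac|exact: cupLK]. Qed.

Lemma capR_power i : capR (e i) = if i is i'.+1 then e i' else 0.
Proof. by case: i => [|i]; [exact: capR_vac|rewrite -cupR_power cupRK]. Qed.

Lemma power_orthonormal : orthonormal e.
Proof.
elim=> [|i IH] [|j].
- exact: vac_nrm.
- by rewrite ip_conj cupL_adjoint capL_power ip0r rmorph0.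
- by rewrite cupL_adjoint capL_power ip0r.
- by rewrite cupL_adjoint capL_power IH.
Qed.

Lemma XL_power i : XL (e i) = q *: (e i.+1 + if i is i'.+1 then e i' else 0) + (if i is 0%N then 0 else e i).
Proof.
rewrite lrep_cup capL_power; congr (_ *: _ + _).
have -> : ip (e i) Om = (i == 0%N)%:R by rewrite -[Om]/(e 0) power_orthonormal.
by case: i => [|i]; rewrite ?scale1r ?subrr // scale0r subr0.
Qed.

Lemma XR_power i : XR (e i) = XL (e i).
Proof. by rewrite XR_E lrep_cup cupR_power capL_power capR_power. Qed.

Lemma power_in_cup i : exists2 a, A a & e i = a Om.
Proof.
suff : (exists2 a, A a & e i = a Om) /\ (exists2 a, A a & e i.+1 = a Om) by case.
(* The three-term recurrence of [XL] solved for its leading term: by induction each [e j] is a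
   polynomial in the cup applied to the vacuum. *)
have E j : e j.+1 = q^-1 *: (XL (e j) - if j is 0%N then 0 else e j) - if j is j'.+1 then e j' else 0.
  by rewrite XL_power addrK scalerA mulVf ?sqrt_mod_neq0 // scale1r addrK.
elim: i => [|i [[a Aa ea] [b Ab eb]]].
  split; first by exists id => //; exact: cup_id.
  exists (fun x => q^-1 *: XL x + 0 *: x); last by rewrite E /= !subr0 scale0r addr0.
  by apply: cup_lin; [exact: XL_cup|exact: cup_scale].
split; first by exists b.
exists (fun x => q^-1 *: (XL \o b) x + ((- q^-1) *: b x + ((-1) *: a x + 0 *: x))).
  apply: cup_lin; first exact: cup_comp XL_cup Ab.
  by apply: cup_lin => //; apply: cup_lin => //; exact: cup_scale.
by rewrite E /= -ea -eb scalerBr scaleNr scaleN1r scale0r addr0 addrA.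
Qed.

End CupOperators.

(** * Invariant subspaces and primitive vectors *)

Section Decomposition.
Variables (R : realType) (P : planar_data R).
Hypothesis hP : is_planar_algebra P.
Variables (H : hilbert R) (iota : (forall n : nat, P n) -> H).
Hypothesis hH : is_completion iota.
Implicit Types (n m k j l i : nat).

Notation deg := (deg iota).
Notation conj := (conj hP hH).
Notation Om := (vacuum iota).
Notation cup := (pa_cup P).
Notation q := (sqrt_mod P).
Notation cupL := (cupL hP hH).
Notation capL := (capL hP hH).
Notation cupR := (cupR hP hH).
Notation capR := (capR hP hH).
Notation XL := (lrep hP hH cup).
Notation XR := (rrep hP hH cup).
Notation e := (cup_power hP hH).

Let bcL := cupL_bop hP hH. Let bcL' := capL_bop hP hH.
Let bcR := cupR_bop hP hH. Let bcR' := capR_bop hP hH.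
Let aL := cupL_adjoint hP hH. Let aR := cupR_adjoint hP hH.
Let kL := cupLK hP hH. Let kR := cupRK hP hH. Let cLR := cup_comm hP hH.

Definition cup_space : closed_subspace H := cspan (range e).
Notation L := cup_space.
Notation pL := (cs_proj cup_space).

Lemma power_in i : cs_set L (e i).
Proof. exact: (@cspan_range _ _ _ e i). Qed.

Lemma cup_space_reducing :
  [/\ commuting pL cupL, commuting pL capL, commuting pL XL & commuting pL XR].
Proof.
have L0 : cs_set L 0 by exact: cs_zero.
have tL x : cs_set L x -> cs_set L (cupL x).
  by apply: cspan_pre => // _ [i _ <-]; exact: (@power_in i.+1).
have tL' x : cs_set L x -> cs_set L (capL x).
  by apply: cspan_pre => // _ [i _ <-]; rewrite capL_power; case: i => // i; exact: power_in.
have tR x : cs_set L x -> cs_set L (cupR x).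
  by apply: cspan_pre => // _ [i _ <-]; rewrite cupR_power; exact: power_in.
have tR' x : cs_set L x -> cs_set L (capR x).
  by apply: cspan_pre => // _ [i _ <-]; rewrite capR_power; case: i => // i; exact: power_in.
have c1 : commuting pL cupL by apply: cs_proj_comm tL tL'.
have c2 : commuting pL capL by apply: cs_proj_comm tL' tL => //; exact: adjoint_sym.
have c3 : commuting pL cupR by apply: cs_proj_comm tR tR'.
have c4 : commuting pL capR by apply: cs_proj_comm tR' tR => //; exact: adjoint_sym.
have lp := proj1 (cs_proj_bop L); have pO : pL Om = Om by apply: cs_proj_id; exact: (@power_in 0).
split=> // x.
  by rewrite !lrep_cup (linD lp) (linZ lp q) (linD lp) (linB lp) (linZ lp _ Om) c1 c2 cs_proj_adjoint pO.
by rewrite !XR_E (linD lp) (linZ lp q) (linD lp) (linB lp) (linZ lp _ Om) c3 c4 cs_proj_adjoint pO.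
Qed.

Lemma cup_space_XR x : cs_set L x -> XR x = XL x.
Proof.
apply: cspan_eq => [||_ [i _ <-]]; [exact: rrep_bop|exact: lrep_bop|exact: XR_power].
Qed.

(* On [L] the operator [cup - 1] is [q] times the free Jacobi matrix perturbed at the corner;
   [1 + q^-1 capL] intertwines it with the unperturbed one. *)
Lemma cup_basis : exists b : nat -> H, [/\ forall i, cs_set L (b i), orthonormal b,
  forall x, cs_set L x -> (forall i, ip x (b i) = 0) -> x = 0 &
  forall i, XL (b i) = q *: (b i.+1 + if i is i'.+1 then b i' else 0) + b i].
Proof.
have [c1 c2 c3 _] := cup_space_reducing; have q0 := sqrt_mod_neq0 hP.
have bp := cs_proj_bop L; have lp := proj1 bp.
have lXL := proj1 (lrep_bop hP hH cup); have lcL := proj1 bcL; have lcL' := proj1 bcL'.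
pose X x := q^-1 *: (XL x - x).
have bX : bop X by apply/bopZ/bopB; [exact: lrep_bop|exact: bop_id].
have lX := proj1 bX.
have sX : is_adjoint X X.
  by move=> x y; rewrite ipZl ipZr ipBl ipBr XL_adjoint sqrt_modV_conj.
have cX : commuting pL X by move=> x; rewrite /X (linZ lp) (linB lp) c3.
have XE i : X (e i) = e i.+1 + (if i is i'.+1 then e i' else - (q^-1 *: Om)).
  rewrite /X XL_power; case: i => [|i].
    by rewrite !addr0 scalerBr scalerA mulVf // scale1r.
  by rewrite addrK scalerA mulVf // scale1r.
pose F x := cupL x + capL x.
have bF : bop F by exact: bopD.
have sF : is_adjoint F F by move=> x y; rewrite ipDl ipDr aL (adjoint_sym aL) addrC.
pose Q x := pL x + q^-1 *: capL (pL x).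
have bQ : bop Q by apply: bopD => //; apply: bopZ; exact: bop_comp.
have lQ := proj1 bQ.
have Qe i : Q (e i) = e i + q^-1 *: (if i is i'.+1 then e i' else 0).
  by rewrite /Q cs_proj_id ?capL_power //; exact: power_in.
have Qp x : Q (pL x) = Q x by rewrite /Q cs_proj_idem.
have QX x : Q (X x) = F (Q x).
  rewrite -Qp cX -[Q x]Qp; have := cs_proj_in L x.
  have := cspan_eq (bop_comp bQ bX) (bop_comp bF bQ); apply => _ [i _ <-] /=.
  rewrite XE (linD lQ) !Qe /F (linD lcL) (linD lcL') (linZ lcL) (linZ lcL') -/(e i.+1) capL_power.
  case: i => [|i].
    rewrite (linN lQ) (linZ lQ) -[Om]/(e 0) Qe (lin0 lcL) (lin0 lcL') !scaler0 !addr0 -addrA subrr addr0.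
    by [].
  by rewrite Qe capL_power -/(e i.+1) addrACA.
(* The modulus exceeds 1, so [1 + q^-1 capL] differs from the identity by a strict contraction and
   is bounded below on [L]. *)
have nq : nrm (q^-1 : R[i]) < 1.
  have sq1 : 1 < Num.sqrt (pa_modulus P).
    by rewrite -[ltLHS](sqrtr1 R) ltr_sqrt ?ltr01 ?(mod_gt0 hP) // (pa_modulus_gt1 hP).
  rewrite /sqrt_mod -fmorphV nrm_real normfV ger0_norm ?sqrtr_ge0 // invf_lt1 //.
  exact: lt_trans sq1.
have [_ nL'] := coisometry_le aL kL.
have k0 : 0 < 1 - nrm (q^-1 : R[i]) by rewrite subr_gt0.
have Qge x : (1 - nrm (q^-1 : R[i])) * nrm (pL x) <= nrm (Q x).
  have := nrm_triangle (Q x) (- (q^-1 *: capL (pL x))); rewrite /Q addrK nrmN nrmZ.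
  have := ler_wpM2l (nrm_ge0 (q^-1 : R[i])) (nL' (pL x)); rewrite mulrBl mul1r lerBlDr.
  by move=> h1 h2; apply: le_trans h2 _; rewrite lerD2l.
have [V [bV VV QV VQ VX]] := polar bQ bp (cs_proj_adjoint L) (cs_proj_idem L) Qp k0 Qge.
have lV := proj1 bV; have VF x : V (X x) = F (V x) by exact: VX.
have inj x : V x = 0 -> pL x = 0.
  by move=> h; apply: ip_eq0; rewrite -cs_proj_adjoint cs_proj_idem -VV h ip0l.
have Vp x : V (pL x) = V x := partial_isometry_proj bV VV x.
have VL x : cs_set L (V x).
  have [y ->] := VQ x; rewrite -Qp; have := cs_proj_in L y.
  apply: cspan_pre => // _ [i _ <-]; rewrite Qe addrC; apply: cs_lin; last exact: power_in.
  by case: i => [|i]; [exact: cs_zero|exact: power_in].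
have rV i : exists x, V x = e i.
  suff [y <-] : exists y, Q y = e i by have [z ->] := QV y; exists z.
  elim: i => [|i [y Qy]]; first by exists (e 0); rewrite Qe scaler0 addr0.
  by exists (e i.+1 - q^-1 *: y); rewrite (linB lQ) (linZ lQ _ y) Qe Qy addrK.
(* The basis is pulled back along [V] from the vectors [e i], in which [F] is the free Jacobi
   matrix. It remains in [L] thanks to [pL]. *)
pose b i := pL (projT1 (cid (rV i))).
have Vb i : V (b i) = e i by rewrite /b Vp; case: cid.
have Lb i : cs_set L (b i) := cs_proj_in L _.
exists b; split=> // [i j|x Lx h|i].
- by rewrite -{1}(cs_proj_id (Lb i)) -VV !Vb power_orthonormal.
- rewrite -(cs_proj_id Lx); apply: inj; apply: ip_eq0; apply: cspan_orth (VL x) => _ [i _ <-].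
  by rewrite -Vb VV (cs_proj_id Lx) h.
have E : X (b i) = b i.+1 + if i is i'.+1 then b i' else 0.
  apply/eqP; rewrite -subr_eq0; apply/eqP; rewrite -(cs_proj_id (Lb i)) -cX -[RHS](subrr (pL 0)).
  have Lr : cs_set L (b i.+1 + if i is i'.+1 then b i' else 0).
    by rewrite -[b i.+1]scale1r; apply: cs_lin => //; case: i => [|i]; [exact: cs_zero|].
  rewrite -{1}(cs_proj_id Lr) -(linB lp) subrr (inj _ _) // (linB lV) VF !Vb (linD lV) Vb.
  rewrite /F -/(e i.+1) capL_power; case: i {Lr} => [|i]; rewrite ?Vb ?(lin0 lV) subrr //.
have <- : q *: X (b i) + b i = XL (b i) by rewrite scalerA divff // scale1r subrK.
by rewrite E.
Qed.

Definition ladder_param n : R := if n == 1%N then (pa_modulus P)^-1 else 0.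

Lemma ladder_param_lt1 n : 0 <= ladder_param n < 1.
Proof.
rewrite /ladder_param; case: eqP => _; last by rewrite lexx ltr01.
by rewrite invr_ge0 ltW ?(mod_gt0 hP) // invf_lt1 ?(mod_gt0 hP) // (pa_modulus_gt1 hP).
Qed.

Definition primitive n (x : P n) : Prop := [/\ (0 < n)%N, capL (deg x) = 0 & capR (deg x) = 0].

Lemma cupR_iter_deg n (x : P n) j : exists y : P (n + j.*2)%N, iter j cupR (deg x) = deg y.
Proof.
elim: j => [|j [y E]]; first by rewrite addn0; exists x.
rewrite iterS E doubleS !addnS; exists (q^-1 *: pa_starj 0 (n + j.*2).+2 y cup).
by rewrite degZ // cupR_deg.
Qed.

Lemma capL_iter n (x : P n) j : (0 < n)%N -> capL (deg x) = 0 ->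
  capL (iter j.+1 cupR (deg x)) = (((ladder_param n)%:C)%C) *: iter j cupR (deg x).
Proof.
move=> n0 h; elim: j => [|j IH].
  (* In degree 1 the cap reaches the cup on the other side. From degree 2 on it touches [x] only,
     and [x] is killed. *)
  rewrite /= /ladder_param; case: n x n0 h => [|[|n]] x // _ h; first exact: capL_cupR1.
  by rewrite capL_cupR // h (lin0 (proj1 bcR)) scale0r.
have [y E] := cupR_iter_deg x j.+1; rewrite iterS E capL_cupR; last by lia.
by rewrite -E IH (linZ (proj1 bcR)).
Qed.

Lemma conj_iter i x : conj (iter i cupL x) = iter i cupR (conj x).
Proof. by elim: i => //= i <-; rewrite -{1}(conjK hP hH (iter i cupL x)). Qed.

Lemma primitive_ladder n (x : P n) : primitive x -> ip (deg x) (deg x) = 1 ->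
  ladder cupL capL cupR capR (ladder_param n) (deg x).
Proof.
move=> [n0 hL hR] x1; split=> // [j|i]; first exact: capL_iter.
(* The relations of the right-hand operators are the mirror images of those on the left for
   [pa_star x]. *)
have hL' : capL (deg (pa_star x)) = 0.
  by apply: (can_inj (conjK hP hH)); rewrite conj0 -(conj_deg hP hH).
have := congr1 conj (capL_iter i n0 hL'); rewrite (conjZ hP hH ((ladder_param n)%:C)%C) S_conj.
by rewrite -(conj_deg hP hH) -!conj_iter conjK.
Qed.

Lemma primitive4 : exists2 x : P 4, primitive x & ip (deg x) (deg x) = 1.
Proof.
pose d : R[i] := ((pa_modulus P)%:C)%C.
have d0 : d != 0 by rewrite (inj_eq (@complexI R)) gt_eqF // (mod_gt0 hP).
have dc : d^* = d by apply/eqP; rewrite eq_complex /= oppr0 !eqxx.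
pose cc : P 4 := pa_starj 0 4 cup cup.
have cc2 : pa_starj 2 2 cup cc = d *: cup.
  rewrite /cc -(@starjA _ _ hP 2 2 2 2 0 4 2 0 0 cup cup cup isT isT isT (or_introl erefl) erefl erefl erefl).
  by rewrite addn0 (cup_cup hP) (pa_starjZl hP) // (one_starj hP).
(* Capping the first two points sends the two adjacent cups to [d] times the cup and the nested cups
   to the cup; the coefficient cancels the two. The vector is self-adjoint, which takes care of the
   other side. *)
pose x0 : P 4 := (- d^-1) *: cc + nest P.
have x0s : pa_star x0 = x0.
  rewrite /x0 (pa_star_antilinear hP) (pa_star_starj hP) // !(star_cup hP) (star_nest hP).
  by congr (_ *: _ + _); rewrite rmorphN fmorphV; congr (- _^-1); exact: dc.
have hL : capL (deg x0) = 0.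
  rewrite capL_deg (pa_starjPr hP) // cc2 (cup_nest hP) scalerA mulNr mulVf // scaleN1r addNr.
  by rewrite (deg0 hH) scaler0.
have hR : capR (deg x0) = 0 by change (conj (capL (conj (deg x0))) = 0); rewrite conj_deg x0s hL conj0.
(* If [nest] were [d^-1] times [cc], its product with [nest] along three strings would be both [d]
   and [d^-1] times the cup, against [d > 1]. *)
have x0n : deg x0 != 0.
  apply/eqP => h0; have := deg_inj hP hH h0; rewrite /x0 addrC scaleNr => /eqP.
  rewrite subr_eq0 => /eqP nE.
  have := nest_nest hP; rewrite {1}nE (pa_starjZl hP) //.
  have -> : pa_starj 3 2 cc (nest P) = cup.
    have := @starjA _ _ hP 2 2 4 2 4 2 0 1 2 cup cup (nest P) isT isT isT (or_intror erefl) erefl erefl erefl.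
    by rewrite (cup_nest hP) (cup_starj hP).
  move=> /eqP; rewrite -subr_eq0 -scalerBl scaler_eq0 => /orP[|/eqP c0].
    rewrite subr_eq0 -(inj_eq (mulfI d0)) divff // -rmorphM => /eqP/(@complexI R) h.
    by have := pa_modulus_gt1 hP; move: h; nra.
  have := cup_cup hP; rewrite c0 (pa_starj0l hP) // => /esym/eqP.
  by rewrite scaler_eq0 (negbTE d0) (negbTE (pa_one_neq0 hP)).
pose r : R[i] := (((nrm (deg x0))^-1)%:C)%C.
exists (r *: x0).
  by split=> //; rewrite degZ //; [rewrite (linZ (proj1 bcL')) hL|rewrite (linZ (proj1 bcR')) hR]; rewrite scaler0.
rewrite ip_nrm degZ // nrmZ nrm_real ger0_norm ?invr_ge0 ?nrm_ge0 // mulVf ?nrm_eq0 //.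
by rewrite expr1n.
Qed.

Definition unit_primitive : set H :=
  [set v | exists n (x : P n), [/\ primitive x, v = deg x & ip v v = 1]].

Notation ladder := (ladder cupL capL cupR capR).
Notation rung := (rung cupL cupR).

Lemma free_rung_orthonormal v : ladder 0 v -> orthonormal (fun p : nat * nat => rung v p.1 p.2).
Proof. by move=> hv; exact: (rung_orthonormal bcL bcL' aL aR kL kR cLR hv). Qed.

Lemma unit_primitive_ladder v : unit_primitive v -> exists2 s : R, 0 <= s < 1 & ladder s v.
Proof.
move=> [n [x [hx -> x1]]]; exists (ladder_param n); first exact: ladder_param_lt1.
exact: primitive_ladder.
Qed.

Lemma unit_primitive_vac v : unit_primitive v -> ip Om v = 0.
Proof. by move=> [n [x [[n0 _ _] -> _]]]; rewrite vacE (deg_orth hP hH) // ltn_eqF. Qed.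

Lemma power_rung_orth v k i j : unit_primitive v -> ip (e k) (rung v i j) = 0.
Proof.
move=> uv; have [s _ hv] := unit_primitive_ladder uv.
elim: k i j => [|k IH] i j.
  case: i => [|i]; last by rewrite -rungU -(adjoint_sym aL) capL_vac ip0l.
  case: j => [|j]; last by rewrite -(rungW cLR) -(adjoint_sym aR) capR_vac ip0l.
  exact: unit_primitive_vac.
rewrite -[e k.+1]/(cupL (e k)) aL; case: i => [|i]; last by rewrite (kL (rung v i j)).
rewrite (rungU0 hv); case: j => [|j]; first by rewrite ip0r.
by rewrite ipZr IH mulr0.
Qed.

Definition orthonormal_primitive (S : set H) : Prop :=
  S `<=` unit_primitive /\ forall v w, S v -> S w -> v <> w -> ip v w = 0.

(** Zorn's lemma. A unit primitive vector orthogonal to all of [S] could be added to it, and it is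
    not already in [S] because it is not orthogonal to itself. *)
Lemma maximal_primitive : exists S, orthonormal_primitive S /\
  forall v, unit_primitive v -> ~ (forall w, S w -> ip v w = 0).
Proof.
have [|S [gS mS]] := @Zorn_bigcup H orthonormal_primitive.
  move=> F FG tF; split; first by move=> v [B FB Bv]; have [h _] := FG B FB; exact: h.
  move=> v w [B FB Bv] [C FC Cw] vw; have [_ hB] := FG B FB; have [_ hC] := FG C FC.
  by have [BC|CB] := tF B C FB FC; [apply: hC => //; exact: BC|apply: hB => //; exact: CB].
exists S; split=> // v uv h; apply: (mS (S `|` [set v])).
  split; first by move=> w Sw; left.
  move=> /(_ v (or_intror erefl)) Sv; have [n [x [_ _ v1]]] := uv.
  by move: v1; rewrite h // => /esym/eqP; rewrite oner_eq0.
have [h1 h2] := gS; split; first by move=> w [/h1//|->].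
move=> w w' [Sw|->] [Sw'|->] ww' //; [exact: h2|by rewrite ip_conj h // rmorph0|exact: h].
Qed.

(* Strong induction on the degree: the homogeneous components of a vector orthogonal to everything
   are primitive, because its images under the caps are again orthogonal to everything. *)
Lemma primitive_total (S : set H) : orthonormal_primitive S ->
  (forall v, unit_primitive v -> ~ (forall w, S w -> ip v w = 0)) ->
  forall x, (forall i, ip x (e i) = 0) -> (forall v, S v -> forall i j, ip x (rung v i j) = 0) -> x = 0.
Proof.
move=> [Su So] mS; pose K x := (forall i, ip x (e i) = 0) /\ (forall v, S v -> forall i j, ip x (rung v i j) = 0).
have KL x : K x -> K (capL x).
  by move=> [h1 h2]; split=> [i|v Sv i j]; rewrite (adjoint_sym aL); [exact: (h1 i.+1)|exact: (h2 v Sv i.+1)].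
have KR x : K x -> K (capR x).
  move=> [h1 h2]; split=> [i|v Sv i j]; rewrite (adjoint_sym aR).
    by rewrite cupR_power.
  by rewrite (rungW cLR) h2.
suff main n x (b : P n) : K x -> ip x (deg b) = 0.
  by move=> x h1 h2; apply: (deg_orth_ext hH) => n b; apply: main.
elim/ltn_ind: n x b => n IH x b Kx; have [h1 h2] := Kx.
case: n IH b => [|n] IH b.
  by rewrite [b](pa_scalarE hP) degZ // -(vacE iota) ipZr (h1 0) mulr0.
(* The homogeneous component of [x] in this degree is obtained by representing the functional
   [a |-> ip (deg a) x]; it is [w] below. *)
have [|y hy] := @pa_riesz _ _ hP n.+1 (fun a => ip (deg a) x).
  by move=> c a a'; rewrite (degP hH) ipDl ipZl.
pose w := pa_star y; have wE (a : P n.+1) : ip (deg a) (deg w) = ip (deg a) x.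
  by rewrite (deg_ip hP hH) pa_ipE (pa_starK hP) -hy.
have capw (X Y : H -> H) : bop X -> is_adjoint X Y -> K (Y x) ->
    (forall m (c : P m), exists c' : P m.+2, X (deg c) = deg c') ->
    (forall (c : P n.+1), (n.+1 < 2)%N -> Y (deg c) = 0) ->
    (forall m (c : P m.+2), exists c' : P m, Y (deg c) = deg c') -> Y (deg w) = 0.
  move=> bX XY KY hX hY0 hY; clear b; move: w wE => w wE; clear hy.
  case: n IH y w wE hY0 => [|n] IH y w wE hY0; first by rewrite hY0.
  have [w' ew] := hY n w; apply: (deg_orth_ext hH) => m c.
  have [mn|mn] := eqVneq m n; last by rewrite ew (deg_orth hP hH) // eq_sym.
  move: c; rewrite mn => c; rewrite ip_conj -XY; have [c' ec] := hX _ c.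
  by rewrite ec wE -ec XY ip_conj IH ?rmorph0 // conjCK.
have w0 : capL (deg w) = 0.
  apply: (capw cupL) => //; [exact: KL|..].
  - by move=> m c; exists (q^-1 *: pa_starj 0 m.+2 cup c); rewrite cupL_deg degZ.
  - by move=> c n2; exact: capL_deg0.
  - by move=> m c; exists (q^-1 *: pa_starj 2 m cup c); rewrite capL_deg degZ.
have w0' : capR (deg w) = 0.
  apply: (capw cupR) => //; [exact: KR|..].
  - by move=> m c; exists (q^-1 *: pa_starj 0 m.+2 c cup); rewrite cupR_deg degZ.
  - move=> c n2; change (conj (capL (conj (deg c))) = 0); by rewrite conj_deg capL_deg0 // conj0.
  - move=> m c; exists (pa_star (q^-1 *: pa_starj 2 m cup (pa_star c))).
    by change (conj (capL (conj (deg c))) = deg (pa_star (q^-1 *: pa_starj 2 m cup (pa_star c)))); rewrite -(conj_deg hP hH) conj_deg capL_deg degZ.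
suff dw : deg w = 0 by rewrite ip_conj -wE dw ip0r rmorph0.
apply/eqP; apply: contrapT => /negP dw.
pose r : R[i] := (((nrm (deg w))^-1)%:C)%C.
apply: (mS (deg (r *: w))).
  exists n.+1, (r *: w); split=> //.
    split=> //; rewrite degZ //; first by rewrite (linZ (proj1 bcL')) w0 scaler0.
    by rewrite (linZ (proj1 bcR')) w0' scaler0.
  rewrite ip_nrm degZ // nrmZ nrm_real ger0_norm ?invr_ge0 ?nrm_ge0 // mulVf ?nrm_eq0 //.
  by rewrite expr1n.
move=> v Sv; have [m [z [_ vz _]]] := Su _ Sv; rewrite vz.
have [mn|mn] := eqVneq n.+1 m; last by rewrite (deg_orth hP hH).
move: z vz; rewrite -mn => z vz; rewrite degZ // ipZl ip_conj wE -ip_conj -vz.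
by rewrite -[v]/(rung v 0 0) h2 // mulr0.
Qed.

(** The isometry of ladders vanishes off the space of [v0]. That space and the space of [v] are
    orthogonal to the vacuum, so the rank one term of [XL] and [XR] does not interfere and [V]
    commutes with the full operators. *)
Lemma coarse_copy v0 v : unit_primitive v0 -> ladder 0 v0 -> unit_primitive v ->
  exists V, [/\ bop V, forall x y, ip (V x) (V y) = ip (cs_proj (rung_space cupL cupR v0) x) y,
    commuting V XL /\ commuting V XR,
    forall x, cs_set (rung_space cupL cupR v) (V x) & forall i j, exists x, rung v i j = V x].
Proof.
move=> u0 h0 uv; have [s s01 hv] := unit_primitive_ladder uv.
have [V [bV VV [V1 V2] V3 V4]] := ladder_isometry bcL bcL' bcR bcR' aL aR kL kR cLR s01 h0 hv.
have vO w x : unit_primitive w -> cs_set (rung_space cupL cupR w) x -> ip Om x = 0.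
  move=> uw; apply: cspan_orth => _ [[i j] _ <-]; exact: (power_rung_orth 0 i j uw).
have VO : V Om = 0.
  by apply: ip_eq0; rewrite VV ip_conj (vO v0) ?rmorph0 //; exact: cs_proj_in.
have OV x : ip (V x) Om = 0 by rewrite ip_conj (vO v) // rmorph0.
by exists V; split=> //; split; [exact: commuting_XL|exact: commuting_XR].
Qed.

Lemma rung_space_reducing v0 : unit_primitive v0 ->
  commuting (cs_proj (rung_space cupL cupR v0)) XL /\ commuting (cs_proj (rung_space cupL cupR v0)) XR.
Proof.
move=> u0; have [s s01 h0] := unit_primitive_ladder u0; pose p := cs_proj (rung_space cupL cupR v0).
have bp : bop p := cs_proj_bop _; have lp := proj1 bp.
have [p1 p2 p3 p4] := rung_reducing bcL bcL' bcR bcR' aL aR kL kR cLR h0.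
have pO : p Om = 0.
  apply: cs_proj_orth => x; apply: cspan_orth => _ [[i j] _ <-]; exact: (power_rung_orth 0 i j u0).
have Op x : ip (p x) Om = 0 by rewrite /p cs_proj_adjoint -/p pO ip0r.
split; [apply: commuting_XL => // x|apply: commuting_XR => // x].
  by rewrite -/p (linD lp) /p p1 p2.
by rewrite -/p (linD lp) /p p3 p4.
Qed.

End Decomposition.

(** * The bimodule decomposition *)

Section Bimodule.
Variables (R : realType) (P : planar_data R).
Hypothesis hP : is_planar_algebra P.
Variables (H : hilbert R) (iota : (forall n : nat, P n) -> H).
Hypothesis hH : is_completion iota.
Implicit Types (n m k j l i : nat).

Notation deg := (deg iota).
Notation conj := (conj hP hH).
Notation M := (planar_vn iota).
Notation A := (cup_vn iota).
Notation Om := (vacuum iota).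
Notation cup := (pa_cup P).
Notation q := (sqrt_mod P).
Notation cupL := (cupL hP hH).
Notation capL := (capL hP hH).
Notation cupR := (cupR hP hH).
Notation capR := (capR hP hH).
Notation XL := (lrep hP hH cup).
Notation XR := (rrep hP hH cup).
Notation e := (cup_power hP hH).
Notation L := (cup_space hP hH).
Notation ladder := (ladder cupL capL cupR capR).
Notation rung := (rung cupL cupR).
Notation rung_space := (rung_space cupL cupR).
Notation ract := (right_op M Om).

Let bXL := lrep_bop hP hH cup. Let bXR := rrep_bop hP hH cup.

Lemma cup_bop a : A a -> bop a.
Proof. by move=> /(cup_sub hP hH)/(planar_bop hP hH). Qed.

Lemma ract_bop a : A a -> bop (ract a).
Proof.
move=> Aa; have [a' Aa' aa] := vn_adjoint (cup_von_neumann hP hH) Aa.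
rewrite (right_opE hP hH (cup_sub hP hH Aa) (cup_sub hP hH Aa') aa).
exact/bop_conj/cup_bop.
Qed.

Definition reducing (T : closed_subspace H) : Prop :=
  commuting (cs_proj T) XL /\ commuting (cs_proj T) XR.

Lemma reducing_act T a x : reducing T -> A a -> cs_set T x -> cs_set T (a x) /\ cs_set T (ract a x).
Proof.
move=> [TL TR] Aa Tx; have bT := cs_proj_bop T; rewrite -(cs_proj_id Tx).
rewrite -(cup_commuting bT TL Aa) -(cup_right_commuting bT TR Aa).
by split; exact: cs_proj_in.
Qed.

(** The actions are compressed to [T] so that they are total maps; on a reducing subspace the
    compression changes nothing. *)
Definition sub_bimodule (T : closed_subspace H) : bimodule H :=
  Bimodule (bm_space := sub_hilbert T) (fun a x => sub_prj T (a (sub_inc x)))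
    (fun a x => sub_prj T (ract a (sub_inc x))).

Lemma sub_bimodule_inc T a (x : sub_bimodule T) : reducing T -> A a ->
  sub_inc (bm_left (sub_bimodule T) a x) = a (sub_inc x) /\
  sub_inc (bm_right (sub_bimodule T) a x) = ract a (sub_inc x).
Proof.
move=> rT Aa; have [h1 h2] := reducing_act rT Aa (sub_inc_in x).
by rewrite /= !sub_incK.
Qed.

Lemma sub_bimodule_bounded T : bounded_actions A (sub_bimodule T).
Proof.
move=> a Aa; have bi := isometric_bop (sub_inc_isometric T); have bp := sub_prj_bop T.
split; apply/bopP.
  exact: (bop_comp bp (bop_comp (cup_bop Aa) bi)).
exact: (bop_comp bp (bop_comp (ract_bop Aa) bi)).
Qed.

Lemma cup_space_rd : reducing L.
Proof. by have [_ _ h1 h2] := cup_space_reducing hP hH. Qed.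

Lemma cup_spaceE : cs_set L = closure [set x | exists2 a, A a & x = a Om].
Proof.
apply/seteqP; split.
  apply: closure_subset => _ [k [c [s [Ss ->]]]].
  elim/big_rec: _ => [|i _ _ [b Ab ->]].
    by exists (fun x => 0 *: x); [exact: cup_scale|rewrite scale0r].
  have [j _ <-] := Ss i; have [a Aa ->] := power_in_cup hP hH j.
  by exists (fun x => c i *: a x + b x) => //; apply: (cup_lin hP hH).
apply: subset_trans (@cs_closed _ _ L); apply: closure_subset => _ [a Aa ->].
by have [] := reducing_act cup_space_rd Aa (@power_in _ _ hP _ _ hH 0).
Qed.

Lemma cup_bimodule_L2 : is_L2A iota (sub_bimodule L).
Proof.
exists (@sub_inc _ _ L); split; first exact: sub_inc_isometric.
  rewrite -[RHS]cup_spaceE; apply/seteqP; split=> [_ [x _ <-]|x Lx]; first exact: sub_inc_in.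
  by have [y <-] := sub_inc_ex Lx; exists y.
by move=> a x Aa; exact: sub_bimodule_inc cup_space_rd Aa.
Qed.

Section Coarse.
Variable v0 : H.
Hypotheses (u0 : unit_primitive hP hH v0) (h0 : ladder 0 v0).
Notation W := (rung_space v0).

Let rW : reducing W := rung_space_reducing u0.

(** The basis [b] makes [XL] a free Jacobi matrix on [L]. Sending a pair of basis vectors to the
    rung with these indices matches it with [XL] in the first index and [XR] in the second. From
    these two operators the relation extends to all of [A]. *)
Lemma coarse_tensor : exists (b : nat -> H) (t : sub_hilbert L -> sub_hilbert L -> sub_hilbert W),
  [/\ forall i, cs_set L (b i),
      closure (hspan (range (fun i => sub_prj L (b i)))) = setT /\ orthonormal (fun i => sub_prj L (b i)),
      forall i, XL (b i) = q *: (b i.+1 + if i is i'.+1 then b i' else 0) + b i,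
      is_hilbert_tensor t &
      forall a x y, A a -> bm_left (sub_bimodule W) a (t x y) = t (bm_left (sub_bimodule L) a x) y /\
        bm_right (sub_bimodule W) a (t x y) = t x (bm_right (sub_bimodule L) a y)].
Proof.
have [b [Lb ob tb Xb]] := cup_basis hP hH; have iL := sub_inc_isometric L; have iW := sub_inc_isometric W.
pose be i := sub_prj L (b i).
have be1 i : sub_inc (be i) = b i by rewrite sub_incK.
have obe : orthonormal be by move=> i j; rewrite -(proj2 iL) !be1 ob.
have tbe : closure (hspan (range be)) = setT.
  apply: orth_total => x h; apply: sub_inc_inj; rewrite (lin0 (proj1 iL)).
  apply: (tb _ (sub_inc_in x)) => i; rewrite -be1 (proj2 iL) h //; by exists i.
pose fe (p : nat * nat) := sub_prj W (rung v0 p.1 p.2).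
have fe1 i j : sub_inc (fe (i, j)) = rung v0 i j by rewrite sub_incK //; exact: rung_in.
have ufr i j : capL (rung v0 i j) = if i is i'.+1 then rung v0 i' j else 0.
  case: i => [|i]; last exact: (cupLK hP hH).
  by rewrite (rungU0 h0); case: j => // j; rewrite scale0r.
have wfr i j : capR (rung v0 i j) = if j is j'.+1 then rung v0 i j' else 0.
  case: j => [|j]; last by rewrite (rungW' (cupRK hP hH) (cup_comm hP hH)).
  by rewrite (rungW0 h0); case: i => // i; rewrite scale0r.
have ofe : orthonormal fe by apply: sub_orthonormal; exact: free_rung_orthonormal.
have tfe := sub_total (fun p : nat * nat => rung v0 p.1 p.2).
have [t [ht tE btl btr]] := tensor_of_basis obe tbe ofe tfe.
have lx x y y' : t x (y + y') = t x y + t x y' by exact: (linD (proj1 (btr x))).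
exists b, t; split=> // a x y Aa.
(* With one factor frozen, the tensor map is extended by zero to all of [H]. The commutation lemmas
   concern operators on [H] and can then be applied. *)
pose TL (y : sub_hilbert L) (z : H) : H := sub_inc (t (sub_prj L z) y).
pose TR (x : sub_hilbert L) (z : H) : H := sub_inc (t x (sub_prj L z)).
have bi := isometric_bop iW; have bj := isometric_bop iL; have bp := sub_prj_bop L.
have bTL u : bop (TL u) by exact: (bop_comp bi (bop_comp (btl u) bp)).
have bTR u : bop (TR u) by exact: (bop_comp bi (bop_comp (btr u) bp)).
have [p1 p2] := cup_space_rd.
have TLp u z : TL u (cs_proj L z) = TL u z by rewrite /TL sub_prj_proj.
have TRp u z : TR u (cs_proj L z) = TR u z by rewrite /TR sub_prj_proj.
have Wvac (w : sub_hilbert W) : ip (sub_inc w) Om = 0.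
  rewrite ip_conj (cspan_orth _ (sub_inc_in w)) ?rmorph0 // => _ [[i j] _ <-].
  exact: (power_rung_orth 0 i j u0).
have XLW (w : sub_hilbert W) : XL (sub_inc w) = q *: (cupL (sub_inc w) + capL (sub_inc w)) + sub_inc w.
  by rewrite lrep_cup Wvac scale0r subr0.
have XRW (w : sub_hilbert W) : XR (sub_inc w) = q *: (cupR (sub_inc w) + capR (sub_inc w)) + sub_inc w.
  by rewrite XR_E Wvac scale0r subr0.
have cTL u : commuting (TL u) XL.
  move=> z; rewrite -TLp p1 -[in RHS]TLp -sub_prjp; move: (sub_prj L z) => {}z.
  apply: (bop_ext tbe (bop_comp (bTL u) (bop_comp bXL bj)) (bop_comp bXL (bop_comp (bTL u) bj))) => _ [i _ <-] /=.
  have bt1 w : bop (fun u => sub_inc (t w u)) by exact: bop_comp bi (btr w).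
  have bt2 : bop (fun u => TL u (XL (sub_inc (be i)))).
    exact: bt1.
  have bt3 : bop (fun u => XL (TL u (sub_inc (be i)))) by exact: (bop_comp bXL (bt1 _)).
  apply: (bop_ext tbe bt2 bt3) => _ [j _ <-].
  rewrite /TL sub_prjK XLW tE fe1 (rungU) ufr be1 Xb.
  rewrite (linD (proj1 bp)) (linZ (proj1 bp)) (linD (proj1 bp)) -/(be _) -/(be _).
  rewrite (linD (proj1 (btl (be j)))) (linZ (proj1 (btl (be j)))) (linD (proj1 (btl (be j)))) !tE.
  rewrite (linD (proj1 bi)) (linZ (proj1 bi)) (linD (proj1 bi)) !fe1; congr (_ *: (_ + _) + _).
  case: i {bt2 bt3} => [|i]; last by rewrite -/(be i) tE fe1.
  by rewrite (lin0 (proj1 bp)) (lin0 (proj1 (btl (be j)))) (lin0 (proj1 bi)).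
have cTR u : commuting (TR u) XR.
  move=> z; rewrite -TRp p2 -[in RHS]TRp -sub_prjp; move: (sub_prj L z) => {}z.
  apply: (bop_ext tbe (bop_comp (bTR u) (bop_comp bXR bj)) (bop_comp bXR (bop_comp (bTR u) bj))) => _ [j _ <-] /=.
  have bt1 w : bop (fun u => sub_inc (t u w)) by exact: bop_comp bi (btl w).
  have bt2 : bop (fun u => TR u (XR (sub_inc (be j)))).
    exact: bt1.
  have bt3 : bop (fun u => XR (TR u (sub_inc (be j)))) by exact: (bop_comp bXR (bt1 _)).
  apply: (bop_ext tbe bt2 bt3) => _ [i _ <-].
  rewrite /TR sub_prjK XRW tE fe1 (rungW (cup_comm hP hH)) wfr cup_space_XR; last exact: sub_inc_in.
  rewrite be1 Xb (linD (proj1 bp)) (linZ (proj1 bp)) (linD (proj1 bp)) -/(be _) -/(be _).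
  rewrite (linD (proj1 (btr (be i)))) (linZ (proj1 (btr (be i)))) (linD (proj1 (btr (be i)))) !tE.
  rewrite (linD (proj1 bi)) (linZ (proj1 bi)) (linD (proj1 bi)) !fe1; congr (_ *: (_ + _) + _).
  case: j {bt2 bt3} => [|j]; last by rewrite -/(be j) tE fe1.
  by rewrite (lin0 (proj1 bp)) (lin0 (proj1 (btr (be i)))) (lin0 (proj1 bi)).
split; apply: sub_inc_inj.
  have [-> _] := sub_bimodule_inc (t x y) rW Aa.
  by have := cup_commuting (bTL y) (cTL y) Aa (sub_inc x); rewrite /TL sub_prjK => <-.
have [_ ->] := sub_bimodule_inc (t x y) rW Aa.
by have := cup_right_commuting (bTR x) (cTR x) Aa (sub_inc y); rewrite /TR sub_prjK => <-.
Qed.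

End Coarse.

Lemma decomposition : exists (J : Type) (F W D : bimodule H),
  is_L2A iota F /\ is_coarse A F W /\
  is_bimodule_sum A (fun o : option J => if o is Some _ then W else F) D /\
  bimodule_iso A (L2M iota) D.
Proof.
(* The vector [v0] is only a model and need not belong to the maximal family [S], which indexes the
   summands. *)
have [x0 px0 x01] := primitive4 hP hH; pose v0 := deg x0.
have u0 : unit_primitive hP hH v0 by exists 4, x0.
have h0 : ladder 0 v0 := primitive_ladder px0 x01.
have [S [[Su So] mS]] := maximal_primitive hP hH.
pose copy v : unit_primitive hP hH v -> _ := coarse_copy u0 h0 (v := v).
pose J := {v : H | S v}.
pose V (v : J) : H -> H := projT1 (cid (copy (sval v) (Su _ (svalP v)))).
have VP (v : J) : [/\ bop (V v), forall x y, ip (V v x) (V v y) = ip (cs_proj (rung_space v0) x) y,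
    commuting (V v) XL /\ commuting (V v) XR,
    forall x, cs_set (rung_space (sval v)) (V v x) & forall i j, exists x, rung (sval v) i j = V v x].
  by rewrite /V; case: cid.
pose F := sub_bimodule L; pose W := sub_bimodule (rung_space v0).
exists J, F, W, (L2M iota).
have rW : reducing (rung_space v0) by exact: rung_space_reducing.
split; first exact: cup_bimodule_L2.
split.
  split; first exact: sub_bimodule_bounded.
  by have [b [t [_ _ _ ht hA]]] := coarse_tensor u0 h0; exists t.
split; last first.
  by exists id; split; [split|move=> z; exists z|].
split; first by move=> a Aa; split; apply/bopP; [exact: cup_bop|exact: ract_bop].
pose inj (o : option J) : (if o is Some _ then W else F) -> L2M iota :=
  match o return (if o is Some _ then W else F) -> L2M iota with
  | Some v => fun x : W => V v (sub_inc x)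
  | None => fun x : F => sub_inc x
  end.
have Vp v x : V v (sub_inc (sub_prj (rung_space v0) x)) = V v x.
  by have [bV VV _ _ _] := VP v; rewrite sub_prjp (partial_isometry_proj bV VV).
have orungs (v w : J) : v <> w -> forall x y, ip (V v x) (V w y) = 0.
  move=> vw x y; have [_ _ _ hv _] := VP v; have [_ _ _ hw _] := VP w.
  have vw' : sval v <> sval w.
    by move: v w vw {hv hw x y} => [v Sv] [w Sw] /= vw E; apply: vw; apply: eq_exist.
  have [s _ lv] := unit_primitive_ladder (Su _ (svalP v)); have [s' _ lw] := unit_primitive_ladder (Su _ (svalP w)).
  have o := rung_orth (cupL_adjoint hP hH) (cupR_adjoint hP hH) (cupLK hP hH) (cupRK hP hH) (cup_comm hP hH) lv lw (So _ _ (svalP v) (svalP w) vw').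
  apply: cspan_orth (hw y) => _ [[i j] _ <-] /=; rewrite ip_conj.
  by rewrite (cspan_orth _ (hv x)) ?rmorph0 // => _ [[k l] _ <-] /=; rewrite ip_conj o rmorph0.
have opower (v : J) (x : F) y : ip (sub_inc x) (V v y) = 0.
  have [_ _ _ hv _] := VP v; rewrite ip_conj; apply/eqP; rewrite fmorph_eq0; apply/eqP.
  apply: cspan_orth (sub_inc_in x) => _ [i _ <-]; rewrite ip_conj.
  apply/eqP; rewrite fmorph_eq0; apply/eqP.
  apply: cspan_orth (hv y) => _ [[k l] _ <-]; exact: power_rung_orth (Su _ (svalP v)).
exists inj; split; first split.
- case=> [v|] /=; last exact: sub_inc_isometric.
  have [bV VV _ _ _] := VP v; have [li ii] := sub_inc_isometric (rung_space v0); split.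
    by move=> c x y; rewrite li (proj1 bV).
  by move=> x y; rewrite VV cs_proj_id ?ii //; exact: sub_inc_in.
- case=> [v|] [w|] // vw x y /=.
  + by apply: orungs => E; apply: vw; rewrite E.
  + by rewrite ip_conj opower rmorph0.
  + exact: opower.
- apply: orth_total => x h; apply: (primitive_total (hP := hP) (hH := hH) (Logic.conj Su So) mS).
    move=> i; apply: h; exists None, (sub_prj L (e i)) => /=.
    by rewrite sub_incK //; exact: power_in.
  move=> v Sv i j; have [_ _ _ _ hr] := VP (exist _ v Sv); have [y ->] := hr i j.
  by apply: h; exists (Some (exist _ v Sv)), (sub_prj (rung_space v0) y); rewrite /= Vp.
case=> [v|] a x Aa /=; last by exact: sub_bimodule_inc cup_space_rd Aa.
have [bV _ [c1 c2] _ _] := VP v; rewrite !Vp.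
by rewrite (cup_commuting bV c1 Aa) (cup_right_commuting bV c2 Aa).
Qed.

End Bimodule.

(** * Maximality and factoriality *)

Section Summability.
Variables (R : realType) (H : hilbert R).

(** Cauchy-Schwarz against the sum of [N] of the vectors bounds [N] times the squared modulus of [c]
    by a constant independent of [N]. *)
Lemma const_orth (x : H) (h : nat -> H) (c : R[i]) : (forall k l, k != l -> ip (h k) (h l) = 0) ->
  (forall k, ip (h k) (h k) = 2) -> (forall k, ip x (h k) = c) -> c = 0.
Proof.
move=> oh nh xh; apply/eqP; rewrite -nrm_eq0 -sqrf_eq0; apply/eqP/le_anti; rewrite sqr_ge0 andbT.
have bd N : N.+1%:R * nrm c ^+ 2 <= 2 * nrm x ^+ 2.
  have := cauchy_schwarz x (\sum_(k < N.+1) h k); rewrite ip_sumr (eq_bigr (fun _ => c)) //.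
  rewrite sumr_const card_ord -[c *+ _]mulr_natl nrmM -(ler_pXn2r (n := 2)) ?nnegrE ?mulr_ge0 ?nrm_ge0 //.
  rewrite !exprMn orth_sum_nrm // (eq_bigr (fun _ => 2)) => [|k _]; last first.
    by apply: (@complexI R); rewrite -ip_nrm nh rmorph_nat.
  have -> : nrm (N.+1%:R : R[i]) = N.+1%:R by rewrite -(rmorph_nat (real_complex R)) nrm_real normr_nat.
  rewrite sumr_const card_ord -[2 *+ _]mulr_natl expr2 -mulrA [nrm x ^+ 2 * _]mulrCA ler_pM2l ?ltr0n //.
  by rewrite [nrm x ^+ 2 * _]mulrC.
rewrite leNgt; apply/negP => c0.
have [n hn] : exists n : nat, 2 * nrm x ^+ 2 / nrm c ^+ 2 < n%:R.
  by exists (Num.truncn (2 * nrm x ^+ 2 / nrm c ^+ 2)).+1; exact: truncnS_gt.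
have := bd n; rewrite leNgt => /negP; apply; rewrite -ltr_pdivrMr //; apply: lt_trans hn _.
by rewrite ltr_nat.
Qed.

(* The differences along the antidiagonals are constant on diagonals, hence vanish. *)
Lemma grid_zero (x : H) (w : nat * nat -> H) : orthonormal w ->
  (forall i j, ip x (w (i.+1, j)) + (if i is i'.+1 then ip x (w (i', j)) else 0) =
     ip x (w (i, j.+1)) + (if j is j'.+1 then ip x (w (i, j')) else 0)) ->
  forall i j, ip x (w (i, j)) = 0.
Proof.
move=> ow rel; pose d i j := ip x (w (i.+1, j)) - ip x (w (i, j.+1)).
have dS i j : d i.+1 j.+1 = d i j.
  have /eqP := rel i.+1 j.+1; rewrite -subr_eq0 => /eqP h; apply/eqP; rewrite -subr_eq0 -[X in _ == X]h /d.
  by apply/eqP; ring.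
have dk i j k : d (i + k)%N (j + k)%N = d i j by elim: k => [|k IH]; rewrite ?addn0 // !addnS dS.
have d0 i j : d i j = 0.
  apply: (@const_orth x (fun k => w ((i + k).+1, (j + k)%N) - w ((i + k)%N, (j + k).+1))) => [k l kl|k|k].
  - rewrite !ipBl !ipBr !ow !xpair_eqE !eqSS !eqn_add2l (negbTE kl) /= subr0 sub0r.
    have n1 : ((i + k).+1 == (i + l)%N) && ((j + k)%N == (j + l).+1) = false by apply/negP => /andP[/eqP h1 /eqP h2]; lia.
    have n2 : ((i + k)%N == (i + l).+1) && ((j + k).+1 == (j + l)%N) = false by apply/negP => /andP[/eqP h1 /eqP h2]; lia.
    by rewrite n1 n2 !oppr0 addr0.
  - rewrite !ipBl !ipBr !ow !xpair_eqE !eqxx.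
    have -> : ((i + k).+1 == (i + k)%N) = false by lia.
    have -> : ((i + k)%N == (i + k).+1) = false by lia.
    by rewrite /= subr0 sub0r opprK.
  - by rewrite ipBr -/(d _ _) dk.
have z0 j : ip x (w (0%N, j)) = 0.
  by have := rel 0 j.+1; rewrite addr0 => /eqP; rewrite addrC -subr_eq -/(d _ _) d0 eq_sym => /eqP.
elim=> [|i IH] j //; have /eqP := d0 i j; by rewrite /d IH subr0 => /eqP.
Qed.

End Summability.

Section Masa.
Variables (R : realType) (P : planar_data R).
Hypothesis hP : is_planar_algebra P.
Variables (H : hilbert R) (iota : (forall n : nat, P n) -> H).
Hypothesis hH : is_completion iota.
Implicit Types (n m k j l i : nat).

Notation deg := (deg iota).
Notation conj := (conj hP hH).
Notation M := (planar_vn iota).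
Notation A := (cup_vn iota).
Notation Om := (vacuum iota).
Notation cup := (pa_cup P).
Notation q := (sqrt_mod P).
Notation cupL := (cupL hP hH).
Notation capL := (capL hP hH).
Notation cupR := (cupR hP hH).
Notation capR := (capR hP hH).
Notation XL := (lrep hP hH cup).
Notation XR := (rrep hP hH cup).
Notation e := (cup_power hP hH).
Notation L := (cup_space hP hH).
Notation ladder := (ladder cupL capL cupR capR).
Notation rung := (rung cupL cupR).
Notation rung_space := (rung_space cupL cupR).
Notation rrep a := (rrep hP hH a).

(** In a coarse copy [XL] and [XR] are the same Jacobi matrix acting on the two indices. Testing
    [XL x = XR x] on the orthonormal vectors [w] gives the relation of [grid_zero], since the
    diagonal terms cancel. *)
Lemma commuting_vector_orth x v : unit_primitive hP hH v -> XL x = XR x ->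
  forall i j, ip x (rung v i j) = 0.
Proof.
move=> uv xx; have [x0 px0 x01] := primitive4 hP hH; pose v0 := deg x0.
have u0 : unit_primitive hP hH v0 by exists 4, x0.
have h0 : ladder 0 v0 := primitive_ladder px0 x01.
have [V [bV VV [V1 V2] _ rV]] := coarse_copy u0 h0 uv.
have kL := cupLK hP hH; have kR := cupRK hP hH; have cLR := cup_comm hP hH.
pose w (p : nat * nat) := V (rung v0 p.1 p.2).
have Ow i j : ip (rung v0 i j) Om = 0 by rewrite ip_conj (power_rung_orth 0 i j u0) rmorph0.
have ow : orthonormal w.
  by move=> p p'; rewrite VV cs_proj_id; [exact: free_rung_orthonormal|exact: rung_in].
have XLw i j : XL (w (i, j)) = q *: (w (i.+1, j) + if i is i'.+1 then w (i', j) else 0) + w (i, j).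
  have [lV _] := bV; rewrite -V1 lrep_cup Ow scale0r subr0 (linD lV) (linZ lV q) (linD lV).
  congr (_ *: (_ + _) + _); case: i => [|i]; last by rewrite (kL (rung v0 i j)).
  by rewrite (rungU0 h0); case: j => [|j] /=; rewrite ?scale0r (lin0 lV).
have XRw i j : XR (w (i, j)) = q *: (w (i, j.+1) + if j is j'.+1 then w (i, j') else 0) + w (i, j).
  have [lV _] := bV; rewrite -V2 XR_E Ow scale0r subr0 (linD lV) (linZ lV q) (linD lV) (rungW cLR).
  congr (_ *: (_ + _) + _); case: j => [|j]; last by rewrite (rungW' kR cLR).
  by rewrite (rungW0 h0); case: i => [|i] /=; rewrite ?scale0r (lin0 lV).
have q0 : q^* != 0 by rewrite fmorph_eq0 sqrt_mod_neq0.
have gz := grid_zero ow (x := x).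
have {}gz i j : ip x (w (i, j)) = 0.
  apply: gz => {}i {}j; apply: (mulfI q0); apply: (addIr (ip x (w (i, j)))).
  have sXR : is_adjoint XR XR by have := rrep_adjoint hP hH cup; rewrite (star_cup hP).
  have := congr1 (fun y => ip y (w (i, j))) xx.
  rewrite /= (XL_adjoint hP hH) sXR XLw XRw !ipDr !ipZr !ipDr => E.
  move: E; case: i => [|i]; case: j => [|j]; rewrite ?ip0r //.
move=> i j; have [y ->] := rV i j.
have Vp := partial_isometry_proj bV VV.
have [Y [bY VY]] := adjoint_ex bV.
rewrite -Vp ip_conj VY -ip_conj.
apply: cspan_orth (cs_proj_in _ _) => _ [[k l] _ <-] /=.
by rewrite ip_conj -VY -ip_conj (gz k l).
Qed.

Lemma masa_vector x : XL x = XR x -> cs_set L x.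
Proof.
move=> xx; have [S [[Su So] mS]] := maximal_primitive hP hH.
suff h : x - cs_proj L x = 0 by move/eqP: h; rewrite subr_eq0 => /eqP->; exact: cs_proj_in.
apply: (primitive_total (Logic.conj Su So) mS) => [i|v Sv i j].
  by apply: proj_orth; exact: power_in.
rewrite ipBl (commuting_vector_orth (Su _ Sv) xx) sub0r; apply/eqP; rewrite oppr_eq0; apply/eqP.
rewrite ip_conj; apply/eqP; rewrite fmorph_eq0; apply/eqP.
apply: cspan_orth (cs_proj_in L x) => _ [k _ <-]; rewrite ip_conj (power_rung_orth _ _ _ (Su _ Sv)).
exact: rmorph0.
Qed.

(** Elements [a] of [A] with [a Om] close to [X Om] need not be uniformly bounded. Commutation with
    [T] is therefore tested on matrix coefficients between homogeneous vectors, where [X] enters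
    through bounded right multiplications of [X Om]. *)
Lemma cup_of_vac X : M X -> cs_set L (X Om) -> A X.
Proof.
move=> MX; rewrite cup_spaceE => /closure_seq[u [Su lu]]; have bX := planar_bop hP hH MX.
rewrite (cup_vnE hP hH); split; first exact/bopP.
move=> T TX; have bT : bop T by apply/bopP; case: TX.
apply/funext; apply: (deg_ext hH (bop_comp bX bT) (bop_comp bT bX)) => n b /=.
apply/eqP; rewrite -subr_eq0; apply/eqP/(deg_orth_ext hH) => m c; apply/eqP; rewrite ipBl subr_eq0; apply/eqP.
have [X' [MX' XX eX]] := planar_adjoint hP hH MX.
rewrite XX (planar_deg hP hH c MX') eX (planar_deg hP hH b MX).
have l1 := hlim_ipr (T (deg b)) (bop_lim (rrep_bop hP hH c) (conj_lim hP hH lu)).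
have l2 := hlim_ipl (deg c) (bop_lim bT (bop_lim (rrep_bop hP hH b) lu)).
apply: hlim_unique l1 _; apply: hlim_ext l2 => k; have [a Aa ua] := Su k.
have Ma := cup_sub hP hH Aa; have [a' [Ma' aa ea]] := planar_adjoint hP hH Ma.
rewrite ua -ea -(planar_deg hP hH b Ma) -(planar_deg hP hH c Ma') -aa; congr ip.
by move: Aa; rewrite (cup_vnE hP hH) => -[_ /(_ T TX)/(congr1 (@^~ (deg b)))].
Qed.

Lemma cup_masa X : M X -> X \o XL = XL \o X -> A X.
Proof.
move=> MX cX; apply: (cup_of_vac MX); apply: masa_vector.
have /(congr1 (@^~ Om)) /= <- := cX; rewrite -(planar_rrepE hP hH cup Om MX); congr X.
by rewrite -[Om]/(e 0) XR_power.
Qed.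

(** Left and right actions of a central [X] agree. Applied to the tensor square of the first basis
    vector, this gives [t y (be 0) = t (be 0) y], which forces [y] to be a multiple of [be 0]; the
    Jacobi relation carries the eigenvalue to the whole basis. *)
Lemma central_scalar X : M X -> commutant M X -> exists c : R[i], X = (fun x => c *: x).
Proof.
move=> MX [/bopP bX cX].
have MXL : M XL by exact: planar_lrep.
have AX : A X by apply: cup_masa => //; exact: cX.
(* A central [X] satisfies [X (y Om) = y (X Om)], which is the defining property of its right
   action. *)
have rX : right_op M Om X = X.
  apply: xget_unique => [|Z [/bopP bZ h]].
    by split=> [|y My]; [exact/bopP|have /(congr1 (@^~ Om)) := cX y My].
  apply: (vac_cyclic hP hH bZ bX) => W MW; rewrite h //.
  by have /(congr1 (@^~ Om)) := cX W MW.
have [x0 px0 x01] := primitive4 hP hH; pose v0 := deg x0.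
have u0 : unit_primitive hP hH v0 by exists 4, x0.
have h0 : ladder 0 v0 := primitive_ladder px0 x01.
have [b [t [Lb [tb ob] Xb [_ _ tt _] hA]]] := coarse_tensor u0 h0.
pose be i := sub_prj L (b i); have be1 i : sub_inc (be i) = b i by rewrite sub_incK.
pose y := sub_prj L (X (sub_inc (be 0))).
have ty : t y (be 0%N) = t (be 0%N) y.
  have [h1 h2] := hA X (be 0%N) (be 0%N) AX; move: h1 h2 => /=; rewrite rX => h1 h2.
  by rewrite -[LHS]h1 h2.
pose c := ip y (be 0%N).
have ey : y = c *: be 0%N.
  apply/eqP; rewrite -subr_eq0; apply/eqP/(total_orth tb) => _ [i _ <-].
  have := tt y (be 0%N) (be i) (be 0%N); rewrite ty tt [ip (be 0%N) (be 0%N)]ob eqxx mulr1 => yi.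
  rewrite ipBl ipZl -/(be i) -yi /c [ip (be 0%N) (be i)]ob; rewrite mulrC subrr //.
have Xbi i : X (b i) = c *: b i.
  have cXL z : X (XL z) = XL (X z) by have /(congr1 (@^~ z)) := cX XL MXL.
  have [lX _] := bX; have [lXL _] := lrep_bop hP hH cup.
  have b0 : X (b 0%N) = c *: b 0%N.
    have [h _] := reducing_act (cup_space_rd hP hH) AX (Lb 0%N).
    by rewrite -(sub_incK h) -{1}(be1 0%N) -/y ey (linZ (proj1 (sub_inc_isometric L))) be1.
  (* [b k.+1] is a combination of [XL (b k)], [b k] and the preceding vector, and [X] commutes with
     [XL]. *)
  have step k : X (b k) = c *: b k -> (if k is k'.+1 then X (b k') = c *: b k' else True) ->
      X (b k.+1) = c *: b k.+1.
    move=> hk hk'; pose r := if k is k'.+1 then b k' else 0.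
    have hr : X r = c *: r by rewrite /r; case: k {hk r} hk' => // _; rewrite (lin0 lX) scaler0.
    have := cXL (b k); rewrite hk (linZ lXL) Xb -/r (linD lX) hk (linZ lX) (linD lX) hr [RHS]scalerDr.
    move=> /addIr; rewrite [RHS]scalerA mulrC -scalerA => /(scalerI (sqrt_mod_neq0 hP)).
    by rewrite scalerDr => /addIr.
  suff : X (b i) = c *: b i /\ X (b i.+1) = c *: b i.+1 by case.
  elim: i => [|i [h1 h2]]; split=> //; exact: step.
exists c; apply: (planar_ext hP hH MX (cup_sub hP hH (cup_scale hP hH c))).
have bi := isometric_bop (sub_inc_isometric L).
have := bop_ext tb (bop_comp bX bi) (bopZ c bi) _ (sub_prj L Om).
rewrite /= !sub_incK; last exact: (@power_in _ _ hP _ _ hH 0).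
by apply=> _ [i _ <-] /=; rewrite be1 Xbi.
Qed.

Lemma planar_factor : is_factor M.
Proof.
split; first exact: planar_von_neumann.
apply/seteqP; split=> [X [MX cX]|_ [c ->]]; first exact: central_scalar.
split; first exact: (cup_sub hP hH (cup_scale hP hH c)).
split; first exact/bopP/bopZ/bop_id.
by move=> Y /(planar_bop hP hH)[lY _]; apply/funext => x /=; rewrite (linZ lY).
Qed.

(** If [k] operators spanned [M], the [k + 1] orthonormal vectors [e i] would lie in the span of the
    [k] vectors [F j Om]. *)
Lemma planar_infinite : ~ finite_dimensional M.
Proof.
move=> [k [F hF]].
have row (i : 'I_k.+1) : exists c : 'I_k -> R[i], e i = \sum_(j < k) c j *: F j Om.
  have [a Aa ->] := power_in_cup hP hH i; have [c ->] := hF a (cup_sub hP hH Aa).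
  by exists c.
pose C := \matrix_(i < k.+1, j < k) projT1 (cid (row i)) j.
have ker0 : kermx C != 0.
  by rewrite -mxrank_eq0 mxrank_ker subn_eq0 -ltnNge ltnS rank_leq_col.
pose u := nz_row (kermx C); have u0 : u != 0 by rewrite nz_row_eq0.
have uC : u *m C = 0 by apply/sub_kermxP; exact: nz_row_sub.
have su : \sum_i u 0 i *: e i = 0.
  transitivity (\sum_j (u *m C) 0 j *: F j Om); last first.
    by rewrite uC big1 // => j _; rewrite mxE scale0r.
  under [RHS]eq_bigr do rewrite mxE scaler_suml.
  rewrite exchange_big; apply: eq_bigr => i _.
  have -> : e i = \sum_(j < k) C i j *: F j Om.
    by under eq_bigr do rewrite mxE; case: cid.
  by rewrite scaler_sumr; apply: eq_bigr => j _; rewrite scalerA.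
case/negP: u0; apply/eqP/rowP => i; rewrite mxE.
have := congr1 (fun x => ip x (e i)) su; rewrite /= ip0l ip_suml (bigD1 i) //= big1 => [|j ji].
  by rewrite addr0 ipZl power_orthonormal eqxx mulr1.
by rewrite ipZl power_orthonormal (inj_eq val_inj) (negbTE ji) mulr0.
Qed.

Lemma planar_II1 : II1_factor M.
Proof.
split; [exact: planar_factor|exact: planar_infinite|].
by exists (trace iota); exact: trace_faithful_normal.
Qed.

Lemma cup_maximal_abelian : maximal_abelian A M.
Proof.
split; [exact: cup_von_neumann|exact: cup_abelian|exact: cup_sub|move=> B _ aB AB BM].
apply/seteqP; split=> // X BX; apply: cup_masa; first exact: BM.
by apply: aB => //; apply: AB; exact: XL_cup.
Qed.

End Masa.

Theorem theorem2p11 (R : realType) (P : planar_data R)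
    (hP : is_planar_algebra P) (H : hilbert R)
    (iota : (forall n : nat, P n) -> H) (hH : is_completion iota) :
  let M := planar_vn iota in
  let A := cup_vn iota in
  (exists (J : Type) (L W D : bimodule H),
      is_L2A iota L /\
      is_coarse A L W /\
      is_bimodule_sum A (fun o : option J => if o is Some _ then W else L) D /\
      bimodule_iso A (L2M iota) D) /\
  II1_factor M /\
  maximal_abelian A M.

Proof.
split; [exact: decomposition|split; [exact: planar_II1|exact: cup_maximal_abelian]].
Qed.
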